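(* Let either (i) $1<p<q<\infty$ and $1/q<s<1/p$, or (ii) $1<q<p<\infty$ and $-1+1/p<s<-1+1/q$. Then there exist an integer $R=R(p,q,s)>1$, an integer $N_0=N_0(p,q,s)\gg R$ and a constant $c(p,q,s)>0$ such that the following holds for every integer $N\ge N_0$. Let $A_N\subset\{2^j: j\in\mathbb{Z},\ j\ge 1\}$ be any finite set such that $$2^{N-1}R^{-1}\le \#A_N\le 2^N,$$ and such that $|n-\tilde n|\ge R$ whenever $2^n,2^{\tilde n}\in A_N$ and $n\ne\tilde n$. Let $P_E$ be the projection $$P_Ef=\sum_{2^j\in A_N}\ \sum_{\mu=0}^{2^j-1}2^j\langle f,h_{j,\mu}\rangle h_{j,\mu}$$ onto the span of $E=\{h_{j,\mu}: 2^j\in A_N,\ 0\le\mu\le 2^j-1\}$. Then $$\|P_E\|_{F^s_{p,q}\to F^s_{p,q}}\ge c(p,q,s)\,2^{N(s-1/q)}\quad\text{in case (i)},$$ $$\|P_E\|_{F^s_{p,q}\to F^s_{p,q}}\ge c(p,q,s)\,2^{N(\frac1q-s-1)}\quad\text{in case (ii)}.$$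
   Context: Haar functions on $\mathbb{R}$: for integers $j\ge 0$ and $\mu\in\mathbb{Z}$, $h_{j,\mu}=\mathbf 1_{I^+_{j,\mu}}-\mathbf 1_{I^-_{j,\mu}}$, where $I^+_{j,\mu}=[2^{-j}\mu,2^{-j}(\mu+\tfrac12))$ and $I^-_{j,\mu}=[2^{-j}(\mu+\tfrac12),2^{-j}(\mu+1))$. Triebel-Lizorkin spaces: let $\psi_0,\psi\in\mathcal S(\mathbb{R})$ be fixed such that, for some $\varepsilon>0$, $|\widehat{\psi_0}(\xi)|>0$ on $(-\varepsilon,\varepsilon)$ and $|\widehat\psi(\xi)|>0$ on $\{\varepsilon/4<|\xi|<\varepsilon\}$, and such that $\int\psi(x)x^n\,dx=0$ for $n=0,1,\dots,M_1$, where $M_1+1>s$. For $k\ge1$ put $\psi_k=2^k\psi(2^k\cdot)$. Then $F^s_{p,q}=F^s_{p,q}(\mathbb{R})$ is the space of all tempered distributions $f\in\mathcal S'(\mathbb{R})$ for which $$\|f\|_{F^s_{p,q}}=\Big\|\Big(\sum_{k=0}^\infty 2^{ksq}|\psi_k*f|^q\Big)^{1/q}\Big\|_{L^p(\mathbb{R})}<\infty.$$ Different admissible choices of $\psi_0,\psi$ give equivalent norms. The constants are allowed to depend on the fixed choice. The operator $P_E$ is initially defined on $L^2(\mathbb{R})$. In the stated parameter ranges one has $-1+1/p<s<1/p$, so the Haar functions belong to $F^s_{p,q}$ and to its dual, and $P_E$ is considered on $F^s_{p,q}$ with $\langle\cdot,\cdot\rangle$ understood as the duality pairing extending the $L^2$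 pairing. $\|P_E\|_{F^s_{p,q}\to F^s_{p,q}}$ denotes the operator norm. *)

(* Defs.v *)
From HB Require Import structures.
From mathcomp Require Import all_boot all_order all_algebra finmap.
From mathcomp Require Import all_classical all_reals all_analysis.
From mathcomp Require Import complex.

Set Implicit Arguments.
Unset Strict Implicit.
Unset Printing Implicit Defensive.

Import Order.TTheory GRing.Theory Num.Theory.
Import numFieldNormedType.Exports.

Local Open Scope classical_set_scope.
Local Open Scope complex_scope.
Local Open Scope ring_scope.

(* [Normc.normc] is the R-valued modulus; the library's [`|z|] is R[i]-valued. *)
Definition cmod {R : realType} (z : R[i]) : R := Normc.normc z.

Section schwartz.
Context {R : realType}.
Implicit Types (f : R -> R[i]).

Definition smooth f : Prop :=
  forall (n : nat) (x : R),
    derivable (derive1n n (fun t => complex.Re (f t))) x 1 /\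
    derivable (derive1n n (fun t => complex.Im (f t))) x 1.

Definition cderive1n (n : nat) f : R -> R[i] := fun x =>
  derive1n n (fun t => complex.Re (f t)) x +i*
  derive1n n (fun t => complex.Im (f t)) x.

Definition schwartz_seminorm (a b : nat) f : \bar R :=
  ereal_sup (range (fun x : R => (`|x| ^+ a * cmod (cderive1n b f x))%:E)).

Definition schwartz f : Prop :=
  smooth f /\ forall a b : nat, (schwartz_seminorm a b f < +oo)%E.

End schwartz.

Section integral.
Context {R : realType}.
Implicit Types (f : R -> R[i]).

Definition cintegral f : R[i] :=
  Rintegral lebesgue_measure setT (fun x : R => complex.Re (f x)) +i*
  Rintegral lebesgue_measure setT (fun x : R => complex.Im (f x)).

Definition fourier f (xi : R) : R[i] :=
  cintegral (fun x => f x * (cos (x * xi) -i* sin (x * xi))).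

Definition square_integrable f : Prop :=
  [/\ measurable_fun setT (fun x : R => complex.Re (f x)),
      measurable_fun setT (fun x : R => complex.Im (f x)) &
      (\int[lebesgue_measure]_(x in setT) ((cmod (f x)) ^+ 2)%:E < +oo)%E].

End integral.

(* A distribution is encoded as a functional on all functions R -> R[i], of
   which only the values on Schwartz functions are constrained or used. *)
Notation functional R := ((R -> R[i]) -> R[i]).

Definition tempered_distribution {R : realType} (T : functional R) : Prop :=
  (forall (a : R[i]) (phi chi : R -> R[i]), schwartz phi -> schwartz chi ->
     T (fun x => a * phi x + chi x) = a * T phi + T chi) /\
  (exists (C : R) (m : nat), forall phi : R -> R[i], schwartz phi ->
     ((cmod (T phi))%:E <=
      C%:E * \sum_(a < m) \sum_(b < m) schwartz_seminorm a b phi)%E).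

Definition regular_distribution {R : realType} (u : R -> R[i]) : functional R :=
  fun phi => cintegral (fun x => u x * phi x).

Definition convolution {R : realType} (phi : R -> R[i]) (T : functional R) :
    R -> R[i] :=
  fun x => T (fun y => phi (x - y)).

Section triebel_lizorkin.
Context {R : realType}.
Variables (p q s : R) (psi0 psi : R -> R[i]).
Implicit Types (T : functional R).

Definition TL_admissible : Prop :=
  [/\ schwartz psi0, schwartz psi,
      exists eps : R, [/\ 0 < eps,
        forall xi : R, `|xi| < eps -> 0 < cmod (fourier psi0 xi) &
        forall xi : R, eps / 4 < `|xi| < eps -> 0 < cmod (fourier psi xi)] &
      exists M1 : int, s < (M1 + 1)%:~R /\
        forall n : nat, (n%:Z <= M1) ->
          cintegral (fun x => psi x * (x ^+ n)%:C) = 0].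

Definition TL_kernel (k : nat) : R -> R[i] :=
  if k is 0%N then psi0 else fun x => (2 ^+ k)%:C * psi (2 ^+ k * x).

Definition TL_lq_sum T (x : R) : \bar R :=
  ((\sum_(0 <= k <oo)
     (2 `^ (k%:R * s * q) * cmod (convolution (TL_kernel k) T x) `^ q)%R%:E)
   `^ q^-1)%E.

Definition TL_norm T : \bar R :=
  Lnorm lebesgue_measure p%:E (TL_lq_sum T).

Definition TL_space : set (functional R) :=
  [set T | tempered_distribution T /\ (TL_norm T < +oo)%E].

Definition duality_pairing_with (g : R -> R[i]) (L : functional R -> R[i]) :
    Prop :=
  [/\ forall (a : R[i]) T U, TL_space T -> TL_space U ->
        L (fun phi => a * T phi + U phi) = a * L T + L U,
      exists C : R, forall T, TL_space T ->
        ((cmod (L T))%:E <= C%:E * TL_norm T)%E &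
      forall u : R -> R[i], square_integrable u ->
        TL_space (regular_distribution u) ->
        L (regular_distribution u) = cintegral (fun x => u x * g x)].

(* <T, g>: the value at T of the bounded linear functional on F^s_{p,q}
   extending u |-> \int u g from L^2 (unique when p, q < oo, by density).
   The pairing is bilinear; it is only used with real-valued g. *)
Definition duality_pairing T (g : R -> R[i]) : R[i] :=
  xget 0 [set z | exists2 L, duality_pairing_with g L & z = L T].

Definition TL_opnorm (P : functional R -> functional R) : \bar R :=
  ereal_sup [set TL_norm (P T) | T in [set T | TL_space T /\
                                              (TL_norm T <= 1)%E]].

End triebel_lizorkin.

Section haar.
Context {R : realType}.

Definition haar (j : nat) (mu : int) (x : R) : R :=
  \1_([set` `[2 ^- j * mu%:~R, 2 ^- j * (mu%:~R + 2^-1)[ ]) x -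
  \1_([set` `[2 ^- j * (mu%:~R + 2^-1), 2 ^- j * (mu%:~R + 1)[ ]) x.

Definition chaar (j : nat) (mu : int) : R -> R[i] := fun x => (haar j mu x)%:C.

(* A is a set of powers of two; [trunc_log 2] recovers j from 2 ^ j. *)
Definition haar_projection (p q s : R) (psi0 psi : R -> R[i]) (A : {fset nat})
    (T : functional R) : functional R :=
  fun phi => \sum_(a <- A) let j := trunc_log 2 a in
    \sum_(mu < 2 ^ j)
      (2 ^+ j)%:C * duality_pairing p q s psi0 psi T (chaar j mu) *
      regular_distribution (chaar j mu) phi.

End haar.

(* Main.v *)
Require Import Defs.
From HB Require Import structures.
From mathcomp Require Import all_boot all_order all_algebra finmap.
From mathcomp Require Import all_classical all_reals all_analysis.
From mathcomp Require Import measurable_realfun complex.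
From mathcomp Require Import ring lra zify.
Set Implicit Arguments.
Unset Strict Implicit.
Unset Printing Implicit Defensive.
Import Order.TTheory GRing.Theory Num.Theory.
Import numFieldNormedType.Exports.
Local Open Scope classical_set_scope.
Local Open Scope complex_scope.
Local Open Scope ring_scope.

(* Write J for the set of exponents of A and sigma = |s|. The projection is tested on
     G = sum over j in J of 2^(-j sigma) sin(2 pi 2^j x) on [0, 1]   ([wave_test])
   and
     f = sum over l in J of 2^((l + N) sigma) times bumps of width 2^(-l-N) at midpoints of dyadic
         intervals of length 2^(-l)   ([bump_test]).
   The midpoints are pruned so that the rescaled tails of the bumps have bounded overlap. Kernel
   estimates then bound f by a constant and G by (#A)^(1/q) (in the dual space (#A)^(1/q')), while
   the separation of J makes the diagonal dominate in <P_E f, G>, which is at least a constant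
   times #A 2^(N (sigma - 1)). In case (i) P_E acts on G and is tested against f, in case (ii) it
   acts on f and is tested against G.
   The pairing with a function h is realised as T |-> sum_k int (psi_k * T) (kap_k * h), where the
   kernels kap_k invert the psi_k in Calderon's reproducing formula; Hoelder's inequality bounds it
   by the norm of T and a square-function-type norm of the kap_k * h. *)

(** * Integration on the real line *)

(** The bumps of one level cover the fraction 2^(-N) of [0, 1], so at most 2^N levels overlap
    boundedly on average. At single points the levels may still pile up; pruning gives up at most
    half of the bumps of each level for a bound at every point. Hence the number of levels costs
    nothing in the norm of f, whereas in G all waves share the interval [0, 1] and the number of
    levels shows. With #A comparable to 2^N, the quotient of #A 2^(N (sigma - 1)) by (#A)^(1/q) is
    of order 2^(N (sigma - 1/q)), which is case (i) with sigma = s; the dual power 1/q' gives 2^(N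
    (sigma - 1 + 1/q)), which is case (ii) with sigma = -s. The bounds on f and G are pointwise, by
    multiples of (1 + |x|)^(-2), so they are uniform in p up to the norm of this weight. The pairing
    inside the projection is chosen among the bounded extensions of the L^2 pairing. An extension
    must therefore be constructed for every Haar function, and this is where -1 + 1/p < s enters.
    Its value is taken only at square integrable functions, where the extension property fixes
    it. *)

Lemma eq_ler (R : numDomainType) (x y : R) : x = y -> x <= y.
Proof. by move=> ->. Qed.

Section integration.
Context {R : realType}.
Local Notation mu := (@lebesgue_measure R).
Implicit Types (f g : R -> R) (a b r x y : R).

Definition Lint f : Prop := mu.-integrable setT (EFin \o f).

Lemma Lint_meas f : Lint f -> measurable_fun setT f.
Proof. by move=> /integrableP[/measurable_EFinP]. Qed.

Lemma Lint_le f g : measurable_fun setT f -> Lint g ->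
  (forall x, `|f x| <= g x) -> Lint f.
Proof.
move=> mf ig fg; apply: le_integrable ig => //; first exact/measurable_EFinP.
by move=> x _ /=; rewrite lee_fin (le_trans (fg x))// ler_norm.
Qed.

Lemma eq_Lint f g : f =1 g -> Lint f -> Lint g.
Proof. by move=> /funext ->. Qed.

Lemma LintD f g : Lint f -> Lint g -> Lint (fun x => f x + g x).
Proof. by move=> fi gi; exact: integrableD fi gi. Qed.

Lemma LintN f : Lint f -> Lint (fun x => - f x).
Proof. by move=> fi; exact: integrableN fi. Qed.

Lemma LintB f g : Lint f -> Lint g -> Lint (fun x => f x - g x).
Proof. by move=> fi gi; apply: LintD => //; exact: LintN. Qed.

Lemma LintZ r f : Lint f -> Lint (fun x => r * f x).
Proof. by move=> fi; exact: (integrableZl _ r fi). Qed.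

Lemma Lint0 : Lint (fun=> 0).
Proof. exact: integrable0. Qed.

Lemma Lint_sum (I : Type) (s : seq I) (P : pred I) (F : I -> R -> R) :
  (forall i, P i -> Lint (F i)) -> Lint (fun x => \sum_(i <- s | P i) F i x).
Proof.
move=> iF; elim: s => [|i s IH].
  by apply: eq_Lint Lint0 => x; rewrite big_nil.
case Pi : (P i); last by apply: eq_Lint IH => x; rewrite big_cons Pi.
apply: eq_Lint (LintD (iF _ Pi) IH) => x; by rewrite big_cons Pi.
Qed.

Lemma Lint_norm f : Lint f -> Lint (fun x => `|f x|).
Proof. by move=> fi; exact: (integrable_norm fi). Qed.

Lemma IntD f g : Lint f -> Lint g ->
  \int[mu]_x (f x + g x) = \int[mu]_x f x + \int[mu]_x g x.
Proof. by move=> fi gi; rewrite RintegralD. Qed.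

Lemma IntB f g : Lint f -> Lint g ->
  \int[mu]_x (f x - g x) = \int[mu]_x f x - \int[mu]_x g x.
Proof. by move=> fi gi; rewrite RintegralB. Qed.

Lemma IntZ r f : Lint f -> \int[mu]_x (r * f x) = r * \int[mu]_x f x.
Proof. by move=> fi; rewrite RintegralZl. Qed.

Lemma Int0 : \int[mu]_x (0 : R) = 0.
Proof. by rewrite Rintegral_cst// mul0r. Qed.

Lemma IntN f : Lint f -> \int[mu]_x (- f x) = - \int[mu]_x f x.
Proof.
move=> fi; rewrite -mulN1r -IntZ//; by apply: eq_Rintegral => x _; rewrite mulN1r.
Qed.

Lemma Int_sum (I : Type) (s : seq I) (P : pred I) (F : I -> R -> R) :
  (forall i, P i -> Lint (F i)) ->
  \int[mu]_x (\sum_(i <- s | P i) F i x) = \sum_(i <- s | P i) \int[mu]_x F i x.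
Proof.
move=> iF; elim: s => [|i s IH].
  by rewrite big_nil -[RHS]Int0; apply: eq_Rintegral => x _; rewrite big_nil.
rewrite big_cons -IH; case Pi : (P i); last first.
  by apply: eq_Rintegral => x _; rewrite big_cons Pi.
rewrite -IntD//; [|exact: iF|exact: Lint_sum].
by apply: eq_Rintegral => x _; rewrite big_cons Pi.
Qed.

Lemma Int_le f g : Lint f -> Lint g -> (forall x, f x <= g x) ->
  \int[mu]_x f x <= \int[mu]_x g x.
Proof. by move=> fi gi fg; apply: le_Rintegral. Qed.

Lemma Int_norm_le f g : measurable_fun setT f -> Lint g ->
  (forall x, `|f x| <= g x) -> `|\int[mu]_x f x| <= \int[mu]_x g x.
Proof.
move=> mf ig fg; have fi := Lint_le mf ig fg.
apply: le_trans (le_normr_Rintegral _ _) _ => //.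
by apply: Int_le => //; exact: Lint_norm.
Qed.

Lemma Lint_EFin f : Lint f -> (\int[mu]_x f x)%:E = (\int[mu]_x (f x)%:E)%E.
Proof. by move=> fi; rewrite /Rintegral fineK//; exact: integrable_fin_num. Qed.

Lemma ge0_Lint f : measurable_fun setT f -> (forall x, 0 <= f x) ->
  (\int[mu]_x (f x)%:E < +oo)%E -> Lint f.
Proof.
move=> mf f0 foo; apply/integrableP; split; first exact/measurable_EFinP.
by under eq_integral do rewrite /= ger0_norm ?f0//.
Qed.

Let measurable_affine a b : measurable_fun setT (fun x => a * x + b).
Proof.
apply: continuous_measurable_fun => x; apply: cvgD; last exact: cvg_cst.
by apply: cvgM; [exact: cvg_cst|exact: cvg_id].
Qed.

(** By uniqueness of Lebesgue measure: the push-forward under [x => a * x + b], scaled by [a], gives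
    every half-open interval its length. *)
Lemma ge0_integral_affine a b (f : R -> \bar R) : 0 < a -> measurable_fun setT f ->
  (forall x, 0 <= f x)%E ->
  (\int[mu]_x f x = a%:E * \int[mu]_x f (a * x + b)%R)%E.
Proof.
move=> a0 mf f0.
pose phi : R -> measurableTypeR R := fun x => a * x + b.
have mphi : measurable_fun setT phi by exact: measurable_affine.
have a0' : 0 <= a by exact: ltW.
pose pm := measure_function_pushforward__canonical__measure_function_Measure mu mphi.
pose m := [the measure _ _ of mscale (NngNum a0') pm].
rewrite (eq_measure_integral m); last first.
  move=> A mA _; apply: lebesgue_measure_unique => //= _ [[x y]] _ <-.
  rewrite /m/= /mscale/= /pushforward/=.
  have -> : phi @^-1` `]x, y] = `](x - b) / a, (y - b) / a]%classic.
    apply/seteqP; split => z /=; rewrite !in_itv/= ltr_pdivrMr// ler_pdivlMr// mulrC /phi.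
      by rewrite ltrBlDr lerBrDr mulrC.
    by rewrite ltrBlDr lerBrDr.
  rewrite !lebesgue_measure_itv/= !lte_fin ltr_pdivrMr// mulfVK ?gt_eqF//.
  rewrite ltrD2r; case: ifPn => xy; last by rewrite mule0.
  rewrite -EFinB -EFinM; congr EFin; rewrite -mulrBl mulrCA divff ?gt_eqF//; lra.
rewrite /m ge0_integral_mscale//= ge0_integral_pushforward//=.
Qed.

Lemma ge0_integral_opp (f : R -> \bar R) : measurable_fun setT f ->
  (forall x, 0 <= f x)%E -> (\int[mu]_x f x = \int[mu]_x f (- x)%R)%E.
Proof.
move=> mf f0.
have mN : measurable_fun setT (-%R : R -> measurableTypeR R).
  apply: continuous_measurable_fun => x; exact: continuousN.
rewrite (eq_measure_integral [the measure _ _ of pushforward mu (-%R : R -> measurableTypeR R)]); last first.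
  by move=> A mA _; rewrite /= lebesgue_measureN.
by rewrite ge0_integral_pushforward.
Qed.

Lemma Lint_affine_gt0 a b f : 0 < a -> Lint f -> Lint (fun x => f (a * x + b)).
Proof.
move=> a0 fi; have mf := Lint_meas fi.
apply/integrableP; split.
  by apply/measurable_EFinP; exact: (measurableT_comp mf (measurable_affine a b)).
have /integrableP[_] := fi.
rewrite (@ge0_integral_affine a b (fun x => `|(EFin \o f) x|%E))//; last first.
  by apply/measurableT_comp => //; exact/measurable_EFinP.
rewrite /=; case: (\int[mu]_x _)%E => [r _||//]; first by rewrite ltey.
by rewrite gt0_muley// lte_fin.
Qed.

Lemma Int_affine_gt0 a b f : 0 < a -> Lint f ->
  \int[mu]_x f (a * x + b) = a^-1 * \int[mu]_x f x.
Proof.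
move=> a0 fi; have mf := Lint_meas fi.
have gi := @Lint_affine_gt0 a b f a0 fi.
apply: (mulfI (lt0r_neq0 a0)); rewrite mulrA divff ?lt0r_neq0// mul1r.
apply/EFin_inj; rewrite EFinM !Lint_EFin//.
have mfe : measurable_fun setT (EFin \o f) by exact/measurable_EFinP.
rewrite [RHS]integralE [in LHS]integralE.
rewrite (@ge0_integral_affine a b _ a0 (measurable_funepos mfe))//.
rewrite (@ge0_integral_affine a b _ a0 (measurable_funeneg mfe))//.
rewrite muleBr//; last first.
  by rewrite fin_num_adde_defl// fin_numN; exact: (integrable_neg_fin_num measurableT gi).
by congr (_ * _ - _ * _)%E; apply: eq_integral => x _; rewrite ?funeposE ?funenegE.
Qed.

Lemma Lint_opp f : Lint f -> Lint (fun x => f (- x)).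
Proof.
move=> fi; have mf := Lint_meas fi.
have mN : measurable_fun setT (-%R : R -> R).
  apply: continuous_measurable_fun => x; exact: continuousN.
apply/integrableP; split.
  by apply/measurable_EFinP; exact: (measurableT_comp mf mN).
have /integrableP[_] := fi.
rewrite (@ge0_integral_opp (fun x => `|(EFin \o f) x|%E))//.
by apply/measurableT_comp => //; exact/measurable_EFinP.
Qed.

Lemma Int_opp f : Lint f -> \int[mu]_x f (- x) = \int[mu]_x f x.
Proof.
move=> fi; have mf := Lint_meas fi.
have mfe : measurable_fun setT (EFin \o f) by exact/measurable_EFinP.
rewrite /Rintegral; congr fine.
rewrite [RHS]integralE [in LHS]integralE.
congr (_ - _)%E; apply/esym.
  rewrite (ge0_integral_opp (measurable_funepos mfe))//.
  by apply: eq_integral => x _; rewrite !funeposE.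
rewrite (ge0_integral_opp (measurable_funeneg mfe))//.
by apply: eq_integral => x _; rewrite !funenegE.
Qed.

Lemma Lint_shift a f : Lint f -> Lint (fun x => f (x - a)).
Proof.
move=> /(@Lint_affine_gt0 1 (- a) f ltr01); apply: eq_Lint => x; by rewrite mul1r.
Qed.

Lemma Int_shift a f : Lint f -> \int[mu]_x f (x - a) = \int[mu]_x f x.
Proof.
move=> fi; rewrite -[RHS]mul1r -{1}invr1 -(@Int_affine_gt0 1 (- a))//.
by apply: eq_Rintegral => x _; rewrite mul1r.
Qed.

Lemma Int_reflect a f : Lint f -> \int[mu]_x f (a - x) = \int[mu]_x f x.
Proof.
move=> fi; rewrite -(Int_opp fi) -(Int_shift a (Lint_opp fi)).
by apply: eq_Rintegral => x _; rewrite opprB.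
Qed.

End integration.

(** * Polynomial weights *)

Section weights.
Context {R : realType}.
Local Notation mu := (@lebesgue_measure R).
Implicit Types (f g : R -> R) (a b r x y c : R).

(** A variant of the Japanese bracket that is submultiplicative with constant one ([japD]), so
    weights move between points without losses. *)
Definition jap x : R := 1 + `|x|.

Lemma jap_ge1 x : 1 <= jap x. Proof. by rewrite /jap lerDl. Qed.
Lemma jap_gt0 x : 0 < jap x. Proof. exact: lt_le_trans (jap_ge1 x). Qed.
Lemma jap_ge0 x : 0 <= jap x. Proof. exact/ltW/jap_gt0. Qed.
Lemma jap_neq0 x : jap x != 0. Proof. exact/lt0r_neq0/jap_gt0. Qed.

Lemma japN x : jap (- x) = jap x. Proof. by rewrite /jap normrN. Qed.

Lemma japD x y : jap (x + y) <= jap x * jap y.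
Proof.
rewrite /jap; have := ler_normD x y; have := normr_ge0 x; have := normr_ge0 y.
set a := `|x|; set b := `|y|; set c := `|_| => b0 a0 h.
have : 0 <= a * b by rewrite mulr_ge0.
lra.
Qed.

Lemma japB x y : jap x <= jap y * jap (x - y).
Proof. by rewrite -{1}(subrK y x) mulrC; exact: japD. Qed.

Lemma le_jap x y : `|x| <= `|y| -> jap x <= jap y.
Proof. by move=> h; rewrite /jap lerD2l. Qed.

Lemma jap_scale_ge c x : 1 <= c -> jap x <= jap (c * x).
Proof.
by move=> c1; apply: le_jap; rewrite normrM ler_peMl// (le_trans c1)// ler_norm.
Qed.

Lemma jap_scale_le c x : 1 <= c -> jap (c * x) <= c * jap x.
Proof.
move=> c1; rewrite /jap normrM ger0_norm; last by apply: le_trans c1.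
by rewrite mulrDr lerD2r mulr1.
Qed.

Lemma japX_gt0 n x : 0 < jap x ^- n.
Proof. by rewrite invr_gt0 exprn_gt0// jap_gt0. Qed.
Lemma japX_ge0 n x : 0 <= jap x ^- n. Proof. exact/ltW/japX_gt0. Qed.
Lemma japX_le1 n x : jap x ^- n <= 1.
Proof. by rewrite invf_le1 ?exprn_gt0 ?jap_gt0// exprn_ege1// jap_ge1. Qed.

Lemma japX_le m n x : (m <= n)%N -> jap x ^- n <= jap x ^- m.
Proof.
by move=> mn; rewrite lef_pV2 ?posrE ?exprn_gt0 ?jap_gt0// ler_weXn2l// jap_ge1.
Qed.

Lemma japXD m n x : jap x ^- (m + n) = jap x ^- m * jap x ^- n.
Proof. by rewrite exprD invfM. Qed.

Lemma japX_mono n x y c : 0 <= c -> jap x <= c * jap y ->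
  jap y ^- n <= c ^+ n * jap x ^- n.
Proof.
move=> c0 h; rewrite ler_pdivlMr ?exprn_gt0 ?jap_gt0//.
rewrite ler_pdivrMl ?exprn_gt0 ?jap_gt0//.
by rewrite mulrC -exprMn lerXn2r// nnegrE ?mulr_ge0 ?jap_ge0.
Qed.

Lemma jap_continuous : continuous jap.
Proof. by move=> x; apply: cvgD; [exact: cvg_cst|exact: norm_continuous]. Qed.

Lemma japX_continuous n : continuous (fun x => jap x ^- n).
Proof.
move=> x; apply: cvgV; first by rewrite expf_neq0// jap_neq0.
by apply: (@continuous_comp _ _ _ jap (fun x : R => x ^+ n)); [exact: jap_continuous|exact: exprn_continuous].
Qed.

Lemma Lint_oneDsqrV : Lint (fun x : R => (oneDsqr x)^-1).
Proof.
apply: ge0_Lint.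
- by apply: continuous_measurable_fun => x; exact: continuous_oneDsqrV.
- by move=> x; rewrite invr_ge0 (le_trans _ (oneDsqr_ge1 x)).
rewrite ge0_symfun_integralT//.
- rewrite -set_itvcy integral0y_oneDsqr -EFinM ltey//.
- exact: continuous_oneDsqrV.
- by move=> x /=; rewrite /oneDsqr sqrrN.
Qed.

Lemma Lint_japX n : (2 <= n)%N -> Lint (fun x => jap x ^- n).
Proof.
move=> n2; apply: Lint_le Lint_oneDsqrV _.
  exact: continuous_measurable_fun (@japX_continuous n).
move=> x; rewrite ger0_norm ?japX_ge0//; apply: le_trans (japX_le x n2) _.
have h : 0 < oneDsqr x by exact: lt_le_trans (oneDsqr_ge1 x).
rewrite lef_pV2 ?posrE ?exprn_gt0 ?jap_gt0// /oneDsqr /jap sqrrD expr1n mul1r.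
by rewrite real_normK ?num_real// lerD2r lerDl mulrn_wge0.
Qed.

Definition japI : R := \int[mu]_x (jap x ^- 2).

Lemma japI_ge0 : 0 <= japI.
Proof. by apply: Rintegral_ge0 => x _; exact: japX_ge0. Qed.

Lemma Lint_scaled_jap c y : 0 < c -> Lint (fun x => c * jap (c * (y - x)) ^- 2).
Proof.
move=> c0; apply: LintZ.
apply: eq_Lint (Lint_affine_gt0 (- (c * y)) c0 (Lint_japX (leqnn 2))) => x /=.
by rewrite -japN mulrBr; congr (jap _ ^- 2); ring.
Qed.

Lemma Int_scaled_jap c y : 0 < c -> \int[mu]_x (c * jap (c * (y - x)) ^- 2) = japI.
Proof.
move=> c0; rewrite IntZ.
  rewrite /japI -[RHS](mulKf (lt0r_neq0 c0)) mulrCA; congr (c * _).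
  rewrite -(Int_affine_gt0 (- (c * y)) c0 (Lint_japX (leqnn 2))).
  by apply: eq_Rintegral => x _ /=; rewrite -japN mulrBr; congr (jap _ ^- 2); ring.
apply: eq_Lint (Lint_affine_gt0 (- (c * y)) c0 (Lint_japX (leqnn 2))) => x /=.
by rewrite -japN mulrBr; congr (jap _ ^- 2); ring.
Qed.

End weights.

(** * Fubini's theorem and dominated convergence *)

Section fubini_dct.
Context {R : realType}.
Local Notation mu := (@lebesgue_measure R).
Implicit Types (f g : R -> R) (a b r x y c : R).

Section fubini_dom.
Variables (F : R -> R -> R) (p q : R -> R).
Hypothesis mF : measurable_fun setT (fun z : R * R => F z.1 z.2).
Hypothesis pi : Lint p.
Hypothesis qi : Lint q.
Hypothesis Fpq : forall x y, `|F x y| <= p x * q y.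

Lemma Lint_dom1 x : Lint (F x).
Proof.
apply: Lint_le (LintZ (p x) qi) (Fpq x).
exact: (measurable_fun_pair2 x mF).
Qed.

Lemma Lint_dom2 y : Lint (F ^~ y).
Proof.
apply: Lint_le (LintZ (q y) pi) _; first exact: (measurable_fun_pair1 y mF).
by move=> x; rewrite mulrC; exact: Fpq.
Qed.

Let Fpq' x y : `|F x y| <= `|p x| * `|q y|.
Proof. by apply: le_trans (Fpq x y) _; rewrite -normrM ler_norm. Qed.

Let mFE : measurable_fun setT (fun z : R * R => (F z.1 z.2)%:E).
Proof. exact/measurable_EFinP. Qed.

(** A product majorant makes the sections and the double integral finite at once; every later
    exchange of integrals comes with one. *)
Let Fint : (mu \x mu)%E.-integrable setT (fun z : R * R => (F z.1 z.2)%:E).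
Proof.
apply/integrable12ltyP => //=.
have pq := Lint_norm pi; have qn := Lint_norm qi.
have ip : (\int[mu]_x (`|p x| * \int[mu]_y `|q y|)%:E < +oo)%E.
  have h : Lint (fun x => `|p x| * \int[mu]_y `|q y|).
    by apply: eq_Lint (LintZ (\int[mu]_y `|q y|) pq) => x; rewrite mulrC.
  by have := Lint_EFin h => /= <-; rewrite ltey.
apply: le_lt_trans ip; apply: ge0_le_integral => //.
- by move=> x _; exact: integral_ge0.
- apply: (@measurable_fun_fubini_tonelli_F _ _ _ _ _ mu (fun z : R * R => `|(F z.1 z.2)%:E|%E)) => //.
  exact: measurableT_comp.
- apply/measurable_EFinP; apply: measurable_funM => //.
  exact: Lint_meas.
move=> x _; rewrite -IntZ// Lint_EFin; last exact: LintZ.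
apply: ge0_le_integral => //.
- apply/measurable_EFinP; apply: measurableT_comp => //.
  exact: (measurable_fun_pair2 x mF).
- apply/measurable_EFinP; apply: measurable_funM => //; exact: Lint_meas.
- by move=> y _; rewrite lee_fin.
Qed.

Lemma Lint_int1 : Lint (fun x => \int[mu]_y F x y).
Proof.
have := integrable_fubini_F Fint; apply: eq_integrable => // x _.
rewrite /fubini_F /= Lint_EFin//; exact: Lint_dom1.
Qed.

Lemma Lint_int2 : Lint (fun y => \int[mu]_x F x y).
Proof.
have [_ h] : True /\ mu.-integrable setT (fubini_G mu (fun z : R * R => (F z.1 z.2)%:E)).
  split => //; apply/integrableP; split; first exact: measurable_fubini_G Fint.
  have := (integrable21ltyP mu mu mFE).1 Fint; apply: le_lt_trans.
  apply: ge0_le_integral => //.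
  - by apply: measurableT_comp => //; exact: measurable_fubini_G Fint.
  - apply: (@measurable_fun_fubini_tonelli_G _ _ _ _ _ mu (fun z : R * R => `|(F z.1 z.2)%:E|%E)) => //.
    exact: measurableT_comp.
  - move=> y _; apply: le_abse_integral => //.
    apply/measurable_EFinP; exact: (measurable_fun_pair1 y mF).
apply: eq_integrable h => // y _.
rewrite /fubini_G /= Lint_EFin//; exact: Lint_dom2.
Qed.

Lemma Int_fubini : \int[mu]_x (\int[mu]_y F x y) = \int[mu]_y (\int[mu]_x F x y).
Proof.
apply/EFin_inj; rewrite !Lint_EFin; [|exact: Lint_int2|exact: Lint_int1].
transitivity (\int[mu]_x \int[mu]_y (F x y)%:E)%E.
  apply: eq_integral => x _; rewrite Lint_EFin//; exact: Lint_dom1.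
rewrite (Fubini Fint); apply: eq_integral => y _.
rewrite Lint_EFin//; exact: Lint_dom2.
Qed.

End fubini_dom.

Lemma Int_dct (fn : nat -> R -> R) f g :
  (forall n, measurable_fun setT (fn n)) -> measurable_fun setT f -> Lint g ->
  (forall n x, `|fn n x| <= g x) ->
  {ae mu, forall x, fn n x @[n --> \oo] --> f x} ->
  \int[mu]_x fn n x @[n --> \oo] --> \int[mu]_x f x.
Proof.
move=> mfn mf ig fg cv.
have cvE : {ae mu, forall x, setT x -> (fn n x)%:E @[n --> \oo] --> (f x)%:E}.
  case: cv => Z [mZ Z0 hZ]; exists Z; split => //; apply: subset_trans hZ => x /=.
  apply: contra_not => hx _; apply: cvg_EFin => //; exact: nearW.
have fgE : {ae mu, forall x n, setT x -> (`|(fn n x)%:E| <= (g x)%:E)%E}.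
  by apply/aeW => x n _; rewrite /= lee_fin.
have mfnE n : measurable_fun setT (fun x => (fn n x)%:E) by exact/measurable_EFinP.
have mfE : measurable_fun setT (fun x => (f x)%:E) by exact/measurable_EFinP.
have [fi _ h] := @dominated_convergence _ _ R mu setT measurableT
  (fun n x => (fn n x)%:E) (EFin \o f) (EFin \o g) mfnE mfE cvE ig fgE.
have fini n : Lint (fn n) by exact: Lint_le (mfn n) ig (fg n).
have h2 : (\int[mu]_x fn n x)%:E @[n --> \oo] --> (\int[mu]_x f x)%:E.
  rewrite Lint_EFin//; apply: cvg_trans h; apply: near_eq_cvg.
  by near=> n; rewrite /= Lint_EFin.
exact: (fine_cvg h2).
Unshelve. all: end_near. Qed.

End fubini_dct.

(** * Indicators, the fundamental theorem of calculus, mean value bounds *)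

Section interval_integrals.
Context {R : realType}.
Local Notation mu := (@lebesgue_measure R).
Implicit Types (f g F G : R -> R) (a b r x y c : R).

Definition ind a b : R -> R := \1_([set` `[a, b[ ]).

Lemma indE a b x : ind a b x = ((a <= x < b)%R : bool)%:R.
Proof. by rewrite /ind indicE mem_setE in_itv. Qed.

Lemma ind_ge0 a b x : 0 <= ind a b x. Proof. by rewrite indE. Qed.
Lemma ind_le1 a b x : ind a b x <= 1.
Proof. by rewrite indE lern1 leq_b1. Qed.

Lemma ind_meas a b : measurable_fun setT (ind a b).
Proof. by apply: measurable_indic; exact: measurable_itv. Qed.

Lemma Lint_ind a b : Lint (ind a b).
Proof. exact: integrable_indic_itv. Qed.

Lemma Int_ind a b : a <= b -> \int[mu]_x ind a b x = b - a.
Proof.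
move=> ab; rewrite /Rintegral integral_indic//= setIT lebesgue_measure_itv/= lte_fin.
by case: ltgtP ab => //= -> _; rewrite subrr.
Qed.

Lemma derivable_cont F : (forall x, derivable F x 1) -> continuous F.
Proof. by move=> dF x; exact/differentiable_continuous/derivable1_diffP/dF. Qed.

Lemma is_derive_cont F f : (forall x, is_derive x 1 F (f x)) -> continuous F.
Proof. by move=> dF; apply: derivable_cont => x; have [] := dF x. Qed.

Lemma mul_ind_restrict f a b : (fun x => f x * ind a b x) = f \_ `[a, b[.
Proof.
apply/funext => x; rewrite indE /patch mem_setE in_itv/=.
by case: ifP; rewrite ?mulr1 ?mulr0.
Qed.

Lemma Lint_mul_ind f a b : continuous f -> Lint (fun x => f x * ind a b x).
Proof.
move=> cf; rewrite mul_ind_restrict.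
have h : mu.-integrable `[a, b] (EFin \o f).
  apply: continuous_compact_integrable; first exact: segment_compact.
  exact: continuous_subspaceT.
have h2 : mu.-integrable `[a, b[ (EFin \o f).
  by apply: integrableS h => //; apply: subset_itvl; rewrite bnd_simp.
by rewrite /Lint -restrict_EFin; apply/integrable_restrict => //; rewrite setTI.
Qed.

Lemma Int_FTC F f a b : a <= b -> (forall x, is_derive x 1 F (f x)) -> continuous f ->
  \int[mu]_x (f x * ind a b x) = F b - F a.
Proof.
move=> ab dF cf.
have -> : \int[mu]_x (f x * ind a b x) = \int[mu]_(x in `[a, b[) f x.
  by rewrite [RHS]Rintegral_mkcond -mul_ind_restrict.
move: ab; rewrite le_eqVlt => /predU1P[->|ab].
  by rewrite set_itv_ge ?bnd_simp// Rintegral_set0 subrr.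
rewrite Rintegral_itv_bndo_bndc; last first.
  have h : mu.-integrable `[a, b] (EFin \o f).
    apply: continuous_compact_integrable; first exact: segment_compact.
    exact: continuous_subspaceT.
  by apply: integrableS h => //; apply: subset_itvl; rewrite bnd_simp.
rewrite /Rintegral (@continuous_FTC2 _ f F)//.
- exact: continuous_subspaceT.
- have cF := is_derive_cont dF; split.
  + by move=> x _; have [] := dF x.
  + exact/cvg_at_right_filter/cF.
  + exact/cvg_at_left_filter/cF.
- by move=> x _; rewrite derive1E; exact: derive_val.
Qed.

(** On [[-n, n[] the integral is a difference of boundary values; dominated convergence removes the
    truncation. *)
Lemma Int_derive0 F f : (forall x, is_derive x 1 F (f x)) -> continuous f ->
  Lint f -> F n%:R @[n --> \oo] --> 0 -> F (- n%:R) @[n --> \oo] --> 0 ->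
  \int[mu]_x f x = 0.
Proof.
move=> dF cf fi F1 F2.
have h1 : \int[mu]_x (f x * ind (- n%:R) n%:R x) @[n --> \oo] --> \int[mu]_x f x.
  apply: (@Int_dct _ _ _ (fun x => `|f x|)).
  - by move=> n; apply: measurable_funM; [exact: Lint_meas|exact: ind_meas].
  - exact: Lint_meas.
  - exact: Lint_norm.
  - move=> n x; rewrite normrM (@ger0_norm _ (ind _ _ _)) ?ind_ge0//.
    by rewrite ler_piMr// ind_le1.
  apply/aeW => x; apply: cvg_near_cst; exists (Num.truncn `|x|).+1 => // n /= hn.
  rewrite indE (_ : (_ <= _ < _) = true) ?mulr1//.
  have : `|x| < n%:R.
    by apply: (lt_le_trans (truncnS_gt _)); rewrite ler_nat.
  by rewrite ltr_norml => /andP[/ltW -> ->].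
have h2 : \int[mu]_x (f x * ind (- n%:R) n%:R x) @[n --> \oo] --> (0 : R).
  rewrite -(subrr (0 : R)); under eq_fun.
    move=> n; rewrite (Int_FTC _ dF cf); last by rewrite (@le_trans _ _ 0)// oppr_le0.
    over.
  exact: cvgB.
exact: (cvg_unique _ h1 h2).
Qed.

Lemma MVT_le F f a b c : (forall x, is_derive x 1 F (f x)) -> a <= b ->
  (forall x, a <= x <= b -> `|f x| <= c) -> `|F b - F a| <= c * (b - a).
Proof.
move=> dF ab fc.
have [x xab ->] := @MVT_segment _ F f a b ab (fun x _ => dF x)
  (continuous_subspaceT (is_derive_cont dF)).
rewrite normrM (@ger0_norm _ (b - a)) ?subr_ge0// ler_wpM2r ?subr_ge0//.
by apply: fc; move: xab; rewrite in_itv.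
Qed.

Lemma MVT_dist F f c x y : (forall x, is_derive x 1 F (f x)) ->
  (forall x, `|f x| <= c) -> `|F x - F y| <= c * `|x - y|.
Proof.
move=> dF fc; have [xy|xy] := leP x y.
  by rewrite distrC (distrC x) (@ger0_norm _ (y - x)) ?subr_ge0//; exact: MVT_le dF xy _.
by rewrite (@gtr0_norm _ (x - y)) ?subr_gt0//; apply: MVT_le dF (ltW xy) _.
Qed.

End interval_integrals.

(** * Kernels, bumps and waves *)

Section kernels.
Context {R : realType}.
Local Notation mu := (@lebesgue_measure R).
Implicit Types (f g F G : R -> R) (a b r x y z c t C : R) (k m j : nat).

(** The order 7 of decay is spent as 3 + 2 + 2: three powers control the overlap of bumps, two give
    decay in the outer variable, two give integrability. Three derivatives match the third
    difference in [bump]. *)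
Definition kernel C f : Prop := exists d : nat -> R -> R,
  [/\ d 0%N = f,
      forall i x, (i < 3)%N -> is_derive x 1 (d i) (d i.+1 x) &
      forall i x, (i <= 3)%N -> `|d i x| <= C * jap x ^- 7].

Definition dil k f x : R := 2 ^+ k * f (2 ^+ k * x).

Definition conv f g x : R := \int[mu]_y (f (x - y) * g y).

Lemma kernel_continuous C f : kernel C f -> continuous f.
Proof. by case=> d [<- dd _]; apply: (@is_derive_cont _ _ (d 1%N)) => x; exact: dd. Qed.

Lemma kernel_le C f x : kernel C f -> `|f x| <= C * jap x ^- 7.
Proof. by case=> d [<- _ dC]; exact: dC. Qed.

Lemma kernel_ge0 C f : kernel C f -> 0 <= C.
Proof.
move=> /(kernel_le 0) h; have := le_trans (normr_ge0 _) h.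
by rewrite pmulr_lge0// japX_gt0.
Qed.

Lemma kernelW C C' f : C <= C' -> kernel C f -> kernel C' f.
Proof.
move=> CC' [d [d0 dd dC]]; exists d; split => // i x i3.
by apply: le_trans (dC i x i3) _; rewrite ler_wpM2r// japX_ge0.
Qed.

Lemma kernelD C C' f g : kernel C f -> kernel C' g -> kernel (C + C') (fun x => f x + g x).
Proof.
move=> [d [d0 dd dC]] [e [e0 ee eC]]; exists (fun i x => d i x + e i x); split.
- by rewrite d0 e0.
- by move=> i x i3; apply: is_deriveD; [exact: dd|exact: ee].
- move=> i x i3; rewrite mulrDl; apply: le_trans (ler_normD _ _) _.
  by apply: lerD; [exact: dC|exact: eC].
Qed.

Lemma kernelZ r C f : kernel C f -> kernel (`|r| * C) (fun x => r * f x).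
Proof.
move=> [d [d0 dd dC]]; exists (fun i x => r * d i x); split.
- by rewrite d0.
- move=> i x i3; have := dd i x i3 => h.
  by rewrite (_ : (fun x => r * d i x) = r \*: d i)//; apply: is_deriveZ.
- by move=> i x i3; rewrite normrM -mulrA ler_wpM2l// dC.
Qed.

Lemma pow2_gt0 k : (0 : R) < 2 ^+ k. Proof. exact: exprn_gt0. Qed.
Lemma pow2_ge0 k : (0 : R) <= 2 ^+ k. Proof. exact/ltW/pow2_gt0. Qed.
Lemma pow2_ge1 k : (1 : R) <= 2 ^+ k. Proof. by apply: exprn_ege1; lra. Qed.
Lemma pow2_neq0 k : (2 ^+ k : R) != 0. Proof. exact/lt0r_neq0/pow2_gt0. Qed.
Lemma ipow2_gt0 k : (0 : R) < 2 ^- k. Proof. by rewrite invr_gt0 pow2_gt0. Qed.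
Lemma ipow2_ge0 k : (0 : R) <= 2 ^- k. Proof. exact/ltW/ipow2_gt0. Qed.
Lemma ipow2_le1 k : 2 ^- k <= 1 :> R.
Proof. by rewrite invf_le1 ?pow2_gt0// pow2_ge1. Qed.

Lemma dil_continuous k f : continuous f -> continuous (dil k f).
Proof.
move=> cf x; apply: cvgM; first exact: cvg_cst.
apply: (@continuous_comp _ _ _ (fun x => 2 ^+ k * x) f); last exact: cf.
by apply: cvgM; [exact: cvg_cst|exact: cvg_id].
Qed.

Lemma reflect_continuous x f : continuous f -> continuous (fun y => f (x - y)).
Proof.
move=> cf y; apply: (@continuous_comp _ _ _ (fun y => x - y) f); last exact: cf.
by apply: cvgB; [exact: cvg_cst|exact: cvg_id].
Qed.

Lemma dil_meas k x C f : kernel C f -> measurable_fun setT (fun y => dil k f (x - y)).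
Proof.
move=> kf; apply: continuous_measurable_fun; apply: reflect_continuous.
exact/dil_continuous/kernel_continuous/kf.
Qed.

Lemma dil_le k x C f : kernel C f ->
  `|dil k f x| <= C * (2 ^+ k * jap (2 ^+ k * x) ^- 7).
Proof.
move=> kf; rewrite /dil normrM (ger0_norm (pow2_ge0 _)) mulrCA ler_wpM2l ?pow2_ge0//.
exact: kernel_le.
Qed.

Lemma Lint_dil k x C f : kernel C f -> Lint (fun y => dil k f (x - y)).
Proof.
move=> kf; apply: Lint_le (dil_meas k x kf) (LintZ C (Lint_scaled_jap x (pow2_gt0 k))) _.
move=> y; apply: le_trans (dil_le k _ kf) _.
rewrite ler_wpM2l ?(kernel_ge0 kf)// ler_wpM2l ?pow2_ge0//; exact: japX_le.
Qed.

Lemma Int_dil k x C f : kernel C f -> \int[mu]_y f y = 0 ->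
  \int[mu]_y dil k f (x - y) = 0.
Proof.
move=> kf f0.
have fi : Lint f.
  by apply: eq_Lint (Lint_opp (@Lint_dil 0 0 C f kf)) => y; rewrite /dil expr0 !mul1r sub0r opprK.
have dfi : Lint (dil k f).
  apply: LintZ; apply: eq_Lint (Lint_affine_gt0 0 (pow2_gt0 k) fi) => y.
  by rewrite addr0.
rewrite (Int_reflect x dfi) /dil IntZ; last first.
  by apply: eq_Lint (Lint_affine_gt0 0 (pow2_gt0 k) fi) => y; rewrite addr0.
have := Int_affine_gt0 0 (pow2_gt0 k) fi.
under eq_Rintegral do rewrite addr0.
by move=> ->; rewrite f0 !mulr0.
Qed.

Let D t f z : R := f z - f (z - t).

Let D_is_derive t F f z : (forall x, is_derive x 1 F (f x)) ->
  is_derive z 1 (D t F) (D t f z).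
Proof.
move=> dF; apply: is_deriveB.
have h : is_derive z 1 (fun z => z - t) (1 : R).
  by rewrite -[X in is_derive _ _ _ X]subr0; apply: is_deriveB.
by have := @is_derive1_comp _ F (fun z => z - t) z _ _ (dF (z - t)) h; rewrite mulr1.
Qed.

Let D_le t F f z B : 0 <= t -> (forall x, is_derive x 1 F (f x)) ->
  (forall w, z - t <= w <= z -> `|f w| <= B) -> `|D t F z| <= B * t.
Proof.
move=> t0 dF fB; have h : z - t <= z by rewrite lerBlDr lerDl.
by have := MVT_le dF h fB; rewrite /D opprB addrCA subrr addr0.
Qed.

(** Three nested mean value estimates. The bound [B] is required only on the segment met by the
    difference, and for every derivative sequence, because [kernel] hides its own. *)
Lemma third_difference C f t z B : 0 <= t -> kernel C f ->
  (forall d, (forall i x, (i < 3)%N -> is_derive x 1 (d i) (d i.+1 x)) ->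
    d 0%N = f -> (forall i x, (i <= 3)%N -> `|d i x| <= C * jap x ^- 7) ->
    forall w, z - t *+ 3 <= w <= z -> `|d 3%N w| <= B) ->
  `|f z - 3 * f (z - t) + 3 * f (z - t *+ 2) - f (z - t *+ 3)| <= B * t ^+ 3.
Proof.
move=> t0 [d [d0 dd dC]] h.
have {}h := h d dd d0 dC.
have e0 x : is_derive x 1 (d 0%N) (d 1%N x) by exact: dd.
have e1 x : is_derive x 1 (d 1%N) (d 2%N x) by exact: dd.
have e2 x : is_derive x 1 (d 2%N) (d 3%N x) by exact: dd.
have -> : f z - 3 * f (z - t) + 3 * f (z - t *+ 2) - f (z - t *+ 3) =
    D t (D t (D t (d 0%N))) z.
  rewrite d0 /D.
  have -> : z - t - t = z - t *+ 2 by ring.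
  have -> : z - t *+ 2 - t = z - t *+ 3 by ring.
  ring.
have D1 x := @D_is_derive t _ _ x e0.
have D2 x := @D_is_derive t _ _ x D1.
have D1' x := @D_is_derive t _ _ x e1.
rewrite (_ : B * t ^+ 3 = B * t * t * t); last by ring.
apply: (D_le t0 D2) => w1 /andP[w1a w1b].
apply: (D_le t0 D1') => w2 /andP[w2a w2b].
apply: (D_le t0 e2) => w3 /andP[w3a w3b].
apply: h; apply/andP; split; lra.
Qed.

(* A third difference of an indicator function, hence orthogonal to quadratic polynomials. *)
Definition bump m c y : R := let t := 2 ^- m.+2 in
  - ind (c - t *+ 2) (c - t) y + 3 * ind (c - t) c y
  - 3 * ind c (c + t) y + ind (c + t) (c + t *+ 2) y.

Lemma bump_meas m c : measurable_fun setT (bump m c).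
Proof.
apply: measurable_funD; last exact: ind_meas.
apply: measurable_funB; last first.
  apply: measurable_funM => //; exact: ind_meas.
apply: measurable_funD; last first.
  apply: measurable_funM => //; exact: ind_meas.
apply: measurableT_comp => //; exact: ind_meas.
Qed.

Lemma bump_abs m c y : `|bump m c y| <=
  3 * ind (c - 2 ^- m.+1) (c + 2 ^- m.+1) y.
Proof.
have e : (2 ^- m.+1 : R) = 2 ^- m.+2 *+ 2.
  by rewrite [in RHS]exprS; field; exact: pow2_neq0.
rewrite /bump e !indE; set t := 2 ^- m.+2.
have t0 : 0 < t by exact: ipow2_gt0.
rewrite mulr2n.
case: (leP (c - (t + t)) y); case: (leP (c - t) y); case: (leP c y);
  case: (leP (c + t) y); case: (ltP y (c + (t + t))) => h1 h2 h3 h4 h5 /=;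
  rewrite ler_norml; apply/andP; split; lra.
Qed.

Lemma Lint_bump m c : Lint (bump m c).
Proof.
apply: Lint_le (bump_meas m c) (LintZ 3 (Lint_ind _ _)) _ => y; exact: bump_abs.
Qed.

Let ind_shift a b s y : ind (a + s) (b + s) y = ind a b (y - s).
Proof. by rewrite !indE lerBrDr ltrBlDr. Qed.

(** The four steps of a bump are translates of one interval; moving the translations to [f] turns
    the heights into the coefficients of a third difference. *)
Lemma conv_bump f m c x : continuous f ->
  let t := 2 ^- m.+2 in
  conv f (bump m c) x = - \int[mu]_y
    ((f (x - y) - 3 * f (x - y - t) + 3 * f (x - y - t *+ 2) - f (x - y - t *+ 3))
     * ind (c - t *+ 2) (c - t) y).
Proof.
move=> cf t.
have cg s : continuous (fun y => f (x - y - s)).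
  move=> y; have := @reflect_continuous (x - s) f cf y.
  rewrite (_ : (fun y => f (x - s - y)) = (fun y => f (x - y - s)))//.
  by apply/funext => z; rewrite addrAC.
have cg0 := @reflect_continuous x f cf.
pose a := c - t *+ 2; pose b := c - t.
have sh s : \int[mu]_y (f (x - y) * ind (a + s) (b + s) y) =
    \int[mu]_y (f (x - y - s) * ind a b y).
  rewrite -(Int_shift s (Lint_mul_ind a b (cg s))).
  apply: eq_Rintegral => y _; rewrite ind_shift.
  by congr (f _ * _); ring.
have sh1 := sh t; have sh2 := sh (t *+ 2); have sh3 := sh (t *+ 3).
have e1 : a + t = c - t by rewrite /a mulr2n; ring.
have e2 : b + t = c by rewrite /b; ring.
have e3 : a + t *+ 2 = c by rewrite /a; ring.
have e4 : b + t *+ 2 = c + t by rewrite /b mulr2n; ring.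
have e5 : a + t *+ 3 = c + t by rewrite /a mulr2n !mulrSr mulr0n; ring.
have e6 : b + t *+ 3 = c + t *+ 2 by rewrite /b mulr2n !mulrSr mulr0n; ring.
rewrite e1 e2 in sh1; rewrite e3 e4 in sh2; rewrite e5 e6 in sh3.
pose A0 := (fun y => f (x - y) * ind a b y).
pose A s := (fun y => f (x - y - s) * ind a b y).
have i0 : Lint A0 by exact: Lint_mul_ind.
have iA s : Lint (A s) by exact: Lint_mul_ind.
have j1 : Lint (fun y => f (x - y) * ind (c - t) c y) by exact: Lint_mul_ind.
have j2 : Lint (fun y => f (x - y) * ind c (c + t) y) by exact: Lint_mul_ind.
have j3 : Lint (fun y => f (x - y) * ind (c + t) (c + t *+ 2) y) by exact: Lint_mul_ind.
transitivity (- (\int[mu]_y A0 y) + 3 * (\int[mu]_y A t y)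
    - 3 * (\int[mu]_y A (t *+ 2) y) + \int[mu]_y A (t *+ 3) y).
  rewrite -sh1 -sh2 -sh3 /conv -(IntN i0) -(IntZ 3 j1) -(IntZ 3 j2).
  rewrite -(IntD (LintN i0) (LintZ 3 j1)).
  rewrite -(IntB (LintD (LintN i0) (LintZ 3 j1)) (LintZ 3 j2)).
  rewrite -(IntD (LintB (LintD (LintN i0) (LintZ 3 j1)) (LintZ 3 j2)) j3).
  by apply: eq_Rintegral => y _; rewrite /bump /A0 -/t -/a -/b; ring.
transitivity (- (\int[mu]_y A0 y - 3 * (\int[mu]_y A t y)
    + 3 * (\int[mu]_y A (t *+ 2) y) - \int[mu]_y A (t *+ 3) y)); first by ring.
congr (- _).
rewrite -(IntZ 3 (iA t)) -(IntZ 3 (iA (t *+ 2))).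
rewrite -(IntB i0 (LintZ 3 (iA t))).
rewrite -(IntD (LintB i0 (LintZ 3 (iA t))) (LintZ 3 (iA (t *+ 2)))).
rewrite -(IntB (LintD (LintB i0 (LintZ 3 (iA t))) (LintZ 3 (iA (t *+ 2)))) (iA (t *+ 3))).
by apply: eq_Rintegral => y _; rewrite /A0 /A; ring.
Qed.

End kernels.

(** * Kernels against bumps *)

Section kernel_estimates.
Context {R : realType}.
Local Notation mu := (@lebesgue_measure R).
Implicit Types (f g F G : R -> R) (a b r x y z c t C : R) (k m j : nat).

Let near_bump_jap m c y : ind (c - 2 ^- m.+1) (c + 2 ^- m.+1) y != 0 ->
  jap (2 ^+ m * (y - c)) <= 2.
Proof.
rewrite indE; case: (boolP (_ && _)) => [/andP[h1 h2] _|_]; last by rewrite eqxx.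
rewrite /jap normrM (ger0_norm (pow2_ge0 m)).
suff : 2 ^+ m * `|y - c| <= 1 by lra.
rewrite mulrC -ler_pdivlMr ?pow2_gt0// div1r ler_norml.
have : (2 ^- m.+1 : R) <= 2 ^- m.
  by rewrite lef_pV2 ?posrE ?pow2_gt0// ler_eXn2l// ltr1n.
by move=> h; apply/andP; split; lra.
Qed.

(** At scales finer than the bump no cancellation is used. On the support [y] is within [2 ^- m] of
    [c], so the weight at [x - y] controls the weight at [x - c]. The constant 96 is the height 3
    times [2 ^ 5], for five powers of [jap] compared with factor 2. *)
Let conv_bump_fine C f m k c x : (m <= k)%N -> kernel C f ->
  `|conv (dil k f) (bump m c) x| <=
    96 * japI * C * (jap (2 ^+ m * (x - c)) ^- 3 * jap (x - c) ^- 2).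
Proof.
move=> mk kf; have C0 := kernel_ge0 kf.
set W := jap _ ^- 3 * jap _ ^- 2.
have W0 : 0 <= W by rewrite mulr_ge0// japX_ge0.
have -> : 96 * japI * C * W = \int[mu]_y (96 * C * W * (2 ^+ k * jap (2 ^+ k * (x - y)) ^- 2)).
  rewrite IntZ ?Int_scaled_jap ?pow2_gt0//; first by ring.
  exact/Lint_scaled_jap/pow2_gt0.
apply: Int_norm_le.
- by apply: measurable_funM; [exact: dil_meas kf|exact: bump_meas].
- by apply: LintZ; exact/Lint_scaled_jap/pow2_gt0.
move=> y; rewrite normrM.
have [i0|i0] := eqVneq (ind (c - 2 ^- m.+1) (c + 2 ^- m.+1) y) 0.
  have := bump_abs m c y; rewrite i0 mulr0 normr_le0 => /eqP ->.
  by rewrite normr0 mulr0 mulr_ge0 ?mulr_ge0 ?pow2_ge0 ?japX_ge0.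
have h2 := near_bump_jap i0.
have b3 : `|bump m c y| <= 3.
  by apply: le_trans (bump_abs m c y) _; rewrite ler_piMr// ind_le1.
have p1 : (1 : R) <= 2 ^+ m := pow2_ge1 m.
have jm : jap (2 ^+ m * (x - c)) <= 2 * jap (2 ^+ k * (x - y)).
  have := japD (2 ^+ m * (y - c)) (2 ^+ m * (x - y)).
  rewrite -mulrDr (_ : y - c + (x - y) = x - c); last by ring.
  move/le_trans; apply; apply: ler_pM => //; rewrite ?jap_ge0//.
  apply: le_jap; rewrite !normrM ler_wpM2r// !ger0_norm ?pow2_ge0//.
  by rewrite ler_weXn2l// ler1n.
have j1 : jap (x - c) <= 2 * jap (2 ^+ k * (x - y)).
  by apply: le_trans jm; apply: jap_scale_ge.
have q3 := japX_mono 3 (ler0n R 2) jm.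
have q2 := japX_mono 2 (ler0n R 2) j1.
have := dil_le k (x - y) kf.
set J := jap (2 ^+ k * (x - y)) in q3 q2 *.
have -> : J ^- 7 = J ^- 3 * J ^- 2 * J ^- 2 by rewrite -!invfM -!exprD.
move=> hd.
apply: le_trans (ler_pM (normr_ge0 _) (normr_ge0 _) hd b3) _.
have q : J ^- 3 * J ^- 2 <= 32 * W.
  apply: le_trans (ler_pM _ _ q3 q2) _; rewrite ?invr_ge0 ?exprn_ge0 ?jap_ge0//.
  by rewrite /W; apply: eq_ler; ring.
have J2 : 0 <= J ^- 2 by rewrite invr_ge0 exprn_ge0// jap_ge0.
have -> : C * (2 ^+ k * (J ^- 3 * J ^- 2 * J ^- 2)) * 3 =
   (3 * C * 2 ^+ k * J ^- 2) * (J ^- 3 * J ^- 2) by ring.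
have -> : 96 * C * W * (2 ^+ k * J ^- 2) = (3 * C * 2 ^+ k * J ^- 2) * (32 * W) by ring.
by apply: ler_wpM2l q; rewrite !mulr_ge0 ?pow2_ge0.
Qed.

(** Put [e = 2 ^- (m - k)]. The third difference and the length of a step together give [e ^+ 4].
    Three of these powers pay for passing from scale [2 ^+ k] to [2 ^+ m] in the tail [jap ^- 3];
    the fourth is the gain. *)
Let conv_bump_coarse C f m k c x : (k <= m)%N -> kernel C f ->
  `|conv (dil k f) (bump m c) x| <=
    4 ^+ 7 * C * 2 ^- (m - k) * (jap (2 ^+ m * (x - c)) ^- 3 * jap (x - c) ^- 2).
Proof.
move=> km kf; have C0 := kernel_ge0 kf.
have cd : continuous (dil k f) by apply: dil_continuous; exact: kernel_continuous kf.
rewrite (conv_bump m c x cd) normrN.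
set t := 2 ^- m.+2 : R; have t0 : 0 < t := ipow2_gt0 m.+2.
pose s := 2 ^+ k * t.
have s0 : 0 < s by rewrite mulr_gt0// pow2_gt0.
pose e : R := 2 ^- (m - k).
have e0 : 0 < e := ipow2_gt0 _.
have e1 : e <= 1 := ipow2_le1 _.
have se : s = e / 4.
  have em : (2 ^+ m : R) = 2 ^+ (m - k) * 2 ^+ k by rewrite -exprD subnK.
  rewrite /s /e /t !exprS em; field.
  by rewrite !pow2_neq0.
pose X := x - c.
set J := jap (2 ^+ k * X).
(* Over the segment of the third difference the argument moves by at most 3, so [jap] there is at
   least [J / 4]. *)
pose B := C * (4 ^+ 7 * J ^- 7).
have J0 n : 0 <= J ^- n by rewrite invr_ge0 exprn_ge0// jap_ge0.
have bnd y : c - t *+ 2 <= y < c - t ->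
  `|dil k f (x - y) - 3 * dil k f (x - y - t) + 3 * dil k f (x - y - t *+ 2)
    - dil k f (x - y - t *+ 3)| <= 2 ^+ k * (B * s ^+ 3).
  move=> /andP[y1 y2].
  pose z := 2 ^+ k * (x - y).
  have -> : dil k f (x - y) - 3 * dil k f (x - y - t) + 3 * dil k f (x - y - t *+ 2)
    - dil k f (x - y - t *+ 3) =
    2 ^+ k * (f z - 3 * f (z - s) + 3 * f (z - s *+ 2) - f (z - s *+ 3)).
    rewrite /dil.
    have -> : 2 ^+ k * (x - y - t) = z - s by rewrite /z /s; ring.
    have -> : 2 ^+ k * (x - y - t *+ 2) = z - s *+ 2 by rewrite /z /s; ring.
    have -> : 2 ^+ k * (x - y - t *+ 3) = z - s *+ 3 by rewrite /z /s; ring.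
    by rewrite /z; ring.
  rewrite normrM (ger0_norm (pow2_ge0 k)) ler_wpM2l ?pow2_ge0//.
  apply: (third_difference (ltW s0) kf) => d dd d0 dC w /andP[w1 w2].
  apply: le_trans (dC 3%N w (leqnn 3)) _; rewrite /B ler_wpM2l//.
  apply: japX_mono => //.
  have := japB (2 ^+ k * X) w.
  move/le_trans; apply; rewrite mulrC ler_wpM2r ?jap_ge0//.
  rewrite /jap; suff : `|2 ^+ k * X - w| <= 3 by lra.
  have zX : 2 ^+ k * X - z = 2 ^+ k * (y - c) by rewrite /z /X; ring.
  have a1 : 2 ^+ k * (y - c) <= 0.
    by rewrite pmulr_rle0 ?pow2_gt0//; lra.
  have a2 : - (s *+ 2) <= 2 ^+ k * (y - c).
    rewrite (_ : - (s *+ 2) = 2 ^+ k * (- (t *+ 2))); last by rewrite /s; ring.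
    by rewrite ler_pM2l ?pow2_gt0//; lra.
  rewrite ler_norml; apply/andP; split; lra.
have hle : `|\int[mu]_y ((dil k f (x - y) - 3 * dil k f (x - y - t)
    + 3 * dil k f (x - y - t *+ 2) - dil k f (x - y - t *+ 3))
     * ind (c - t *+ 2) (c - t) y)| <= 2 ^+ k * (B * s ^+ 3) * t.
  have -> : 2 ^+ k * (B * s ^+ 3) * t =
     \int[mu]_y (2 ^+ k * (B * s ^+ 3) * ind (c - t *+ 2) (c - t) y).
    rewrite IntZ ?Int_ind; [|lra|exact: Lint_ind].
    by congr (_ * _); ring.
  apply: Int_norm_le.
  - have cg s' : continuous (fun y => dil k f (x - y - s')).
      move=> y; have := @reflect_continuous _ (x - s') _ cd y.
      rewrite (_ : (fun y => dil k f (x - s' - y)) = (fun y => dil k f (x - y - s')))//.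
      by apply/funext => z; rewrite addrAC.
    have mg s' := continuous_measurable_fun (cg s').
    apply: measurable_funM; last exact: ind_meas.
    apply: measurable_funB => //; apply: measurable_funD.
      apply: measurable_funB; last exact: measurable_funM.
      exact: dil_meas kf.
    exact: measurable_funM.
  - exact/LintZ/Lint_ind.
  move=> y; rewrite normrM (ger0_norm (ind_ge0 _ _ _)) indE.
  case: (boolP (_ && _)) => [h|_]; last by rewrite !mulr0.
  by rewrite !mulr1 bnd.
apply: le_trans hle _.
have -> : 2 ^+ k * (B * s ^+ 3) * t = C * 4 ^+ 7 * (J ^- 7 * s ^+ 4).
  by rewrite /B /s; ring.
have -> : 4 ^+ 7 * C * e * (jap (2 ^+ m * X) ^- 3 * jap X ^- 2) =
  C * 4 ^+ 7 * (e * (jap (2 ^+ m * X) ^- 3 * jap X ^- 2)) by ring.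
rewrite ler_wpM2l ?mulr_ge0//.
have s4 : s ^+ 4 <= e ^+ 4.
  by rewrite lerXn2r ?nnegrE ?(ltW s0) ?(ltW e0)// se; lra.
have q1 : J ^- 3 <= e ^- 3 * jap (2 ^+ m * X) ^- 3.
  rewrite -(exprVn e); apply: (@japX_mono R 3 (2 ^+ m * X) (2 ^+ k * X)).
    by rewrite invr_ge0 ltW.
  have em : (2 ^+ m : R) = 2 ^+ (m - k) * 2 ^+ k by rewrite -exprD subnK.
  rewrite /e invrK /J em -mulrA.
  by apply: jap_scale_le; exact: pow2_ge1.
have q2 : J ^- 2 <= jap X ^- 2.
  rewrite lef_pV2 ?posrE ?exprn_gt0 ?jap_gt0// lerXn2r ?nnegrE ?jap_ge0//.
  by apply: jap_scale_ge; exact: pow2_ge1.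
have q3 : J ^- 7 <= J ^- 3 * J ^- 2.
  by rewrite -invfM -exprD; apply: japX_le.
have q4 : J ^- 7 <= e ^- 3 * jap (2 ^+ m * X) ^- 3 * jap X ^- 2.
  by apply: le_trans q3 _; apply: ler_pM.
apply: le_trans (ler_pM (J0 _) (exprn_ge0 _ (ltW s0)) q4 s4) _.
apply: eq_ler; field.
by rewrite !jap_neq0 lt0r_neq0.
Qed.

Definition Kbump : R := 96 * japI + 4 ^+ 7.

Lemma Kbump_gt0 : 0 < Kbump.
Proof. by rewrite ltr_wpDl ?mulr_ge0 ?japI_ge0// exprn_gt0. Qed.

(** Truncated subtraction covers both regimes: for [m <= k] the factor [2 ^- (m - k)] is 1. *)
Lemma conv_bump_le C f m k c x : kernel C f ->
  `|conv (dil k f) (bump m c) x| <=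
    Kbump * C * 2 ^- (m - k) * (jap (2 ^+ m * (x - c)) ^- 3 * jap (x - c) ^- 2).
Proof.
move=> kf; have C0 := kernel_ge0 kf.
have [mk|/ltnW km] := leqP m k.
  have -> : (m - k = 0)%N by apply/eqP; rewrite subn_eq0.
  rewrite expr0 invr1 mulr1; apply: le_trans (conv_bump_fine c x mk kf) _.
  rewrite ler_wpM2r ?mulr_ge0 ?japX_ge0// ler_wpM2r// /Kbump lerDl exprn_ge0//.
apply: le_trans (conv_bump_coarse c x km kf) _.
rewrite ler_wpM2r ?mulr_ge0 ?japX_ge0// ler_wpM2r ?ipow2_ge0// ler_wpM2r//.
by rewrite /Kbump lerDr !mulr_ge0// japI_ge0.
Qed.

End kernel_estimates.

(** * Kernels against waves *)

Section wave.
Context {R : realType}.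
Local Notation mu := (@lebesgue_measure R).
Implicit Types (f g F G : R -> R) (a b r x y z c t C : R) (k m j : nat).

Definition freq j : R := 2 * pi * 2 ^+ j.

Lemma freq_gt0 j : 0 < freq j.
Proof. by rewrite /freq !mulr_gt0 ?pi_gt0 ?pow2_gt0. Qed.

Definition wave j y : R := sin (freq j * y) * ind 0 1 y.

Lemma is_derive_scale r (x : R) : is_derive x 1 (fun y => r * y) r.
Proof.
rewrite (_ : (fun y => r * y) = r \*: (fun y : R => y))//.
by rewrite -[X in is_derive _ _ _ X]mulr1; exact: is_deriveZ.
Qed.

Lemma is_derive_sin_scale r x : is_derive x 1 (fun y => sin (r * y)) (r * cos (r * x)).
Proof.
rewrite mulrC.
exact: (@is_derive1_comp _ sin (fun y => r * y) x _ _ (is_derive_sin _) (is_derive_scale r x)).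
Qed.

Lemma is_derive_cos_scale r x : is_derive x 1 (fun y => cos (r * y)) (- (r * sin (r * x))).
Proof.
rewrite mulrC -mulNr.
exact: (@is_derive1_comp _ cos (fun y => r * y) x _ _ (is_derive_cos _) (is_derive_scale r x)).
Qed.

Lemma continuous_sin_scale r : continuous (fun y : R => sin (r * y)).
Proof. by apply: is_derive_cont => x; exact: is_derive_sin_scale. Qed.

Lemma continuous_cos_scale r : continuous (fun y : R => cos (r * y)).
Proof. by apply: is_derive_cont => x; exact: is_derive_cos_scale. Qed.

Lemma norm_sin_le1 (x : R) : `|sin x| <= 1.
Proof. by rewrite ler_norml sin_geN1 sin_le1. Qed.

Lemma norm_cos_le1 (x : R) : `|cos x| <= 1.
Proof. by rewrite ler_norml cos_geN1 cos_le1. Qed.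

Lemma cos_int (n : nat) : cos (2 * pi * n%:R) = 1 :> R.
Proof.
elim: n => [|n IH]; first by rewrite mulr0 cos0.
rewrite -[RHS]IH -[in RHS]cosD2pi; congr cos; rewrite -natr1; ring.
Qed.

Lemma sin_int (n : nat) : sin (2 * pi * n%:R) = 0 :> R.
Proof.
elim: n => [|n IH]; first by rewrite mulr0 sin0.
rewrite -[RHS]IH -[in RHS]sinD2pi; congr sin; rewrite -natr1; ring.
Qed.

Lemma wave_meas j : measurable_fun setT (wave j).
Proof.
apply: measurable_funM; last exact: ind_meas.
exact: continuous_measurable_fun (@continuous_sin_scale (freq j)).
Qed.

Lemma wave_abs j y : `|wave j y| <= ind 0 1 y.
Proof.
by rewrite /wave normrM (ger0_norm (ind_ge0 _ _ _)) ler_piMl ?ind_ge0// norm_sin_le1.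
Qed.

(** The primitive of the sine that vanishes at all multiples of [2 ^- j]. In particular it vanishes
    at both ends of [0, 1], so integration by parts leaves no boundary term. *)
Definition wprim j y : R := (1 - cos (freq j * y)) / freq j.

Lemma wprim_is_derive j x : is_derive x 1 (wprim j) (sin (freq j * x)).
Proof.
have f0 := lt0r_neq0 (freq_gt0 j).
have -> : wprim j = (freq j)^-1 \*: (fun y => 1 - cos (freq j * y)).
  by apply/funext => y; rewrite /wprim mulrC.
have -> : sin (freq j * x) = (freq j)^-1 *: (0 - - (freq j * sin (freq j * x))).
  by rewrite sub0r opprK /GRing.scale/= mulKf.
by apply: is_deriveZ; apply: is_deriveB; exact: is_derive_cos_scale.
Qed.

Lemma wprim_le j y : `|wprim j y| <= 2 ^- j.
Proof.
have f0 := freq_gt0 j.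
rewrite /wprim normrM normfV (gtr0_norm f0) ler_pdivrMr//.
have -> : 2 ^- j * freq j = 2 * pi by rewrite /freq; field; rewrite pow2_neq0.
apply: le_trans (ler_normB _ _) _; rewrite normr1.
have := norm_cos_le1 (freq j * y); have := @pi_ge2 R; lra.
Qed.

Lemma wprim0 j : wprim j 0 = 0.
Proof. by rewrite /wprim mulr0 cos0 subrr mul0r. Qed.

Lemma wprim1 j : wprim j 1 = 0.
Proof.
rewrite /wprim mulr1 /freq (_ : 2 ^+ j = (2 ^ j)%:R :> R); last by rewrite natrX.
by rewrite cos_int subrr mul0r.
Qed.

(** The sine vanishes at 0 and 1, so cutting it off amounts to composing it with the clamp onto
    [0, 1]. This makes the wave Lipschitz on the whole line. *)
Let clamp y : R := Num.max 0 (Num.min y 1).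

Let waveE j y : wave j y = sin (freq j * clamp y).
Proof.
rewrite /wave indE /clamp; case: (leP y 1) => [y1|y1].
  have [y0|y0] := leP 0 y.
    case: (ltP y 1) => y1' /=; first by rewrite mulr1.
    have -> : y = 1 by apply/eqP; rewrite eq_le y1 y1'.
    rewrite mulr0 mulr1 /freq (_ : 2 ^+ j = (2 ^ j)%:R :> R); last by rewrite natrX.
    by rewrite sin_int.
  by rewrite /= !mulr0 sin0.
have -> : (0 <= y < 1) = false by apply/negbTE/negP => /andP[_]; lra.
rewrite mulr0 max_r// mulr1 /freq (_ : 2 ^+ j = (2 ^ j)%:R :> R); last by rewrite natrX.
by rewrite sin_int.
Qed.

Let clamp_lip x y : `|clamp x - clamp y| <= `|x - y|.
Proof.
have lip (u v : R) : u <= v -> `|clamp u - clamp v| <= `|u - v|.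
  move=> uv; rewrite distrC (distrC u) (@ger0_norm _ (v - u)) ?subr_ge0// /clamp.
  case: (leP u 1) => u1; case: (leP v 1) => v1; rewrite ?(max_r (@ler01 R));
    case: (leP 0 u) => a; case: (leP 0 v) => b; rewrite ler_norml; apply/andP; split; lra.
by have [xy|/ltW xy] := leP x y; [exact: lip|rewrite distrC (distrC x); exact: lip].
Qed.

Lemma wave_lip j x y : `|wave j x - wave j y| <= freq j * `|x - y|.
Proof.
rewrite !waveE; apply: le_trans (MVT_dist (c := freq j) _ _ (@is_derive_sin_scale (freq j)) _) _.
  move=> z; rewrite normrM (gtr0_norm (freq_gt0 j)) ler_piMr ?(ltW (freq_gt0 j))//.
  exact: norm_cos_le1.
by rewrite ler_wpM2l ?clamp_lip// ltW// freq_gt0.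
Qed.

Let jap_near x y : (0 <= x < 1) || (0 <= y < 1) -> jap x <= 2 * jap (x - y).
Proof.
move=> /orP[/andP[x0 x1]|/andP[y0 y1]].
  have e : jap x = 1 + x by rewrite /jap ger0_norm.
  have := jap_ge1 (x - y); lra.
apply: le_trans (japB x y) _; rewrite ler_wpM2r ?jap_ge0// /jap ger0_norm//; lra.
Qed.

(** Integration by parts: the wave is replaced by its primitive, of size [2 ^- j], and the kernel by
    its derivative, which costs [2 ^+ k]. *)
Let conv_wave_coarse C f j k x : (k <= j)%N -> kernel C f ->
  `|conv (dil k f) (wave j) x| <= 4 * japI * C * 2 ^- (j - k) * jap x ^- 2.
Proof.
move=> kj [d [d0 dd dC]].
have kf : kernel C f by exists d.
have C0 := kernel_ge0 kf.
pose f1 := d 1%N.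
have df z : is_derive z 1 f (f1 z) by rewrite -d0; exact: dd.
have df1 z : is_derive z 1 f1 (d 2%N z) by exact: dd.
have cf1 : continuous f1 by exact: is_derive_cont df1.
pose g1 y := 2 ^+ k * (2 ^+ k * f1 (2 ^+ k * (x - y))).
have dg y : is_derive y 1 (fun y => dil k f (x - y)) (- g1 y).
  have h1 : is_derive y 1 (fun y => 2 ^+ k * (x - y)) (- (2 ^+ k)).
    rewrite (_ : (fun y => 2 ^+ k * (x - y)) = 2 ^+ k \*: (fun y => x - y))//.
    rewrite -mulrN1; apply: is_deriveZ; rewrite -(sub0r (1 : R)).
    exact: is_deriveB.
  have h2 := @is_derive1_comp _ f (fun y => 2 ^+ k * (x - y)) y _ _ (df _) h1.
  rewrite (_ : (fun y => dil k f (x - y)) = 2 ^+ k \*: (f \o (fun y => 2 ^+ k * (x - y))))//.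
  rewrite (_ : - g1 y = 2 ^+ k *: (f1 (2 ^+ k * (x - y)) * - 2 ^+ k)).
    exact: is_deriveZ.
  by rewrite /g1 /GRing.scale/=; ring.
have cg1 : continuous g1.
  move=> y; apply: cvgM; first exact: cvg_cst.
  apply: cvgM; first exact: cvg_cst.
  apply: (@continuous_comp _ _ _ (fun y => 2 ^+ k * (x - y)) f1); last exact: cf1.
  apply: cvgM; first exact: cvg_cst.
  by apply: cvgB; [exact: cvg_cst|exact: cvg_id].
have cdl : continuous (fun y => dil k f (x - y)) by exact: is_derive_cont dg.
have cw : continuous (wprim j) by exact: is_derive_cont (wprim_is_derive j).
have prod y : is_derive y 1 (fun y => dil k f (x - y) * wprim j y)
    (dil k f (x - y) * sin (freq j * y) - g1 y * wprim j y).
  have := is_deriveM (dg y) (wprim_is_derive j y).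
  rewrite (_ : _ *: _ + _ *: _ = dil k f (x - y) * sin (freq j * y) - g1 y * wprim j y)//.
  by rewrite /GRing.scale/=; ring.
have cs := @continuous_sin_scale (freq j).
have c1 : continuous (fun y => dil k f (x - y) * sin (freq j * y)).
  by move=> y; apply: cvgM; [exact: cdl|exact: cs].
have c2 : continuous (fun y => g1 y * wprim j y).
  by move=> y; apply: cvgM; [exact: cg1|exact: cw].
have ftc : \int[mu]_y ((dil k f (x - y) * sin (freq j * y) - g1 y * wprim j y) * ind 0 1 y) = 0.
  rewrite (Int_FTC ler01 prod) ?wprim0 ?wprim1 ?mulr0 ?subrr//.
  by move=> y; apply: cvgB; [exact: c1|exact: c2].
have -> : conv (dil k f) (wave j) x = \int[mu]_y (g1 y * wprim j y * ind 0 1 y).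
  apply/eqP; rewrite -subr_eq0 -[X in _ == X]ftc -IntB; first last.
  - exact: Lint_mul_ind.
  - by apply: eq_Lint (Lint_mul_ind 0 1 c1) => y; rewrite /wave mulrA.
  by apply/eqP; apply: eq_Rintegral => y _; rewrite /wave; ring.
have ji := Lint_scaled_jap x (pow2_gt0 k).
have -> : 4 * japI * C * 2 ^- (j - k) * jap x ^- 2 =
    \int[mu]_y (4 * C * 2 ^- (j - k) * jap x ^- 2 * (2 ^+ k * jap (2 ^+ k * (x - y)) ^- 2)).
  by rewrite IntZ// Int_scaled_jap ?pow2_gt0//; ring.
apply: Int_norm_le.
- apply: measurable_funM; last exact: ind_meas.
  exact: continuous_measurable_fun.
- exact: LintZ.
move=> y; rewrite normrM (normrM (g1 y)) indE; case: (boolP (0 <= y < 1)) => y01; last first.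
  by rewrite normr0 mulr0 !mulr_ge0 ?pow2_ge0 ?japX_ge0 ?ipow2_ge0.
rewrite normr1 mulr1.
have -> : `|g1 y| = 2 ^+ k * (2 ^+ k * `|f1 (2 ^+ k * (x - y))|).
  by rewrite /g1 2!normrM !(ger0_norm (pow2_ge0 _)).
have J : jap x <= 2 * jap (2 ^+ k * (x - y)).
  have jn : jap x <= 2 * jap (x - y) by apply: jap_near; rewrite y01 orbT.
  apply: le_trans jn _.
  by rewrite ler_wpM2l//; apply: jap_scale_ge; exact: pow2_ge1.
have q := japX_mono 2 (ler0n R 2) J.
have h1 : `|f1 (2 ^+ k * (x - y))| <= C * (jap (2 ^+ k * (x - y)) ^- 2 * jap (2 ^+ k * (x - y)) ^- 2).
  apply: le_trans (dC 1%N _ isT) _; rewrite ler_wpM2l// -japXD; exact: japX_le.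
have -> : (2 ^- (j - k) : R) = 2 ^+ k * 2 ^- j.
  rewrite -[in RHS](subnK kj) exprD; field; by rewrite !pow2_neq0.
set J2 := jap (2 ^+ k * (x - y)) ^- 2 in q h1 *.
have J20 : 0 <= J2 by exact: japX_ge0.
have h2 := wprim_le j y.
have -> : 4 * C * (2 ^+ k * 2 ^- j) * jap x ^- 2 * (2 ^+ k * J2) =
  (2 ^+ k * (2 ^+ k * (C * (2 ^+ 2 * jap x ^- 2 * J2)))) * 2 ^- j by ring.
apply: ler_pM => //.
rewrite !ler_wpM2l ?pow2_ge0//; apply: le_trans h1 _.
by rewrite ler_wpM2l// ler_wpM2r.
Qed.

(** Mean zero allows the value [wave j x] to be subtracted. The Lipschitz bound then yields [2 ^+ j]
    times a distance, and one power of the decay of the kernel absorbs that distance at scale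
    [2 ^- k]. *)
Let conv_wave_fine C f j k x : (j <= k)%N -> kernel C f -> \int[mu]_y f y = 0 ->
  `|conv (dil k f) (wave j) x| <= 32 * japI * C * 2 ^- (k - j) * jap x ^- 2.
Proof.
move=> jk kf f0; have C0 := kernel_ge0 kf.
have i1 : Lint (fun y => dil k f (x - y) * wave j y).
  apply: (@Lint_le _ _ (fun y => `|dil k f (x - y)|)).
  - by apply: measurable_funM; [exact: dil_meas kf|exact: wave_meas].
  - exact/Lint_norm/Lint_dil/kf.
  move=> y; rewrite normrM ler_piMr//; apply: le_trans (wave_abs _ _) (ind_le1 _ _ _).
have i2 : Lint (fun y => wave j x * dil k f (x - y)).
  exact/LintZ/Lint_dil/kf.
have -> : conv (dil k f) (wave j) x = \int[mu]_y (dil k f (x - y) * (wave j y - wave j x)).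
  rewrite -[LHS]subr0 -[X in _ - X](mulr0 (wave j x)) -(Int_dil k x kf f0) -IntZ; last exact: Lint_dil kf.
  by rewrite -IntB//; apply: eq_Rintegral => y _; ring.
have ji := Lint_scaled_jap x (pow2_gt0 k).
have -> : 32 * japI * C * 2 ^- (k - j) * jap x ^- 2 =
    \int[mu]_y (32 * C * 2 ^- (k - j) * jap x ^- 2 * (2 ^+ k * jap (2 ^+ k * (x - y)) ^- 2)).
  by rewrite IntZ// Int_scaled_jap ?pow2_gt0//; ring.
apply: Int_norm_le.
- apply: measurable_funM; first exact: dil_meas kf.
  by apply: measurable_funB => //; exact: wave_meas.
- exact: LintZ.
move=> y; rewrite normrM.
case: (boolP ((0 <= x < 1) || (0 <= y < 1))) => [h|]; last first.
  rewrite negb_or => /andP[/negbTE hx /negbTE hy].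
  rewrite /wave !indE hx hy !mulr0 subrr normr0 mulr0.
  by rewrite !mulr_ge0 ?pow2_ge0 ?japX_ge0 ?ipow2_ge0.
have J : jap x <= 2 * jap (2 ^+ k * (x - y)).
  apply: le_trans (jap_near h) _.
  by rewrite ler_wpM2l//; apply: jap_scale_ge; exact: pow2_ge1.
have q := japX_mono 2 (ler0n R 2) J.
have h1 := dil_le k (x - y) kf.
have h2 := wave_lip j y x.
have pi4 : freq j <= 8 * 2 ^+ j.
  by rewrite /freq ler_wpM2r ?pow2_ge0//; have := @pihalf_lt2 R; lra.
set J1 := jap (2 ^+ k * (x - y)) in q h1 *.
have h3 : freq j * `|y - x| <= 8 * 2 ^- (k - j) * J1.
  have -> : 8 * 2 ^- (k - j) * J1 = 8 * 2 ^+ j * (2 ^- k * J1).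
    rewrite -[in RHS](subnK jk) exprD; field; by rewrite !pow2_neq0.
  apply: ler_pM => //; first exact/ltW/freq_gt0.
  rewrite ler_pdivlMl ?pow2_gt0// /J1 /jap normrM (ger0_norm (pow2_ge0 _)) distrC.
  by rewrite lerDr.
apply: le_trans (ler_pM (normr_ge0 _) (normr_ge0 _) h1 (le_trans h2 h3)) _.
have J10 : 0 < J1 by exact: jap_gt0.
have q7 : J1 ^- 7 * J1 <= J1 ^- 2 * J1 ^- 2.
  rewrite -[X in _ * X]invrK -invfM -invfM -!exprD.
  rewrite (_ : J1 ^+ 7 * J1^-1 = J1 ^+ 6); last by rewrite exprS mulrAC divff ?mul1r// lt0r_neq0.
  exact: (@japX_le R 4 6).
have -> : C * (2 ^+ k * J1 ^- 7) * (8 * 2 ^- (k - j) * J1) =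
  (C * 2 ^+ k * 8 * 2 ^- (k - j)) * (J1 ^- 7 * J1) by ring.
have -> : 32 * C * 2 ^- (k - j) * jap x ^- 2 * (2 ^+ k * J1 ^- 2) =
  (C * 2 ^+ k * 8 * 2 ^- (k - j)) * (2 ^+ 2 * jap x ^- 2 * J1 ^- 2) by ring.
rewrite ler_wpM2l ?mulr_ge0 ?pow2_ge0 ?ipow2_ge0//.
apply: le_trans q7 _; rewrite ler_wpM2r ?japX_ge0//.
Qed.

Definition Kwave : R := 32 * japI + 1.

Lemma Kwave_gt0 : 0 < Kwave.
Proof. by rewrite ltr_wpDl// mulr_ge0 ?japI_ge0. Qed.

Lemma conv_wave_le C f j k x : kernel C f -> (k <= j)%N \/ \int[mu]_y f y = 0 ->
  `|conv (dil k f) (wave j) x| <= Kwave * C * 2 ^- ((j - k) + (k - j)) * jap x ^- 2.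
Proof.
move=> kf; have C0 := kernel_ge0 kf.
have h0 : 32 * japI * C <= Kwave * C by rewrite ler_wpM2r// /Kwave lerDl.
have [kj _|jk] := leqP k j.
  rewrite (_ : (k - j = 0)%N) ?addn0; last by apply/eqP; rewrite subn_eq0.
  apply: le_trans (conv_wave_coarse x kj kf) _.
  rewrite ler_wpM2r ?japX_ge0// ler_wpM2r ?ipow2_ge0//; apply: le_trans h0.
  by rewrite ler_wpM2r// ler_wpM2r ?japI_ge0//; lra.
case=> [//|f0].
rewrite (_ : (j - k = 0)%N) ?add0n; last by apply/eqP; rewrite subn_eq0 ltnW.
apply: le_trans (conv_wave_fine x (ltnW jk) kf f0) _.
by rewrite ler_wpM2r ?japX_ge0// ler_wpM2r ?ipow2_ge0.
Qed.

End wave.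

(** * Fourier transforms of compactly supported multipliers *)

Section smoothness.
Context {R : realType}.
Local Notation mu := (@lebesgue_measure R).
Implicit Types (f g a : R -> R) (x y t B C : R) (n : nat).

(** Derivatives are quantified rather than computed, so closure under the operations follows from
    the [is_derive] rules alone. *)
Fixpoint Cn n f : Prop := if n is n'.+1 then
  exists f', (forall x, is_derive x 1 f (f' x)) /\ Cn n' f' else continuous f.

Lemma Cn_continuous n f : Cn n f -> continuous f.
Proof. by case: n => //= n [f' [df _]]; exact: is_derive_cont df. Qed.

Lemma CnW n f : Cn n.+1 f -> Cn n f.
Proof.
elim: n f => [|n IH] f; first exact: Cn_continuous.
by move=> [f' [df Cf']]; exists f'; split => //; exact: IH.
Qed.

Lemma Cn_cst n (c : R) : Cn n (fun=> c).
Proof.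
elim: n c => [|n IH] c; first by move=> x; exact: cvg_cst.
exists (fun=> 0); split; last exact: IH.
by move=> x; exact: is_derive_cst.
Qed.

Lemma Cn_id n : Cn n (fun x => x).
Proof.
case: n => [|n]; first by move=> x; exact: cvg_id.
exists (fun=> 1); split; last exact: Cn_cst.
by move=> x; exact: is_derive_id.
Qed.

Lemma CnD n f g : Cn n f -> Cn n g -> Cn n (fun x => f x + g x).
Proof.
elim: n f g => [|n IH] f g; first by move=> cf cg x; apply: cvgD; [exact: cf|exact: cg].
move=> [f' [df cf]] [g' [dg cg]]; exists (fun x => f' x + g' x); split; last exact: IH.
by move=> x; apply: is_deriveD.
Qed.

Lemma is_derive_mul f g (f' g' : R) x : is_derive x 1 f f' -> is_derive x 1 g g' ->
  is_derive x 1 (fun y => f y * g y) (f' * g x + f x * g').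
Proof.
move=> df dg; have := is_deriveM df dg.
by rewrite /GRing.scale/= (_ : f x * g' + g x * f' = f' * g x + f x * g')//; ring.
Qed.

Lemma CnM n f g : Cn n f -> Cn n g -> Cn n (fun x => f x * g x).
Proof.
elim: n f g => [|n IH] f g; first by move=> cf cg x; apply: cvgM; [exact: cf|exact: cg].
move=> hf hg; have wf := CnW hf; have wg := CnW hg.
case: hf => f' [df cf]; case: hg => g' [dg cg].
exists (fun x => f' x * g x + f x * g' x); split.
  by move=> x; exact: is_derive_mul.
by apply: CnD; exact: IH.
Qed.

Lemma CnZ n (c : R) f : Cn n f -> Cn n (fun x => c * f x).
Proof. by move=> cf; apply: CnM => //; exact: Cn_cst. Qed.

Lemma CnN n f : Cn n f -> Cn n (fun x => - f x).
Proof.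
move=> cf; rewrite (_ : (fun x => - f x) = (fun x => -1 * f x)); first exact: CnZ.
by apply/funext => x; rewrite mulN1r.
Qed.

Lemma CnB n f g : Cn n f -> Cn n g -> Cn n (fun x => f x - g x).
Proof. by move=> cf cg; apply: CnD => //; exact: CnN. Qed.

Lemma CnV n f : (forall x, f x != 0) -> Cn n f -> Cn n (fun x => (f x)^-1).
Proof.
move=> f0; elim: n => [|n IH] cf; first by move=> x; apply: cvgV => //; exact: cf.
have wf := CnW cf; case: cf => f' [df cf].
exists (fun x => - f' x * ((f x)^-1 * (f x)^-1)); split.
  move=> x; have := is_deriveV (f0 x) (df x).
  rewrite /GRing.scale/= (_ : - f x ^- 2 * f' x = - f' x * ((f x)^-1 * (f x)^-1))//.
  by rewrite expr2 invfM; ring.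
apply: CnM; first exact: CnN.
by apply: CnM; exact: IH.
Qed.

Lemma Cn_comp n f g : Cn n f -> Cn n g -> Cn n (fun x => f (g x)).
Proof.
elim: n f g => [|n IH] f g.
  by move=> cf cg x; apply: (@continuous_comp _ _ _ g f); [exact: cg|exact: cf].
move=> [f' [df cf]] hg; have wg := CnW hg; case: hg => g' [dg cg].
exists (fun x => f' (g x) * g' x); split; last by apply: CnM => //; exact: IH.
by move=> x; exact: (is_derive1_comp (df (g x)) (dg x)).
Qed.

Definition ppart x : R := Num.max x 0.

Lemma ppart_ge0 x : 0 <= ppart x. Proof. by rewrite le_max lexx orbT. Qed.
Lemma ppart_gt0 x : 0 < x -> 0 < ppart x. Proof. by move=> x0; rewrite lt_max x0. Qed.
Lemma ppart_le0 x : x <= 0 -> ppart x = 0. Proof. by move=> x0; rewrite /ppart max_r. Qed.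

Lemma ppart_continuous : continuous ppart.
Proof. by move=> x; apply: continuous_max; [exact: cvg_id|exact: cvg_cst]. Qed.

Lemma ppart_sqr_is_derive x : is_derive x 1 (fun y => ppart y ^+ 2) (2 * ppart x).
Proof.
have h : h^-1 *: (ppart (h *: (1 : R) + x) ^+ 2 - ppart x ^+ 2) @[h --> 0^'] --> 2 * ppart x.
  apply/cvgrPdist_le => e e0; near=> h.
  have h0 : h != 0 by near: h; exact: nbhs_dnbhs_neq.
  rewrite /GRing.scale/= mulr1.
  have -> : 2 * ppart x - h^-1 * (ppart (h + x) ^+ 2 - ppart x ^+ 2) =
     h^-1 * (2 * ppart x * h - (ppart (h + x) ^+ 2 - ppart x ^+ 2)) by field.
  have : `|2 * ppart x * h - (ppart (h + x) ^+ 2 - ppart x ^+ 2)| <= `|h| * `|h|.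
    rewrite -normrM -expr2 ger0_norm ?sqr_ge0// /ppart ler_norml.
    by case: (leP (h + x) 0) => a; case: (leP x 0) => b; apply/andP; split; nra.
  move=> le; rewrite normrM normfV ler_pdivrMl ?normr_gt0//.
  apply: le_trans le _; rewrite ler_wpM2l//.
  by near: h; apply: dnbhs0_le.
apply: DeriveDef; first by apply/cvg_ex; exists (2 * ppart x).
exact/cvg_lim.
Unshelve. all: end_near. Qed.

Lemma ppartX_is_derive n x :
  is_derive x 1 (fun y => ppart y ^+ n.+2) (n.+2%:R * ppart x ^+ n.+1).
Proof.
elim: n x => [|n IH] x; first by rewrite expr1; exact: ppart_sqr_is_derive.
have e k y : ppart y ^+ k.+2 = y * ppart y ^+ k.+1.
  rewrite [LHS]exprS; have [y0|y0] := leP y 0.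
    by rewrite ppart_le0// exprS !mul0r mulr0.
  by congr (_ * _); rewrite /ppart max_l// ltW.
rewrite (_ : (fun y => ppart y ^+ n.+3) = (fun y => y * ppart y ^+ n.+2)); last first.
  by apply/funext => y; rewrite e.
rewrite (_ : _ * _ = 1 * ppart x ^+ n.+2 + x * (n.+2%:R * ppart x ^+ n.+1)).
  by apply: is_derive_mul.
by rewrite mul1r (mulrCA x) -e -(natr1 n.+2); ring.
Qed.

(** These powers are the building blocks of the cutoffs: seven derivatives suffice for Fourier
    transforms that decay to order 7. *)
Lemma Cn_ppartX n : Cn n (fun x => ppart x ^+ n.+1).
Proof.
elim: n => [|n IH].
  by rewrite (_ : (fun x => ppart x ^+ 1) = ppart)//; exact: ppart_continuous.
exists (fun x => n.+2%:R * ppart x ^+ n.+1); split; last exact: CnZ.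
exact: ppartX_is_derive.
Qed.

Definition suppB B f : Prop := forall x, B < `|x| -> f x = 0.

Lemma suppB_derive B f f' : suppB B f -> (forall x, is_derive x 1 f (f' x)) -> suppB B f'.
Proof.
move=> sf df x Bx.
have h : is_derive x 1 f 0.
  apply: (@near_eq_is_derive _ _ _ (cst 0)).
    near=> y; apply/esym; apply: sf.
    near: y; apply: (@cvgr_gt _ _ _ _ (fun y : R => `|y|) `|x|) => //.
    exact: norm_continuous.
have := @derive_val _ _ _ _ _ _ _ (df x).
by rewrite derive_val.
Unshelve. all: end_near. Qed.

Lemma suppB_Lint B f : suppB B f -> continuous f -> Lint f.
Proof.
move=> sf cf.
apply: eq_Lint (Lint_mul_ind (- (`|B| + 1)) (`|B| + 1) cf) => x.
rewrite indE; case: (boolP (_ && _)) => h; rewrite ?mulr1// mulr0.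
apply/esym/sf; rewrite ltNge; apply: contra h => h.
have := ler_norm B => hB; move: h; rewrite ler_norml => /andP[h1 h2]; apply/andP; split; lra.
Qed.

Lemma suppB_cvg B f : suppB B f -> f n%:R @[n --> \oo] --> 0 /\ f (- n%:R) @[n --> \oo] --> 0.
Proof.
move=> sf; split; apply: cvg_near_cst; exists (Num.truncn `|B|).+1 => // n /= hn; apply: sf.
  rewrite normr_nat; apply: le_lt_trans (ler_norm _) _.
  by apply: (lt_le_trans (truncnS_gt _)); rewrite ler_nat.
rewrite normrN normr_nat; apply: le_lt_trans (ler_norm _) _.
by apply: (lt_le_trans (truncnS_gt _)); rewrite ler_nat.
Qed.

End smoothness.

(** * Cosine and sine transforms *)

Section real_fourier.
Context {R : realType}.
Local Notation mu := (@lebesgue_measure R).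
Implicit Types (f g a : R -> R) (x y t B C : R) (n : nat).

Definition Fc a x : R := \int[mu]_t (a t * cos (t * x)).
Definition Fs a x : R := \int[mu]_t (a t * sin (t * x)).

(** Stable under multiplication by the variable ([rapid_mulX]), which is what iterating
    differentiation under the integral requires. *)
Definition rapid a : Prop := continuous a /\
  forall n, exists C, forall x, `|a x| <= C * jap x ^- n.

Definition mulX a t : R := t * a t.

Lemma rapid_Lint a : rapid a -> Lint a.
Proof.
move=> [ca /(_ 2%N)[C h]]; apply: Lint_le (LintZ C (Lint_japX (leqnn 2))) h.
exact: continuous_measurable_fun.
Qed.

Lemma mulX_continuous a : continuous a -> continuous (mulX a).
Proof. by move=> ca x; apply: cvgM; [exact: cvg_id|exact: ca]. Qed.

Lemma rapid_mulX a : rapid a -> rapid (mulX a).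
Proof.
move=> [ca ra]; split; first exact: mulX_continuous.
move=> n; have [C h] := ra n.+1; exists C => x.
rewrite /mulX normrM; apply: (@le_trans _ _ (jap x * (C * jap x ^- n.+1))).
  by apply: ler_pM => //; rewrite /jap lerDr.
by rewrite mulrCA exprS invfM (mulrA (jap x)) divff ?jap_neq0// mul1r.
Qed.

Lemma Cn_suppB_rapid n B a : Cn n a -> suppB B a -> rapid a.
Proof.
move=> /Cn_continuous ca sa; split => // k.
have [M hM] : exists M, forall x, `|x| <= B -> `|a x| <= M.
  have [B0|B0] := ltP B 0.
    by exists 0 => x xB; have := le_lt_trans xB B0; rewrite normr_lt0.
  have cn : {within `[-B, B], continuous (fun x => `|a x|)}.
    apply: continuous_subspaceT => x; apply: (@continuous_comp _ _ _ a (fun y : R => `|y|)).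
      exact: ca.
    exact: norm_continuous.
  have BB : - B <= B by lra.
  have [c _ hc] := @EVT_max _ (fun x => `|a x|) (- B) B BB cn.
  by exists `|a c| => x xB; apply: hc; rewrite in_itv/= -ler_norml.
exists (`|M| * (1 + `|B|) ^+ k) => x.
have [xB|xB] := leP `|x| B; last first.
  by rewrite sa// normr0 !mulr_ge0 ?exprn_ge0 ?addr_ge0 ?japX_ge0.
apply: le_trans (hM x xB) _; apply: le_trans (ler_norm _) _.
rewrite -mulrA ler_peMr// ler_pdivlMr ?exprn_gt0 ?jap_gt0// mul1r.
rewrite lerXn2r ?nnegrE ?jap_ge0 ?addr_ge0// /jap lerD2l.
exact: le_trans xB (ler_norm _).
Qed.

Let cos_prod_meas a x : measurable_fun setT a -> measurable_fun setT (fun t => a t * cos (t * x)).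
Proof.
move=> ma; apply: measurable_funM => //; apply: continuous_measurable_fun.
rewrite (_ : (fun t => cos (t * x)) = (fun t => cos (x * t))); first exact: continuous_cos_scale.
by apply/funext => t; rewrite mulrC.
Qed.

Let sin_prod_meas a x : measurable_fun setT a -> measurable_fun setT (fun t => a t * sin (t * x)).
Proof.
move=> ma; apply: measurable_funM => //; apply: continuous_measurable_fun.
rewrite (_ : (fun t => sin (t * x)) = (fun t => sin (x * t))); first exact: continuous_sin_scale.
by apply/funext => t; rewrite mulrC.
Qed.

Lemma Lint_mul_cos a x : Lint a -> Lint (fun t => a t * cos (t * x)).
Proof.
move=> ia; apply: Lint_le (cos_prod_meas x (Lint_meas ia)) (Lint_norm ia) _ => t.
by rewrite normrM ler_piMr// norm_cos_le1.
Qed.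

Lemma Lint_mul_sin a x : Lint a -> Lint (fun t => a t * sin (t * x)).
Proof.
move=> ia; apply: Lint_le (sin_prod_meas x (Lint_meas ia)) (Lint_norm ia) _ => t.
by rewrite normrM ler_piMr// norm_sin_le1.
Qed.

Let is_derive_cos_r t x : is_derive x 1 (fun x => cos (t * x)) (- (t * sin (t * x))).
Proof. exact: is_derive_cos_scale. Qed.

Lemma Fc_is_derive a x : rapid a -> is_derive x 1 (Fc a) (- Fs (mulX a) x).
Proof.
move=> ra; have ia := rapid_Lint ra; have ima := rapid_Lint (rapid_mulX ra).
pose f := fun x t => a t * cos (t * x).
have df y t : is_derive y 1 (f ^~ t) (- (mulX a t * sin (t * y))).
  rewrite (_ : - _ = a t *: - (t * sin (t * y))); last by rewrite /GRing.scale/= /mulX; ring.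
  exact: (is_deriveZ (a t) (is_derive_cos_r t y)).
have d1 y t : partial1of2 f y t = - (mulX a t * sin (t * y)).
  by rewrite /partial1of2 derive1E; have := df y t => h; exact: derive_val.
have xI : `]x - 1, x + 1[%classic x by rewrite /= in_itv/=; apply/andP; split; lra.
have intf y : `]x - 1, x + 1[%classic y -> mu.-integrable setT (EFin \o f y).
  by move=> _; exact: Lint_mul_cos.
have derf y t : `]x - 1, x + 1[%classic y -> setT t -> derivable (f ^~ t) y 1.
  by move=> _ _; have [] := df y t.
have G0 t : 0 <= `|mulX a t| by [].
have Gi : mu.-integrable setT (EFin \o (fun t => `|mulX a t|)) by exact: Lint_norm.
have Gu y t : `]x - 1, x + 1[%classic y -> setT t -> `|partial1of2 f y t| <= `|mulX a t|.
  by move=> _ _; rewrite d1 normrN normrM ler_piMr// norm_sin_le1.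
have := @differentiation_under_integral _ _ _ mu f setT measurableT x _ _ xI intf derf _ G0 Gi Gu.
have h := @derivable_under_integral _ _ _ mu f setT measurableT x _ _ xI intf derf _ G0 Gi Gu.
rewrite derive1E => e; apply: DeriveDef => //.
rewrite -[LHS]/('D_1 (fun x => \int[mu]_t f x t) x) e /Fs -IntN; last exact: Lint_mul_sin.
by apply: eq_Rintegral => t _; exact: d1.
Qed.

Lemma Fs_is_derive a x : rapid a -> is_derive x 1 (Fs a) (Fc (mulX a) x).
Proof.
move=> ra; have ia := rapid_Lint ra; have ima := rapid_Lint (rapid_mulX ra).
pose f := fun x t => a t * sin (t * x).
have df y t : is_derive y 1 (f ^~ t) (mulX a t * cos (t * y)).
  rewrite (_ : _ * _ = a t *: (t * cos (t * y))); last by rewrite /GRing.scale/= /mulX; ring.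
  exact: (is_deriveZ (a t) (is_derive_sin_scale t y)).
have d1 y t : partial1of2 f y t = (mulX a t * cos (t * y)).
  by rewrite /partial1of2 derive1E; have := df y t => h; exact: derive_val.
have xI : `]x - 1, x + 1[%classic x by rewrite /= in_itv/=; apply/andP; split; lra.
have intf y : `]x - 1, x + 1[%classic y -> mu.-integrable setT (EFin \o f y).
  by move=> _; exact: Lint_mul_sin.
have derf y t : `]x - 1, x + 1[%classic y -> setT t -> derivable (f ^~ t) y 1.
  by move=> _ _; have [] := df y t.
have G0 t : 0 <= `|mulX a t| by [].
have Gi : mu.-integrable setT (EFin \o (fun t => `|mulX a t|)) by exact: Lint_norm.
have Gu y t : `]x - 1, x + 1[%classic y -> setT t -> `|partial1of2 f y t| <= `|mulX a t|.
  by move=> _ _; rewrite d1 normrM ler_piMr// norm_cos_le1.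
have := @differentiation_under_integral _ _ _ mu f setT measurableT x _ _ xI intf derf _ G0 Gi Gu.
have h := @derivable_under_integral _ _ _ mu f setT measurableT x _ _ xI intf derf _ G0 Gi Gu.
rewrite derive1E => e; apply: DeriveDef => //.
rewrite -[LHS]/('D_1 (fun x => \int[mu]_t f x t) x) e /Fc.
by apply: eq_Rintegral => t _; exact: d1.
Qed.

Lemma Fcs_Cn n a : rapid a -> Cn n (Fc a) /\ Cn n (Fs a).
Proof.
elim: n a => [|n IH] a ra.
  split; [apply: (@is_derive_cont _ _ (fun x => - Fs (mulX a) x))|
          apply: (@is_derive_cont _ _ (Fc (mulX a)))] => x.
    exact: Fc_is_derive.
  exact: Fs_is_derive.
have [h1 h2] := IH _ (rapid_mulX ra); split.
  by exists (fun x => - Fs (mulX a) x); split; [move=> x; exact: Fc_is_derive|exact: CnN].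
by exists (Fc (mulX a)); split => // x; exact: Fs_is_derive.
Qed.

Lemma Fcs_by_parts n B a a' x : suppB B a -> (forall x, is_derive x 1 a (a' x)) -> Cn n a' ->
  x * Fc a x = - Fs a' x /\ x * Fs a x = Fc a' x.
Proof.
move=> sa da ca'; have sa' := suppB_derive sa da.
have ca := is_derive_cont da; have c' := Cn_continuous ca'.
have ia := suppB_Lint sa ca; have ia' := suppB_Lint sa' c'.
have ms t : is_derive t 1 (fun t => a t * sin (t * x))
    (a' t * sin (t * x) + a t * (x * cos (t * x))).
  apply: is_derive_mul => //.
  rewrite (_ : (fun t => sin (t * x)) = (fun t => sin (x * t))); last first.
    by apply/funext => u; rewrite mulrC.
  by rewrite (mulrC t x); exact: is_derive_sin_scale.
have mc t : is_derive t 1 (fun t => a t * cos (t * x))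
    (a' t * cos (t * x) + a t * - (x * sin (t * x))).
  apply: is_derive_mul => //.
  rewrite (_ : (fun t => cos (t * x)) = (fun t => cos (x * t))); last first.
    by apply/funext => u; rewrite mulrC.
  by rewrite (mulrC t x); exact: is_derive_cos_scale.
have cs : continuous (fun t => sin (t * x)).
  rewrite (_ : (fun t => sin (t * x)) = (fun t => sin (x * t))); first exact: continuous_sin_scale.
  by apply/funext => u; rewrite mulrC.
have cc : continuous (fun t => cos (t * x)).
  rewrite (_ : (fun t => cos (t * x)) = (fun t => cos (x * t))); first exact: continuous_cos_scale.
  by apply/funext => u; rewrite mulrC.
have i1 := Lint_mul_sin x ia'; have i2 := Lint_mul_cos x ia.
have i3 := Lint_mul_cos x ia'; have i4 := Lint_mul_sin x ia.
split.
- have sp : suppB B (fun t => a t * sin (t * x)) by move=> t /sa ->; rewrite mul0r.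
  have [z1 z2] := suppB_cvg sp.
  have e : \int[mu]_t (a' t * sin (t * x) + x * (a t * cos (t * x))) = 0.
    apply: (@Int_derive0 _ (fun t => a t * sin (t * x))) => //.
    + by move=> t; rewrite mulrCA; exact: ms.
    + move=> t; apply: cvgD; first by apply: cvgM; [exact: c'|exact: cs].
      apply: cvgM; first exact: cvg_cst.
      by apply: cvgM; [exact: ca|exact: cc].
    + by apply: LintD => //; exact: LintZ.
  move: e; rewrite IntD//; last exact: LintZ.
  by rewrite IntZ// -/(Fs a' x) -/(Fc a x) => /eqP; rewrite addrC addr_eq0 => /eqP.
- have sp : suppB B (fun t => a t * cos (t * x)) by move=> t /sa ->; rewrite mul0r.
  have [z1 z2] := suppB_cvg sp.
  have e : \int[mu]_t (a' t * cos (t * x) - x * (a t * sin (t * x))) = 0.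
    apply: (@Int_derive0 _ (fun t => a t * cos (t * x))) => //.
    + move=> t; have := mc t.
      by rewrite (_ : a t * - _ = - (x * (a t * sin (t * x))))//; ring.
    + move=> t; apply: cvgB; first by apply: cvgM; [exact: c'|exact: cc].
      apply: cvgM; first exact: cvg_cst.
      by apply: cvgM; [exact: ca|exact: cs].
    + by apply: LintB => //; exact: LintZ.
  move: e; rewrite IntB//; last exact: LintZ.
  by rewrite IntZ// -/(Fc a' x) -/(Fs a x) => /eqP; rewrite subr_eq0 => /eqP.
Qed.

(** One integration by parts per power: the bounds of order [n] for the transforms [u] of [a] and
    [x * u] of the derivative add up to a bound for [jap x * u]. *)
Lemma Fcs_decay n B a : Cn n a -> suppB B a ->
  exists C, forall x, `|Fc a x| <= C * jap x ^- n /\ `|Fs a x| <= C * jap x ^- n.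
Proof.
elim: n a => [|n IH] a ca sa.
  have ia := suppB_Lint sa ca; have ia' := Lint_norm ia.
  exists (\int[mu]_t `|a t|) => x; rewrite expr0 invr1 mulr1; split.
    apply: Int_norm_le => //; first exact: cos_prod_meas (Lint_meas ia).
    by move=> t; rewrite normrM ler_piMr// norm_cos_le1.
  apply: Int_norm_le => //; first exact: sin_prod_meas (Lint_meas ia).
  by move=> t; rewrite normrM ler_piMr// norm_sin_le1.
have [C1 h1] := IH a (CnW ca) sa.
case: ca => a' [da ca'].
have [C2 h2] := IH a' ca' (suppB_derive sa da).
exists (C1 + C2) => x; have [c1 s1] := h1 x; have [c2 s2] := h2 x.
have [e1 e2] := Fcs_by_parts x sa da ca'.
have key (u v : R) : `|u| <= C1 * jap x ^- n -> `|x * u| <= C2 * jap x ^- n ->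
    `|u| <= (C1 + C2) * jap x ^- n.+1.
  move=> u1 u2; rewrite exprS invfM mulrCA mulrC ler_pdivlMr ?jap_gt0//.
  rewrite {1}/jap mulrDr mulr1 mulrDl -normrM (mulrC u); exact: lerD.
split; first by apply: (key _ 0) => //; rewrite e1 normrN.
by apply: (key _ 0) => //; rewrite e2.
Qed.

Lemma suppB_mulX B a : suppB B a -> suppB B (mulX a).
Proof. by move=> sa x /sa h; rewrite /mulX h mulr0. Qed.

Lemma Cn_mulX n a : Cn n a -> Cn n (mulX a).
Proof. by move=> ca; apply: CnM => //; exact: Cn_id. Qed.

(** Up to sign, the derivatives of the transforms are transforms of [t ^ i * a t], which has the
    same support and smoothness as [a]. *)
Lemma Fcs_kernel B a : Cn 7 a -> suppB B a ->
  (exists C, kernel C (Fc a)) /\ (exists C, kernel C (Fs a)).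
Proof.
move=> ca sa.
pose a1 := mulX a; pose a2 := mulX a1; pose a3 := mulX a2.
have c1 : Cn 7 a1 by exact: Cn_mulX.
have c2 : Cn 7 a2 by exact: Cn_mulX.
have c3 : Cn 7 a3 by exact: Cn_mulX.
have s1 : suppB B a1 by exact: suppB_mulX.
have s2 : suppB B a2 by exact: suppB_mulX.
have s3 : suppB B a3 by exact: suppB_mulX.
have [C0 h0] := Fcs_decay ca sa.
have [C1 h1] := Fcs_decay c1 s1.
have [C2 h2] := Fcs_decay c2 s2.
have [C3 h3] := Fcs_decay c3 s3.
have r0 := Cn_suppB_rapid ca sa; have r1 := Cn_suppB_rapid c1 s1.
have r2 := Cn_suppB_rapid c2 s2.
pose C := `|C0| + `|C1| + `|C2| + `|C3|.
have le0 x : C0 * jap x ^- 7 <= C * jap x ^- 7.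
  rewrite ler_wpM2r ?japX_ge0//; apply: le_trans (ler_norm _) _.
  by rewrite /C -!addrA lerDl !addr_ge0.
have le1 x : C1 * jap x ^- 7 <= C * jap x ^- 7.
  rewrite ler_wpM2r ?japX_ge0//; apply: le_trans (ler_norm _) _.
  by rewrite /C addrAC -!addrA addrCA lerDl !addr_ge0.
have le2 x : C2 * jap x ^- 7 <= C * jap x ^- 7.
  rewrite ler_wpM2r ?japX_ge0//; apply: le_trans (ler_norm _) _.
  by rewrite /C addrAC lerDr !addr_ge0.
have le3 x : C3 * jap x ^- 7 <= C * jap x ^- 7.
  rewrite ler_wpM2r ?japX_ge0//; apply: le_trans (ler_norm _) _.
  by rewrite /C lerDr !addr_ge0.
split; exists C.
- exists (fun i => nth (Fc a) [:: Fc a; (fun x => - Fs a1 x); (fun x => - Fc a2 x); Fs a3] i).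
  split => //.
  + case=> [|[|[|//]]] x _ /=; first exact: Fc_is_derive.
      by apply: is_deriveN; exact: Fs_is_derive.
    by have := Fc_is_derive x r2 => /is_deriveN; rewrite opprK.
  + case=> [|[|[|[|//]]]] x _ /=; rewrite ?normrN.
    * by apply: le_trans (le0 x); exact: (h0 x).1.
    * by apply: le_trans (le1 x); exact: (h1 x).2.
    * by apply: le_trans (le2 x); exact: (h2 x).1.
    * by apply: le_trans (le3 x); exact: (h3 x).2.
- exists (fun i => nth (Fs a) [:: Fs a; Fc a1; (fun x => - Fs a2 x); (fun x => - Fc a3 x)] i).
  split => //.
  + case=> [|[|[|//]]] x _ /=; [exact: Fs_is_derive|exact: Fc_is_derive|].
    by apply: is_deriveN; exact: Fs_is_derive.
  + case=> [|[|[|[|//]]]] x _ /=; rewrite ?normrN.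
    * by apply: le_trans (le0 x); exact: (h0 x).2.
    * by apply: le_trans (le1 x); exact: (h1 x).1.
    * by apply: le_trans (le2 x); exact: (h2 x).2.
    * by apply: le_trans (le3 x); exact: (h3 x).1.
Qed.

End real_fourier.

(** * Cutoffs and division by a Fourier transform *)

Section cutoff.
Context {R : realType}.
Variable eps : R.
Hypothesis eps_gt0 : 0 < eps.
Implicit Types (x : R).

Let pw x : R := ppart x ^+ 8.
(** The squares of [3 eps / 5] and [9 eps / 10]: [chi0] is 1 up to the first radius and 0 from the
    second on. Then [chi0 x - chi0 (2 * x)] vanishes for |x| below [3 eps / 10], which exceeds
    [eps / 4], and so it lives in the annulus where the transform of [psi] has no zero. [E] is
    positive exactly inside this annulus's hole, [H] exactly beyond the outer radius. *)
Let alpha : R := 9 / 25 * eps ^+ 2.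
Let beta : R := 81 / 100 * eps ^+ 2.
Let A x : R := pw (beta - x ^+ 2).
Let B x : R := pw (x ^+ 2 - alpha).
Let E x : R := pw (alpha / 4 - x ^+ 2).
Let H x : R := pw (x ^+ 2 - beta).

Let bounds : [/\ 0 < alpha, alpha < beta, beta < eps ^+ 2 & eps ^+ 2 / 16 < alpha / 4].
Proof.
have e2 : 0 < eps ^+ 2 by exact: exprn_gt0.
rewrite /alpha /beta; split; lra.
Qed.

Let pw_ge0 x : 0 <= pw x. Proof. by rewrite exprn_ge0// ppart_ge0. Qed.
Let pw_gt0 x : 0 < x -> 0 < pw x. Proof. by move=> x0; rewrite exprn_gt0// ppart_gt0. Qed.
Let pw_0 x : x <= 0 -> pw x = 0. Proof. by move=> x0; rewrite /pw ppart_le0// expr0n. Qed.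

Let Cn_sqr : Cn 7 (fun x : R => x ^+ 2).
Proof.
rewrite (_ : (fun x : R => x ^+ 2) = (fun x => x * x)); last by apply/funext => x; rewrite expr2.
by apply: CnM; exact: Cn_id.
Qed.

Let Cn_pw (f : R -> R) : Cn 7 f -> Cn 7 (fun x => pw (f x)).
Proof. by move=> cf; exact: (Cn_comp (@Cn_ppartX R 7) cf). Qed.

Let Cn_A : Cn 7 A. Proof. by apply: Cn_pw; apply: CnB => //; exact: Cn_cst. Qed.
Let Cn_B : Cn 7 B. Proof. by apply: Cn_pw; apply: CnB => //; exact: Cn_cst. Qed.
Let Cn_E : Cn 7 E. Proof. by apply: Cn_pw; apply: CnB => //; exact: Cn_cst. Qed.
Let Cn_H : Cn 7 H. Proof. by apply: Cn_pw; apply: CnB => //; exact: Cn_cst. Qed.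

Let AB_gt0 x : 0 < A x + B x.
Proof.
have [h|h] := ltP (x ^+ 2) beta.
  by rewrite ltr_wpDr ?pw_ge0// pw_gt0// subr_gt0.
rewrite ltr_wpDl ?pw_ge0// pw_gt0// subr_gt0; apply: lt_le_trans h.
by have [] := bounds.
Qed.

Definition chi0 x : R := A x * (A x + B x)^-1.

Lemma chi0_Cn : Cn 7 chi0.
Proof.
apply: CnM => //; apply: CnV; last exact: CnD.
by move=> x; rewrite lt0r_neq0 ?AB_gt0.
Qed.

Lemma chi0_eq1 x : x ^+ 2 <= alpha -> chi0 x = 1.
Proof.
move=> h; rewrite /chi0 (_ : B x = 0) ?addr0; last by rewrite /B pw_0// subr_le0.
by rewrite divff// lt0r_neq0// pw_gt0// subr_gt0; apply: le_lt_trans h _; have [] := bounds.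
Qed.

Lemma chi0_eq0 x : beta <= x ^+ 2 -> chi0 x = 0.
Proof. by move=> h; rewrite /chi0 (_ : A x = 0) ?mul0r// /A pw_0// subr_le0. Qed.

Lemma chi0_ge0 x : 0 <= chi0 x.
Proof. by rewrite divr_ge0 ?pw_ge0// ltW// AB_gt0. Qed.

Let sqr_ge c x : 0 <= c -> c < `|x| -> c ^+ 2 <= x ^+ 2.
Proof.
move=> c0 cx; rewrite -(real_normK (num_real x)) lerXn2r ?nnegrE//; exact: ltW.
Qed.

Let beta_le x : eps < `|x| -> beta <= x ^+ 2.
Proof.
move=> h; apply: le_trans (sqr_ge (ltW eps_gt0) h); by have [_ _ /ltW] := bounds.
Qed.

Lemma chi0_suppB : suppB eps chi0.
Proof. by move=> x /beta_le; exact: chi0_eq0. Qed.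

Lemma chi0_one_near x : `|x| <= eps / 2 -> chi0 x = 1.
Proof.
move=> h; apply: chi0_eq1; rewrite -(real_normK (num_real x)).
apply: (@le_trans _ _ ((eps / 2) ^+ 2)); last first.
  by rewrite exprMn /alpha; have := exprn_gt0 2 eps_gt0; lra.
by rewrite lerXn2r ?nnegrE//; apply: divr_ge0 => //; exact: ltW.
Qed.

(** The quotient is [chi] times the conjugate of [P + i Q] over [P ^+ 2 + Q ^+ 2 + W]. The padding
    [W] keeps the denominator positive everywhere and is zero wherever [chi] is not. *)
Let divisor_exists (P Q W chi : R -> R) : Cn 7 P -> Cn 7 Q -> Cn 7 W -> Cn 7 chi ->
  (forall x, 0 <= W x) -> (forall x, 0 < P x ^+ 2 + Q x ^+ 2 + W x) ->
  (forall x, W x * chi x = 0) -> suppB eps chi ->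
  exists mr mi : R -> R, [/\ Cn 7 mr, Cn 7 mi,
    suppB eps mr /\ suppB eps mi, forall x, chi x = 0 -> mr x = 0 /\ mi x = 0 &
    forall x, mr x * P x - mi x * Q x = chi x /\ mr x * Q x + mi x * P x = 0].
Proof.
move=> cP cQ cW cchi W0 D0 Wchi schi.
pose D x := P x ^+ 2 + Q x ^+ 2 + W x.
have cD : Cn 7 (fun x => (D x)^-1).
  apply: CnV; first by move=> x; rewrite lt0r_neq0// D0.
  apply: CnD => //; apply: CnD.
    by rewrite (_ : (fun x => P x ^+ 2) = (fun x => P x * P x)); [exact: CnM|apply/funext => x; rewrite expr2].
  by rewrite (_ : (fun x => Q x ^+ 2) = (fun x => Q x * Q x)); [exact: CnM|apply/funext => x; rewrite expr2].
exists (fun x => chi x * (P x * (D x)^-1)), (fun x => - (chi x * (Q x * (D x)^-1))); split.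
- by apply: CnM => //; exact: CnM.
- by apply: CnN; apply: CnM => //; exact: CnM.
- by split => x /schi ->; rewrite mul0r ?oppr0.
- by move=> x ->; rewrite !mul0r oppr0.
move=> x; have Dx : D x != 0 by rewrite lt0r_neq0// D0.
split; last by ring.
have := Wchi x => h.
transitivity (chi x * (P x ^+ 2 + Q x ^+ 2 + W x) / D x).
  by rewrite mulrDr (mulrC _ (W x)) h; ring.
by rewrite -/(D x) mulfK.
Qed.

Lemma low_multiplier (P Q : R -> R) : Cn 7 P -> Cn 7 Q ->
  (forall x, `|x| < eps -> 0 < P x ^+ 2 + Q x ^+ 2) ->
  exists mr mi : R -> R, [/\ Cn 7 mr, Cn 7 mi, suppB eps mr, suppB eps mi &
    forall x, mr x * P x - mi x * Q x = chi0 x /\ mr x * Q x + mi x * P x = 0].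
Proof.
move=> cP cQ h.
suff [mr [mi [c1 c2 [s1 s2] _ e]]] : exists mr mi : R -> R, [/\ Cn 7 mr, Cn 7 mi,
    suppB eps mr /\ suppB eps mi, forall x, chi0 x = 0 -> mr x = 0 /\ mi x = 0 &
    forall x, mr x * P x - mi x * Q x = chi0 x /\ mr x * Q x + mi x * P x = 0].
  by exists mr, mi.
apply: (divisor_exists cP cQ Cn_H chi0_Cn).
- by move=> x; exact: pw_ge0.
- move=> x; have [xe|xe] := ltP `|x| eps.
    by rewrite ltr_wpDr ?pw_ge0// h.
  rewrite ltr_wpDl ?addr_ge0 ?sqr_ge0// pw_gt0// subr_gt0.
  rewrite -(real_normK (num_real x)); apply: (@lt_le_trans _ _ (eps ^+ 2)).
    by have [] := bounds.
  by rewrite lerXn2r ?nnegrE// ltW.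
- move=> x; have [xb|xb] := leP (x ^+ 2) beta.
    by rewrite /H pw_0 ?mul0r// subr_le0.
  by rewrite chi0_eq0 ?mulr0// ltW.
- exact: chi0_suppB.
Qed.

(** The multipliers vanish near 0 and can be divided by the variable. The quotients [nr] and [ni]
    will produce a primitive of the dual kernel. *)
Lemma high_multiplier (P Q : R -> R) : Cn 7 P -> Cn 7 Q ->
  (forall x, eps / 4 < `|x| < eps -> 0 < P x ^+ 2 + Q x ^+ 2) ->
  exists mr mi nr ni : R -> R, [/\ [/\ Cn 7 mr, Cn 7 mi, suppB eps mr & suppB eps mi],
    [/\ Cn 7 nr, Cn 7 ni, suppB eps nr & suppB eps ni],
    forall x, mr x * P x - mi x * Q x = chi0 x - chi0 (2 * x) /\ mr x * Q x + mi x * P x = 0 &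
    mr = mulX nr /\ mi = mulX ni].
Proof.
move=> cP cQ h.
pose chi1 x := chi0 x - chi0 (2 * x).
have cchi1 : Cn 7 chi1.
  apply: CnB; first exact: chi0_Cn.
  by apply: (Cn_comp chi0_Cn); apply: CnZ; exact: Cn_id.
have z1 x : beta <= x ^+ 2 -> chi1 x = 0.
  move=> hb; rewrite /chi1 !chi0_eq0 ?subrr// exprMn; apply: le_trans hb _.
  have := sqr_ge0 x; nra.
have z2 x : x ^+ 2 <= alpha / 4 -> chi1 x = 0.
  move=> ha; rewrite /chi1 !chi0_eq1 ?subrr//; last first.
    by apply: le_trans ha _; have [] := bounds; lra.
  by rewrite exprMn; lra.
have [mr [mi [cmr cmi [smr smi] mz eq]]] : exists mr mi : R -> R,
    [/\ Cn 7 mr, Cn 7 mi, suppB eps mr /\ suppB eps mi,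
      forall x, chi1 x = 0 -> mr x = 0 /\ mi x = 0 &
    forall x, mr x * P x - mi x * Q x = chi1 x /\ mr x * Q x + mi x * P x = 0].
  apply: (divisor_exists cP cQ (CnD Cn_H Cn_E) cchi1).
  - by move=> x; rewrite addr_ge0// pw_ge0.
  - move=> x; have [xe|xe] := ltP `|x| eps; last first.
      rewrite ltr_wpDl ?addr_ge0 ?sqr_ge0// ltr_wpDr ?pw_ge0// pw_gt0// subr_gt0.
      rewrite -(real_normK (num_real x)); apply: (@lt_le_trans _ _ (eps ^+ 2)).
        by have [] := bounds.
      by rewrite lerXn2r ?nnegrE// ltW.
    have [xe'|xe'] := ltP (eps / 4) `|x|.
      by rewrite ltr_wpDr ?addr_ge0 ?pw_ge0// h// xe' xe.
    rewrite ltr_wpDl ?addr_ge0 ?sqr_ge0// ltr_wpDl ?pw_ge0// pw_gt0// subr_gt0.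
    rewrite -(real_normK (num_real x)); apply: (@le_lt_trans _ _ ((eps / 4) ^+ 2)).
      by rewrite lerXn2r ?nnegrE//; apply: divr_ge0 => //; exact: ltW.
    by rewrite exprMn; have [] := bounds; lra.
  - move=> x; have [xb|xb] := ltP (x ^+ 2) beta; last by rewrite z1 ?mulr0.
    have [xa|xa] := leP (x ^+ 2) (alpha / 4); first by rewrite z2 ?mulr0.
    by rewrite /H /E !pw_0 ?addr0 ?mul0r// subr_le0 ltW.
  - by move=> x /beta_le; exact: z1.
(* [x / (x ^+ 2 + E x)] is [1 / x] wherever the multipliers may be nonzero, and it is regular at
   0. *)
have den x : 0 < x ^+ 2 + E x.
  have [->|x0] := eqVneq x 0; last by rewrite ltr_wpDr ?pw_ge0// exprn_even_gt0.
  by rewrite expr0n add0r /E pw_gt0// expr0n/= subr0; have [] := bounds; lra.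
have cden : Cn 7 (fun x => x * (x ^+ 2 + E x)^-1).
  apply: CnM; first exact: Cn_id.
  by apply: CnV; [move=> x; rewrite lt0r_neq0// den|exact: CnD].
have mE (m : R -> R) : (forall x, chi1 x = 0 -> m x = 0) ->
    m = mulX (fun x => m x * (x * (x ^+ 2 + E x)^-1)).
  move=> mz'; apply/funext => x; rewrite /mulX.
  have [xa|xa] := leP (x ^+ 2) (alpha / 4); first by rewrite mz' ?mul0r ?mulr0// z2.
  have x0 : x != 0 by apply: contraTneq xa => ->; rewrite expr0n/= -leNgt; have [] := bounds; lra.
  by rewrite /E pw_0 ?addr0 ?subr_le0 ?ltW//; field.
exists mr, mi, (fun x => mr x * (x * (x ^+ 2 + E x)^-1)), (fun x => mi x * (x * (x ^+ 2 + E x)^-1)).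
split => //.
- split; [exact: CnM|exact: CnM|by move=> x /smr ->; rewrite mul0r|by move=> x /smi ->; rewrite mul0r].
- by split; apply: mE => x /mz[].
Qed.

End cutoff.

(** * Complex-valued functions *)

Local Notation Re := complex.Re.
Local Notation Im := complex.Im.

Section complex_numbers.
Context {R : realType}.
Implicit Types (z w : R[i]) (r x : R).

Lemma ReM z w : Re (z * w) = Re z * Re w - Im z * Im w.
Proof. by case: z => a b; case: w. Qed.
Lemma ImM z w : Im (z * w) = Re z * Im w + Im z * Re w.
Proof. by case: z => a b; case: w. Qed.
Lemma ReD z w : Re (z + w) = Re z + Re w.
Proof. by case: z => a b; case: w. Qed.
Lemma ImD z w : Im (z + w) = Im z + Im w.
Proof. by case: z => a b; case: w. Qed.
Lemma complex_eq z w : Re z = Re w -> Im z = Im w -> z = w.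
Proof. by case: z => a b; case: w => c d /= -> ->. Qed.

Lemma Re_sum I (s : seq I) (P : pred I) (F : I -> R[i]) :
  Re (\sum_(i <- s | P i) F i) = \sum_(i <- s | P i) Re (F i).
Proof. by elim/big_rec2 : _ => // i x y _ <-; rewrite ReD. Qed.
Lemma Im_sum I (s : seq I) (P : pred I) (F : I -> R[i]) :
  Im (\sum_(i <- s | P i) F i) = \sum_(i <- s | P i) Im (F i).
Proof. by elim/big_rec2 : _ => // i x y _ <-; rewrite ImD. Qed.

Lemma cmodE z : cmod z = Num.sqrt (Re z ^+ 2 + Im z ^+ 2).
Proof. by case: z. Qed.

Lemma cmod_ge0 z : 0 <= cmod z. Proof. by rewrite cmodE sqrtr_ge0. Qed.
Lemma cmodM z w : cmod (z * w) = cmod z * cmod w. Proof. exact: Normc.normcM. Qed.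
Lemma cmodD z w : cmod (z + w) <= cmod z + cmod w. Proof. exact: le_normcD. Qed.
Lemma cmod0 : cmod (0 : R[i]) = 0. Proof. exact: Normc.normc0. Qed.

Lemma cmodR r : cmod r%:C = `|r|.
Proof. by rewrite cmodE/= expr0n addr0 sqrtr_sqr. Qed.

Lemma cmod_Re z : `|Re z| <= cmod z.
Proof. by rewrite cmodE -sqrtr_sqr ler_wsqrtr// lerDl sqr_ge0. Qed.
Lemma cmod_Im z : `|Im z| <= cmod z.
Proof. by rewrite cmodE -sqrtr_sqr ler_wsqrtr// lerDr sqr_ge0. Qed.

Lemma cmod_le z : cmod z <= `|Re z| + `|Im z|.
Proof.
rewrite cmodE -[leRHS]ger0_norm ?addr_ge0// -sqrtr_sqr ler_wsqrtr//.
rewrite sqrrD !real_normK ?num_real// addrAC lerDl mulrn_wge0// mulr_ge0//.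
Qed.

Lemma cmod_sum I (s : seq I) (P : pred I) (F : I -> R[i]) :
  cmod (\sum_(i <- s | P i) F i) <= \sum_(i <- s | P i) cmod (F i).
Proof.
elim/big_rec2 : _ => [|i x y _ h]; first by rewrite cmod0.
by apply: le_trans (cmodD _ _) _; rewrite lerD2l.
Qed.

Lemma ReZ r z : Re (r%:C * z) = r * Re z.
Proof. by rewrite ReM/= mul0r subr0. Qed.
Lemma ImZ r z : Im (r%:C * z) = r * Im z.
Proof. by rewrite ImM/= mul0r addr0. Qed.
Lemma ReZr r z : Re (z * r%:C) = Re z * r.
Proof. by rewrite ReM/= mulr0 subr0. Qed.
Lemma ImZr r z : Im (z * r%:C) = Im z * r.
Proof. by rewrite ImM/= mulr0 add0r. Qed.

Lemma complex_sqr_gt0 z : 0 < cmod z -> 0 < Re z ^+ 2 + Im z ^+ 2.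
Proof. by rewrite cmodE sqrtr_gt0. Qed.

End complex_numbers.

Section complex_integration.
Context {R : realType}.
Local Notation mu := (@lebesgue_measure R).
Implicit Types (f g : R -> R[i]) (x y : R) (a : R[i]).

Definition cmeas d (T : measurableType d) (F : T -> R[i]) : Prop :=
  measurable_fun setT (fun t => Re (F t)) /\ measurable_fun setT (fun t => Im (F t)).

Lemma cmeasM d (T : measurableType d) (F G : T -> R[i]) :
  cmeas F -> cmeas G -> cmeas (fun t => F t * G t).
Proof.
move=> [F1 F2] [G1 G2]; split.
  under eq_fun do rewrite ReM; by apply: measurable_funB; exact: measurable_funM.
under eq_fun do rewrite ImM; by apply: measurable_funD; exact: measurable_funM.
Qed.

Lemma cmeas_comp d d' (T : measurableType d) (T' : measurableType d')
  (F : T -> R[i]) (phi : T' -> T) : measurable_fun setT phi -> cmeas F ->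
  cmeas (fun t => F (phi t)).
Proof. by move=> mphi [F1 F2]; split; [exact: measurableT_comp F1 mphi|exact: measurableT_comp F2 mphi]. Qed.

Lemma cmeasR d (T : measurableType d) (F : T -> R) :
  measurable_fun setT F -> cmeas (fun t => (F t)%:C).
Proof. by move=> mF; split => //=; exact: measurable_cst. Qed.

Definition cLint f : Prop := Lint (fun x => Re (f x)) /\ Lint (fun x => Im (f x)).

Lemma eq_cintegral f g : f =1 g -> cintegral f = cintegral g.
Proof. by move=> /funext ->. Qed.

Lemma cLint_le f (p : R -> R) : cmeas f -> Lint p -> (forall x, cmod (f x) <= p x) -> cLint f.
Proof.
move=> [m1 m2] ip fp; split; apply: Lint_le ip _ => // x; apply: le_trans (fp x).
  exact: cmod_Re.
exact: cmod_Im.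
Qed.

Lemma cintegralZ a f : cLint f -> cintegral (fun x => a * f x) = a * cintegral f.
Proof.
move=> [f1 f2]; apply: complex_eq; rewrite ?ReM ?ImM /cintegral/=.
  rewrite -!IntZ// -IntB; [|exact: LintZ|exact: LintZ].
  by apply: eq_Rintegral => x _; rewrite ReM.
rewrite -!IntZ// -IntD; [|exact: LintZ|exact: LintZ].
by apply: eq_Rintegral => x _; rewrite ImM.
Qed.

Lemma cLintZ a f : cLint f -> cLint (fun x => a * f x).
Proof.
move=> [f1 f2]; split.
  by apply: eq_Lint (LintB (LintZ (Re a) f1) (LintZ (Im a) f2)) => x; rewrite ReM.
by apply: eq_Lint (LintD (LintZ (Re a) f2) (LintZ (Im a) f1)) => x; rewrite ImM.
Qed.

Lemma cintegralD f g : cLint f -> cLint g ->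
  cintegral (fun x => f x + g x) = cintegral f + cintegral g.
Proof.
move=> [f1 f2] [g1 g2]; apply: complex_eq; rewrite ?ReD ?ImD /cintegral/=.
  by rewrite -IntD//; apply: eq_Rintegral => x _; rewrite ReD.
by rewrite -IntD//; apply: eq_Rintegral => x _; rewrite ImD.
Qed.

Lemma cintegral_sum I (s : seq I) (F : I -> R -> R[i]) : (forall i, cLint (F i)) ->
  cintegral (fun x => \sum_(i <- s) F i x) = \sum_(i <- s) cintegral (F i).
Proof.
move=> iF; apply: complex_eq; rewrite ?Re_sum ?Im_sum /cintegral/=.
  rewrite -Int_sum; last by move=> i _; have [] := iF i.
  by apply: eq_Rintegral => x _; rewrite Re_sum.
rewrite -Int_sum; last by move=> i _; have [] := iF i.
by apply: eq_Rintegral => x _; rewrite Im_sum.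
Qed.

(** The factor 2 comes from estimating the real and imaginary parts separately. *)
Lemma cintegral_le f (p : R -> R) : cmeas f -> Lint p -> (forall x, cmod (f x) <= p x) ->
  cmod (cintegral f) <= 2 * \int[mu]_x p x.
Proof.
move=> [m1 m2] ip fp; apply: le_trans (cmod_le _) _; rewrite /cintegral/= mulrDl mul1r.
by apply: lerD; apply: Int_norm_le => // x; apply: le_trans (fp x); [exact: cmod_Re|exact: cmod_Im].
Qed.

Lemma cintegral_shift y f : cLint f -> cintegral (fun x => f (x - y)) = cintegral f.
Proof.
move=> [f1 f2]; apply: complex_eq; rewrite /cintegral/=; [exact: (Int_shift y f1)|exact: (Int_shift y f2)].
Qed.

Lemma cLint_shift y f : cLint f -> cLint (fun x => f (x - y)).
Proof. by move=> [f1 f2]; split; [exact: (Lint_shift y f1)|exact: (Lint_shift y f2)]. Qed.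

Lemma cintegral_affine (c b : R) f : 0 < c -> cLint f ->
  cintegral (fun x => f (c * x + b)) = (c^-1)%:C * cintegral f.
Proof.
move=> c0 [f1 f2]; apply: complex_eq; rewrite ?ReZ ?ImZ /cintegral/=.
  exact: (Int_affine_gt0 b c0 f1).
exact: (Int_affine_gt0 b c0 f2).
Qed.

Lemma cLint_affine (c b : R) f : 0 < c -> cLint f -> cLint (fun x => f (c * x + b)).
Proof.
by move=> c0 [f1 f2]; split; [exact: (Lint_affine_gt0 b c0 f1)|exact: (Lint_affine_gt0 b c0 f2)].
Qed.

Section cfubini.
Variables (F : R -> R -> R[i]) (p q : R -> R).
Hypothesis mF : cmeas (fun z : R * R => F z.1 z.2).
Hypothesis pi : Lint p.
Hypothesis qi : Lint q.
Hypothesis Fpq : forall x y, cmod (F x y) <= p x * q y.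

Let FR x y : `|Re (F x y)| <= p x * q y. Proof. exact: le_trans (cmod_Re _) (Fpq x y). Qed.
Let FI x y : `|Im (F x y)| <= p x * q y. Proof. exact: le_trans (cmod_Im _) (Fpq x y). Qed.

Lemma cfubini_cLint1 x : cLint (F x).
Proof. by split; [exact: (Lint_dom1 mF.1 qi FR)|exact: (Lint_dom1 mF.2 qi FI)]. Qed.

Lemma cfubini_cLint_int1 : cLint (fun x => cintegral (F x)).
Proof. by split; [exact: (Lint_int1 mF.1 pi qi FR)|exact: (Lint_int1 mF.2 pi qi FI)]. Qed.

Lemma cfubini : cintegral (fun x => cintegral (F x)) = cintegral (fun y => cintegral (F ^~ y)).
Proof.
by apply: complex_eq; rewrite /cintegral/=; [exact: (Int_fubini mF.1 pi qi FR)|exact: (Int_fubini mF.2 pi qi FI)].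
Qed.

End cfubini.

End complex_integration.

(** * Schwartz functions as kernels *)

Section schwartz_kernels.
Context {R : realType}.
Local Notation mu := (@lebesgue_measure R).
Implicit Types (f g : R -> R[i]) (x y : R).

Lemma schwartz_bound f b n : schwartz f ->
  exists C, 0 <= C /\ forall x, cmod (cderive1n b f x) <= C * jap x ^- n.
Proof.
move=> [_ sf].
have bd a : exists C, forall x, `|x| ^+ a * cmod (cderive1n b f x) <= C.
  have := sf a b; rewrite /schwartz_seminorm; set s := ereal_sup _ => h.
  have ub x : ((`|x| ^+ a * cmod (cderive1n b f x))%:E <= s)%E.
    by apply: ereal_sup_ubound; exists x.
  case: s h ub => [r| |] // _ ub; first by exists r => x; rewrite -lee_fin.
  by have := ub 0; rewrite leeNy_eq.
have [C0 h0] := bd 0%N; have [Cn hn] := bd n.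
exists (2 ^+ n * (`|C0| + `|Cn|)); split; first by rewrite mulr_ge0 ?exprn_ge0// addr_ge0.
move=> x; rewrite ler_pdivlMr ?exprn_gt0 ?jap_gt0//.
have m0 := cmod_ge0 (cderive1n b f x); set m := cmod _ in h0 hn m0 *.
have k : jap x ^+ n <= 2 ^+ n * (1 + `|x| ^+ n).
  have [x1|x1] := leP `|x| 1.
    apply: (@le_trans _ _ (2 ^+ n)); last by rewrite ler_peMr ?exprn_ge0// lerDl exprn_ge0.
    by rewrite lerXn2r ?nnegrE ?jap_ge0// /jap; lra.
  apply: (@le_trans _ _ (2 ^+ n * `|x| ^+ n)); last by rewrite ler_wpM2l ?exprn_ge0// lerDr.
  by rewrite -exprMn lerXn2r ?nnegrE ?jap_ge0 ?mulr_ge0// /jap; lra.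
apply: le_trans (ler_wpM2l m0 k) _; rewrite mulrCA ler_wpM2l ?exprn_ge0// mulrDr mulr1.
apply: lerD; last by rewrite mulrC; apply: le_trans (hn x) _; exact: ler_norm.
by have := h0 x; rewrite expr0 mul1r => /le_trans; apply; exact: ler_norm.
Qed.

Lemma schwartz_is_derive f n x : schwartz f ->
  is_derive x 1 (derive1n n (fun t => Re (f t))) (derive1n n.+1 (fun t => Re (f t)) x) /\
  is_derive x 1 (derive1n n (fun t => Im (f t))) (derive1n n.+1 (fun t => Im (f t)) x).
Proof.
move=> [sm _]; have [d1 d2] := sm n x; split.
  apply: DeriveDef; first exact: d1.
  rewrite derive1nS derive1E; reflexivity.
apply: DeriveDef; first exact: d2.
rewrite derive1nS derive1E; reflexivity.
Qed.

Definition ckernel (C : R) f : Prop :=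
  kernel C (fun x => Re (f x)) /\ kernel C (fun x => Im (f x)).

Lemma schwartz_ckernel f : schwartz f -> exists C, ckernel C f.
Proof.
move=> sf.
have [C0 [p0 h0]] := schwartz_bound 0 7 sf; have [C1 [p1 h1]] := schwartz_bound 1 7 sf.
have [C2 [p2 h2]] := schwartz_bound 2 7 sf; have [C3 [p3 h3]] := schwartz_bound 3 7 sf.
pose C := C0 + C1 + C2 + C3.
have bnd i x : (i <= 3)%N -> cmod (cderive1n i f x) <= C * jap x ^- 7.
  case: i => [|[|[|[|//]]]] _; apply: le_trans (_ : _ <= _) _;
    [exact: h0|by rewrite ler_wpM2r ?japX_ge0// /C; lra|
     exact: h1|by rewrite ler_wpM2r ?japX_ge0// /C; lra|
     exact: h2|by rewrite ler_wpM2r ?japX_ge0// /C; lra|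
     exact: h3|by rewrite ler_wpM2r ?japX_ge0// /C; lra].
exists C; split.
  exists (fun i => derive1n i (fun t => Re (f t))); split; first exact: erefl.
  - by move=> i x _; have [] := schwartz_is_derive i x sf.
  - by move=> i x /(bnd _ x); apply: le_trans; exact: (cmod_Re (cderive1n i f x)).
exists (fun i => derive1n i (fun t => Im (f t))); split; first exact: erefl.
- by move=> i x _; have [] := schwartz_is_derive i x sf.
- by move=> i x /(bnd _ x); apply: le_trans; exact: (cmod_Im (cderive1n i f x)).
Qed.

Lemma schwartz_rapid f : schwartz f -> rapid (fun x => Re (f x)) /\ rapid (fun x => Im (f x)).
Proof.
move=> sf; have [C [k1 k2]] := schwartz_ckernel sf.
split; (split; first by [exact: kernel_continuous k1|exact: kernel_continuous k2]).
  move=> n; have [D [_ h]] := schwartz_bound 0 n sf; exists D => x.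
  by apply: le_trans (h x); exact: (cmod_Re (cderive1n 0 f x)).
move=> n; have [D [_ h]] := schwartz_bound 0 n sf; exists D => x.
by apply: le_trans (h x); exact: (cmod_Im (cderive1n 0 f x)).
Qed.

End schwartz_kernels.

(** * Dual kernels and the reproducing formula *)

Section theta_mass.
Context {R : realType}.
Local Notation mu := (@lebesgue_measure R).
Implicit Types (a : R -> R) (x t : R) (n : nat).

Lemma kernel_cvg0 (C : R) (f : R -> R) : kernel C f ->
  f n%:R @[n --> \oo] --> 0 /\ f (- n%:R) @[n --> \oo] --> 0.
Proof.
move=> kf; have C0 := kernel_ge0 kf.
have key (v : nat -> R) : (forall n, `|v n| = n%:R) -> f (v n) @[n --> \oo] --> 0.
  move=> vn; apply: norm_cvg0.
  apply: (@squeeze_cvgr _ _ _ _ (cst 0) (fun n => C * n.+1%:R^-1)).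
  - near=> n; rewrite normr_ge0/=; apply: le_trans (kernel_le (v n) kf) _.
    rewrite ler_wpM2l//; apply: le_trans (japX_le (v n) (isT : (1 <= 7)%N)) _.
    by rewrite expr1 /jap vn nat1r.
  - exact: cvg_cst.
  - rewrite -[X in _ --> X](mulr0 C); apply: cvgM; first exact: cvg_cst.
    exact: cvg_harmonic.
by split; apply: key => n; rewrite ?normrN normr_nat.
Unshelve. all: end_near. Qed.

(** A Cesaro weight on the half line. Its cosine transform [K] below is a Fejer kernel, hence
    nonnegative. *)
Let k n t : R := (1 - t / n.+1%:R) * ind 0 n.+1%:R t.

Let n_gt0 n : (0 : R) < n.+1%:R. Proof. by rewrite ltr0n. Qed.

Let k_ge0 n t : 0 <= k n t.
Proof.
rewrite /k indE; case: (boolP (_ && _)) => [/andP[t0 tn]|_]; last by rewrite mulr0.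
by rewrite mulr1 subr_ge0 ler_pdivrMr// mul1r ltW.
Qed.

Let k_le n t : k n t <= ind 0 n.+1%:R t.
Proof.
rewrite /k indE; case: (boolP (_ && _)) => [/andP[t0 tn]|_]; last by rewrite mulr0.
by rewrite !mulr1 lerBlDr lerDl divr_ge0.
Qed.

Let lin_continuous n : continuous (fun t : R => 1 - t / n.+1%:R).
Proof.
by move=> t; apply: cvgB; [exact: cvg_cst|apply: cvgM; [exact: cvg_id|exact: cvg_cst]].
Qed.

Let Lint_k n : Lint (k n). Proof. exact: Lint_mul_ind. Qed.

Let K n x : R := \int[mu]_t (k n t * cos (x * t)).

Let Lint_k_cos n x : Lint (fun t => k n t * cos (x * t)).
Proof.
by apply: eq_Lint (Lint_mul_cos x (Lint_k n)) => t; rewrite (mulrC t).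
Qed.

Let lin_is_derive n t : is_derive t 1 (fun t : R => 1 - t / n.+1%:R) (- n.+1%:R^-1).
Proof.
rewrite -(sub0r n.+1%:R^-1); apply: is_deriveB.
rewrite (_ : (fun x : R => x / n.+1%:R) = (fun x => n.+1%:R^-1 * x)); first exact: is_derive_scale.
by apply/funext => x; rewrite mulrC.
Qed.

Let K_ge0 n x : 0 <= K n x.
Proof.
have [->|x0] := eqVneq x 0.
  by apply: Rintegral_ge0 => t _; rewrite mul0r cos0 mulr1 k_ge0.
pose c : R := n.+1%:R^-1.
pose F t := x^-1 * ((1 - t / n.+1%:R) * sin (x * t)) - (c * x ^- 2) * cos (x * t).
have dF t : is_derive t 1 F ((1 - t / n.+1%:R) * cos (x * t)).
  have h1 := is_deriveZ x^-1 (is_derive_mul (lin_is_derive n t) (is_derive_sin_scale x t)).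
  have h2 := is_deriveZ (c * x ^- 2) (is_derive_cos_scale x t).
  have := is_deriveB h1 h2; rewrite /GRing.scale/=.
  rewrite (_ : _ - _ = (1 - t / n.+1%:R) * cos (x * t))//.
  by rewrite /c; field; rewrite x0 lt0r_neq0.
have cF : continuous (fun t => (1 - t / n.+1%:R) * cos (x * t)).
  by move=> t; apply: cvgM; [exact: lin_continuous|exact: continuous_cos_scale].
have -> : K n x = F n.+1%:R - F 0.
  rewrite -(Int_FTC _ dF cF) ?ler0n//.
  by apply: eq_Rintegral => t _; rewrite /k; ring.
rewrite /F divff ?lt0r_neq0// subrr mul0r mulr0 sub0r !mulr0 sin0 cos0 !mulr0 sub0r mulr1 opprK.
rewrite -mulNr -[X in _ + X]mulr1 addrC mulNr -mulrBr mulr_ge0 ?subr_ge0 ?cos_le1//.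
by rewrite mulr_ge0 ?invr_ge0 ?sqr_ge0// ler0n.
Qed.

Let cos_near (u : R) : `|u| <= 1 -> cos 1 <= cos u.
Proof.
move=> u1; have -> : cos u = cos `|u|.
  by case: (ger0P u) => _ //; rewrite cosN.
have p1 : (1 : R) <= pi by have := @pi_ge2 R; lra.
have := u1; rewrite le_eqVlt => /predU1P[->//|lt1].
rewrite ltW// ltr_cos// in_itv/=; apply/andP; split => //; last exact: le_trans p1.
Qed.

Let Int_k n : \int[mu]_t k n t = n.+1%:R / 2.
Proof.
pose F t := t - (n.+1%:R^-1 / 2) * (t * t).
have dF t : is_derive t 1 F (1 - t / n.+1%:R).
  have := is_deriveB (is_derive_id t 1)
    (is_deriveZ (n.+1%:R^-1 / 2) (is_derive_mul (is_derive_id t 1) (is_derive_id t 1))).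
  rewrite /GRing.scale/= (_ : _ - _ = 1 - t / n.+1%:R)//.
  by field; rewrite lt0r_neq0.
rewrite /k (Int_FTC _ dF (@lin_continuous n)) ?ler0n// /F.
by field; rewrite lt0r_neq0.
Qed.

Let K_large n x : `|x| * n.+1%:R <= 1 -> cos 1 * (n.+1%:R / 2) <= K n x.
Proof.
move=> xn; rewrite -Int_k -IntZ//; apply: Int_le => //; first exact: LintZ.
move=> t; rewrite mulrC; have [i0|i0] := eqVneq (ind 0 n.+1%:R t) 0.
  by rewrite /k i0 !mulr0 !mul0r.
rewrite ler_wpM2l// ?k_ge0//; apply: cos_near.
move: i0; rewrite indE; case: (boolP (_ && _)) => [/andP[t0 tn] _|]; last by rewrite eqxx.
rewrite normrM (ger0_norm t0); apply: le_trans xn; rewrite ler_wpM2l//; exact: ltW.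
Qed.

(** Fourier inversion would give 2 pi a(0), but only the sign is wanted. The Cesaro means of the
    integral are twice the integrals of [a x * K n x]. These are bounded below by a positive
    constant, because [K n] is nonnegative and at least [cos 1 * (n.+1%:R / 2)] for |x| up to
    [n.+1%:R^-1], where eventually [a] is 1. *)
Lemma Fc_mass (C e : R) a : 0 < e -> Lint a -> (forall x, 0 <= a x) ->
  (forall x, `|x| <= e -> a x = 1) -> kernel C (Fc a) -> 0 < \int[mu]_t Fc a t.
Proof.
move=> e0 ia a0 a1 kF.
have iF : Lint (Fc a).
  apply: eq_Lint (Lint_opp (Lint_dil 0 0 kF)) => t.
  by rewrite /dil expr0 !mul1r sub0r opprK.
have mF := Lint_meas iF.
have even t : Fc a (- t) = Fc a t.
  by apply: eq_Rintegral => x _; rewrite mulrN cosN.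
have cos1 : (0 : R) < cos 1 by exact: cos1_gt0.
have bk n t : `|k n t| <= 1.
  by rewrite ger0_norm ?k_ge0//; apply: le_trans (k_le n t) (ind_le1 _ _ _).
have iFk n : Lint (fun t => Fc a t * k n t).
  apply: Lint_le (Lint_norm iF) _ => [|t]; last by rewrite normrM ler_piMr.
  by apply: measurable_funM => //; exact: Lint_meas.
have iFk' n : Lint (fun t => Fc a t * k n (- t)).
  by apply: eq_Lint (Lint_opp (iFk n)) => t; rewrite even.
have cv : \int[mu]_t (Fc a t * (k n t + k n (- t))) @[n --> \oo] --> \int[mu]_t Fc a t.
  apply: (@Int_dct _ _ _ (fun t => 2 * `|Fc a t|)).
  - move=> n; apply: measurable_funM => //; apply: measurable_funD; first exact: Lint_meas.
    exact: Lint_meas (Lint_opp (Lint_k n)).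
  - exact: mF.
  - exact/LintZ/Lint_norm.
  - move=> n t; rewrite normrM mulrC ler_wpM2r//; apply: le_trans (ler_normD _ _) _.
    have := bk n t; have := bk n (- t); lra.
  (* At 0 both half-line weights are 1 and their sum tends to 2, so the origin is the exceptional
     null set. *)
  exists [set 0]; split => //; first exact: lebesgue_measure_set1.
  move=> t /=; apply: contra_notP => t0; rewrite -[X in _ --> X]mulr1.
  apply: cvgM; first exact: cvg_cst.
  have kk n : k n t + k n (- t) = k n `|t|.
    have tn : t != 0 by apply/eqP.
    case: (ltgtP t 0) => [tneg|tpos|]; last by move/eqP; rewrite (negbTE tn).
      by rewrite /k !indE (leNgt 0 t) tneg/= mulr0 add0r ltr0_norm.
    by rewrite /k !indE (leNgt 0 (- t)) oppr_lt0 tpos/= mulr0 addr0 gtr0_norm.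
  under eq_fun do rewrite kk.
  have cv1 : 1 - `|t| / n.+1%:R @[n --> \oo] --> (1 : R).
    rewrite -[X in _ --> X](subr0 1); apply: cvgB; first exact: cvg_cst.
    rewrite -[X in _ --> X](mulr0 `|t|); apply: cvgM; first exact: cvg_cst.
    exact: cvg_harmonic.
  apply: cvg_trans cv1; apply: near_eq_cvg; near=> n.
  rewrite /k indE normr_ge0/= (_ : (`|t| < n.+1%:R) = true) ?mulr1//.
  apply: (lt_le_trans (truncnS_gt _)); rewrite ler_nat ltnS.
  by near: n; exact: nbhs_infty_ge.
have fub n : Lint (fun x => a x * K n x) /\
    \int[mu]_t (Fc a t * k n t) = \int[mu]_x (a x * K n x).
  have mj : measurable_fun setT (fun z : R * R => a z.1 * (k n z.2 * cos (z.1 * z.2))).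
    apply: measurable_funM.
      by apply: (measurableT_comp (Lint_meas ia)); exact: measurable_fst.
    apply: measurable_funM.
      by apply: (measurableT_comp (Lint_meas (Lint_k n))); exact: measurable_snd.
    apply: (measurableT_comp (f := cos)); first exact: continuous_measurable_fun (@continuous_cos R).
    by apply: measurable_funM; [exact: measurable_fst|exact: measurable_snd].
  have ub x t : `|a x * (k n t * cos (x * t))| <= a x * k n t.
    rewrite normrM (ger0_norm (a0 x)) ler_wpM2l// normrM (ger0_norm (k_ge0 n t)).
    by rewrite ler_piMr ?k_ge0// norm_cos_le1.
  split; first by apply: eq_Lint (Lint_int1 mj ia (Lint_k n) ub) => x; rewrite IntZ.
  have := Int_fubini mj ia (Lint_k n) ub => /=.
  under eq_Rintegral do rewrite IntZ//.
  move=> ->; apply: eq_Rintegral => t _.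
  rewrite mulrC -IntZ; last exact: Lint_mul_cos.
  by apply: eq_Rintegral => x _; ring.
have low : \forall n \near \oo, cos 1 <= \int[mu]_t (Fc a t * (k n t + k n (- t))).
  near=> n.
  have ne : (n.+1%:R : R)^-1 <= e.
    rewrite -[leRHS]invrK lef_pV2 ?posrE// ?invr_gt0//.
    apply: ltW; apply: (lt_le_trans (truncnS_gt _)); rewrite ler_nat ltnS.
    by near: n; exact: nbhs_infty_ge.
  have -> : \int[mu]_t (Fc a t * (k n t + k n (- t))) = 2 * \int[mu]_t (Fc a t * k n t).
    rewrite mulrDl mul1r -{2}(Int_opp (iFk n)).
    under [in X in _ = _ + X]eq_Rintegral do rewrite even.
    by rewrite -IntD//; apply: eq_Rintegral => t _; ring.
  suff : cos 1 <= \int[mu]_t (Fc a t * k n t) by have := cos1; lra.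
  have [iaK ->] := fub n.
  have -> : cos 1 = \int[mu]_x (cos 1 * (n.+1%:R / 2) * ind (- n.+1%:R^-1) n.+1%:R^-1 x).
    rewrite IntZ; last exact: Lint_ind.
    rewrite Int_ind; last by rewrite (@le_trans _ _ 0)// ?oppr_le0 invr_ge0.
    by field; rewrite lt0r_neq0.
  apply: Int_le => //; first exact/LintZ/Lint_ind.
  move=> x; rewrite indE; case: (boolP (_ && _)) => [/andP[x1 x2]|_]; last first.
    by rewrite mulr0 mulr_ge0.
  have xn : `|x| <= n.+1%:R^-1 by rewrite ler_norml x1 ltW.
  rewrite mulr1 a1 ?mul1r; last exact: le_trans ne.
  by apply: K_large; rewrite -ler_pdivlMr// div1r.
apply: lt_le_trans cos1 _; rewrite -(cvg_lim _ cv)//; apply: limr_ge => //.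
by apply/cvg_ex; eexists; exact: cv.
Unshelve. all: end_near. Qed.

End theta_mass.

Section reproducing.
Context {R : realType}.
Local Notation mu := (@lebesgue_measure R).
Implicit Types (f g m : R -> R[i]) (a : R -> R) (x t : R).

Definition cexpi t : R[i] := cos t +i* sin t.
Definition cexpNi t : R[i] := cos t -i* sin t.

Lemma cmod_cexpNi t : cmod (cexpNi t) = 1.
Proof. by rewrite cmodE/= sqrrN cos2Dsin2 sqrtr1. Qed.

Lemma cexpNiB (a b : R) : cexpNi (a - b) = cexpNi a * cexpi b.
Proof. by apply: complex_eq; rewrite ?ReM ?ImM/= ?cosB ?sinB; ring. Qed.

Lemma fourier_Re f x : cLint f ->
  Re (fourier f x) = Fc (fun t => Re (f t)) x + Fs (fun t => Im (f t)) x.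
Proof.
move=> [f1 f2]; rewrite /fourier/=.
rewrite -IntD; [|exact: Lint_mul_cos|exact: Lint_mul_sin].
by apply: eq_Rintegral => t _; rewrite ReM/=; ring.
Qed.

Lemma fourier_Im f x : cLint f ->
  Im (fourier f x) = Fc (fun t => Im (f t)) x - Fs (fun t => Re (f t)) x.
Proof.
move=> [f1 f2]; rewrite /fourier/=.
rewrite -IntB; [|exact: Lint_mul_cos|exact: Lint_mul_sin].
by apply: eq_Rintegral => t _; rewrite ImM/=; ring.
Qed.

Lemma cLint_cmod_bound f : cLint f ->
  exists p : R -> R, Lint p /\ forall x, cmod (f x) <= p x.
Proof.
move=> [f1 f2]; exists (fun x => `|Re (f x)| + `|Im (f x)|); split.
  by apply: LintD; exact: Lint_norm.
by move=> x; exact: cmod_le.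
Qed.

Lemma cLint_meas f : cLint f -> cmeas f.
Proof. by move=> [f1 f2]; split; exact: Lint_meas. Qed.

(** Fubini moves the Fourier transform from [m] to [f]; the translation becomes a modulation. *)
Lemma fourier_exchange f m t : cLint f -> cLint m ->
  cintegral (fun x => f x * fourier m (x - t)) =
  cintegral (fun xi => m xi * fourier f xi * cexpi (xi * t)).
Proof.
move=> cf cm.
have [p [ip fp]] := cLint_cmod_bound cf; have [q [iq mq]] := cLint_cmod_bound cm.
pose F x xi := f x * (m xi * cexpNi (xi * (x - t))).
have mF : cmeas (fun z : R * R => F z.1 z.2).
  apply: cmeasM; first exact: (cmeas_comp measurable_fst (cLint_meas cf)).
  apply: cmeasM; first exact: (cmeas_comp measurable_snd (cLint_meas cm)).
  have ma : measurable_fun setT (fun z : R * R => z.2 * (z.1 - t)).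
    apply: measurable_funM; first exact: measurable_snd.
    by apply: measurable_funB => //; exact: measurable_fst.
  split => /=.
    by apply: (measurableT_comp (f := cos)) => //; exact: continuous_measurable_fun (@continuous_cos R).
  apply: measurableT_comp => //.
  by apply: (measurableT_comp (f := sin)) => //; exact: continuous_measurable_fun (@continuous_sin R).
have Fpq x xi : cmod (F x xi) <= p x * q xi.
  by rewrite /F !cmodM cmod_cexpNi mulr1; apply: ler_pM => //; exact: cmod_ge0.
have m1 x : cLint (fun xi => m xi * cexpNi (xi * (x - t))).
  apply: cLint_le iq _.
    apply: cmeasM; first exact: cLint_meas.
    split => /=.
      apply: (measurableT_comp (f := cos)); first exact: continuous_measurable_fun (@continuous_cos R).
      exact: measurable_funM.
    apply: measurableT_comp => //.
    apply: (measurableT_comp (f := sin)); first exact: continuous_measurable_fun (@continuous_sin R).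
    exact: measurable_funM.
  by move=> xi; rewrite cmodM cmod_cexpNi mulr1.
have m2 xi : cLint (fun x => f x * cexpNi (x * xi)).
  apply: cLint_le ip _.
    apply: cmeasM; first exact: cLint_meas.
    split => /=.
      apply: (measurableT_comp (f := cos)); first exact: continuous_measurable_fun (@continuous_cos R).
      exact: measurable_funM.
    apply: measurableT_comp => //.
    apply: (measurableT_comp (f := sin)); first exact: continuous_measurable_fun (@continuous_sin R).
    exact: measurable_funM.
  by move=> x; rewrite cmodM cmod_cexpNi mulr1.
transitivity (cintegral (fun x => cintegral (F x))).
  by apply: eq_cintegral => x; rewrite /F (cintegralZ (f x) (m1 x)).
rewrite (cfubini mF ip iq Fpq); apply: eq_cintegral => xi.
rewrite mulrAC -(cintegralZ (m xi * cexpi (xi * t)) (m2 xi)); apply: eq_cintegral => x.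
by rewrite /F mulrBr cexpNiB (mulrC xi x); ring.
Qed.

Definition theta_of a t : R[i] := Fc a t +i* Fs a t.

Lemma multiplier_identity f m a t : cLint f -> cLint m -> Lint a ->
  (forall x, m x * fourier f x = (a x)%:C) ->
  cintegral (fun x => f x * fourier m (x - t)) = theta_of a t.
Proof.
move=> cf cm ia h; rewrite fourier_exchange//; apply: complex_eq; rewrite /cintegral/=.
  by apply: eq_Rintegral => x _; rewrite h ReZ.
by apply: eq_Rintegral => x _; rewrite h ImZ.
Qed.

Lemma theta_of_dilate a t : Lint a ->
  theta_of (fun x => a x - a (2 * x)) t = theta_of a t - (2^-1)%:C * theta_of a (t / 2).
Proof.
move=> ia.
have two0 : (0 : R) < 2 by [].
have ia2 : Lint (fun x => a (2 * x)).
  by apply: eq_Lint (Lint_affine_gt0 0 two0 ia) => x; rewrite addr0.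
have e1 : Fc (fun x => a (2 * x)) t = 2^-1 * Fc a (t / 2).
  rewrite /Fc -(Int_affine_gt0 0 two0 (Lint_mul_cos (t / 2) ia)).
  by apply: eq_Rintegral => x _; rewrite addr0; congr (_ * cos _); field.
have e2 : Fs (fun x => a (2 * x)) t = 2^-1 * Fs a (t / 2).
  rewrite /Fs -(Int_affine_gt0 0 two0 (Lint_mul_sin (t / 2) ia)).
  by apply: eq_Rintegral => x _; rewrite addr0; congr (_ * sin _); field.
apply: complex_eq; rewrite ?ReD ?ImD/= ?ReZ ?ImZ/=.
  rewrite mul0r subr0 -e1 /Fc -IntB; [|exact: Lint_mul_cos..].
  by apply: eq_Rintegral => x _; ring.
rewrite mul0r addr0 -e2 /Fs -IntB; [|exact: Lint_mul_sin..].
by apply: eq_Rintegral => x _; ring.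
Qed.

Lemma ckernelW C C' f : C <= C' -> ckernel C f -> ckernel C' f.
Proof. by move=> h [k1 k2]; split; exact: kernelW h _. Qed.

Lemma fourier_ckernel B (mr mi : R -> R) : Cn 7 mr -> Cn 7 mi -> suppB B mr -> suppB B mi ->
  exists C, ckernel C (fourier (fun x => mr x +i* mi x)).
Proof.
move=> c1 c2 s1 s2.
have im : cLint (fun x => mr x +i* mi x).
  by split; [exact: suppB_Lint s1 (Cn_continuous c1)|exact: suppB_Lint s2 (Cn_continuous c2)].
have [[C1 k1] [C2 k2]] := Fcs_kernel c1 s1; have [[C3 k3] [C4 k4]] := Fcs_kernel c2 s2.
have k2' : kernel C2 (fun x => - Fs mr x).
  have := kernelZ (-1) k2; rewrite normrN normr1 mul1r.
  by rewrite (_ : (fun x => _) = (fun x => - Fs mr x))//; apply/funext => x; rewrite mulN1r.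
exists ((C1 + C4) + (C3 + C2)).
have p1 := kernel_ge0 k1; have p2 := kernel_ge0 k2; have p3 := kernel_ge0 k3; have p4 := kernel_ge0 k4.
split.
  rewrite (_ : (fun x => Re _) = (fun x => Fc mr x + Fs mi x)); last first.
    by apply/funext => x; rewrite fourier_Re.
  by apply: kernelW (kernelD k1 k4); lra.
rewrite (_ : (fun x => Im _) = (fun x => Fc mi x + - Fs mr x)); last first.
  by apply/funext => x; rewrite fourier_Im.
by apply: kernelW (kernelD k3 k2'); lra.
Qed.

(* [kap] is the Fourier transform of (chi0 xi - chi0 (2 xi)) / fourier psi xi and [theta] that of chi0:
   the right-hand sides below then telescope when summed over the dyadic dilates. *)
Lemma dual_kernels s psi0 psi : TL_admissible s psi0 psi ->
  exists (kap0 kap lam theta : R -> R[i]) (C : R),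
  [/\ [/\ ckernel C kap0, ckernel C kap, ckernel C lam & ckernel C theta],
      forall x, is_derive x 1 (fun t => Re (lam t)) (Re (kap x)) /\
                is_derive x 1 (fun t => Im (lam t)) (Im (kap x)),
      0 < Re (cintegral theta),
      forall t, cintegral (fun x => psi0 x * kap0 (x - t)) = theta t &
      forall t, cintegral (fun x => psi x * kap (x - t)) =
                theta t - (2^-1)%:C * theta (t / 2)].
Proof.
move=> [s0 s1 [eps [eps0 h0 h1]] _].
have [r0 i0] := schwartz_rapid s0; have [r1 i1] := schwartz_rapid s1.
have cl0 : cLint psi0 by split; exact: rapid_Lint.
have cl1 : cLint psi by split; exact: rapid_Lint.
have cre f : rapid (fun x => Re (f x)) -> rapid (fun x => Im (f x)) -> cLint f ->
    Cn 7 (fun x => Re (fourier f x)) /\ Cn 7 (fun x => Im (fourier f x)).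
  move=> rr ri cl; have [a1 a2] := Fcs_Cn 7 rr; have [b1 b2] := Fcs_Cn 7 ri; split.
    rewrite (_ : (fun x => _) = (fun x => Fc (fun t => Re (f t)) x + Fs (fun t => Im (f t)) x)).
      exact: CnD.
    by apply/funext => x; rewrite fourier_Re.
  rewrite (_ : (fun x => _) = (fun x => Fc (fun t => Im (f t)) x - Fs (fun t => Re (f t)) x)).
    exact: CnB.
  by apply/funext => x; rewrite fourier_Im.
have [P0 Q0] := cre _ r0 i0 cl0; have [P1 Q1] := cre _ r1 i1 cl1.
have [mr0 [mi0 [c1 c2 S1 S2 E0]]] := low_multiplier eps0 P0 Q0
  (fun x hx => complex_sqr_gt0 (h0 x hx)).
have [mr [mi [nr [ni [[d1 d2 T1 T2] [e1 e2 U1 U2] E1 [N1 N2]]]]]] := high_multiplier eps0 P1 Q1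
  (fun x hx => complex_sqr_gt0 (h1 x hx)).
pose m0 x := mr0 x +i* mi0 x; pose m x := mr x +i* mi x.
have im0 : cLint m0.
  by split; [exact: suppB_Lint S1 (Cn_continuous c1)|exact: suppB_Lint S2 (Cn_continuous c2)].
have im : cLint m.
  by split; [exact: suppB_Lint T1 (Cn_continuous d1)|exact: suppB_Lint T2 (Cn_continuous d2)].
have ichi : Lint (chi0 eps).
  exact: suppB_Lint (chi0_suppB eps0) (Cn_continuous (chi0_Cn eps0)).
have ichi2 : Lint (fun x => chi0 eps x - chi0 eps (2 * x)).
  apply: LintB => //.
  by apply: eq_Lint (Lint_affine_gt0 0 (ltr0n R 2) ichi) => x; rewrite addr0.
have [K0 k0] := fourier_ckernel c1 c2 S1 S2.
have [K1 k1] := fourier_ckernel d1 d2 T1 T2.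
have [[K2 k2] [K3 k3]] := Fcs_kernel (chi0_Cn eps0) (chi0_suppB eps0).
have [[K4 k4] [K5 k5]] := Fcs_kernel e1 U1.
have [[K6 k6] [K7 k7]] := Fcs_kernel e2 U2.
(* Dividing the multiplier of [kap] by [i * xi] gives its primitive. *)
pose lam x : R[i] := (Fs nr x - Fc ni x) +i* (Fs ni x + Fc nr x).
have p2 := kernel_ge0 k2; have p3 := kernel_ge0 k3; have p4 := kernel_ge0 k4.
have p5 := kernel_ge0 k5; have p6 := kernel_ge0 k6; have p7 := kernel_ge0 k7.
have p0 := kernel_ge0 k0.1; have p1 := kernel_ge0 k1.1.
pose C := K0 + K1 + K2 + K3 + K4 + K5 + K6 + K7.
exists (fourier m0), (fourier m), lam, (theta_of (chi0 eps)), C; split.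
- split.
  + by apply: ckernelW k0; rewrite /C; lra.
  + by apply: ckernelW k1; rewrite /C; lra.
  + split.
      have k6' := kernelZ (-1) k6; rewrite normrN normr1 mul1r in k6'.
      rewrite (_ : (fun x => Re _) = (fun x => Fs nr x + -1 * Fc ni x)).
        by apply: kernelW (kernelD k5 k6'); rewrite /C; lra.
      by apply/funext => x /=; rewrite mulN1r.
    by apply: kernelW (kernelD k7 k4); rewrite /C; lra.
  + by split; [apply: kernelW k2|apply: kernelW k3]; rewrite /C; lra.
- move=> x.
  have q1 := Cn_suppB_rapid e1 U1; have q2 := Cn_suppB_rapid e2 U2.
  rewrite (fourier_Re x im) (fourier_Im x im) /= -/(m _) N1 N2; split.
    have := is_deriveB (Fs_is_derive x q1) (Fc_is_derive x q2).
    by rewrite opprK.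
  exact: is_deriveD (Fs_is_derive x q2) (Fc_is_derive x q1).
- rewrite /cintegral/=.
  apply: (@Fc_mass _ K2 (eps / 2)) => //; first by rewrite divr_gt0.
    exact: chi0_ge0.
  exact: chi0_one_near.
- move=> t; apply: multiplier_identity => // x.
  have [u1 u2] := E0 x.
  by apply: complex_eq; rewrite ?ReM ?ImM/=.
- move=> t; rewrite -theta_of_dilate//; apply: multiplier_identity => // x.
  have [u1 u2] := E1 x.
  by apply: complex_eq; rewrite ?ReM ?ImM/=.
Qed.

End reproducing.

(** * Convolutions with tempered distributions *)

Section tempered_convolution.
Context {R : realType}.
Local Notation mu := (@lebesgue_measure R).
Implicit Types (f phi chi : R -> R[i]) (T : functional R) (x y r : R).

Lemma derive1n_seq (F : nat -> R -> R) :
  (forall n x, is_derive x 1 (F n) (F n.+1 x)) -> forall n, derive1n n (F 0%N) = F n.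
Proof.
move=> dF; elim=> [|n IH]; first exact: derive1n0.
rewrite derive1nS IH; apply/funext => x; rewrite derive1E.
by have := dF n x => h; exact: derive_val.
Qed.

(** Explicit derivative sequences through which the seminorms are computed; [derive1n_seq]
    identifies them with the iterated derivatives. *)
Definition dseq f (Fr Fi : nat -> R -> R) : Prop :=
  [/\ Fr 0%N = (fun t => Re (f t)), Fi 0%N = (fun t => Im (f t)),
      forall n x, is_derive x 1 (Fr n) (Fr n.+1 x) &
      forall n x, is_derive x 1 (Fi n) (Fi n.+1 x)].

Lemma dseq_smooth f Fr Fi : dseq f Fr Fi -> smooth f.
Proof.
move=> [r0 i0 dr di] n x; rewrite -r0 -i0 (derive1n_seq dr) (derive1n_seq di).
by have [h1 _] := dr n x; have [h2 _] := di n x.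
Qed.

Lemma dseq_cderive1n f Fr Fi n x : dseq f Fr Fi -> cderive1n n f x = Fr n x +i* Fi n x.
Proof.
by move=> [r0 i0 dr di]; rewrite /cderive1n -r0 -i0 (derive1n_seq dr) (derive1n_seq di).
Qed.

Lemma seminorm_le f Fr Fi a b (C : R) : dseq f Fr Fi ->
  (forall x, `|x| ^+ a * cmod (Fr b x +i* Fi b x) <= C) ->
  (schwartz_seminorm a b f <= C%:E)%E.
Proof.
move=> df h; apply: ge_ereal_sup => _ [x _ <-].
by rewrite lee_fin (dseq_cderive1n b x df).
Qed.

Lemma schwartz_dseq f Fr Fi : dseq f Fr Fi ->
  (forall a b, exists C, forall x, `|x| ^+ a * cmod (Fr b x +i* Fi b x) <= C) -> schwartz f.
Proof.
move=> df h; split; first exact: dseq_smooth df.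
by move=> a b; have [C hC] := h a b; apply: le_lt_trans (seminorm_le df hC) _; rewrite ltey.
Qed.

Lemma dseq_of_schwartz f : schwartz f ->
  dseq f (fun n => derive1n n (fun t => Re (f t))) (fun n => derive1n n (fun t => Im (f t))).
Proof.
move=> sf; split; [exact: erefl|exact: erefl|move=> n x|move=> n x].
  exact: (schwartz_is_derive n x sf).1.
exact: (schwartz_is_derive n x sf).2.
Qed.

Let aff (r b x : R) phi y : R[i] := r%:C * phi (b * (x - y)).

Let affD (r b x : R) (g : nat -> R -> R) n y : R := r * (- b) ^+ n * g n (b * (x - y)).

Let affD_is_derive r b x g n y : (forall n x, is_derive x 1 (g n) (g n.+1 x)) ->
  is_derive y 1 (affD r b x g n) (affD r b x g n.+1 y).
Proof.
move=> dg.
have h1 : is_derive y 1 (fun y => b * (x - y)) (- b).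
  rewrite (_ : (fun y => b * (x - y)) = b \*: (fun y => x - y))//.
  rewrite -mulrN1; apply: is_deriveZ; rewrite -(sub0r (1 : R)).
  exact: is_deriveB.
have h2 := @is_derive1_comp _ (g n) (fun y => b * (x - y)) y _ _ (dg n _) h1.
have h3 := is_deriveZ (r * (- b) ^+ n) h2.
rewrite (_ : affD r b x g n = (r * (- b) ^+ n) \*: (g n \o (fun y => b * (x - y))))//.
rewrite (_ : affD r b x g n.+1 y = (r * (- b) ^+ n) *: (g n.+1 (b * (x - y)) * - b))//.
by rewrite /affD /GRing.scale/= exprS; ring.
Qed.

Let aff_dseq r b x phi Fr Fi : dseq phi Fr Fi ->
  dseq (aff r b x phi) (affD r b x Fr) (affD r b x Fi).
Proof.
move=> [r0 i0 dr di]; split.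
- by apply/funext => y; rewrite /affD expr0 mulr1 r0 /aff ReZ.
- by apply/funext => y; rewrite /affD expr0 mulr1 i0 /aff ImZ.
- by move=> n y; exact: affD_is_derive.
- by move=> n y; exact: affD_is_derive.
Qed.

Let cmodZ r (u v : R) : cmod ((r * u) +i* (r * v)) = `|r| * cmod (u +i* v).
Proof.
rewrite -cmodR -cmodM; congr cmod; by apply: complex_eq; rewrite ?ReZ ?ImZ.
Qed.

Let jap_aff b x y : 1 <= b -> jap y <= jap x * jap (b * (x - y)).
Proof.
move=> b1; apply: le_trans (japB y x) _; rewrite ler_wpM2l ?jap_ge0//.
by rewrite -japN opprB; exact: jap_scale_ge.
Qed.

Let normX_jap y a : `|y| ^+ a <= jap y ^+ a.
Proof. by rewrite lerXn2r ?nnegrE ?jap_ge0// /jap lerDr. Qed.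

Let aff_decay b x phi n a : 1 <= b -> schwartz phi ->
  exists C, 0 <= C /\ forall y,
    `|y| ^+ a * cmod (cderive1n n phi (b * (x - y))) <= C * jap x ^+ a.
Proof.
move=> b1 sphi; have [C [C0 h]] := schwartz_bound n a sphi.
exists C; split => // y.
apply: le_trans (ler_pM _ _ (normX_jap y a) (h _)) _; rewrite ?exprn_ge0 ?cmod_ge0//.
rewrite mulrCA ler_wpM2l// ler_pdivrMr ?exprn_gt0 ?jap_gt0// -exprMn.
by rewrite lerXn2r ?nnegrE ?mulr_ge0 ?jap_ge0// jap_aff.
Qed.

Lemma aff_schwartz r b x phi : 1 <= b -> schwartz phi ->
  schwartz (fun y => r%:C * phi (b * (x - y))).
Proof.
move=> b1 sphi; have ds := dseq_of_schwartz sphi.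
apply: (schwartz_dseq (aff_dseq r b x ds)) => a n.
have [C [C0 h]] := aff_decay x n a b1 sphi.
exists (`|r * (- b) ^+ n| * (C * jap x ^+ a)) => y.
rewrite /affD cmodZ mulrCA ler_wpM2l//; exact: h.
Qed.

(** Mean value theorem in the translation parameter. The growth of [|y| ^+ a] is absorbed by the
    decay of [g'], up to a power of [jap x]. *)
Let translate_diff (g g' : R -> R) (b x x' y : R) (a : nat) (C : R) : 1 <= b -> 0 <= C ->
  (forall u : R, is_derive u 1 g (g' u)) -> (forall u, `|g' u| <= C * jap u ^- a) ->
  `|x' - x| <= 1 ->
  `|y| ^+ a * `|g (b * (x' - y)) - g (b * (x - y))| <= b * (C * (2 * jap x) ^+ a) * `|x' - x|.
Proof.
move=> b1 C0 dg gb hx; have b0 : 0 <= b by apply: le_trans b1.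
pose G (u : R) : R := `|y| ^+ a * g (b * (u - y)).
pose G' (u : R) : R := `|y| ^+ a * (g' (b * (u - y)) * b).
have dG (u : R) : is_derive u 1 G (G' u).
  have h1 : is_derive u 1 (fun u => b * (u - y)) b.
    rewrite (_ : (fun u => b * (u - y)) = b \*: (fun u => u - y))//.
    rewrite -[X in is_derive _ _ _ X]mulr1; apply: is_deriveZ.
    by rewrite -[X in is_derive _ _ _ X]subr0; apply: is_deriveB.
  have h2 := @is_derive1_comp _ g (fun u => b * (u - y)) u _ _ (dg _) h1.
  exact: (is_deriveZ (`|y| ^+ a) h2).
have G'b (u : R) : `|u - x| <= 1 -> `|G' u| <= b * (C * (2 * jap x) ^+ a).
  move=> ux; rewrite /G' !normrM (ger0_norm b0) ger0_norm ?exprn_ge0//.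
  rewrite mulrA mulrC ler_wpM2l//.
  apply: le_trans (ler_pM _ _ (normX_jap y a) (gb _)) _; rewrite ?exprn_ge0//.
  rewrite mulrCA ler_wpM2l// ler_pdivrMr ?exprn_gt0 ?jap_gt0// -exprMn.
  rewrite lerXn2r ?nnegrE ?mulr_ge0 ?jap_ge0//.
  apply: le_trans (jap_aff u y b1) _; rewrite ler_wpM2r ?jap_ge0//.
  apply: le_trans (japB u x) _; rewrite mulrC ler_wpM2r ?jap_ge0// /jap; lra.
have -> : `|y| ^+ a * `|g (b * (x' - y)) - g (b * (x - y))| = `|G x' - G x|.
  by rewrite /G -mulrBr normrM (@ger0_norm _ (`|y| ^+ a)) ?exprn_ge0.
have [xx|/ltW xx] := leP x x'.
  rewrite (ger0_norm (_ : 0 <= x' - x)) ?subr_ge0//; apply: (MVT_le dG xx) => u /andP[u1 u2].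
  apply: G'b; move: hx; rewrite !ger0_norm ?subr_ge0//; lra.
rewrite distrC (distrC x') (ger0_norm (_ : 0 <= x - x')) ?subr_ge0//.
apply: (MVT_le dG xx) => u /andP[u1 u2].
apply: G'b; move: hx; rewrite !ler0_norm ?subr_le0//; lra.
Qed.

(** [T] is controlled by finitely many seminorms, and each of them is at most linear in [|x' - x|]
    on a difference of translates. The purpose is continuity, hence measurability, of
    [convolution]. *)
Lemma tempered_conv_lip r b x phi T : 1 <= b -> schwartz phi -> tempered_distribution T ->
  exists M, 0 <= M /\ forall x', `|x' - x| <= 1 ->
    cmod (T (fun y => r%:C * phi (b * (x' - y))) - T (fun y => r%:C * phi (b * (x - y))))
      <= M * `|x' - x|.
Proof.
move=> b1 sphi [Tlin [CT [m Tb]]]; have ds := dseq_of_schwartz sphi.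
have b0 : 0 <= b by apply: le_trans b1.
(* The difference is written in the shape [a * phi + chi], the one in which the linearity of [T] is
   given. *)
pose F x' y := (-1)%:C * aff r b x phi y + aff r b x' phi y.
pose Gr x' n y := - affD r b x (fun n => derive1n n (fun t => Re (phi t))) n y
                + affD r b x' (fun n => derive1n n (fun t => Re (phi t))) n y.
pose Gi x' n y := - affD r b x (fun n => derive1n n (fun t => Im (phi t))) n y
                + affD r b x' (fun n => derive1n n (fun t => Im (phi t))) n y.
have [r0 i0 dr di] := ds.
have dF x' : dseq (F x') (Gr x') (Gi x').
  have [a1 a2 a3 a4] := aff_dseq r b x ds; have [b1' b2 b3 b4] := aff_dseq r b x' ds.
  split.
  - apply/funext => y; rewrite /Gr /F ReD ReZ mulN1r.
    by move/(congr1 (@^~ y)) : a1 => /= ->; move/(congr1 (@^~ y)) : b1' => /= ->.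
  - apply/funext => y; rewrite /Gi /F ImD ImZ mulN1r.
    by move/(congr1 (@^~ y)) : a2 => /= ->; move/(congr1 (@^~ y)) : b2 => /= ->.
  - by move=> n y; apply: is_deriveD.
  - by move=> n y; apply: is_deriveD.
have bnd (an : nat * nat) : exists M, 0 <= M /\ forall x', `|x' - x| <= 1 -> forall y,
    `|y| ^+ an.1 * cmod (Gr x' an.2 y +i* Gi x' an.2 y) <= M * `|x' - x|.
  case: an => a n; rewrite [(a, n).1]/= [(a, n).2]/=; have [C [C0 h]] := schwartz_bound n.+1 a sphi.
  pose c := r * (- b) ^+ n; pose B := b * (C * (2 * jap x) ^+ a).
  have B0 : 0 <= B by rewrite !mulr_ge0 ?exprn_ge0 ?mulr_ge0 ?jap_ge0.
  exists (`|c| * (B + B)); split; first by rewrite mulr_ge0// addr_ge0.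
  move=> x' hx y.
  have hr u : `|derive1n n.+1 (fun t => Re (phi t)) u| <= C * jap u ^- a.
    by apply: le_trans (h u); exact: (cmod_Re (cderive1n n.+1 phi u)).
  have hi u : `|derive1n n.+1 (fun t => Im (phi t)) u| <= C * jap u ^- a.
    by apply: le_trans (h u); exact: (cmod_Im (cderive1n n.+1 phi u)).
  have kr := translate_diff y b1 C0 (dr n) hr hx.
  have ki := translate_diff y b1 C0 (di n) hi hx.
  pose A : R := derive1n n (fun t => Re (phi t)) (b * (x' - y)) -
      derive1n n (fun t => Re (phi t)) (b * (x - y)).
  pose D : R := derive1n n (fun t => Im (phi t)) (b * (x' - y)) -
      derive1n n (fun t => Im (phi t)) (b * (x - y)).
  have er : Gr x' n y = c * A by rewrite /A /Gr /affD /c; ring.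
  have ei : Gi x' n y = c * D by rewrite /D /Gi /affD /c; ring.
  have e : cmod (Gr x' n y +i* Gi x' n y) = `|c| * cmod (A +i* D).
    by rewrite er ei; exact: cmodZ.
  rewrite e mulrCA -mulrA ler_wpM2l//.
  apply: le_trans (ler_wpM2l (exprn_ge0 _ (normr_ge0 y)) (cmod_le _)) _; rewrite [Re _]/= [Im _]/=.
  by rewrite mulrDr mulrDl; exact: lerD.
have [M hM] := choice bnd.
pose S := \sum_(a < m) \sum_(n < m) M (val a, val n).
have S0 : 0 <= S by apply: sumr_ge0 => a _; apply: sumr_ge0 => n _; exact: (hM _).1.
exists (`|CT| * S); split; first by rewrite mulr_ge0.
move=> x' hx.
have sF : schwartz (F x').
  apply: (schwartz_dseq (dF x')) => a n.
  by exists (M (a, n) * `|x' - x|); exact: (hM (a, n)).2 x' hx.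
have -> : T (fun y => r%:C * phi (b * (x' - y))) - T (fun y => r%:C * phi (b * (x - y))) = T (F x').
  rewrite /F Tlin; [|exact: aff_schwartz|exact: aff_schwartz].
  by rewrite addrC (_ : (-1)%:C = -1 :> R[i]) ?mulN1r//; apply: complex_eq; rewrite //= oppr0.
rewrite -lee_fin; apply: le_trans (Tb _ sF) _.
have le1 : (\sum_(a < m) \sum_(n < m) schwartz_seminorm a n (F x') <= (S * `|x' - x|)%:E)%E.
  rewrite /S mulr_suml -sumEFin; apply: lee_sum => a _.
  rewrite mulr_suml -sumEFin; apply: lee_sum => n _.
  apply: (seminorm_le (dF x')); exact: (hM (val a, val n)).2 x' hx.
have ge : (0 <= \sum_(a < m) \sum_(n < m) schwartz_seminorm a n (F x'))%E.
  apply: sume_ge0 => a _; apply: sume_ge0 => n _.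
  apply: (@le_trans _ _ (`|0 : R| ^+ a * cmod (cderive1n n (F x') 0))%:E).
    by rewrite lee_fin mulr_ge0 ?exprn_ge0 ?cmod_ge0.
  by apply: ereal_sup_ubound; exists 0.
apply: (@le_trans _ _ (`|CT|%:E * \sum_(a < m) \sum_(n < m) schwartz_seminorm a n (F x'))%E).
  by apply: lee_wpmul2r => //; rewrite lee_fin ler_norm.
by rewrite -mulrA EFinM; apply: lee_wpmul2l => //; rewrite lee_fin.
Qed.

Lemma TL_kernelE psi0 psi k x : TL_kernel psi0 psi k x =
  (2 ^+ k)%:C * (if k is 0%N then psi0 else psi) (2 ^+ k * x).
Proof.
case: k => [|k] //=; rewrite expr0 mul1r.
by apply: complex_eq; rewrite ?ReZ ?ImZ mul1r.
Qed.

Lemma convolution_cmeas psi0 psi k T : schwartz psi0 -> schwartz psi ->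
  tempered_distribution T -> cmeas (convolution (TL_kernel psi0 psi k) T).
Proof.
move=> s0 s1 tT.
pose phi := if k is 0%N then psi0 else psi.
have sphi : schwartz phi by rewrite /phi; case: (k).
have cE : convolution (TL_kernel psi0 psi k) T =
    (fun x => T (fun y => (2 ^+ k)%:C * phi (2 ^+ k * (x - y)))).
  apply/funext => x; rewrite /convolution; congr T; apply/funext => y.
  by rewrite TL_kernelE.
have b1 : (1 : R) <= 2 ^+ k := pow2_ge1 k.
have cont (P : R[i] -> R) : (forall z w, P (z - w) = P z - P w) -> (forall z, `|P z| <= cmod z) ->
    continuous (fun x => P (T (fun y => (2 ^+ k)%:C * phi (2 ^+ k * (x - y))))).
  move=> PB Pc x; have [M [M0 h]] := tempered_conv_lip (2 ^+ k) x b1 sphi tT.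
  apply/cvgrPdist_le => e e0; near=> x'.
  have x1 : `|x' - x| <= 1.
    by rewrite distrC; near: x'; apply: cvgr_dist_le => //; exact: cvg_id.
  have x2 : `|x' - x| <= e / (M + 1).
    rewrite distrC; near: x'; apply: cvgr_dist_le; first exact: cvg_id.
    by rewrite divr_gt0// ltr_wpDl.
  rewrite distrC -PB; apply: le_trans (Pc _) _; apply: le_trans (h x' x1) _.
  apply: (@le_trans _ _ ((M + 1) * `|x' - x|)); first by rewrite ler_wpM2r// lerDl.
  by rewrite mulrC -ler_pdivlMr// ltr_wpDl.
rewrite cE; split; apply: continuous_measurable_fun; apply: cont.
- by case=> a b [c d].
- exact: cmod_Re.
- by case=> a b [c d].
- exact: cmod_Im.
Unshelve. all: end_near. Qed.

End tempered_convolution.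

(** * The reproducing formula as a limit *)

Section reproducing_limit.
Context {R : realType}.
Local Notation mu := (@lebesgue_measure R).
Implicit Types (u a b : R -> R[i]) (h : R -> R) (x y z t C : R) (k K : nat).

Lemma TLk_dil a b k x :
  Re (TL_kernel a b k x) = dil k (fun t => Re ((if k is 0%N then a else b) t)) x /\
  Im (TL_kernel a b k x) = dil k (fun t => Im ((if k is 0%N then a else b) t)) x.
Proof. by rewrite TL_kernelE ReZ ImZ. Qed.

Lemma ckernel_base C a b k : ckernel C a -> ckernel C b ->
  ckernel C (if k is 0%N then a else b).
Proof. by case: k. Qed.

Lemma ckernel_ge0 C a : ckernel C a -> 0 <= C. Proof. by move=> [/kernel_ge0]. Qed.

Lemma ckernel_le C a x : ckernel C a -> cmod (a x) <= 2 * C * jap x ^- 7.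
Proof.
move=> [k1 k2]; apply: le_trans (cmod_le _) _; rewrite -mulrA mulrDl mul1r.
by apply: lerD; [exact: (kernel_le x k1)|exact: (kernel_le x k2)].
Qed.

Lemma TLk_le C a b k x : ckernel C a -> ckernel C b ->
  cmod (TL_kernel a b k x) <= 2 * C * (2 ^+ k * jap (2 ^+ k * x) ^- 7).
Proof.
move=> ka kb; rewrite TL_kernelE cmodM cmodR (ger0_norm (pow2_ge0 k)) mulrCA.
by rewrite ler_wpM2l ?pow2_ge0//; apply: ckernel_le; exact: ckernel_base.
Qed.

Lemma TLk_le_jap C a b k x n : (n <= 7)%N -> ckernel C a -> ckernel C b ->
  cmod (TL_kernel a b k x) <= 2 * C * 2 ^+ k * jap x ^- n.
Proof.
move=> n7 ka kb; apply: le_trans (TLk_le k x ka kb) _.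
rewrite -[leRHS]mulrA ler_wpM2l ?mulr_ge0 ?(ckernel_ge0 ka)//.
rewrite ler_wpM2l ?pow2_ge0//; apply: le_trans (japX_le _ n7) _.
rewrite lef_pV2 ?posrE ?exprn_gt0 ?jap_gt0// lerXn2r ?nnegrE ?jap_ge0//.
by apply: jap_scale_ge; exact: pow2_ge1.
Qed.

Lemma TLk_cmeas C a b k : ckernel C a -> ckernel C b -> cmeas (TL_kernel a b k).
Proof.
move=> ka kb; have [k1 k2] := ckernel_base k ka kb; split.
  rewrite (_ : (fun t => _) = dil k (fun t => Re ((if k is 0%N then a else b) t))).
    by apply: continuous_measurable_fun; apply: dil_continuous; exact: kernel_continuous k1.
  by apply/funext => t; have [] := TLk_dil a b k t.
rewrite (_ : (fun t => _) = dil k (fun t => Im ((if k is 0%N then a else b) t))).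
  by apply: continuous_measurable_fun; apply: dil_continuous; exact: kernel_continuous k2.
by apply/funext => t; have [] := TLk_dil a b k t.
Qed.

(** Almost everywhere continuity lets approximate identities converge to [h] by dominated
    convergence, and still admits indicators, hence Haar functions and bumps. *)
Definition nice h : Prop := [/\ measurable_fun setT h, exists M, forall x, `|h x| <= M,
  exists B, suppB B h & {ae mu, forall x, {for x, continuous h}}].

Lemma nice_jap h n : nice h -> exists M, 0 <= M /\ forall x, jap x ^+ n * `|h x| <= M.
Proof.
move=> [mh [M hM] [B sB] _]; exists ((1 + `|B|) ^+ n * `|M|); split.
  by rewrite mulr_ge0// exprn_ge0// addr_ge0.
move=> x; have [xB|xB] := leP `|x| B; last first.
  by rewrite sB// normr0 mulr0 mulr_ge0// exprn_ge0// addr_ge0.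
apply: ler_pM => //; rewrite ?exprn_ge0 ?jap_ge0//; last exact: le_trans (hM x) (ler_norm _).
by rewrite lerXn2r ?nnegrE ?jap_ge0 ?addr_ge0// /jap lerD2l (le_trans xB)// ler_norm.
Qed.

Lemma nice_meas h : nice h -> measurable_fun setT h. Proof. by case. Qed.

Lemma nice_Lint h n : nice h -> Lint (fun x => jap x ^+ n * `|h x|).
Proof.
move=> nh; have [M [M0 hM]] := nice_jap (n + 2) nh.
apply: (@Lint_le _ _ (fun x => M * jap x ^- 2)).
- apply: measurable_funM.
    apply: continuous_measurable_fun => x.
    by apply: (@continuous_comp _ _ _ jap (fun x : R => x ^+ n)); [exact: jap_continuous|exact: exprn_continuous].
  exact: (measurableT_comp _ (nice_meas nh)).
- exact/LintZ/Lint_japX.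
move=> x; rewrite ger0_norm ?mulr_ge0 ?exprn_ge0 ?jap_ge0//.
rewrite ler_pdivlMr ?exprn_gt0 ?jap_gt0//; apply: le_trans (hM x).
by rewrite exprD mulrAC.
Qed.

Definition cconv a h x : R[i] := cintegral (fun z => a (x - z) * (h z)%:C).

Lemma measB d (T : measurableType d) (f g : T -> R) : measurable_fun setT f ->
  measurable_fun setT g -> measurable_fun setT (fun w => f w - g w).
Proof. exact: measurable_funB. Qed.

Section fixed_kernels.
Variables (psi0 psi kap0 kap theta : R -> R[i]) (C : R).
Hypotheses (kpsi0 : ckernel C psi0) (kpsi : ckernel C psi).
Hypotheses (kkap0 : ckernel C kap0) (kkap : ckernel C kap) (ktheta : ckernel C theta).
Hypothesis id0 : forall t, cintegral (fun x => psi0 x * kap0 (x - t)) = theta t.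
Hypothesis id1 : forall t, cintegral (fun x => psi x * kap (x - t)) =
                           theta t - (2^-1)%:C * theta (t / 2).

Let P := TL_kernel psi0 psi.
Let D := TL_kernel kap0 kap.
Let C0 : 0 <= C := ckernel_ge0 kpsi0.

Variable h : R -> R.
Hypothesis nh : nice h.

Let G k := cconv (D k) h.

Let G_dom k x z : cmod (D k (x - z) * (h z)%:C) <=
  (2 * C * 2 ^+ k * jap x ^- 5) * (jap z ^+ 5 * `|h z|).
Proof.
rewrite cmodM cmodR mulrA ler_wpM2r//.
apply: le_trans (TLk_le_jap k (x - z) (isT : (5 <= 7)%N) kkap0 kkap) _.
rewrite -[leRHS]mulrA ler_wpM2l ?mulr_ge0 ?pow2_ge0// mulrC.
by apply: japX_mono; [exact: jap_ge0|exact: japB].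
Qed.

Let G_meas k : cmeas (fun w : R * R => D k (w.1 - w.2) * (h w.2)%:C).
Proof.
apply: cmeasM.
  apply: (cmeas_comp _ (TLk_cmeas k kkap0 kkap)).
  by apply: measB; [exact: measurable_fst|exact: measurable_snd].
by apply: cmeasR; apply: (measurableT_comp (nice_meas nh)); exact: measurable_snd.
Qed.

Let Lint_p k n : (2 <= n)%N -> Lint (fun x => 2 * C * 2 ^+ k * jap x ^- n).
Proof. by move=> n2; apply: LintZ; exact: Lint_japX. Qed.

Lemma cconv_cmeas k : cmeas (G k).
Proof.
apply: cLint_meas.
exact: (@cfubini_cLint_int1 _ (fun x z => D k (x - z) * (h z)%:C) _ _ (G_meas k)
  (Lint_p k (isT : (2 <= 5)%N)) (nice_Lint 5 nh) (G_dom k)).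
Qed.

Lemma cconv_le k : exists Ck, 0 <= Ck /\ forall x, cmod (G k x) <= Ck * jap x ^- 5.
Proof.
pose I := \int[mu]_z (jap z ^+ 5 * `|h z|).
have I0 : 0 <= I by apply: Rintegral_ge0 => z _; rewrite mulr_ge0 ?exprn_ge0 ?jap_ge0.
exists (2 * (2 * C * 2 ^+ k) * I); split; first by rewrite !mulr_ge0 ?pow2_ge0.
move=> x; apply: le_trans (cintegral_le (p := fun z => (2 * C * 2 ^+ k * jap x ^- 5) * (jap z ^+ 5 * `|h z|)) _ _ _) _.
- split; [exact: (measurable_fun_pair2 x (G_meas k).1)|exact: (measurable_fun_pair2 x (G_meas k).2)].
- exact/LintZ/nice_Lint.
- exact: G_dom.
rewrite IntZ; last exact: nice_Lint.
by apply: eq_ler; rewrite -/I; ring.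
Qed.

(** An approximate identity up to the factor [cintegral theta]. By [Th_Q] the correlation of the
    kernels of level [k] is a difference of two consecutive [Q], which is what makes the series
    telescope. *)
Let Q K t : R[i] := (2 ^+ K)%:C * theta (2 ^+ K * t).
Let Th k t : R[i] := cintegral (fun x => P k x * D k (x - t)).

Let cl_pair a b t : ckernel C a -> ckernel C b -> cLint (fun x => a x * b (x - t)).
Proof.
move=> ka kb; apply: (@cLint_le _ _ (fun x => (2 * C) * (2 * C) * jap x ^- 7)).
- apply: cmeasM.
    split; [exact: (continuous_measurable_fun (kernel_continuous ka.1))|
            exact: (continuous_measurable_fun (kernel_continuous ka.2))].
  have mb : cmeas b by split; [exact: (continuous_measurable_fun (kernel_continuous kb.1))|
            exact: (continuous_measurable_fun (kernel_continuous kb.2))].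
  by apply: (cmeas_comp _ mb); exact: measB.
- exact/LintZ/Lint_japX.
move=> x; rewrite cmodM.
have -> : 2 * C * (2 * C) * jap x ^- 7 = (2 * C * jap x ^- 7) * (2 * C) by ring.
apply: ler_pM; rewrite ?cmod_ge0//; first exact: (ckernel_le x ka).
by apply: le_trans (ckernel_le _ kb) _; rewrite ler_piMr ?mulr_ge0// japX_le1.
Qed.

Let Th_Q k t : Th k t = if k is k'.+1 then Q k t - Q k' t else Q 0%N t.
Proof.
case: k => [|k].
  rewrite /Th /P /D /= id0 /Q expr0 mul1r.
  by apply: complex_eq; rewrite ?ReZ ?ImZ mul1r.
have e : Th k.+1 t = (2 ^+ k.+1)%:C * cintegral (fun x => psi x * kap (x - 2 ^+ k.+1 * t)).
  have cl := cl_pair (2 ^+ k.+1 * t) kpsi kkap.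
  have := cintegral_affine 0 (pow2_gt0 k.+1) cl => e1.
  have -> : cintegral (fun x => psi x * kap (x - 2 ^+ k.+1 * t)) = (2 ^+ k.+1)%:C *
     cintegral (fun x => psi (2 ^+ k.+1 * x + 0) * kap (2 ^+ k.+1 * x + 0 - 2 ^+ k.+1 * t)).
    rewrite e1 mulrA -rmorphM/= divff ?pow2_neq0//.
    by apply: complex_eq; rewrite ?ReZ ?ImZ mul1r.
  rewrite mulrA -cintegralZ; last exact: (cLint_affine 0 (pow2_gt0 k.+1) cl).
  apply: eq_cintegral => x; rewrite /P /D !TL_kernelE addr0 mulrBr; ring.
rewrite e id1 /Q mulrBr; congr (_ - _); rewrite mulrA -rmorphM/= exprS.
have -> : 2 * 2 ^+ k * t / 2 = 2 ^+ k * t by field.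
by congr (_%:C * _); field.
Qed.

Let Qh_dom K y z : cmod ((h z)%:C * Q K (z - y)) <=
  `|h z| * (2 * C * (2 ^+ K * jap (2 ^+ K * (y - z)) ^- 7)).
Proof.
rewrite cmodM cmodR ler_wpM2l// /Q cmodM cmodR (ger0_norm (pow2_ge0 K)) mulrCA.
rewrite ler_wpM2l ?pow2_ge0//; apply: le_trans (ckernel_le _ ktheta) _.
by rewrite -japN -mulrN opprB.
Qed.

Let mtheta : cmeas theta.
Proof.
split; [exact: (continuous_measurable_fun (kernel_continuous ktheta.1))|
  exact: (continuous_measurable_fun (kernel_continuous ktheta.2))].
Qed.

Let Qh_meas K : cmeas (fun w : R * R => (h w.2)%:C * Q K (w.2 - w.1)).
Proof.
apply: cmeasM.
  by apply: cmeasR; apply: (measurableT_comp (nice_meas nh)); exact: measurable_snd.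
apply: cmeasM; first by apply: cmeasR; exact: measurable_cst.
apply: (cmeas_comp _ mtheta); apply: measurable_funM => //.
by apply: measB; [exact: measurable_snd|exact: measurable_fst].
Qed.

Let Qh_meas1 K y : cmeas (fun z => (h z)%:C * Q K (z - y)).
Proof.
split; [exact: (measurable_fun_pair2 y (Qh_meas K).1)|exact: (measurable_fun_pair2 y (Qh_meas K).2)].
Qed.

(** The decay in [y] must be uniform in [K] for the passage to the limit; the boundedness and
    compact support of [h] pay for moving the weight from [z] to [y]. *)
Let Qh_dom2 : exists M, 0 <= M /\ forall K y z, cmod ((h z)%:C * Q K (z - y)) <=
  (M * jap y ^- 2) * (2 ^+ K * jap (2 ^+ K * (y - z)) ^- 2).
Proof.
have [M [M0 hM]] := nice_jap 2 nh.
exists (2 * C * M); split; first by rewrite !mulr_ge0.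
move=> K y z; apply: le_trans (Qh_dom K y z) _.
set J := jap (2 ^+ K * (y - z)).
have j1 : jap y <= jap z * J.
  apply: le_trans (japB y z) _; rewrite ler_wpM2l ?jap_ge0//.
  by apply: jap_scale_ge; exact: pow2_ge1.
have j2 := japX_mono 2 (jap_ge0 z) j1.
have j3 : J ^- 7 <= jap z ^+ 2 * jap y ^- 2 * J ^- 2.
  apply: le_trans (japX_le _ (isT : (4 <= 7)%N)) _.
  by rewrite (japXD 2 2) ler_wpM2r ?japX_ge0.
apply: (@le_trans _ _ (`|h z| * (2 * C * (2 ^+ K * (jap z ^+ 2 * jap y ^- 2 * J ^- 2))))).
  by rewrite ler_wpM2l// ler_wpM2l ?mulr_ge0// ler_wpM2l ?pow2_ge0.
have -> : `|h z| * (2 * C * (2 ^+ K * (jap z ^+ 2 * jap y ^- 2 * J ^- 2))) =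
  (jap z ^+ 2 * `|h z|) * (2 * C * jap y ^- 2 * (2 ^+ K * J ^- 2)) by ring.
have -> : 2 * C * M * jap y ^- 2 * (2 ^+ K * J ^- 2) =
  M * (2 * C * jap y ^- 2 * (2 ^+ K * J ^- 2)) by ring.
by apply: ler_wpM2r; rewrite ?mulr_ge0 ?pow2_ge0 ?japX_ge0.
Qed.

Let H K y : R[i] := cintegral (fun z => (h z)%:C * Q K (z - y)).

Let Qh_cLint K y : cLint (fun z => (h z)%:C * Q K (z - y)).
Proof.
have [M [M0 hM]] := Qh_dom2.
apply: cLint_le (Qh_meas1 K y) (LintZ (M * jap y ^- 2) (Lint_scaled_jap y (pow2_gt0 K))) _.
by move=> z; exact: hM.
Qed.

Let H_le : exists M, 0 <= M /\ forall K y, cmod (H K y) <= M * jap y ^- 2.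
Proof.
have [M [M0 hM]] := Qh_dom2; exists (2 * M * japI); split; first by rewrite !mulr_ge0 ?japI_ge0.
move=> K y; apply: le_trans (cintegral_le (Qh_meas1 K y)
  (LintZ (M * jap y ^- 2) (Lint_scaled_jap y (pow2_gt0 K))) (hM K y)) _.
rewrite IntZ ?Int_scaled_jap ?pow2_gt0//; last exact/Lint_scaled_jap/pow2_gt0.
by apply: eq_ler; ring.
Qed.

Let H_meas K : cmeas (H K).
Proof.
apply: cLint_meas.
have dom y z : cmod ((h z)%:C * Q K (z - y)) <= (2 * C * 2 ^+ K * jap y ^- 2) * (jap z ^+ 2 * `|h z|).
  apply: le_trans (Qh_dom K y z) _.
  have j : jap (2 ^+ K * (y - z)) ^- 7 <= jap z ^+ 2 * jap y ^- 2.
    apply: le_trans (japX_le _ (isT : (2 <= 7)%N)) _.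
    apply: japX_mono; first exact: jap_ge0.
    apply: le_trans (japB y z) _; rewrite ler_wpM2l ?jap_ge0//.
    by apply: jap_scale_ge; exact: pow2_ge1.
  have -> : (2 * C * 2 ^+ K * jap y ^- 2) * (jap z ^+ 2 * `|h z|) =
    `|h z| * (2 * C * (2 ^+ K * (jap z ^+ 2 * jap y ^- 2))) by ring.
  by rewrite ler_wpM2l// ler_wpM2l ?mulr_ge0// ler_wpM2l ?pow2_ge0.
exact: (@cfubini_cLint_int1 _ (fun y z => (h z)%:C * Q K (z - y)) _ _ (Qh_meas K)
  (Lint_p K (isT : (2 <= 2)%N)) (nice_Lint 2 nh) dom).
Qed.

Let E k y : R[i] := cintegral (fun z => (h z)%:C * Th k (z - y)).

Let E_H k y : E k y = if k is k'.+1 then H k y - H k' y else H 0%N y.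
Proof.
case: k => [|k]; first by apply: eq_cintegral => z; rewrite Th_Q.
rewrite -[X in _ - X]mul1r -mulNr -cintegralZ; last exact: Qh_cLint.
rewrite -cintegralD; [|exact: Qh_cLint|exact: cLintZ (Qh_cLint k y)].
by apply: eq_cintegral => z; rewrite Th_Q; ring.
Qed.

(** Associativity of the convolutions: by Fubini both kernels act on [h] together, through their
    correlation [Th]. *)
Let P_G k y : cintegral (fun x => P k (x - y) * G k x) = E k y.
Proof.
have mP := TLk_cmeas k kpsi0 kpsi; have mD := TLk_cmeas k kkap0 kkap.
pose F x z := P k (x - y) * (D k (x - z) * (h z)%:C).
pose p x := 2 * C * 2 ^+ k * jap (x - y) ^- 2.
pose q z := 2 * C * 2 ^+ k * (jap z ^+ 0 * `|h z|).
have ip : Lint p.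
  by apply: LintZ; exact: (Lint_shift y (Lint_japX (leqnn 2))).
have iq : Lint q by apply: LintZ; exact: nice_Lint.
have dom x z : cmod (F x z) <= p x * q z.
  rewrite /F cmodM; apply: ler_pM; rewrite ?cmod_ge0//.
    exact: TLk_le_jap (isT : (2 <= 7)%N) kpsi0 kpsi.
  rewrite cmodM cmodR /q expr0 mul1r ler_wpM2r//.
  by apply: le_trans (TLk_le_jap k _ (isT : (0 <= 7)%N) kkap0 kkap) _; rewrite expr0 invr1 mulr1.
have mF : cmeas (fun w : R * R => F w.1 w.2).
  apply: cmeasM; last exact: G_meas.
  by apply: (cmeas_comp _ mP); apply: measB => //; exact: measurable_fst.
have clG x : cLint (fun z => D k (x - z) * (h z)%:C).
  exact: (@cfubini_cLint1 _ (fun x z => D k (x - z) * (h z)%:C) _ _ (G_meas k)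
    (nice_Lint 5 nh) (G_dom k)).
transitivity (cintegral (fun x => cintegral (F x))).
  by apply: eq_cintegral => x; rewrite /F (cintegralZ _ (clG x)).
rewrite (cfubini mF ip iq dom); apply: eq_cintegral => z.
have cl2 : cLint (fun x => P k x * D k (x - (z - y))).
  apply: (@cLint_le _ _ (fun x => (2 * C * 2 ^+ k) * (2 * C * 2 ^+ k) * jap x ^- 2)).
  - by apply: cmeasM => //; apply: (cmeas_comp _ mD); exact: measB.
  - exact/LintZ/Lint_japX.
  move=> x; rewrite cmodM -mulrA (mulrC (cmod _)) ; apply: ler_pM; rewrite ?cmod_ge0//.
    by apply: le_trans (TLk_le_jap k _ (isT : (0 <= 7)%N) kkap0 kkap) _; rewrite expr0 invr1 mulr1.
  exact: TLk_le_jap (isT : (2 <= 7)%N) kpsi0 kpsi.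
rewrite /Th -(cintegral_shift y cl2) -cintegralZ; last exact: (cLint_shift y cl2).
apply: eq_cintegral => x; rewrite /F.
have -> : x - y - (z - y) = x - z by ring.
by ring.
Qed.

Section square_integrable_input.
Variables (u : R -> R[i]) (qu : R -> R).
Hypotheses (mu_ : cmeas u) (iqu : Lint qu).
Hypothesis uqu : forall y, cmod (u y) * jap y ^- 2 <= qu y.

Let U k := convolution (P k) (regular_distribution u).

Let U_G k : cLint (fun x => U k x * G k x) /\
  cintegral (fun x => U k x * G k x) = cintegral (fun y => u y * E k y).
Proof.
have [Ck [Ck0 hG]] := cconv_le k.
have mP := TLk_cmeas k kpsi0 kpsi.
pose F x y := (u y * P k (x - y)) * G k x.
pose p x := (2 * C * 2 ^+ k) * Ck * jap x ^- 3.
have ip : Lint p by apply: LintZ; exact: Lint_japX.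
have domP x y : cmod (P k (x - y)) <= (2 * C * 2 ^+ k) * (jap x ^+ 2 * jap y ^- 2).
  apply: le_trans (TLk_le_jap k (x - y) (isT : (2 <= 7)%N) kpsi0 kpsi) _.
  rewrite ler_wpM2l ?mulr_ge0 ?pow2_ge0//; apply: japX_mono; first exact: jap_ge0.
  by rewrite -(japN (x - y)) opprB; exact: japB.
have dom x y : cmod (F x y) <= p x * qu y.
  rewrite /F !cmodM.
  apply: (@le_trans _ _ (cmod (u y) * ((2 * C * 2 ^+ k) * (jap x ^+ 2 * jap y ^- 2)) * (Ck * jap x ^- 5))).
    by apply: ler_pM; rewrite ?mulr_ge0 ?cmod_ge0// ler_wpM2l ?cmod_ge0.
  have -> : cmod (u y) * ((2 * C * 2 ^+ k) * (jap x ^+ 2 * jap y ^- 2)) * (Ck * jap x ^- 5) =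
     p x * (cmod (u y) * jap y ^- 2).
    rewrite /p (japXD 2 3).
    have e : jap x ^+ 2 * jap x ^- 2 = 1 by rewrite divff// expf_neq0// jap_neq0.
    transitivity (2 * C * 2 ^+ k * Ck * jap x ^- 3 * (cmod (u y) * jap y ^- 2) * (jap x ^+ 2 * jap x ^- 2)).
      by ring.
    by rewrite e mulr1.
  by rewrite ler_wpM2l// /p !mulr_ge0 ?pow2_ge0 ?japX_ge0.
have mF : cmeas (fun w : R * R => F w.1 w.2).
  apply: cmeasM; last exact: (cmeas_comp measurable_fst (cconv_cmeas k)).
  apply: cmeasM; first exact: (cmeas_comp measurable_snd mu_).
  apply: (cmeas_comp _ mP).
  by apply: measB; [exact: measurable_fst|exact: measurable_snd].
have clu x : cLint (fun y => u y * P k (x - y)).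
  apply: (@cLint_le _ _ (fun y => (2 * C * 2 ^+ k) * jap x ^+ 2 * qu y)).
  - by apply: cmeasM => //; apply: (cmeas_comp _ mP); exact: measB.
  - exact: LintZ.
  move=> y; rewrite cmodM; apply: le_trans (ler_wpM2l (cmod_ge0 _) (domP x y)) _.
  have -> : cmod (u y) * (2 * C * 2 ^+ k * (jap x ^+ 2 / jap y ^+ 2)) =
    2 * C * 2 ^+ k * jap x ^+ 2 * (cmod (u y) * jap y ^- 2) by ring.
  by rewrite ler_wpM2l ?mulr_ge0 ?pow2_ge0 ?exprn_ge0 ?jap_ge0.
have e x : U k x * G k x = cintegral (F x).
  rewrite mulrC /U /convolution /regular_distribution -(cintegralZ _ (clu x)).
  by apply: eq_cintegral => y; rewrite /F mulrC.
split.
  have := cfubini_cLint_int1 mF ip iqu dom; rewrite (_ : (fun x => cintegral (F x)) = (fun x => U k x * G k x))//.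
  by apply/funext => x; rewrite e.
transitivity (cintegral (fun x => cintegral (F x))); first by apply: eq_cintegral => x; rewrite e.
rewrite (cfubini mF ip iqu dom); apply: eq_cintegral => y.
rewrite -P_G -cintegralZ; first by apply: eq_cintegral => x; rewrite /F mulrA.
have [Ck' [_ hG']] := cconv_le k.
apply: (@cLint_le _ _ (fun x => (2 * C * 2 ^+ k) * Ck * jap x ^- 5)).
- by apply: cmeasM; [apply: (cmeas_comp _ mP); exact: measB|exact: cconv_cmeas].
- exact/LintZ/Lint_japX.
move=> x; rewrite cmodM -mulrA; apply: ler_pM; rewrite ?cmod_ge0//.
by apply: le_trans (TLk_le_jap k _ (isT : (0 <= 7)%N) kpsi0 kpsi) _; rewrite expr0 invr1 mulr1.
Qed.

Let uH_cLint K : cLint (fun y => u y * H K y).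
Proof.
have [M [M0 hM]] := H_le.
apply: (@cLint_le _ _ (fun y => M * qu y)); [by apply: cmeasM|exact: LintZ|].
move=> y; rewrite cmodM; apply: le_trans (ler_wpM2l (cmod_ge0 _) (hM K y)) _.
by rewrite mulrCA ler_wpM2l.
Qed.

Let abK (a b : R[i]) : a + (b + -1 * a) = b.
Proof. by rewrite mulN1r addrC subrK. Qed.

Let sum_H K : \sum_(k < K.+1) cintegral (fun x => U k x * G k x) = cintegral (fun y => u y * H K y).
Proof.
elim: K => [|K IH].
  rewrite big_ord1 (U_G 0).2; apply: eq_cintegral => y.
  by rewrite E_H.
rewrite big_ord_recr IH/= (U_G K.+1).2.
have -> : cintegral (fun y => u y * E K.+1 y) =
    cintegral (fun y => u y * H K.+1 y) + -1 * cintegral (fun y => u y * H K y).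
  rewrite -(cintegralZ (-1) (uH_cLint K)) -(cintegralD (uH_cLint K.+1) (cLintZ (-1) (uH_cLint K))).
  by apply: eq_cintegral => y; rewrite E_H; ring.
by apply: abK.
Qed.

(** In this form the dilation sits in [h], whose argument tends to [y], and [theta] is a fixed
    integrable factor. *)
Let H_subst K y : H K y = cintegral (fun w => (h (2 ^- K * w + y))%:C * theta w).
Proof.
have p0 : (0 : R) < 2 ^- K := ipow2_gt0 K.
have := cintegral_affine y p0 (Qh_cLint K y); rewrite invrK => e.
apply: (@mulfI _ (2 ^+ K)%:C); first by apply/eqP => -[]; exact/eqP/pow2_neq0.
rewrite -e -cintegralZ; last first.
  have := cLintZ (2 ^- K)%:C (cLint_affine y p0 (Qh_cLint K y)).
  rewrite (_ : (fun x => _) = (fun w => (h (2 ^- K * w + y))%:C * theta w))//.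
  apply/funext => w; rewrite /Q addrK (mulVKf (pow2_neq0 K)).
  have E1 : (2 ^- K)%:C * (2 ^+ K)%:C = 1 :> R[i] by rewrite -rmorphM/= mulVf ?pow2_neq0.
  transitivity ((2 ^- K)%:C * (2 ^+ K)%:C * ((h (2 ^- K * w + y))%:C * theta w)); first by ring.
  by rewrite E1 mul1r.
apply: eq_cintegral => w; rewrite /Q addrK (mulVKf (pow2_neq0 K)); ring.
Qed.

Let H_cvg y : {for y, continuous h} ->
  Re (H K y) @[K --> \oo] --> h y * Re (cintegral theta) /\
  Im (H K y) @[K --> \oo] --> h y * Im (cintegral theta).
Proof.
move=> ch.
have [mh [M hM] _ _] := nh.
have gen (P' : R[i] -> R) : kernel C (fun w => P' (theta w)) -> (forall (r : R) (z : R[i]), P' (r%:C * z) = r * P' z) ->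
    \int[mu]_w (P' ((h (2 ^- K * w + y))%:C * theta w)) @[K --> \oo] --> h y * \int[mu]_w P' (theta w).
  move=> kP PZ.
  have iP : Lint (fun w => P' (theta w)).
    apply: eq_Lint (Lint_opp (Lint_dil 0 0 kP)) => t.
    by rewrite /dil expr0 !mul1r sub0r opprK.
  rewrite -IntZ//; apply: (@Int_dct _ _ _ (fun w => M * `|P' (theta w)|)).
  - move=> K; under eq_fun do rewrite PZ.
    apply: measurable_funM; last exact: Lint_meas.
    apply: (measurableT_comp mh).
    by apply: measurable_funD => //; exact: measurable_funM.
  - by apply: measurable_funM => //; exact: Lint_meas.
  - exact/LintZ/Lint_norm.
  - by move=> K w; rewrite PZ normrM ler_wpM2r.
  apply/aeW => w; under eq_fun do rewrite PZ.
  apply: cvgM; last exact: cvg_cst.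
  apply: (@cvg_comp _ _ _ (fun K => 2 ^- K * w + y) h); last exact: ch.
  rewrite (_ : nbhs y = nbhs (0 * w + y)); last by rewrite mul0r add0r.
  apply: cvgD; last exact: cvg_cst.
  apply: cvgM; last exact: cvg_cst.
  under eq_fun do rewrite -exprVn.
  by apply: cvg_expr; rewrite ger0_norm ?invr_ge0// invf_lt1// ltr1n.
split.
  rewrite (_ : (fun K => Re (H K y)) = (fun K => \int[mu]_w (Re ((h (2 ^- K * w + y))%:C * theta w)))).
    have := gen (fun w : R[i] => Re w) ktheta.1 (@ReZ R); rewrite (_ : \int[mu]_w Re (theta w) = Re (cintegral theta))//; apply.
  by apply/funext => K; rewrite H_subst.
rewrite (_ : (fun K => Im (H K y)) = (fun K => \int[mu]_w (Im ((h (2 ^- K * w + y))%:C * theta w)))).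
  have := gen (fun w : R[i] => Im w) ktheta.2 (@ImZ R); rewrite (_ : \int[mu]_w Im (theta w) = Im (cintegral theta))//; apply.
by apply/funext => K; rewrite H_subst.
Qed.

Let uH_cvg : let l := cintegral theta * cintegral (fun x => u x * (h x)%:C) in
  Re (cintegral (fun y => u y * H K y)) @[K --> \oo] --> Re l /\
  Im (cintegral (fun y => u y * H K y)) @[K --> \oo] --> Im l.
Proof.
move=> l.
have [M [M0 hM]] := H_le.
have [mh [B hB] _ [Z [mZ Z0 hZ]]] := nh.
have [M2 [M20 hM2]] := nice_jap 2 nh.
have cluh : cLint (fun x => u x * (h x)%:C).
  apply: (@cLint_le _ _ (fun y => M2 * qu y)); [|exact: LintZ|].
    by apply: cmeasM => //; exact: cmeasR.
  move=> y; rewrite cmodM cmodR; apply: (@le_trans _ _ ((jap y ^+ 2 * `|h y|) * (cmod (u y) * jap y ^- 2))).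
    apply: eq_ler; have e : jap y ^+ 2 * jap y ^- 2 = 1 by rewrite divff// expf_neq0// jap_neq0.
    transitivity (cmod (u y) * `|h y| * (jap y ^+ 2 * jap y ^- 2)); first by rewrite e mulr1.
    by ring.
  by apply: ler_pM; rewrite ?mulr_ge0 ?exprn_ge0 ?jap_ge0 ?cmod_ge0 ?japX_ge0.
have lE : l = cintegral (fun y => cintegral theta * (u y * (h y)%:C)) by rewrite cintegralZ.
have dom K y : cmod (u y * H K y) <= M * qu y.
  rewrite cmodM; apply: le_trans (ler_wpM2l (cmod_ge0 _) (hM K y)) _.
  by rewrite mulrCA ler_wpM2l.
have cm K : cmeas (fun y => u y * H K y) by exact: cmeasM.
have cm2 : cmeas (fun y => cintegral theta * (u y * (h y)%:C)).
  by apply: cLint_meas; exact: cLintZ.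
rewrite lE; split.
  apply: (@Int_dct _ _ _ (fun y => M * qu y)) => //.
  - by move=> K; exact: (cm K).1.
  - exact: cm2.1.
  - exact: LintZ.
  - by move=> K y; exact: le_trans (cmod_Re _) (dom K y).
  exists Z; split => //; apply: subset_trans hZ => y /=; apply: contra_not => /H_cvg[h1 h2].
  under eq_fun do rewrite ReM.
  rewrite (_ : Re _ = Re (u y) * (h y * Re (cintegral theta)) - Im (u y) * (h y * Im (cintegral theta))).
    by apply: cvgB; apply: cvgM => //; exact: cvg_cst.
  by rewrite ReM ReZr ImZr; ring.
apply: (@Int_dct _ _ _ (fun y => M * qu y)) => //.
- by move=> K; exact: (cm K).2.
- exact: cm2.2.
- exact: LintZ.
- by move=> K y; exact: le_trans (cmod_Im _) (dom K y).
exists Z; split => //; apply: subset_trans hZ => y /=; apply: contra_not => /H_cvg[h1 h2].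
under eq_fun do rewrite ImM.
rewrite (_ : Im _ = Re (u y) * (h y * Im (cintegral theta)) + Im (u y) * (h y * Re (cintegral theta))).
  by apply: cvgD; apply: cvgM => //; exact: cvg_cst.
by rewrite ImM ReZr ImZr; ring.
Qed.

Lemma reproducing_cvg : let l := cintegral theta * cintegral (fun x => u x * (h x)%:C) in
  let S K := \sum_(k < K) cintegral (fun x =>
    convolution (TL_kernel psi0 psi k) (regular_distribution u) x *
    cconv (TL_kernel kap0 kap k) h x) in
  Re (S K) @[K --> \oo] --> Re l /\ Im (S K) @[K --> \oo] --> Im l.
Proof.
move=> l S; have [h1 h2] := uH_cvg.
have e K : S K.+1 = cintegral (fun y => u y * H K y) by exact: sum_H.
split.
  rewrite -(@cvg_shiftS _ (fun K => Re (S K))).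
  by rewrite (_ : (fun K => Re (S K.+1)) = (fun K => Re (cintegral (fun y => u y * H K y))))//; apply/funext => K; rewrite e.
rewrite -(@cvg_shiftS _ (fun K => Im (S K))).
by rewrite (_ : (fun K => Im (S K.+1)) = (fun K => Im (cintegral (fun y => u y * H K y))))//; apply/funext => K; rewrite e.
Qed.

End square_integrable_input.
End fixed_kernels.
End reproducing_limit.

(** * Duality pairings on Triebel-Lizorkin spaces *)

Section triebel_lizorkin_duality.
Context {R : realType}.
Local Notation mu := (@lebesgue_measure R).

Lemma ler_powRl (a b r : R) : 0 <= r -> 0 <= a -> a <= b -> a `^ r <= b `^ r.
Proof.
by move=> r0 a0 ab; apply: ge0_ler_powR; rewrite ?nnegrE// (le_trans a0).
Qed.

Lemma powRVK (a r : R) : r != 0 -> 0 <= a -> (a `^ r) `^ r^-1 = a.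
Proof. by move=> r0 a0; rewrite -powRrM divff// powRr1. Qed.

Lemma powRKV (a r : R) : r != 0 -> 0 <= a -> (a `^ r^-1) `^ r = a.
Proof. by move=> r0 a0; rewrite -powRrM mulVf// powRr1. Qed.

(** Young's inequality on the normalised terms. The second factor enters through an upper bound [Y],
    the form in which pointwise estimates provide it. *)
Lemma hoelder_sum (a b : nat -> R) (K : nat) (q q' Y : R) :
  (forall k, 0 <= a k) -> (forall k, 0 <= b k) -> 0 < q -> 0 < q' ->
  q^-1 + q'^-1 = 1 -> 0 <= Y -> \sum_(k < K) b k `^ q' <= Y `^ q' ->
  \sum_(k < K) a k * b k <= (\sum_(k < K) a k `^ q) `^ q^-1 * Y.
Proof.
move=> a0 b0 q0 q'0 qq Y0 hb.
set S := \sum_(k < K) a k `^ q.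
have S0 : 0 <= S by apply: sumr_ge0 => k _; exact: powR_ge0.
have [e|Sn] := eqVneq S 0.
  rewrite big1 ?mulr_ge0 ?powR_ge0// => k _.
  have : a k `^ q == 0.
    by rewrite eq_le powR_ge0 andbT -e /S (bigD1 k)//= lerDl sumr_ge0// => *; exact: powR_ge0.
  by rewrite powR_eq0 (gt_eqF q0)/= andbT => /eqP ->; rewrite mul0r.
have [e|Yn] := eqVneq Y 0.
  rewrite e mulr0 big1// => k _.
  have : b k `^ q' == 0.
    rewrite eq_le powR_ge0 andbT -(powR0 (lt0r_neq0 q'0)) -e (le_trans _ hb)//.
    by rewrite (bigD1 k)//= lerDl sumr_ge0// => *; exact: powR_ge0.
  by rewrite powR_eq0 (gt_eqF q'0)/= andbT => /eqP ->; rewrite mulr0.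
have Sp : 0 < S by rewrite lt_neqAle eq_sym Sn.
have Yp : 0 < Y by rewrite lt_neqAle eq_sym Yn.
set X := S `^ q^-1; have Xp : 0 < X by exact: powR_gt0.
rewrite -[leRHS]mulr1 -ler_pdivrMl ?mulr_gt0// mulr_sumr -[leRHS]qq.
apply: (@le_trans _ _ (\sum_(k < K) ((a k `^ q / S) / q + (b k `^ q' / Y `^ q') / q'))).
  apply: ler_sum => k _.
  have -> : (X * Y)^-1 * (a k * b k) = (a k / X) * (b k / Y) by rewrite invfM; ring.
  have h := @conjugate_powR _ (a k / X) (b k / Y) q q' _ _ q0 q'0 qq.
  apply: le_trans (h _ _) _; rewrite ?divr_ge0 ?(ltW Xp) ?(ltW Yp)//.
  rewrite !powRM ?invr_ge0 ?(ltW Xp) ?(ltW Yp)//.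
  have inv (z r : R) : 0 < z -> z^-1 `^ r = (z `^ r)^-1.
    by move=> z0; rewrite -(powR_inv1 (ltW z0)) -powRrM mulN1r powRN.
  by rewrite !inv// /X powRKV ?gt_eqF.
rewrite big_split/= -!mulr_suml -/S divff// lerD ?mul1r// ler_piMl ?invr_ge0 ?(ltW q'0)//.
by rewrite ler_pdivrMr ?powR_gt0// mul1r.
Qed.

Lemma ge0_le_Lnorm (p : R) (f g : R -> \bar R) : 0 < p ->
  measurable_fun setT f -> measurable_fun setT g ->
  (forall x, 0 <= f x)%E -> (forall x, f x <= g x)%E ->
  ('N[mu]_p%:E[f] <= 'N[mu]_p%:E[g])%E.
Proof.
move=> p0 mf mg f0 fg; have g0 x : (0 <= g x)%E by exact: le_trans (f0 x) (fg x).
rewrite Lnorm.unlock/=; apply: gt0_ler_poweR; rewrite ?invr_ge0 ?(ltW p0)//.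
- by rewrite in_itv/= leey andbT integral_ge0// => x _; exact: poweR_ge0.
- by rewrite in_itv/= leey andbT integral_ge0// => x _; exact: poweR_ge0.
apply: ge0_le_integral => //.
- by move=> x _; exact: poweR_ge0.
- apply: (measurableT_comp (measurable_poweR p)); exact: measurableT_comp mf.
- apply: (measurableT_comp (measurable_poweR p)); exact: measurableT_comp mg.
move=> x _; rewrite !gee0_abs//; apply: gt0_ler_poweR => //; rewrite ?(ltW p0)//.
  by rewrite in_itv/= leey f0.
by rewrite in_itv/= leey g0.
Qed.

Lemma Lnorm_bound (p D : R) (f : R -> R) : 0 < p -> 0 <= D ->
  (forall x, 0 <= f x) -> (\int[mu]_x (f x `^ p)%:E <= (D `^ p)%:E)%E ->
  ('N[mu]_p%:E[EFin \o f] <= D%:E)%E.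
Proof.
move=> p0 D0 f0 h; have eD : D%:E = ((D `^ p)%:E `^ p^-1)%E by rewrite poweR_EFin powRVK ?gt_eqF.
rewrite eD Lnorm.unlock.
apply: gt0_ler_poweR; first by rewrite invr_ge0 ltW.
- by rewrite in_itv/= leey andbT integral_ge0// => x _; exact: poweR_ge0.
- by rewrite in_itv/= leey andbT lee_fin powR_ge0.
apply: le_trans h; rewrite le_eqVlt; apply/orP; left; apply/eqP.
by apply: eq_integral => x _; rewrite /= ger0_norm.
Qed.

Variables (p q s : R) (psi0 psi : R -> R[i]).
Hypotheses (p1 : 1 < p) (q1 : 1 < q) (spsi0 : schwartz psi0) (spsi : schwartz psi).
Implicit Types (T U : functional R).

Let p0 : 0 < p. Proof. exact: lt_trans p1. Qed.
Let q0 : 0 < q. Proof. exact: lt_trans q1. Qed.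

Local Notation TLn := (TL_norm p q s psi0 psi).

Let term T k x : R := 2 `^ (k%:R * s * q) * cmod (convolution (TL_kernel psi0 psi k) T x) `^ q.

Let term_ge0 T k x : 0 <= term T k x. Proof. by rewrite mulr_ge0 ?powR_ge0. Qed.

Lemma cmod_meas d (X : measurableType d) (F : X -> R[i]) : cmeas F ->
  measurable_fun setT (fun x => cmod (F x)).
Proof.
move=> [m1 m2]; rewrite (_ : (fun x => _) = (fun x => Num.sqrt (Re (F x) ^+ 2 + Im (F x) ^+ 2))).
  apply: (measurableT_comp (continuous_measurable_fun (@sqrt_continuous R))).
  by apply: measurable_funD; exact: measurable_funX.
by apply/funext => x; rewrite cmodE.
Qed.

Let term_meas T k : tempered_distribution T -> measurable_fun setT (term T k).
Proof.
move=> tT; apply: measurable_funM => //; apply: (measurableT_comp (measurable_powR q)).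
exact/cmod_meas/convolution_cmeas.
Qed.

Lemma TL_lq_sum_meas T : tempered_distribution T ->
  measurable_fun setT (TL_lq_sum q s psi0 psi T).
Proof.
move=> tT; apply: (measurableT_comp (measurable_poweR q^-1)).
apply: (@ge0_emeasurable_sum _ _ _ _ (fun k x => (term T k x)%:E) xpredT).
  by move=> k x _ _; rewrite lee_fin.
by move=> k _; apply/measurable_EFinP; exact: term_meas.
Qed.

Lemma TL_lq_sum_ge T K x :
  (((\sum_(k < K) term T k x) `^ q^-1)%:E <= TL_lq_sum q s psi0 psi T x)%E.
Proof.
rewrite -poweR_EFin; apply: gt0_ler_poweR; rewrite ?invr_ge0 ?(ltW q0)//.
- by rewrite in_itv/= leey lee_fin sumr_ge0.
- by rewrite in_itv/= leey andbT; apply: nneseries_ge0 => k _ _; rewrite lee_fin; exact: term_ge0.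
rewrite -sumEFin -(big_mkord xpredT (fun k => (term T k x)%:E)).
by apply: nneseries_lim_ge => k _ _; rewrite lee_fin.
Qed.

Lemma TL_lq_sum_le T x (D : R) : 0 <= D ->
  (forall K, \sum_(k < K) term T k x <= D `^ q) -> (TL_lq_sum q s psi0 psi T x <= D%:E)%E.
Proof.
move=> D0 h; rewrite -(powRVK (lt0r_neq0 q0) D0) -poweR_EFin.
apply: gt0_ler_poweR; rewrite ?invr_ge0 ?(ltW q0)//.
- by rewrite in_itv/= leey andbT; apply: nneseries_ge0 => k _ _; rewrite lee_fin; exact: term_ge0.
- by rewrite in_itv/= leey lee_fin powR_ge0.
apply: lime_le; first by apply: is_cvg_nneseries => k _ _; rewrite lee_fin; exact: term_ge0.
by apply: nearW => K; rewrite big_mkord sumEFin lee_fin.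
Qed.

(** The weight is at most 1 and [r > 1], so its power [r] is dominated by the weight itself and the
    single integral [japI] serves all exponents. *)
Lemma Lnorm_jap (r D : R) : 1 < r -> 0 <= D ->
  ('N[mu]_r%:E[EFin \o (fun x => D * jap x ^- 2)%R] <= (D * @japI R `^ r^-1)%:E)%E.
Proof.
move=> r1 D0; have r0 : 0 < r by exact: lt_trans r1.
have mj : measurable_fun setT (fun x : R => jap x ^- 2) by apply: Lint_meas; exact: Lint_japX.
apply: Lnorm_bound => //; rewrite ?mulr_ge0 ?powR_ge0//.
  by move=> x; rewrite mulr_ge0 ?japX_ge0.
rewrite powRM ?powR_ge0// powRKV ?gt_eqF ?japI_ge0// EFinM /japI Lint_EFin; last exact: Lint_japX.
rewrite -ge0_integralZl_EFin ?powR_ge0//; last 2 first.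
- by move=> x _; rewrite lee_fin japX_ge0.
- exact/measurable_EFinP.
apply: ge0_le_integral => //.
- by move=> x _; rewrite lee_fin powR_ge0.
- by apply/measurable_EFinP; apply: (measurableT_comp (measurable_powR r)); exact: measurable_funM.
- by apply/measurable_EFinP; exact: measurable_funM.
move=> x _; rewrite -EFinM lee_fin powRM ?japX_ge0// ler_wpM2l ?powR_ge0//.
rewrite -[leRHS](@powRr1 _ (jap x ^- 2)) ?japX_ge0//.
have [j0 j1] : 0 < jap x ^- 2 /\ jap x ^- 2 <= 1 by split; [exact: japX_gt0|exact: japX_le1].
by apply: ger_powR; rewrite ?j0//= ltW.
Qed.

Lemma TL_norm_le T (D : R) : tempered_distribution T -> 0 <= D ->
  (forall K x, \sum_(k < K) 2 `^ (k%:R * s * q) * cmod (convolution (TL_kernel psi0 psi k) T x) `^ q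
     <= (D * jap x ^- 2) `^ q) ->
  (TLn T <= (D * @japI R `^ p^-1)%:E)%E.
Proof.
move=> tT D0 h; apply: le_trans (Lnorm_jap p1 D0).
apply: ge0_le_Lnorm => //.
- exact: TL_lq_sum_meas.
- apply/measurable_EFinP/measurable_funM => //.
  by apply: Lint_meas; exact: Lint_japX.
- by move=> x; exact: poweR_ge0.
move=> x; apply: TL_lq_sum_le; first by rewrite mulr_ge0 ?japX_ge0.
by move=> K; exact: h.
Qed.

Lemma TL_pairing_le T (g : nat -> R -> R) (w : R -> R) (p' q' : R) K :
  tempered_distribution T -> 0 < p' -> 0 < q' -> p^-1 + p'^-1 = 1 -> q^-1 + q'^-1 = 1 ->
  (forall k, measurable_fun setT (g k)) -> (forall k x, 0 <= g k x) ->
  measurable_fun setT w -> (forall x, 0 <= w x) ->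
  (forall x, \sum_(k < K) (2 `^ (- (k%:R * s)) * g k x) `^ q' <= w x `^ q') ->
  (\sum_(k < K) \int[mu]_x (cmod (convolution (TL_kernel psi0 psi k) T x) * g k x)%:E
   <= TLn T * 'N[mu]_p'%:E[EFin \o w])%E.
Proof.
move=> tT p'0 q'0 pp qq mg g0 mw w0 h.
pose S x := (\sum_(k < K) term T k x) `^ q^-1.
have mS : measurable_fun setT S.
  apply: (measurableT_comp (measurable_powR q^-1)).
  by apply: measurable_sum => k; exact: term_meas.
have mcg k : measurable_fun setT (fun x => cmod (convolution (TL_kernel psi0 psi k) T x) * g k x).
  by apply: measurable_funM => //; exact/cmod_meas/convolution_cmeas.
apply: (@le_trans _ _ ('N[mu]_1[EFin \o (S \* w)%R])%E); last first.
  apply: le_trans (hoelder mu mS mw p0 p'0 pp) _.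
  apply: lee_wpmul2r; first exact: Lnorm_ge0.
  apply: ge0_le_Lnorm => //.
  - exact/measurable_EFinP.
  - exact: TL_lq_sum_meas.
  - by move=> x; rewrite lee_fin powR_ge0.
  - by move=> x; exact: TL_lq_sum_ge.
rewrite Lnorm1 -ge0_integral_sum//; last 2 first.
- by move=> k; apply/measurable_EFinP; exact: mcg.
- by move=> k x _; rewrite lee_fin mulr_ge0 ?cmod_ge0.
apply: ge0_le_integral => //.
- by move=> x _; rewrite sume_ge0// => k _; rewrite lee_fin mulr_ge0 ?cmod_ge0.
- by apply: emeasurable_sum => k; apply/measurable_EFinP; exact: mcg.
- apply: measurableT_comp => //; apply/measurable_EFinP; exact: measurable_funM.
move=> x _ /=; rewrite sumEFin lee_fin ger0_norm ?mulr_ge0 ?powR_ge0//.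
pose a k := 2 `^ (k%:R * s) * cmod (convolution (TL_kernel psi0 psi k) T x).
pose b k := 2 `^ (- (k%:R * s)) * g k x.
have := @hoelder_sum a b K q q' (w x) _ _ q0 q'0 qq (w0 x) (h x).
have -> : \sum_(k < K) a k `^ q = \sum_(k < K) term T k x.
  by apply: eq_bigr => k _; rewrite /a powRM ?powR_ge0 ?cmod_ge0// -powRrM.
rewrite (eq_bigr (fun k : 'I_K => cmod (convolution (TL_kernel psi0 psi k) T x) * g k x)); last first.
  move=> k _; rewrite /a /b mulrACA -powRD ?subrr ?powRr0 ?mul1r//.
  by rewrite pnatr_eq0 implybT.
by apply=> k; rewrite mulr_ge0 ?powR_ge0 ?cmod_ge0.
Qed.

End triebel_lizorkin_duality.

Lemma abs_series_cvg (R : realType) (a b : nat -> R) (B : R) :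
  (forall k, `|a k| <= b k) -> (forall K, \sum_(k < K) b k <= B) ->
  exists l, (\sum_(k < K) a k) @[K --> \oo] --> l /\ `|l| <= B.
Proof.
move=> ab bB; pose u K := \sum_(k < K) a k.
have uB K : `|u K| <= B.
  by apply: le_trans (bB K); apply: le_trans (ler_norm_sum _ _ _) _; apply: ler_sum => k _; exact: ab.
have us : u = series a by apply/funext => K; rewrite /u /series/= big_mkord.
have cu : cvgn u.
  rewrite us; apply: normed_cvg; rewrite /normed_series_of.
  apply: nondecreasing_is_cvgn.
    by apply/nondecreasing_seqP => n; rewrite !seriesEord/= big_ord_recr/= lerDl.
  exists B => _ [K _ <-]; rewrite /series/= big_mkord; apply: le_trans (bB K).
  by apply: ler_sum => k _; exact: ab.
exists (limn u); split; first exact: cu.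
rewrite ler_norml; apply/andP; split.
  by apply: limr_ge => //; apply: nearW => K; have := uB K; rewrite ler_norml => /andP[].
by apply: limr_le => //; apply: nearW => K; have := uB K; rewrite ler_norml => /andP[].
Qed.

(** * The functional attached to a function *)

Section dual_functional.
Context {R : realType}.
Local Notation mu := (@lebesgue_measure R).
Variables (p q s : R) (psi0 psi kap0 kap theta : R -> R[i]) (C : R).
Hypotheses (spsi0 : schwartz psi0) (spsi : schwartz psi).
Hypotheses (kpsi0 : ckernel C psi0) (kpsi : ckernel C psi).
Hypotheses (kkap0 : ckernel C kap0) (kkap : ckernel C kap) (ktheta : ckernel C theta).
Hypothesis theta_gt0 : 0 < Re (cintegral theta).
Hypothesis id0 : forall t, cintegral (fun x => psi0 x * kap0 (x - t)) = theta t.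
Hypothesis id1 : forall t, cintegral (fun x => psi x * kap (x - t)) =
                           theta t - (2^-1)%:C * theta (t / 2).
Variables (h : R -> R) (D0 : R).
Hypotheses (nh : nice h).

Local Notation TLn := (TL_norm p q s psi0 psi).
Local Notation TLs := (TL_space p q s psi0 psi).
Let g k := cconv (TL_kernel kap0 kap k) h.
Let cv k (T : functional R) := convolution (TL_kernel psi0 psi k) T.

Hypothesis DB : forall T, TLs T -> forall K,
  (\sum_(k < K) \int[mu]_x (cmod (cv k T x) * cmod (g k x))%:E <= D0%:E * TLn T)%E.

Let fin T : TLs T -> TLn T = (fine (TLn T))%:E /\ 0 <= fine (TLn T).
Proof.
move=> [_ f]; have n0 : (0 <= TLn T)%E by exact: Lnorm_ge0.
by split; [rewrite fineK// ge0_fin_numE|exact: fine_ge0].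
Qed.

Let mcg T k : TLs T -> measurable_fun setT (fun x => cmod (cv k T x) * cmod (g k x)).
Proof.
move=> [tT _]; apply: measurable_funM; first exact/cmod_meas/convolution_cmeas.
by apply: cmod_meas; exact: (cconv_cmeas kpsi0 kkap0 kkap nh).
Qed.

Let Lcg T k : TLs T -> Lint (fun x => cmod (cv k T x) * cmod (g k x)).
Proof.
move=> TT; apply: ge0_Lint; first exact: mcg.
  by move=> x; rewrite mulr_ge0 ?cmod_ge0.
have := DB TT k.+1; rewrite big_ord_recr/= => hk.
apply: le_lt_trans (_ : (_ <= D0%:E * TLn T)%E) _; last first.
  by have [-> _] := fin TT; rewrite -EFinM ltry.
apply: le_trans hk; rewrite leeDr// sume_ge0// => i _.
by rewrite integral_ge0// => x _; rewrite lee_fin mulr_ge0 ?cmod_ge0.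
Qed.

Let ccg T k : TLs T -> cLint (fun x => cv k T x * g k x).
Proof.
move=> TT; apply: (cLint_le _ (Lcg k TT)); last by move=> x; rewrite cmodM.
apply: cmeasM; last exact: (cconv_cmeas kpsi0 kkap0 kkap nh).
by have [tT _] := TT; exact: convolution_cmeas.
Qed.

Let tm T k := cintegral (fun x => cv k T x * g k x).
Let P T K := \sum_(k < K) tm T k.

Let tm_le T k : TLs T -> cmod (tm T k) <= 2 * \int[mu]_x (cmod (cv k T x) * cmod (g k x)).
Proof.
move=> TT; apply: cintegral_le; [exact/cLint_meas/ccg|exact: Lcg|].
by move=> x; rewrite cmodM.
Qed.

Let sum_le T K : TLs T ->
  \sum_(k < K) 2 * \int[mu]_x (cmod (cv k T x) * cmod (g k x)) <= 2 * (D0 * fine (TLn T)).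
Proof.
move=> TT; rewrite -mulr_sumr ler_wpM2l// -lee_fin -sumEFin.
have := DB TT K; have [{2}-> _] := fin TT; rewrite -EFinM; apply: le_trans.
by rewrite le_eqVlt; apply/orP; left; apply/eqP; apply: eq_bigr => k _; rewrite Lint_EFin//; exact: Lcg.
Qed.

Let is_lim (T : functional R) (z : R[i]) := Re (P T K) @[K --> \oo] --> Re z /\ Im (P T K) @[K --> \oo] --> Im z.

Let lim_ex T : TLs T -> exists z, is_lim T z /\ cmod z <= 4 * (D0 * fine (TLn T)).
Proof.
move=> TT.
have [a [ha aB]] := abs_series_cvg (fun k => le_trans (cmod_Re _) (tm_le k TT)) (fun K => sum_le K TT).
have [b [hb bB]] := abs_series_cvg (fun k => le_trans (cmod_Im _) (tm_le k TT)) (fun K => sum_le K TT).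
exists (a +i* b); split.
  split=> /=.
    by rewrite (_ : (fun K => Re (P T K)) = (fun K => \sum_(k < K) Re (tm T k)))//; apply/funext => K; rewrite Re_sum.
  by rewrite (_ : (fun K => Im (P T K)) = (fun K => \sum_(k < K) Im (tm T k)))//; apply/funext => K; rewrite Im_sum.
(* One factor 2 is in [sum_le], from [cintegral_le]; the other comes from adding the real and
   imaginary parts. *)
apply: le_trans (cmod_le _) _ => /=; apply: le_trans (lerD aB bB) _.
by apply: eq_ler; ring.
Qed.

(** Total because [limn] is; on [TLs] the limits exist by [lim_ex]. *)
Let Lim T : R[i] := limn (fun K => Re (P T K)) +i* limn (fun K => Im (P T K)).

Let LimE T z : is_lim T z -> Lim T = z.
Proof.
move=> [h1 h2]; apply: complex_eq => /=; first exact: (cvg_lim _ h1).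
exact: (cvg_lim _ h2).
Qed.

Let c := cintegral theta.
Let cn0 : c != 0. Proof. by apply/eqP => c0; move: theta_gt0; rewrite -/c c0 ltxx. Qed.

Let Lim_le T : TLs T -> ((cmod (c^-1 * Lim T))%:E <= (4 / Re c * D0)%:E * TLn T)%E.
Proof.
move=> TT; have [z [/LimE -> zB]] := lim_ex TT.
have [-> f0] := fin TT; rewrite -EFinM lee_fin cmodM.
have e : cmod c^-1 <= (Re c)^-1.
  have cc : cmod c^-1 * cmod c = 1 by rewrite -cmodM mulVf// cmodR normr1.
  have rc : Re c <= cmod c by exact: le_trans (ler_norm _) (cmod_Re _).
  rewrite -[leRHS]mul1r ler_pdivlMr// -cc.
  by rewrite ler_wpM2l ?cmod_ge0.
apply: le_trans (ler_pM _ _ e zB) _; rewrite ?cmod_ge0//.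
by apply: eq_ler; ring.
Qed.

Let P_lin a T U K : TLs T -> TLs U ->
  P (fun phi => a * T phi + U phi) K = a * P T K + P U K.
Proof.
move=> TT TU; rewrite /P mulr_sumr -big_split/=; apply: eq_bigr => k _.
rewrite /tm -(cintegralZ a (ccg k TT)) -(cintegralD (cLintZ a (ccg k TT)) (ccg k TU)).
by apply: eq_cintegral => x; rewrite /cv /convolution mulrDl mulrA.
Qed.

Let Lim_lin a T U : TLs T -> TLs U ->
  Lim (fun phi => a * T phi + U phi) = a * Lim T + Lim U.
Proof.
move=> TT TU; have [z [lz _]] := lim_ex TT; have [w [lw _]] := lim_ex TU.
rewrite (LimE lz) (LimE lw) (@LimE _ (a * z + w))//.
move: lz lw => [z1 z2] [w1 w2]; split.
  rewrite (_ : (fun K => _) = (fun K => Re a * Re (P T K) - Im a * Im (P T K) + Re (P U K))).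
    by rewrite ReD ReM; apply: cvgD => //; apply: cvgB; apply: cvgM => //; exact: cvg_cst.
  by apply/funext => K; rewrite P_lin// ReD ReM.
rewrite (_ : (fun K => _) = (fun K => Re a * Im (P T K) + Im a * Re (P T K) + Im (P U K))).
  by rewrite ImD ImM; apply: cvgD => //; apply: cvgD; apply: cvgM => //; exact: cvg_cst.
by apply/funext => K; rewrite P_lin// ImD ImM.
Qed.

Let Lim_square_integrable u : square_integrable u ->
  Lim (regular_distribution u) = c * cintegral (fun x => u x * (h x)%:C).
Proof.
move=> [m1 m2 fu]; have mu2 : cmeas u by [].
(* The integrable majorant of the product [cmod (u x) * jap x ^- 2], by the inequality a b <= a^2 +
   b^2. *)
pose qu x := cmod (u x) ^+ 2 + jap x ^- 4.
have iqu : Lint qu.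
  apply: LintD; last exact: Lint_japX.
  by apply: ge0_Lint => //; [apply: measurable_funX; exact: cmod_meas|move=> x; rewrite exprn_ge0 ?cmod_ge0].
have uq y : cmod (u y) * jap y ^- 2 <= qu y.
  rewrite /qu (_ : jap y ^- 4 = (jap y ^- 2) ^+ 2); last by rewrite exprVn -exprM.
  by have := cmod_ge0 (u y); have := japX_ge0 2 y; move: (cmod _) (jap y ^- 2) => a b; nra.
by have /LimE := reproducing_cvg kpsi0 kpsi kkap0 kkap ktheta id0 id1 nh mu2 iqu uq.
Qed.

(** The reproducing formula returns the pairing times [cintegral theta], which is divided out. Its
    real part is what is known to be positive, whence the constant. *)
Lemma dual_functional : exists L, duality_pairing_with p q s psi0 psi (fun x => (h x)%:C) L /\
  forall T, TLs T -> ((cmod (L T))%:E <= (4 / Re (cintegral theta) * D0)%:E * TLn T)%E.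
Proof.
exists (fun T => c^-1 * Lim T); split; last exact: Lim_le; split.
- by move=> a T U TT TU; rewrite Lim_lin// mulrDr mulrCA.
- by exists (4 / Re c * D0); exact: Lim_le.
by move=> u su _; rewrite Lim_square_integrable// mulKf.
Qed.

End dual_functional.

(** * Bumps, waves and indicators against complex kernels *)

Section test_functions.
Context {R : realType}.
Local Notation mu := (@lebesgue_measure R).
Implicit Types (a b : R -> R[i]) (h f : R -> R) (k : nat) (x : R).

Lemma cconvE a b h k x :
  cconv (TL_kernel a b k) h x =
  conv (dil k (fun t => Re ((if k is 0%N then a else b) t))) h x +i*
  conv (dil k (fun t => Im ((if k is 0%N then a else b) t))) h x.
Proof.
apply: complex_eq => /=; apply: eq_Rintegral => z _; have [e1 e2] := TLk_dil a b k (x - z).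
  by rewrite ReZr -e1 mulrC.
by rewrite ImZr -e2 mulrC.
Qed.

Lemma convolution_regular (a : R -> R[i]) h x :
  convolution a (regular_distribution (fun y => (h y)%:C)) x = cconv a h x.
Proof. by apply: eq_cintegral => y; rewrite mulrC. Qed.

Lemma niceZ (c : R) h : nice h -> nice (fun x => c * h x).
Proof.
move=> [mh [M hM] [B hB] ch]; split.
- exact: measurable_funM.
- by exists (`|c| * M) => x; rewrite normrM ler_wpM2l.
- by exists B => x Bx; rewrite hB// mulr0.
case: ch => Z [mZ Z0 hZ]; exists Z; split => //; apply: subset_trans hZ => x /=.
by apply: contra_not => cx; apply: cvgM => //; exact: cvg_cst.
Qed.

Lemma niceD f h : nice f -> nice h -> nice (fun x => f x + h x).
Proof.
move=> [mf [M1 h1] [B1 s1] c1] [mh [M2 h2] [B2 s2] c2]; split.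
- exact: measurable_funD.
- by exists (M1 + M2) => x; apply: le_trans (ler_normD _ _) _; exact: lerD.
- by exists (Num.max B1 B2) => x; rewrite gt_max => /andP[b1 b2]; rewrite s1// s2// addr0.
apply: negligibleS (negligibleU c1 c2) => x /= nc.
by apply/not_andP; apply: contra_not nc => -[cf ch]; exact: cvgD.
Qed.

Lemma nice0 : nice (fun=> 0 : R).
Proof.
split => //; [by exists 0 => x; rewrite normr0|by exists 0|].
by apply: aeW => x; exact: cvg_cst.
Qed.

Lemma nice_sum I (r : seq I) (P : pred I) (F : I -> R -> R) : (forall i, nice (F i)) ->
  nice (fun x => \sum_(i <- r | P i) F i x).
Proof.
move=> nF; elim: r => [|i r IH].
  by under eq_fun do rewrite big_nil; exact: nice0.
under eq_fun do rewrite big_cons; case: (P i) => //; exact: niceD.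
Qed.

Lemma nice_ind (a b : R) : nice (ind a b).
Proof.
split; first exact: ind_meas.
- by exists 1 => x; rewrite ger0_norm ?ind_ge0 ?ind_le1.
- exists (Num.max `|a| `|b|) => x; rewrite gt_max => /andP[xa xb]; rewrite indE.
  case: (boolP (_ <= x < _)) => // /andP[ax bx]; exfalso.
  have [x0|x0] := ltP 0 x; first by move: xb; rewrite (gtr0_norm x0) ltNge (le_trans (ltW bx))// ler_norm.
  by move: xa; rewrite (ler0_norm x0) ltNge -normrN (le_trans _ (ler_norm _))// lerN2.
have n1 (c : R) : mu.-negligible [set c].
  by exists [set c]; split => //; exact: lebesgue_measure_set1.
apply: negligibleS (negligibleU (n1 a) (n1 b)).
move=> x /=; apply: contra_notP => /not_orP[/eqP xa /eqP xb].
have near_cst (l : R) : (\forall y \near x, ind a b y = l) -> {for x, continuous (ind a b)}.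
  move=> hl; have e : ind a b x = l by exact: nbhs_singleton hl.
  suff : ind a b y @[y --> (x : R)] --> ind a b x by [].
  by rewrite e; apply: cvg_near_cst; exact: hl.
have [ax|ax|] := ltgtP a x; last by move=> e; rewrite e eqxx in xa.
  have [bx|bx|] := ltgtP b x; last by move=> e; rewrite e eqxx in xb.
    apply: (near_cst 0); near=> y; rewrite indE; case: (boolP (_ <= y < _)) => // /andP[_].
    by rewrite ltNge => /negP[]; apply: ltW; near: y; exact: lt_nbhsr.
  apply: (near_cst 1); near=> y; rewrite indE (_ : _ && _ = true)//; apply/andP; split.
    by apply: ltW; near: y; exact: lt_nbhsr.
  by near: y; exact: lt_nbhsl.
apply: (near_cst 0); near=> y; rewrite indE; case: (boolP (_ <= y < _)) => // /andP[].
by rewrite leNgt => /negP[]; near: y; exact: lt_nbhsl.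
Unshelve. all: by end_near. Qed.

Lemma nice_bump m c : nice (bump m c : R -> R).
Proof. pose t : R := 2 ^- m.+2.
rewrite (_ : bump m c = fun y => (-1) * ind (c - t *+ 2) (c - t) y + 3 * ind (c - t) c y +
  (-3) * ind c (c + t) y + ind (c + t) (c + t *+ 2) y).
  by apply: niceD; [apply: niceD; [apply: niceD|]|]; do ?apply: niceZ; exact: nice_ind.
by apply/funext => y; rewrite /bump -/t mulN1r mulNr. Qed.

Lemma nice_wave j : nice (wave j : R -> R).
Proof.
split; first exact: wave_meas.
- by exists 1 => x; exact: le_trans (wave_abs j x) (ind_le1 _ _ _).
- have [_ _ [B hB] _] := nice_ind 0 1; exists B => x Bx.
  by apply/eqP; rewrite -normr_eq0 eq_le normr_ge0 andbT -(hB x Bx) wave_abs.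
apply: aeW => x; apply/cvgrPdist_le => e e0.
have f0 := freq_gt0 j (R := R).
near=> y; apply: le_trans (wave_lip j x y) _; rewrite mulrC -ler_pdivlMr//.
near: y; apply: cvgr_dist_le; [exact: cvg_id|exact: divr_gt0].
Unshelve. all: by end_near. Qed.

Lemma cconv_cLint a b h (C : R) k x : ckernel C a -> ckernel C b -> nice h ->
  cLint (fun z => TL_kernel a b k (x - z) * (h z)%:C).
Proof.
move=> ka kb nh; have C0 := ckernel_ge0 ka.
apply: (@cLint_le _ _ (fun z => 2 * C * 2 ^+ k * (jap z ^+ 0 * `|h z|))).
- apply: cmeasM; last by apply: cmeasR; exact: nice_meas.
  by apply: (cmeas_comp _ (TLk_cmeas k ka kb)); exact: measB.
- exact/LintZ/nice_Lint.
move=> z; rewrite cmodM cmodR expr0 mul1r ler_wpM2r//.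
by apply: le_trans (TLk_le_jap k _ (isT : (0 <= 7)%N) ka kb) _; rewrite expr0 invr1 mulr1.
Qed.

Lemma cconv_sum a b (C : R) k I (r : seq I) (F : I -> R -> R) x :
  ckernel C a -> ckernel C b -> (forall i, nice (F i)) ->
  cconv (TL_kernel a b k) (fun z => \sum_(i <- r) F i z) x =
  \sum_(i <- r) cconv (TL_kernel a b k) (F i) x.
Proof.
move=> ka kb nF; rewrite -cintegral_sum; last by move=> i; exact: cconv_cLint ka kb (nF i).
by apply: eq_cintegral => z; rewrite raddf_sum mulr_sumr.
Qed.

Lemma cconvZ a b (C : R) k (c : R) h x : ckernel C a -> ckernel C b -> nice h ->
  cconv (TL_kernel a b k) (fun z => c * h z) x = c%:C * cconv (TL_kernel a b k) h x.
Proof.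
move=> ka kb nh; rewrite -(cintegralZ _ (cconv_cLint k x ka kb nh)).
by apply: eq_cintegral => z; rewrite rmorphM mulrCA.
Qed.

Lemma cconv_bump_le a b (C : R) k m (c x : R) : ckernel C a -> ckernel C b ->
  cmod (cconv (TL_kernel a b k) (bump m c) x) <=
  2 * Kbump * C * 2 ^- (m - k) * (jap (2 ^+ m * (x - c)) ^- 3 * jap (x - c) ^- 2).
Proof.
move=> ka kb; have [k1 k2] := ckernel_base k ka kb.
rewrite cconvE; apply: le_trans (cmod_le _) _ => /=.
apply: le_trans (lerD (conv_bump_le m k c x k1) (conv_bump_le m k c x k2)) _.
by apply: eq_ler; ring.
Qed.

(** The mean of [b] is what matters: [a] acts at [k = 0] only, which lies in the coarse regime
    [k <= j]. *)
Lemma cconv_wave_le a b (C : R) k j x : ckernel C a -> ckernel C b ->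
  (k <= j)%N \/ cintegral b = 0 ->
  cmod (cconv (TL_kernel a b k) (wave j) x) <=
  2 * Kwave * C * 2 ^- ((j - k) + (k - j)) * jap x ^- 2.
Proof.
move=> ka kb hk; have [k1 k2] := ckernel_base k ka kb.
have [h1 h2] : ((k <= j)%N \/ \int[mu]_y Re ((if k is 0%N then a else b) y) = 0) /\
   ((k <= j)%N \/ \int[mu]_y Im ((if k is 0%N then a else b) y) = 0).
  case: (leqP k j) hk => [kj _|jk [//|]]; first by split; left.
  move=> e; split; right; case: k jk {k1 k2} => // k _.
    exact: (congr1 (fun z => Re z) e).
  exact: (congr1 (fun z => Im z) e).
rewrite cconvE; apply: le_trans (cmod_le _) _ => /=.
apply: le_trans (lerD (conv_wave_le x k1 h1) (conv_wave_le x k2 h2)) _.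
by apply: eq_ler; ring.
Qed.

Lemma cintegral_derive0 a b (C : R) : ckernel C a -> ckernel C b ->
  (forall x, is_derive x 1 (fun t => Re (a t)) (Re (b x)) /\
             is_derive x 1 (fun t => Im (a t)) (Im (b x))) -> cintegral b = 0.
Proof.
move=> [a1 a2] [b1 b2] ab.
have gen (F f : R -> R) : kernel C F -> kernel C f -> (forall x, is_derive x 1 F (f x)) ->
    \int[mu]_x f x = 0.
  move=> kF kf d; have [c1 c2] := kernel_cvg0 kF.
  apply: (Int_derive0 d) => //; first exact: kernel_continuous kf.
  by apply: eq_Lint (Lint_opp (Lint_dil 0 0 kf)) => t; rewrite /dil expr0 !mul1r sub0r opprK.
apply: complex_eq => /=.
  by apply: (gen _ _ a1 b1) => x; have [] := ab x.
by apply: (gen _ _ a2 b2) => x; have [] := ab x.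
Qed.

End test_functions.

(** * Bounded pairings for test functions and indicators *)

Section dual_system.
Context {R : realType}.
Local Notation mu := (@lebesgue_measure R).
Implicit Types (F f : R -> R) (k : nat) (x : R).

(** With a decaying primitive [F] of the kernel only the endpoints count, so the convolution with an
    indicator is concentrated near them. This is the purpose of [lam]. *)
Lemma conv_dil_ind F f k (a b x : R) : a <= b -> (forall y : R, is_derive y 1 F (f y)) ->
  continuous f -> conv (dil k f) (ind a b) x = F (2 ^+ k * (x - a)) - F (2 ^+ k * (x - b)).
Proof.
move=> ab dF cf.
have d (y : R) : is_derive y 1 (fun y => - F (2 ^+ k * (x - y))) (dil k f (x - y)).
  have h1 : is_derive y (1 : R) (fun y => 2 ^+ k * (x - y)) (- 2 ^+ k).
    rewrite -mulrN1; apply: is_deriveZ; rewrite -(sub0r (1 : R)).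
    by apply: is_deriveB.
  have h2 := is_deriveN (@is_derive1_comp _ F (fun y => 2 ^+ k * (x - y)) y _ _ (dF _) h1).
  by rewrite /dil mulrC; rewrite mulrN opprK in h2.
rewrite /conv (Int_FTC ab d); first by rewrite opprK addrC.
move=> y; apply: (@continuous_comp _ _ _ (fun y => x - y) (dil k f)).
  by apply: cvgB; [exact: cvg_cst|exact: cvg_id].
exact: dil_continuous.
Qed.

Lemma geo_sum_le (rho : R) K : 0 <= rho -> rho < 1 -> \sum_(k < K) rho ^+ k <= (1 - rho)^-1.
Proof.
move=> r0 r1; have d0 : 0 < 1 - rho by rewrite subr_gt0.
have -> : \sum_(k < K) rho ^+ k = (1 - rho ^+ K) / (1 - rho).
  elim: K => [|K IH]; first by rewrite big_ord0 expr0 subrr mul0r.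
  by rewrite big_ord_recr/= IH exprS; field; rewrite gt_eqF.
by rewrite ler_pdivrMr// mulVf ?gt_eqF// lerBlDr lerDl exprn_ge0.
Qed.

Lemma two_powR_gt1 (t : R) : 0 < t -> 1 < 2 `^ t.
Proof.
move=> t0; have := @gt0_ltr_powR R t t0 1 2; rewrite powR1 !nnegrE.
by apply; rewrite ?ltr1n.
Qed.

Lemma conjugate_exponent (p : R) : 1 < p -> exists p', [/\ 1 < p', p^-1 + p'^-1 = 1 & p'^-1 = 1 - p^-1].
Proof.
move=> p1; have pp : 0 < p by exact: lt_trans p1.
have p0 : 0 < 1 - p^-1 by rewrite subr_gt0 invf_lt1.
exists (1 - p^-1)^-1; split.
- by rewrite invf_gt1// ltrBlDr ltrDl invr_gt0.
- by rewrite invrK addrC subrK.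
- by rewrite invrK.
Qed.

Variables (p q s : R) (psi0 psi : R -> R[i]).
Hypotheses (p1 : 1 < p) (q1 : 1 < q) (ps : -1 + p^-1 < s) (adm : TL_admissible s psi0 psi).

Local Notation TLs := (TL_space p q s psi0 psi).
Local Notation TLn := (TL_norm p q s psi0 psi).
Local Notation pairing := (duality_pairing_with p q s psi0 psi).

(** The hypothesis of [TL_pairing_le] with a weight that lies in every L^{p'} for [p' > 1], so that
    the pairing is bounded for all [p]. *)
Definition dual_bound (kap0 kap : R -> R[i]) (q' : R) (h : R -> R) (D : R) : Prop :=
  forall K x, \sum_(k < K) (2 `^ (- (k%:R * s)) * cmod (cconv (TL_kernel kap0 kap k) h x)) `^ q'
    <= (D * jap x ^- 2) `^ q'.

(** A family with a single nonzero member. This serves indicators, for which the levels are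
    estimated in L^{p'} one by one and then summed. *)
Lemma TL_pairing1_le (T : functional R) (g : R -> R) (p' : R) k :
  tempered_distribution T -> 0 < p' -> p^-1 + p'^-1 = 1 ->
  measurable_fun setT g -> (forall x, 0 <= g x) ->
  (\int[mu]_x (cmod (convolution (TL_kernel psi0 psi k) T x) * g x)%:E
   <= TLn T * 'N[mu]_p'%:E[EFin \o (fun x => 2 `^ (- (k%:R * s)) * g x)%R])%E.
Proof.
move=> tT p'0 pp mg g0; have [spsi0 spsi _ _] := adm.
have [q' [q'1 qq _]] := conjugate_exponent q1.
have q'0 : 0 < q' by exact: lt_trans q'1.
pose g' j x := if j == k then g x else 0.
have g'0 j x : 0 <= g' j x by rewrite /g'; case: ifP.
apply: le_trans (TL_pairing_le (K := k.+1) (g := g') (w := fun x => 2 `^ (- (k%:R * s)) * g x) p1 q1 spsi0 spsi tT p'0 q'0 pp qq _ g'0 _ _ _).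
- rewrite big_ord_recr/= {2}/g' eqxx leeDr// sume_ge0// => j _.
  by rewrite integral_ge0// => x _; rewrite lee_fin mulr_ge0 ?cmod_ge0.
- by move=> j; rewrite /g'; case: (j == k).
- exact: measurable_funM.
- by move=> x; rewrite mulr_ge0 ?powR_ge0.
move=> x; rewrite big_ord_recr/= {2}/g' eqxx big1 ?add0r// => j _.
by rewrite /g' ltn_eqF// mulr0 powR0// gt_eqF.
Qed.

Section kernels.
Variables (kap0 kap lam theta : R -> R[i]) (C p' : R).
Hypotheses (k0 : ckernel C psi0) (k1 : ckernel C psi) (kk0 : ckernel C kap0).
Hypotheses (kk : ckernel C kap) (kl : ckernel C lam) (kt : ckernel C theta).
Hypothesis dlam : forall x, is_derive x 1 (fun t => Re (lam t)) (Re (kap x)) /\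
                            is_derive x 1 (fun t => Im (lam t)) (Im (kap x)).
Hypothesis tht : 0 < Re (cintegral theta).
Hypothesis id0 : forall t, cintegral (fun x => psi0 x * kap0 (x - t)) = theta t.
Hypothesis id1 : forall t, cintegral (fun x => psi x * kap (x - t)) =
                           theta t - (2^-1)%:C * theta (t / 2).
Hypotheses (p'1 : 1 < p') (pp : p^-1 + p'^-1 = 1).
Let p'0 : 0 < p'. Proof. exact: lt_trans p'1. Qed.
Let C0 : 0 <= C := ckernel_ge0 k0.
Let J0 := @japI_ge0 R.

Lemma pointwise_pairing (q' : R) h D : 1 < q' -> q^-1 + q'^-1 = 1 ->
  nice h -> 0 <= D -> dual_bound kap0 kap q' h D ->
  exists L, pairing (fun x => (h x)%:C) L /\ forall T, TLs T ->
    ((cmod (L T))%:E <= (4 / Re (cintegral theta) * (D * @japI R `^ p'^-1))%:E * TLn T)%E.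
Proof.
move=> q'1 qq nh D0 hD; have q'0 : 0 < q' by exact: lt_trans q'1.
have [spsi0 spsi _ _] := adm.
have DB T : TLs T -> forall K, (\sum_(k < K) \int[mu]_x
    (cmod (convolution (TL_kernel psi0 psi k) T x) * cmod (cconv (TL_kernel kap0 kap k) h x))%:E
    <= (D * @japI R `^ p'^-1)%:E * TLn T)%E.
  move=> [tT _] K; apply: le_trans (TL_pairing_le (g := fun k x => cmod (cconv (TL_kernel kap0 kap k) h x)) (w := fun x => D * jap x ^- 2) p1 q1 spsi0 spsi tT p'0 q'0 pp qq _ _ _ _ _) _ => //.
  - by move=> k; apply: cmod_meas; exact: (cconv_cmeas k0 kk0 kk nh).
  - by move=> k x; exact: cmod_ge0.
  - by apply: measurable_funM => //; apply: Lint_meas; exact: Lint_japX.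
  - by move=> x; rewrite mulr_ge0 ?japX_ge0.
  rewrite muleC; apply: lee_wpmul2r; first exact: Lnorm_ge0.
  exact: Lnorm_jap.
exact: (dual_functional spsi0 spsi k0 k1 kk0 kk kt tht id0 id1 nh DB).
Qed.

(** Level [k] is concentrated within [2 ^- k] of the endpoints, so its L^{p'} norm is of order
    2^(-k/p'). With the weight 2^(-k s) the levels form a geometric series of ratio 2^(-(s + 1/p')),
    which converges because s > -1 + 1/p. *)
Lemma indicator_pairing (a b : R) : a <= b ->
  exists L, pairing (fun x => (ind a b x)%:C) L.
Proof.
move=> ab; have nh := nice_ind a b.
set g := fun k => cconv (TL_kernel kap0 kap k) (ind a b).
pose e k x := jap (2 ^+ k * (a - x)) ^- 2 + jap (2 ^+ k * (b - x)) ^- 2.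
have g_le k x : cmod (g k.+1 x) <= 2 * C * e k.+1 x.
  rewrite /g cconvE; apply: le_trans (cmod_le _) _ => /=.
  have [kl1 kl2] := kl; have [kk1 kk2] := kk.
  rewrite (conv_dil_ind _ _ ab (fun y => (dlam y).1) (kernel_continuous kk1)).
  rewrite (conv_dil_ind _ _ ab (fun y => (dlam y).2) (kernel_continuous kk2)).
  have est f (y : R) : kernel C f -> `|f (2 ^+ k.+1 * (x - y))| <= C * jap (2 ^+ k.+1 * (y - x)) ^- 2.
    move=> kf; apply: le_trans (kernel_le _ kf) _; rewrite -japN -mulrN opprB.
    by rewrite ler_wpM2l// japX_le.
  apply: le_trans (lerD (ler_normB _ _) (ler_normB _ _)) _.
  apply: le_trans (lerD (lerD (est _ _ kl1) (est _ _ kl1)) (lerD (est _ _ kl2) (est _ _ kl2))) _.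
  by apply: eq_ler; rewrite /e; ring.
have e_ge0 k x : 0 <= e k x by rewrite addr_ge0 ?japX_ge0.
have e_le2 k x : e k x <= 2 by have -> : (2 : R) = 1 + 1 by []; rewrite lerD ?japX_le1.
have e_int k : Lint (e k) /\ \int[mu]_x e k x = 2 * (2 ^- k * @japI R).
  have l1 y : Lint (fun x => jap (2 ^+ k * (y - x)) ^- 2) /\
      \int[mu]_x jap (2 ^+ k * (y - x)) ^- 2 = 2 ^- k * @japI R.
    have L1 : Lint (fun x => jap (2 ^+ k * (y - x)) ^- 2).
      apply: eq_Lint (LintZ (2 ^- k) (Lint_scaled_jap y (pow2_gt0 k))) => x.
      by rewrite mulKf ?pow2_neq0.
    split => //; rewrite -(Int_scaled_jap y (pow2_gt0 k)) IntZ// mulKf ?pow2_neq0//.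
  have [la ia] := l1 a; have [lb ib] := l1 b; split; first exact: LintD.
  by rewrite IntD// ia ib; ring.
pose Dk k := 4 * C * 2 `^ (- (k%:R * s)) * (2 ^- k * @japI R) `^ p'^-1.
have Dk_ge0 k : 0 <= Dk k by rewrite !mulr_ge0 ?powR_ge0.
have N_le k : ('N[mu]_p'%:E[EFin \o (fun x => 2 `^ (- (k.+1%:R * s)) * cmod (g k.+1 x))%R] <= (Dk k.+1)%:E)%E.
  apply: Lnorm_bound => //; first by move=> x; rewrite mulr_ge0 ?powR_ge0 ?cmod_ge0.
  have [le ie] := e_int k.+1.
  (* Half of [e] is at most 1, so its power [p'] is bounded by itself, whose integral is known; the
     halving turns [2 * C] into [4 * C]. *)
  pose A := (4 * C * 2 `^ (- (k.+1%:R * s))) `^ p'.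
  apply: (@le_trans _ _ (\int[mu]_x (A * (2^-1 * e k.+1 x))%:E)%E); last first.
    rewrite -Lint_EFin; last exact/LintZ/LintZ.
    rewrite lee_fin IntZ; last exact: LintZ.
    rewrite IntZ// ie /Dk powRM ?mulr_ge0 ?powR_ge0// -/A ler_wpM2l ?powR_ge0//.
    rewrite powRKV ?gt_eqF ?mulr_ge0 ?ipow2_ge0//.
    by apply: eq_ler; field; rewrite pow2_neq0.
  apply: ge0_le_integral => //.
  - by move=> x _; rewrite lee_fin powR_ge0.
  - apply/measurable_EFinP; apply: (measurableT_comp (measurable_powR p')).
    apply: measurable_funM => //; apply: cmod_meas; exact: (cconv_cmeas k0 kk0 kk nh).
  - by apply/measurable_EFinP/measurable_funM => //; apply: measurable_funM => //; exact: Lint_meas.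
  move=> x _; rewrite lee_fin.
  have h1 : 2 `^ (- (k.+1%:R * s)) * cmod (g k.+1 x) <= (4 * C * 2 `^ (- (k.+1%:R * s))) * (2^-1 * e k.+1 x).
    apply: le_trans (ler_wpM2l (powR_ge0 _ _) (g_le k x)) _.
    by apply: eq_ler; field.
  apply: le_trans (ler_powRl (ltW p'0) _ h1) _; first by rewrite mulr_ge0 ?powR_ge0 ?cmod_ge0.
  rewrite powRM ?mulr_ge0 ?powR_ge0// -/A ler_wpM2l ?powR_ge0//.
  have [e0|e0] := eqVneq (2^-1 * e k.+1 x) 0; first by rewrite e0 powR0 ?gt_eqF.
  rewrite -[leRHS]powRr1 ?mulr_ge0//; apply: ger_powR; last exact: ltW.
  rewrite lt_neqAle eq_sym e0 mulr_ge0//= mulrC ler_pdivrMr// mul1r; exact: e_le2.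
(* Level 0 uses [kap0], which comes without a primitive; it is a single term, bounded by the decay
   of the convolution. *)
have [Ck [Ck0 hCk]] := cconv_le k0 kk0 kk nh 0.
have [spsi0 spsi _ _] := adm.
pose rho : R := 2 `^ (- (s + p'^-1)).
have sp : 0 < s + p'^-1 by move: ps pp; move: p^-1 p'^-1 => u v; lra.
have rho1 : rho < 1.
  by rewrite /rho powRN invf_lt1 ?powR_gt0// two_powR_gt1.
have DkE k : Dk k = 4 * C * @japI R `^ p'^-1 * rho ^+ k.
  have i2 : (2 ^- k : R) = 2 `^ (- k%:R) by rewrite powRN powR_mulrn.
  rewrite /Dk powRM ?ipow2_ge0// i2 -powR_mulrn ?powR_ge0// /rho -!powRrM.
  have -> : - (s + p'^-1) * k%:R = - (k%:R * s) + - k%:R * p'^-1 by ring.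
  rewrite (@powRD _ _ (- (k%:R * s))) ?pnatr_eq0 ?implybT//; ring.
pose D0 := Ck * @japI R `^ p'^-1 + 4 * C * @japI R `^ p'^-1 * (1 - rho)^-1.
have r0 : 0 <= rho by exact: powR_ge0.
suff DB T : TLs T -> forall K, (\sum_(k < K) \int[mu]_x
    (cmod (convolution (TL_kernel psi0 psi k) T x) * cmod (g k x))%:E <= D0%:E * TLn T)%E.
  have [L [hL _]] := dual_functional spsi0 spsi k0 k1 kk0 kk kt tht id0 id1 nh DB.
  by exists L.
move=> TT K; have [tT fT] := TT.
have tn0 : (0 <= TLn T)%E by exact: Lnorm_ge0.
pose E k := if k is 0%N then Ck * @japI R `^ p'^-1 else 4 * C * @japI R `^ p'^-1 * rho ^+ k.
have E0 k : 0 <= E k by case: k => [|k]; rewrite !mulr_ge0 ?powR_ge0 ?exprn_ge0.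
have hk k : (\int[mu]_x (cmod (convolution (TL_kernel psi0 psi k) T x) * cmod (g k x))%:E
    <= (E k)%:E * TLn T)%E.
  have mgk : measurable_fun setT (fun x => cmod (g k x)).
    by apply: cmod_meas; exact: (cconv_cmeas k0 kk0 kk nh).
  apply: le_trans (TL_pairing1_le k tT p'0 pp mgk (fun x => cmod_ge0 _)) _.
  rewrite muleC; apply: lee_wpmul2r => //.
  case: k mgk => [|k] mgk; last by rewrite /E -DkE; exact: N_le.
  apply: le_trans (Lnorm_jap p'1 Ck0).
  apply: ge0_le_Lnorm => //.
  - by apply/measurable_EFinP/measurable_funM.
  - by apply/measurable_EFinP/measurable_funM => //; apply: Lint_meas; exact: Lint_japX.
  - by move=> x; rewrite lee_fin mulr_ge0 ?powR_ge0 ?cmod_ge0.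
  - move=> x; rewrite lee_fin mul0r oppr0 powRr0 mul1r; apply: le_trans (hCk x) _.
    by rewrite ler_wpM2l// japX_le.
apply: (@le_trans _ _ (\sum_(k < K) ((E k)%:E * TLn T))%E).
  by apply: lee_sum => k _; exact: hk.
rewrite -ge0_sume_distrl; last by move=> k _; rewrite lee_fin.
rewrite sumEFin; apply: lee_wpmul2r => //; rewrite lee_fin.
case: K => [|K]; first by rewrite big_ord0 addr_ge0 ?mulr_ge0 ?powR_ge0 ?invr_ge0 ?subr_ge0 ?(ltW rho1).
rewrite big_ord_recl/= lerD2l -mulr_sumr ler_wpM2l ?mulr_ge0 ?powR_ge0//.
apply: le_trans (geo_sum_le K r0 rho1); apply: ler_sum => k _.
by rewrite exprS ler_piMl ?exprn_ge0// ltW.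
Qed.

End kernels.

Lemma dual_system (q' : R) : 1 < q' -> q^-1 + q'^-1 = 1 ->
  exists kap0 kap C Cd, [/\
    [/\ ckernel C psi0, ckernel C psi, ckernel C kap0 & ckernel C kap],
    cintegral kap = 0, 0 < Cd,
    forall h D, nice h -> 0 <= D -> dual_bound kap0 kap q' h D ->
      exists L, pairing (fun x => (h x)%:C) L /\
        forall T, TLs T -> ((cmod (L T))%:E <= (Cd * D)%:E * TLn T)%E &
    forall a b, a <= b -> exists L, pairing (fun x => (ind a b x)%:C) L].
Proof.
move=> q'1 qq; have [spsi0 spsi _ _] := adm.
have [p' [p'1 pp _]] := conjugate_exponent p1.
have [kap0 [kap [lam [theta [C1 [[kk0 kk kl kt] dlam tht id0 id1]]]]]] := dual_kernels adm.
have [C2 k0] := schwartz_ckernel spsi0; have [C3 k1] := schwartz_ckernel spsi.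
pose C := C1 + C2 + C3.
have [c1 c2 c3] := And3 (ckernel_ge0 kk) (ckernel_ge0 k0) (ckernel_ge0 k1).
have [/ckernelW w1 /ckernelW w2 /ckernelW w3] : [/\ C1 <= C, C2 <= C & C3 <= C].
  by rewrite /C; split; lra.
move: kk0 kk kl kt k0 k1 => /w1 kk0 /w1 kk /w1 kl /w1 kt /w2 k0 /w3 k1.
have J0 := @japI_ge0 R.
have c0 : 0 < 4 / Re (cintegral theta) by rewrite divr_gt0.
exists kap0, kap, C, (4 / Re (cintegral theta) * (@japI R `^ p'^-1 + 1)); split => //.
- exact: cintegral_derive0 kl kk dlam.
- by rewrite mulr_gt0// ltr_wpDl ?powR_ge0.
- move=> h D nh D0 hD.
  have [L [h1 h2]] := pointwise_pairing k0 k1 kk0 kk kt tht id0 id1 p'1 pp q'1 qq nh D0 hD.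
  exists L; split => // T TT; apply: le_trans (h2 T TT) _.
  apply: lee_wpmul2r; first exact: Lnorm_ge0.
  by rewrite lee_fin -[leRHS]mulrA ler_wpM2l ?(ltW c0)// mulrC ler_wpM2r// lerDl.
by move=> a b; exact: (indicator_pairing k0 k1 kk0 kk kl kt dlam tht id0 id1 p'1 pp).
Qed.

End dual_system.

(** * Haar projections *)

Section operator_norm.
Context {R : realType}.
Local Notation mu := (@lebesgue_measure R).
Implicit Types (u v h g : R -> R).

Local Notation reg u := (regular_distribution (fun x => (u x)%:C)).

Lemma cintegralR u : cintegral (fun x => (u x)%:C) = (\int[mu]_x u x)%:C.
Proof. by apply: complex_eq => //=; exact: Int0. Qed.

Lemma nice_Lint0 h : nice h -> Lint h.
Proof.
move=> nh; apply: (Lint_le (nice_meas nh) (nice_Lint 0 nh)) => x.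
by rewrite expr0 mul1r.
Qed.

Lemma niceM h g : nice h -> nice g -> nice (fun x => h x * g x).
Proof.
move=> [mf [M1 h1] [B1 s1] c1] [mh [M2 h2] [B2 s2] c2]; split.
- exact: measurable_funM.
- by exists (M1 * M2) => x; rewrite normrM ler_pM.
- by exists B1 => x b1; rewrite s1// mul0r.
apply: negligibleS (negligibleU c1 c2) => x /= nc.
by apply/not_andP; apply: contra_not nc => -[cf ch]; exact: cvgM.
Qed.

Lemma nice_square_integrable u : nice u -> square_integrable (fun x => (u x)%:C).
Proof.
move=> nu; split; [exact: nice_meas|exact: measurable_cst|].
have L2 := nice_Lint0 (niceM nu nu).
under eq_integral do rewrite cmodR -normrX ger0_norm ?sqr_ge0// expr2.
by rewrite -Lint_EFin// ltry.
Qed.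

Lemma nice_tempered u : nice u -> tempered_distribution (reg u).
Proof.
move=> nu; have mu_ : cmeas (fun x => (u x)%:C) by apply: cmeasR; exact: nice_meas.
have sw (phi : R -> R[i]) : schwartz phi -> exists M, [/\ cmeas phi, (forall x, cmod (phi x) <= M) & (M%:E <= schwartz_seminorm 0 0 phi)%E].
  move=> sphi; have [C ck] := schwartz_ckernel sphi.
  have cm : cmeas phi by split; [exact: (continuous_measurable_fun (kernel_continuous ck.1))|
            exact: (continuous_measurable_fun (kernel_continuous ck.2))].
  have [_ /(_ 0 0)%N fin] := sphi.
  have ub x : ((cmod (phi x))%:E <= schwartz_seminorm 0 0 phi)%E.
    apply: ereal_sup_ubound; exists x => //=; rewrite expr0 mul1r /cderive1n/=.
    by rewrite cmodE.
  have fn : schwartz_seminorm 0 0 phi \is a fin_num.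
    by rewrite ge0_fin_numE//; apply: le_trans (ub 0); rewrite lee_fin cmod_ge0.
  exists (fine (schwartz_seminorm 0 0 phi)); split => //; last by rewrite fineK.
  by move=> x; rewrite -lee_fin fineK.
have cl (phi : R -> R[i]) : schwartz phi -> cLint (fun x => (u x)%:C * phi x).
  move=> /sw[M [cm hM _]]; apply: (@cLint_le _ _ (fun x => M * `|u x|)); first exact: cmeasM.
    exact/LintZ/Lint_norm/nice_Lint0.
  by move=> x; rewrite cmodM cmodR mulrC ler_wpM2r.
split.
  move=> a phi chi sphi schi; rewrite /regular_distribution -(cintegralZ a (cl _ sphi)).
  rewrite -(cintegralD (cLintZ a (cl _ sphi)) (cl _ schi)).
  by apply: eq_cintegral => x; ring.
exists (2 * \int[mu]_x `|u x|), 1%N => phi sphi; rewrite !big_ord1/=.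
have [M [cm hM hS]] := sw _ sphi.
have I0 : 0 <= \int[mu]_x `|u x| by apply: Rintegral_ge0.
apply: (@le_trans _ _ ((2 * \int[mu]_x `|u x|)%:E * M%:E)%E); last first.
  by apply: lee_wpmul2l => //; rewrite lee_fin mulr_ge0.
rewrite -EFinM lee_fin; apply: le_trans (cintegral_le (p := fun x => M * `|u x|) _ _ _) _.
- exact: cmeasM.
- exact/LintZ/Lint_norm/nice_Lint0.
- by move=> x; rewrite cmodM cmodR mulrC ler_wpM2r.
by rewrite IntZ; [apply: eq_ler; ring|exact/Lint_norm/nice_Lint0].
Qed.

Lemma haar_ind (j : nat) (n : int) (x : R) : haar j n x =
  ind (2 ^- j * n%:~R) (2 ^- j * (n%:~R + 2^-1)) x -
  ind (2 ^- j * (n%:~R + 2^-1)) (2 ^- j * (n%:~R + 1)) x.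
Proof. by []. Qed.

Lemma nice_haar (j : nat) (n : int) : nice (haar j n : R -> R).
Proof.
rewrite (_ : haar j n = fun x => ind (2 ^- j * n%:~R) (2 ^- j * (n%:~R + 2^-1)) x +
  (-1) * ind (2 ^- j * (n%:~R + 2^-1)) (2 ^- j * (n%:~R + 1)) x).
  by apply: niceD; [|apply: niceZ]; exact: nice_ind.
by apply/funext => x; rewrite mulN1r.
Qed.

Variables (p q s : R) (psi0 psi : R -> R[i]) (C : R).
Hypotheses (k0 : ckernel C psi0) (k1 : ckernel C psi).
Local Notation TLs := (TL_space p q s psi0 psi).
Local Notation TLn := (TL_norm p q s psi0 psi).
Local Notation pairing := (duality_pairing_with p q s psi0 psi).
Hypothesis ind_pairing : forall a b : R, a <= b ->
  exists L, pairing (fun x => (ind a b x)%:C) L.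

Lemma haar_pairing (j : nat) (n : int) : exists L, pairing (chaar j n) L.
Proof.
have i2 := ltW (ipow2_gt0 j (R := R)).
have [|L1 [l1 [C1 b1] e1]] := @ind_pairing (2 ^- j * n%:~R) (2 ^- j * (n%:~R + 2^-1)).
  by rewrite ler_wpM2l// lerDl.
have [|L2 [l2 [C2 b2] e2]] := @ind_pairing (2 ^- j * (n%:~R + 2^-1)) (2 ^- j * (n%:~R + 1)).
  by rewrite ler_wpM2l// lerD2l; lra.
exists (fun T => L1 T - L2 T); split.
- by move=> a T U TT TU; rewrite l1// l2//; ring.
- exists (`|C1| + `|C2|) => T TT.
  have n0 : (0 <= TLn T)%E by exact: Lnorm_ge0.
  have fn : TLn T \is a fin_num by rewrite ge0_fin_numE//; case: TT.
  move: (b1 T TT) (b2 T TT); rewrite -(fineK fn) -!EFinM !lee_fin => h1 h2.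
  have f0 : 0 <= fine (TLn T) by exact: fine_ge0.
  apply: le_trans (cmodD _ _) _; rewrite mulrDl lerD//.
    by apply: le_trans h1 _; rewrite ler_wpM2r// ler_norm.
  have -> : cmod (- L2 T) = cmod (L2 T) by rewrite -mulN1r cmodM (_ : -1 = (-1)%:C) ?cmodR ?normrN ?normr1 ?mul1r// rmorphN.
  by apply: le_trans h2 _; rewrite ler_wpM2r// ler_norm.
move=> u su Tu; rewrite e1// e2//.
have cl a b : cLint (fun x => u x * (ind a b x)%:C).
  have [m1 m2 fu] := su.
  apply: (@cLint_le _ _ (fun x => cmod (u x) ^+ 2 + ind a b x)).
  - by apply: cmeasM => //; apply: cmeasR; exact: ind_meas.
  - apply: LintD; last exact: Lint_ind.
    by apply: ge0_Lint => //; [apply: measurable_funX; exact: cmod_meas|move=> x; rewrite exprn_ge0 ?cmod_ge0].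
  move=> x; rewrite cmodM cmodR indE; case: (_ && _); rewrite /= ?normr1 ?normr0.
    by have := cmod_ge0 (u x); move: (cmod _) => z; nra.
  by rewrite mulr0 addr0 exprn_ge0 ?cmod_ge0.
rewrite -mulN1r -cintegralZ// -cintegralD//; last exact: cLintZ.
by apply: eq_cintegral => x; rewrite /chaar haar_ind rmorphB/=; ring.
Qed.

(** [xget] returns the value of some admissible functional, and the third clause of
    [duality_pairing_with] determines that value at a square integrable [u]. Existence is
    [haar_pairing]. *)
Lemma duality_pairing_regular u (j : nat) (n : int) : nice u -> TLs (reg u) ->
  duality_pairing p q s psi0 psi (reg u) (chaar j n) = (\int[mu]_x (u x * haar j n x))%:C.
Proof.
move=> nu Tu; rewrite /duality_pairing.
have [L pL] := haar_pairing j n.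
have [L' [_ _ e] ->] := @xgetPex _ 0 [set z | exists2 L, pairing (chaar j n) L & z = L (reg u)]
  (ex_intro _ (L (reg u)) (ex_intro2 _ _ L pL erefl)).
rewrite e//; last exact: nice_square_integrable.
by rewrite -cintegralR; apply: eq_cintegral => x; rewrite rmorphM.
Qed.

Definition haar_coef u (j : nat) (n : int) : R := 2 ^+ j * \int[mu]_x (u x * haar j n x).

(** The pairing of the projection of [u] with [g], by [Int_haar_sum]. Its symmetry ([haar_formC])
    lets the two test functions exchange roles between the two cases. *)
Definition haar_form (A : {fset nat}) u g : R :=
  \sum_(a <- A) let j := trunc_log 2 a in \sum_(n < 2 ^ j)
    haar_coef u j n * \int[mu]_x (haar j n x * g x).

Definition haar_block u (j : nat) (x : R) : R := \sum_(n < 2 ^ j) haar_coef u j n * haar j n x.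

Definition haar_sum (A : {fset nat}) u (x : R) : R := \sum_(a <- A) haar_block u (trunc_log 2 a) x.

Lemma nice_haar_block u j : nice (haar_block u j).
Proof. by apply: nice_sum => n; apply: niceZ; exact: nice_haar. Qed.

Lemma nice_haar_sum A u : nice (haar_sum A u).
Proof. by apply: nice_sum => a; exact: nice_haar_block. Qed.

Lemma convolution_haar_projection A u k : nice u -> TLs (reg u) ->
  convolution (TL_kernel psi0 psi k) (haar_projection p q s psi0 psi A (reg u)) =
  convolution (TL_kernel psi0 psi k) (reg (haar_sum A u)).
Proof.
move=> nu Tu; apply/funext => x; rewrite convolution_regular (cconv_sum _ _ _ k0 k1); last first.
  by move=> a; exact: nice_haar_block.
rewrite /convolution /haar_projection; apply: eq_bigr => a _.
rewrite (cconv_sum _ _ _ k0 k1); last by move=> n; apply: niceZ; exact: nice_haar.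
apply: eq_bigr => n _; rewrite (cconvZ _ _ _ k0 k1); last exact: nice_haar.
by rewrite duality_pairing_regular// -[in RHS]convolution_regular /haar_coef rmorphM.
Qed.

Lemma Int_haar_sum A u g : nice g -> \int[mu]_x (haar_sum A u x * g x) = haar_form A u g.
Proof.
move=> ng; rewrite /haar_sum; under eq_Rintegral do rewrite mulr_suml.
rewrite Int_sum; last by move=> a _; apply/nice_Lint0/niceM => //; exact: nice_haar_block.
apply: eq_bigr => a _; rewrite /haar_block; under eq_Rintegral do rewrite mulr_suml.
rewrite Int_sum; last first.
  by move=> n _; apply/nice_Lint0/niceM => //; apply: niceZ; exact: nice_haar.
apply: eq_bigr => n _.
rewrite -(IntZ (haar_coef u _ n) (nice_Lint0 (niceM (nice_haar (trunc_log 2 a) n) ng))).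
by apply: eq_Rintegral => x _; rewrite mulrA.
Qed.

Lemma opnorm_ge (A : {fset nat}) u g L (D : R) : nice u -> nice g ->
  (TLn (reg u) <= 1)%E -> pairing (fun x => (g x)%:C) L ->
  (forall T, TLs T -> ((cmod (L T))%:E <= D%:E * TLn T)%E) ->
  0 < D ->
  ((haar_form A u g / D)%:E <= TL_opnorm p q s psi0 psi (haar_projection p q s psi0 psi A))%E.
Proof.
move=> nu ng Tu [Llin Lbd Lsq] LD D0.
have Tus : TLs (reg u) by split; [exact: nice_tempered|exact: le_lt_trans Tu (ltry _)].
set v := haar_sum A u; have nv : nice v by exact: nice_haar_sum.
have ev k := convolution_haar_projection A k nu Tus.
(* The norm sees a functional only through its convolutions with the kernels, so agreement there is
   enough. *)
have eT : TLn (haar_projection p q s psi0 psi A (reg u)) = TLn (reg v).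
  rewrite /TL_norm; congr Lnorm; apply/funext => x; rewrite /TL_lq_sum.
  by under eq_eseriesr do rewrite ev.
apply: (@le_trans _ _ (TLn (reg v))); last first.
  by rewrite -eT; apply: ereal_sup_ubound; exists (reg u).
have [->|fv] := eqVneq (TLn (reg v)) +oo%E; first exact: leey.
have vs : TLs (reg v) by split; [exact: nice_tempered|rewrite ltey].
have n0 : (0 <= TLn (reg v))%E by exact: Lnorm_ge0.
have fn : TLn (reg v) \is a fin_num by rewrite ge0_fin_numE// ltey.
move: (LD _ vs); rewrite (Lsq _ (nice_square_integrable nv) vs) -(fineK fn) -EFinM !lee_fin.
have -> : cintegral (fun x => (v x)%:C * (g x)%:C) = (haar_form A u g)%:C.
  rewrite -Int_haar_sum// -cintegralR; apply: eq_cintegral => x; exact: esym (rmorphM _ _ _).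
rewrite cmodR => h; rewrite ler_pdivrMr// mulrC; exact: le_trans (ler_norm _) h.
Qed.

End operator_norm.

(** * Pruned point sets *)

Section pruning.
Context {R : realType}.
Implicit Types (a y z : R) (l m t : nat).

(* The terms are increments of [y / (1 + a |y|)], also in [integer_sum]. *)
Lemma half_integer_sum a (c M : nat) : 0 < a ->
  \sum_(m < M) jap (a * (m%:R + 2^-1 - c%:R)) ^- 2 <= 2 / a.
Proof.
move=> a0.
pose Psi (k : nat) : R := (k%:R - c%:R) / (1 + a * `|k%:R - c%:R|).
have d0 (y : R) : 0 < 1 + a * `|y| by rewrite ltr_wpDr// mulr_ge0// ltW.
have PsiB k : `|Psi k| <= a^-1.
  rewrite /Psi normrM normfV (gtr0_norm (d0 _)) ler_pdivrMr// mulrDr mulr1 mulKf ?gt_eqF//.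
  by rewrite lerDr invr_ge0 ltW.
have step (m : nat) : jap (a * (m%:R + 2^-1 - c%:R)) ^- 2 <= Psi m.+1 - Psi m.
  have pos (y : R) : 0 <= y -> (1 + a * (y + 2^-1)) ^- 2 <=
      (y + 1) / (1 + a * (y + 1)) - y / (1 + a * y).
    move=> y0.
    have p1 : 0 < 1 + a * y by rewrite ltr_wpDr// mulr_ge0// ltW.
    have p2 : 0 < 1 + a * (y + 1) by rewrite ltr_wpDr// mulr_ge0// ?addr_ge0// ltW.
    have p3 : 0 < 1 + a * (y + 2^-1) by rewrite ltr_wpDr// mulr_ge0// ?addr_ge0// ltW.
    have -> : (y + 1) / (1 + a * (y + 1)) - y / (1 + a * y) = ((1 + a * (y + 1)) * (1 + a * y))^-1.
      by field; rewrite !gt_eqF.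
    rewrite lef_pV2 ?posrE ?mulr_gt0 ?exprn_gt0//; nra.
  rewrite /Psi /jap normrM (gtr0_norm a0).
  have [cm|mc] := leqP c m.
    have y0 : 0 <= m%:R - c%:R :> R by rewrite subr_ge0 ler_nat.
    have -> : m.+1%:R - c%:R = m%:R - c%:R + 1 :> R by rewrite -addn1 natrD addrAC.
    have -> : m%:R + 2^-1 - c%:R = m%:R - c%:R + 2^-1 :> R by rewrite addrAC.
    move: (m%:R - c%:R) y0 => y y0; rewrite (ger0_norm y0) (@ger0_norm _ (_ + 1)) ?addr_ge0//.
    by rewrite (@ger0_norm _ (_ + 2^-1)) ?addr_ge0//; exact: pos.
  have mc' : (0 : R) <= c%:R - m%:R - 1 by rewrite -addrA -opprD subr_ge0 natr1 ler_nat.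
  have mS : m.+1%:R = m%:R + 1 :> R by rewrite -addn1 natrD.
  have := pos _ mc'.
  have -> : `|m%:R + 2^-1 - c%:R| = c%:R - m%:R - 1 + 2^-1 :> R.
    rewrite ler0_norm; [by field|lra].
  have -> : `|m.+1%:R - c%:R| = c%:R - m%:R - 1 :> R.
    by rewrite mS ler0_norm; [ring|lra].
  have -> : `|m%:R - c%:R| = c%:R - m%:R - 1 + 1 :> R by rewrite ler0_norm; [ring|lra].
  move/le_trans; apply; rewrite mS; apply: eq_ler.
  have -> : m%:R + 1 - c%:R = - (c%:R - m%:R - 1) :> R by ring.
  have -> : m%:R - c%:R = - (c%:R - m%:R - 1 + 1) :> R by ring.
  by rewrite !mulNr opprK addrC.
apply: le_trans (ler_sum _ (fun (m : 'I_M) _ => step m)) _.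
rewrite -(big_mkord xpredT (fun m => Psi m.+1 - Psi m)) telescope_sumr//.
apply: le_trans (ler_norm _) _; apply: le_trans (ler_normB _ _) _.
by rewrite mulrDl mul1r lerD.
Qed.

Lemma integer_sum z (M : nat) : \sum_(m < M) jap (z - m%:R) ^- 2 <= 4.
Proof.
pose Psi (k : nat) : R := (k%:R - z) / (1 + `|k%:R - z|).
have d0 (y : R) : 0 < 1 + `|y| by rewrite ltr_wpDr.
have PsiB k : `|Psi k| <= 1.
  by rewrite /Psi normrM normfV (gtr0_norm (d0 _)) ler_pdivrMr// mul1r lerDr.
have step (m : nat) : jap (z - m%:R) ^- 2 <= 2 * (Psi m.+1 - Psi m).
  have mS : m.+1%:R - z = m%:R - z + 1 :> R by rewrite -addn1 natrD addrAC.
  rewrite -japN opprB /Psi /jap mS; move: (m%:R - z) => y {mS}.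
  have [y0|y0] := leP 0 y.
    rewrite !ger0_norm ?addr_ge0//.
    have -> : 2 * ((y + 1) / (1 + (y + 1)) - y / (1 + y)) = ((1 + (y + 1)) * (1 + y) / 2)^-1.
      by field; rewrite !gt_eqF//; lra.
    rewrite lef_pV2 ?posrE; [nra|rewrite exprn_gt0; lra|rewrite !mulr_gt0//; lra].
  have [y1|y1] := leP (y + 1) 0.
    rewrite !ler0_norm//; last exact: ltW.
    have -> : 2 * ((y + 1) / (1 - (y + 1)) - y / (1 - y)) = ((- y) * (1 - y) / 2)^-1.
      have -> : 1 - (y + 1) = - y by ring.
      have n1 : y != 0 by rewrite lt_eqF.
      have n2 : 1 - y != 0 by rewrite gt_eqF//; lra.
      by field; rewrite ?oppr_eq0 n1 n2.
    rewrite lef_pV2 ?posrE; [nra|rewrite exprn_gt0; lra|rewrite !mulr_gt0//; lra].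
  rewrite (gtr0_norm y1) (ltr0_norm y0).
  apply: (@le_trans _ _ 1); first by rewrite invf_le1 ?exprn_gt0 ?exprn_ege1//; lra.
  have h1 : (y + 1) / 2 <= (y + 1) / (1 + (y + 1)).
    by rewrite ler_wpM2l ?(ltW y1)// lef_pV2 ?posrE; lra.
  have h2 : - y / 2 <= - (y / (1 - y)).
    by rewrite -mulNr ler_wpM2l ?oppr_ge0 ?(ltW y0)// lef_pV2 ?posrE; lra.
  lra.
apply: le_trans (ler_sum _ (fun (m : 'I_M) _ => step m)) _.
rewrite -mulr_sumr -(big_mkord xpredT (fun m => Psi m.+1 - Psi m)) telescope_sumr//.
have := PsiB M; have := PsiB 0%N; rewrite !ler_norml => /andP[h1 h2] /andP[h3 h4]; lra.
Qed.

Lemma dyadic_layer I (r : seq I) (P : pred I) (u : I -> R) (B : R) :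
  (forall i, 1 <= u i) ->
  (forall t, \sum_(i <- r | P i && (u i <= 2 ^+ t)) 1 <= B * 4 ^+ t) ->
  \sum_(i <- r | P i) u i ^- 3 <= 16 * B.
Proof.
move=> u1 hB.
have B0 : 0 <= B.
  have := hB 0%N; rewrite expr0 mulr1; apply: le_trans; exact: sumr_ge0.
have u0 i : 0 < u i by exact: lt_le_trans (u1 i).
pose S := \sum_(i <- r | P i) u i.
have [T hT] : exists T : nat, S <= 2 ^+ T.
  exists (Num.truncn S).+1; apply/ltW; apply: (lt_trans (truncnS_gt S)).
  by rewrite -natrX ltr_nat ltn_expl.
have layer i : u i <= 2 ^+ T -> u i ^- 3 <= \sum_(t < T.+1 | u i <= 2 ^+ t) 8 * 8 ^- t.
  move=> uT; have ex : exists t, u i <= 2 ^+ t by exists T.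
  pose t0 := ex_minn ex; have [ut tmin] : u i <= 2 ^+ t0 /\ forall t, u i <= 2 ^+ t -> (t0 <= t)%N.
    by rewrite /t0; case: ex_minnP.
  have t0T : (t0 < T.+1)%N by rewrite ltnS; exact: tmin.
  rewrite (bigD1 (Ordinal t0T))//=; apply: ler_wpDr.
    by apply: sumr_ge0 => t _; rewrite mulr_ge0// invr_ge0 exprn_ge0.
  have low : 2 ^+ t0 / 2 <= u i.
    case: (posnP t0) => [->|t0p]; first by rewrite expr0 mul1r (le_trans _ (u1 i))// invf_le1// ler1n.
    rewrite leNgt; apply/negP => lt.
    have : (t0 <= t0.-1)%N.
      apply: tmin; move: lt; rewrite -{1}(prednK t0p) exprS mulrC mulKf//; exact: ltW.
    by rewrite leqNgt prednK// leqnn.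
  rewrite -[leRHS]invrK lef_pV2 ?posrE ?invr_gt0 ?mulr_gt0 ?invr_gt0 ?exprn_gt0//.
  apply: (@le_trans _ _ ((2 ^+ t0 / 2) ^+ 3)); last by rewrite lerXn2r ?nnegrE ?divr_ge0 ?exprn_ge0// ltW.
  apply: eq_ler; rewrite invfM invrK exprMn exprVn -exprM mulnC exprM.
  have -> : (2 ^+ 3 : R) = 8 by ring.
  by rewrite mulrC.
apply: (@le_trans _ _ (\sum_(i <- r | P i) \sum_(t < T.+1 | u i <= 2 ^+ t) 8 * 8 ^- t)).
  move: hT; rewrite {}/S; elim: r {hB} => [|i r IH]; first by rewrite !big_nil.
  rewrite !big_cons; case: (P i) => // hT.
  have s0 : 0 <= \sum_(j <- r | P j) u j by apply: sumr_ge0 => j _; exact: ltW.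
  apply: lerD; first by apply: layer; apply: le_trans hT; rewrite lerDl.
  by apply: IH; apply: le_trans hT; rewrite lerDr ltW.
rewrite (exchange_big_dep xpredT)//=.
apply: (@le_trans _ _ (\sum_(t < T.+1) 8 * B * (2^-1) ^+ t)).
  apply: ler_sum => t _.
  rewrite (eq_bigr (fun=> 8 * 8 ^- t * 1)); last by move=> i _; rewrite mulr1.
  rewrite -mulr_sumr; apply: le_trans (ler_wpM2l _ (hB t)) _.
    by rewrite mulr_ge0// invr_ge0 exprn_ge0.
  apply: eq_ler; rewrite exprVn.
  have -> : (8 ^+ t : R) = 4 ^+ t * 2 ^+ t by rewrite -exprMn; congr (_ ^+ _); ring.
  by field; rewrite !expf_neq0// ?pnatr_eq0.
rewrite -mulr_sumr; apply: le_trans (ler_wpM2l _ (geo_sum_le T.+1 _ _)) _.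
- by rewrite mulr_ge0.
- by rewrite invr_ge0.
- by rewrite invf_lt1// ltr1n.
by apply: eq_ler; field.
Qed.

Lemma level_fixpoint (Psi : (nat -> nat -> bool) -> nat -> nat -> bool) :
  (forall k1 k2 l, (forall l', (l' < l)%N -> k1 l' = k2 l') -> Psi k1 l = Psi k2 l) ->
  exists keep, forall l, keep l = Psi keep l.
Proof.
move=> loc; pose F n := iter n Psi (fun _ _ => true).
have stab n m l : (l < n)%N -> (l < m)%N -> F n l = F m l.
  elim: n m l => // n IH [|m] l // ln lm; apply: loc => l' ll'.
  by apply: IH; [exact: leq_trans ll' ln|exact: leq_trans ll' lm].
exists (fun l => F l.+1 l) => l; apply: loc => l' ll'.
exact: stab.
Qed.

Variables (N : nat) (J : seq nat).
Hypotheses (uJ : uniq J) (sJ : (size J <= 2 ^ N)%N).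

Definition pt l m : R := 2 ^- l * (m%:R + 2^-1).
Definition dist l m y : R := jap (2 ^+ (l + N) * (y - pt l m)).

Lemma level_sum l l' m' : (l' < l)%N ->
  \sum_(m < 2 ^ l) dist l' m' (pt l m) ^- 2 <= 2 * (2 ^+ l / 2 ^+ (l' + N)).
Proof.
move=> ll'.
have a0 : 0 < 2 ^+ (l' + N) / 2 ^+ l :> R by rewrite divr_gt0 ?pow2_gt0.
pose c := (2 ^ (l - l') * m' + 2 ^ (l - l').-1)%N.
have := half_integer_sum c (2 ^ l) a0; rewrite invf_div => h.
apply: le_trans h; apply: eq_ler; apply: eq_bigr => m _; rewrite /dist; congr (jap _ ^- 2).
rewrite /pt /c natrD natrM !natrX.
have d0 : (0 < l - l')%N by rewrite subn_gt0.
have e : (2 ^+ l : R) = 2 * 2 ^+ (l - l').-1 * 2 ^+ l'.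
  by rewrite -exprS prednK// -exprD subnK// ltnW.
have -> : (2 ^+ (l - l') : R) = 2 * 2 ^+ (l - l').-1 by rewrite -exprS prednK.
by rewrite exprD e; field; rewrite !pow2_neq0.
Qed.

(* A point is kept when the kept points of coarser levels weigh at most 4 at it. At most 2 ^ N levels
   make the average weight at most 2, so that half of the points of each level survive. *)
Lemma pruning : exists keep : nat -> nat -> bool,
  (forall l, 2 ^+ l / 2 <= \sum_(m < 2 ^ l | keep l m) (1 : R)) /\
  (forall l m, keep l m ->
     \sum_(l' <- J | (l' < l)%N) \sum_(m' < 2 ^ l' | keep l' m') dist l' m' (pt l m) ^- 2 <= 4).
Proof.
pose Phi (k : nat -> nat -> bool) l m : R :=
  \sum_(l' <- J | (l' < l)%N) \sum_(m' < 2 ^ l' | k l' m') dist l' m' (pt l m) ^- 2.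
have [|keep hk] := @level_fixpoint (fun k l m => Phi k l m <= 4).
  move=> k1 k2 l e; apply/funext => m; congr (_ <= _); apply: eq_bigr => l' ll'.
  by apply: eq_bigl => m'; rewrite e.
exists keep; split; last by move=> l m; rewrite hk.
move=> l.
have tot : \sum_(m < 2 ^ l) Phi keep l m <= 2 * 2 ^+ l.
  rewrite /Phi exchange_big/=.
  apply: (@le_trans _ _ (\sum_(l' <- J | (l' < l)%N) 2 * (2 ^+ l / 2 ^+ N))).
    apply: ler_sum => l' ll'; rewrite exchange_big/=.
    apply: (@le_trans _ _ (\sum_(m' < 2 ^ l') 2 * (2 ^+ l / 2 ^+ (l' + N)))); last first.
      rewrite sumr_const card_ord -[_ *+ (2 ^ _)]mulr_natr natrX exprD; apply: eq_ler.
      by field; rewrite !pow2_neq0.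
    rewrite big_mkcond/=; apply: ler_sum => m' _; case: ifP => _; first exact: level_sum.
    by rewrite mulr_ge0// divr_ge0 ?pow2_ge0.
  rewrite big_const_seq iter_addr addr0 -[_ *+ count _ _]mulr_natr.
  apply: (@le_trans _ _ (2 * (2 ^+ l / 2 ^+ N) * 2 ^+ N)).
    rewrite ler_wpM2l ?mulr_ge0 ?invr_ge0 ?pow2_ge0// -natrX ler_nat (leq_trans _ sJ)//.
    exact: count_size.
  by apply: eq_ler; field; rewrite pow2_neq0.
have : \sum_(m < 2 ^ l) (1 : R) = 2 ^+ l by rewrite sumr_const card_ord natrX.
rewrite (bigID (fun m : 'I__ => keep l m))/= => e1.
have bad : \sum_(m < 2 ^ l | ~~ keep l m) (1 : R) <= 2 ^+ l / 2.
  rewrite ler_pdivlMr// -(ler_pM2l (_ : 0 < 2 :> R))//; apply: le_trans tot.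
  rewrite mulrCA mulr_suml; apply: (@le_trans _ _ (\sum_(m < 2 ^ l | ~~ keep l m) Phi keep l m)).
    apply: ler_sum => m; rewrite hk -ltNge => h.
    by rewrite mul1r (le_trans _ (ltW h))//; lra.
  rewrite [leRHS](bigID (fun m : 'I__ => keep l m))/= lerDr; apply: sumr_ge0 => m _.
  by apply: sumr_ge0 => l' _; apply: sumr_ge0 => m' _; exact: japX_ge0.
by move: e1 bad; lra.
Qed.

Variable keep : nat -> nat -> bool.
Hypothesis hkeep : forall l m, keep l m ->
  \sum_(l' <- J | (l' < l)%N) \sum_(m' < 2 ^ l' | keep l' m') dist l' m' (pt l m) ^- 2 <= 4.

(* Among the counted points choose one of the finest level: the pruning condition there bounds the
   number of coarser ones. *)
Let count_le y t :
  \sum_(l <- J) \sum_(m < 2 ^ l | keep l m && (dist l m y <= 2 ^+ t)) (1 : R) <= 20 * 4 ^+ t.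
Proof.
have f0 : 0 <= 4 ^+ t :> R by exact: exprn_ge0.
pose Q l := (l \in J) && [exists m : 'I_(2 ^ l), keep l m && (dist l m y <= 2 ^+ t)].
have [[l0 Ql0]|nQ] := pselect (exists l, Q l); last first.
  rewrite big_seq big1 ?mulr_ge0// => l lJ; rewrite big1// => m hm.
  by exfalso; apply: nQ; exists l; rewrite /Q lJ; apply/existsP; exists m.
have bd l : Q l -> (l <= \max_(j <- J) j)%N.
  by move=> /andP[lJ _]; rewrite -(big_map id xpredT id) map_id (big_rem l)//= leq_maxl.
have [L /andP[LJ /existsP[mu0 /andP[kL dL]]] maxL] := ex_maxnP (ex_intro _ l0 Ql0) bd.
pose yL := pt L mu0.
pose cl l : R := \sum_(m < 2 ^ l | keep l m && (dist l m y <= 2 ^+ t)) 1.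
have lowl l : (l < L)%N -> cl l <= 4 * 4 ^+ t * \sum_(m < 2 ^ l | keep l m) dist l m yL ^- 2.
  move=> lL; rewrite /cl mulr_sumr big_mkcondr/=; apply: ler_sum => m km.
  case: ifP => [dm|_]; last by rewrite !mulr_ge0// japX_ge0.
  have b : dist l m yL <= 2 * 2 ^+ t.
    rewrite /dist /jap in dm dL *.
    have : `|2 ^+ (l + N) * (yL - pt l m)| <= `|2 ^+ (l + N) * (y - pt l m)| + `|2 ^+ (L + N) * (y - yL)|.
      have -> : 2 ^+ (l + N) * (yL - pt l m) = 2 ^+ (l + N) * (y - pt l m) - 2 ^+ (l + N) * (y - yL) by ring.
      apply: le_trans (ler_normB _ _) _; rewrite lerD2l !normrM ler_wpM2r//.
      by rewrite !ger0_norm ?pow2_ge0// ler_eXn2l ?ltr1n// leq_add2r ltnW.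
    by move: dm dL; rewrite -/yL; lra.
  have d0 : 0 < dist l m yL ^+ 2 by rewrite exprn_gt0// jap_gt0.
  rewrite ler_pdivlMr// mul1r.
  apply: le_trans (_ : (2 * 2 ^+ t) ^+ 2 <= _).
    by rewrite lerXn2r ?nnegrE ?jap_ge0// mulr_ge0// pow2_ge0.
  apply: eq_ler; rewrite exprMn -exprM mulnC exprM.
  by congr (_ * _ ^+ _); ring.
have topl : cl L <= 4 * 4 ^+ t.
  apply: (@le_trans _ _ (4 ^+ t * \sum_(m < 2 ^ L) jap ((2 ^+ L * y - 2^-1) - m%:R) ^- 2)); last first.
    by rewrite mulrC ler_wpM2r// integer_sum.
  rewrite /cl mulr_sumr big_mkcond/=; apply: ler_sum => m _.
  case: ifP => [/andP[_ dm]|_]; last by rewrite mulr_ge0// japX_ge0.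
  rewrite ler_pdivlMr ?exprn_gt0 ?jap_gt0// mul1r.
  apply: le_trans (_ : (2 ^+ t) ^+ 2 <= _); last first.
    by apply: eq_ler; rewrite -exprM mulnC exprM; congr (_ ^+ _); ring.
  rewrite lerXn2r ?nnegrE ?jap_ge0 ?pow2_ge0//; apply: le_trans dm.
  have -> : 2 ^+ L * y - 2^-1 - m%:R = 2 ^+ L * (y - pt L m).
    by rewrite /pt; field; rewrite pow2_neq0.
  by rewrite /dist addnC exprD -mulrA; apply: jap_scale_ge; exact: pow2_ge1.
rewrite (bigID (fun l => (l < L)%N))/=.
have -> : 20 * 4 ^+ t = 16 * 4 ^+ t + 4 * 4 ^+ t :> R by ring.
apply: lerD.
  apply: (@le_trans _ _ (\sum_(l <- J | (l < L)%N) 4 * 4 ^+ t * \sum_(m < 2 ^ l | keep l m) dist l m yL ^- 2)).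
    by apply: ler_sum => l; exact: lowl.
  rewrite -mulr_sumr; apply: le_trans (ler_wpM2l _ (hkeep kL)) _; first by rewrite mulr_ge0.
  by apply: eq_ler; ring.
rewrite big_mkcond (bigD1_seq L)//= ltnn/= [X in _ + X]big_seq_cond [X in _ + X]big1 ?addr0// => l /andP[lJ lnL].
case: ifP => // lL; rewrite big1// => m hm; exfalso.
have Ql : Q l by rewrite /Q lJ; apply/existsP; exists m.
by move: lL; rewrite ltn_neqAle lnL (maxL _ Ql).
Qed.

Definition Koverlap : R := 16 * 20.

Lemma Koverlap_ge0 : 0 <= Koverlap. Proof. exact: mulr_ge0. Qed.

Lemma overlap_le y : \sum_(l <- J) \sum_(m < 2 ^ l | keep l m) dist l m y ^- 3 <= Koverlap.
Proof.
pose r : seq (nat * nat) := [seq (l, m) | l <- J, m <- index_iota 0 (2 ^ l)].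
have conv (P : nat -> nat -> bool) (F : nat -> nat -> R) :
    \sum_(l <- J) \sum_(m < 2 ^ l | P l m) F l m = \sum_(i <- r | P i.1 i.2) F i.1 i.2.
  rewrite [RHS]big_mkcond big_allpairs_dep/=; apply: eq_bigr => l _.
  by rewrite big_mkord -big_mkcond.
rewrite (conv keep (fun l m => dist l m y ^- 3)).
apply: dyadic_layer => [i|t]; first exact: jap_ge1.
rewrite -(conv (fun l m => keep l m && (dist l m y <= 2 ^+ t)) (fun _ _ => 1)).
exact: count_le.
Qed.

End pruning.

(** * The two test functions *)

Section test_function_norms.
Context {R : realType}.
Local Notation mu := (@lebesgue_measure R).

Lemma sum_powR_le (a : nat -> R) (K : nat) (B S Q : R) : 1 <= Q ->
  (forall k, 0 <= a k) -> (forall k : 'I_K, a k <= B) -> \sum_(k < K) a k <= S ->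
  \sum_(k < K) a k `^ Q <= B `^ (Q - 1) * S.
Proof.
move=> Q1 a0 aB aS; apply: le_trans (ler_wpM2l (powR_ge0 _ _) aS).
rewrite mulr_sumr; apply: ler_sum => k _.
have <- : a k `^ (Q - 1) * a k = a k `^ Q.
  by rewrite -{2}(powRr1 (a0 k)) -powRD ?subrK// gt_eqF//; lra.
by rewrite ler_wpM2r// ler_powRl// subr_ge0.
Qed.

Lemma sum_powR_le1 (a : nat -> R) (K : nat) (S Q : R) : 1 <= Q -> 0 <= S ->
  (forall k, 0 <= a k) -> \sum_(k < K) a k <= S -> \sum_(k < K) a k `^ Q <= S `^ Q.
Proof.
move=> Q1 S0 a0 aS; apply: le_trans (sum_powR_le Q1 a0 (B := S) _ aS) _.
  move=> k; apply: le_trans aS; rewrite (bigD1 k)//= lerDl; exact: sumr_ge0.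
rewrite -{2}(powRr1 S0) -powRD ?subrK//; apply/implyP; rewrite gt_eqF//; lra.
Qed.

Lemma two_sided_geo (rho : R) (m K : nat) : 0 <= rho -> rho < 1 ->
  \sum_(k < K) rho ^+ ((m - k) + (k - m)) <= 2 / (1 - rho).
Proof.
move=> r0 r1.
apply: (@le_trans _ _ (\sum_(k < m + K) rho ^+ ((m - k) + (k - m)))).
  rewrite -!(big_mkord xpredT (fun k => rho ^+ ((m - k) + (k - m)))).
  rewrite [leRHS](big_cat_nat (n := K))//= ?leq_addl// lerDl.
  by apply: sumr_ge0 => k _; exact: exprn_ge0.
rewrite big_split_ord/= mulrDl mul1r; apply: lerD.
  apply: le_trans (geo_sum_le m r0 r1); rewrite (reindex_inj rev_ord_inj)/=.
  apply: ler_sum => k _; rewrite subKn ?ltn_ord// (eqP (_ : (m - k.+1 - m)%N == 0%N)) ?addn0.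
    by rewrite exprS ler_piMl ?exprn_ge0// ltW.
  by rewrite subn_eq0 leq_subr.
apply: le_trans (geo_sum_le K r0 r1); apply: ler_sum => k _.
by rewrite addKn (eqP (_ : (m - (m + k))%N == 0%N)) ?add0n// subn_eq0 leq_addr.
Qed.

Lemma uniq_sum_le (J : seq nat) (M : nat) (F : nat -> R) : uniq J ->
  (forall j, j \in J -> (j < M)%N) -> (forall j, 0 <= F j) ->
  \sum_(j <- J) F j <= \sum_(j < M) F j.
Proof.
move=> uJ JM F0; rewrite -(big_mkord xpredT F).
have e : perm_eq J [seq j <- index_iota 0 M | j \in J].
  apply: uniq_perm => //; first by rewrite filter_uniq// iota_uniq.
  move=> j; rewrite mem_filter mem_index_iota /=.
  by case: (boolP (j \in J)) => // /JM ->.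
rewrite (perm_big _ e) big_filter [leLHS]big_mkcond; apply: ler_sum => j _.
by case: ifP.
Qed.

Variable sigma : R.
Hypothesis sig : 0 < sigma < 1.
Let s0 : 0 < sigma. Proof. by case/andP: sig. Qed.
Let s1 : sigma < 1. Proof. by case/andP: sig. Qed.

Definition decay : R := 2 `^ (- Num.min sigma (1 - sigma)).
Definition Kdecay : R := 2 / (1 - decay).

Lemma decay_ge0 : 0 <= decay. Proof. exact: powR_ge0. Qed.
Lemma decay_lt1 : decay < 1.
Proof.
rewrite /decay powRN invf_lt1 ?powR_gt0// two_powR_gt1// lt_min s0/= subr_gt0//.
Qed.
Lemma Kdecay_ge0 : 0 <= Kdecay.
Proof. by rewrite divr_ge0// subr_ge0 ltW// decay_lt1. Qed.

Lemma decayX (d : nat) (t : R) : Num.min sigma (1 - sigma) <= t -> 2 `^ (- (d%:R * t)) <= decay ^+ d.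
Proof.
move=> dt; rewrite -powR_mulrn ?decay_ge0// /decay -powRrM; apply: ler_powR; first by rewrite ler1n.
by rewrite mulNr lerN2 mulrC ler_wpM2l.
Qed.

Lemma bump_weight (k m : nat) :
  2 `^ (- (k%:R * sigma)) * 2 `^ (m%:R * sigma) * 2 ^- (m - k) <= decay ^+ ((m - k) + (k - m)).
Proof.
rewrite -powRD ?pnatr_eq0 ?implybT//.
have -> : (2 ^- (m - k) : R) = 2 `^ (- (m - k)%:R) by rewrite powRN powR_mulrn.
rewrite -powRD ?pnatr_eq0 ?implybT//.
have [km|/ltnW mk] := leqP k m.
  rewrite (eqP (_ : (k - m)%N == 0%N)) ?subn_eq0// addn0.
  apply: le_trans (@decayX (m - k) (1 - sigma) _); last by rewrite ge_min lexx orbT.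
  by apply: eq_ler; congr (2 `^ _); rewrite natrB//; ring.
rewrite (eqP (_ : (m - k)%N == 0%N)) ?subn_eq0// add0n.
apply: le_trans (@decayX (k - m) sigma _); last by rewrite ge_min lexx.
by apply: eq_ler; congr (2 `^ _); rewrite natrB//; ring.
Qed.

Lemma wave_weight (k j : nat) :
  2 `^ (k%:R * sigma) * 2 `^ (- (j%:R * sigma)) * 2 ^- ((j - k) + (k - j)) <= decay ^+ ((j - k) + (k - j)).
Proof.
rewrite -powRD ?pnatr_eq0 ?implybT//.
have -> (d : nat) : (2 ^- d : R) = 2 `^ (- d%:R) by rewrite powRN powR_mulrn.
rewrite -powRD ?pnatr_eq0 ?implybT//.
have [kj|/ltnW jk] := leqP k j.
  rewrite (eqP (_ : (k - j)%N == 0%N)) ?subn_eq0// addn0.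
  apply: le_trans (@decayX (j - k) sigma _); last by rewrite ge_min lexx.
  apply: ler_powR; first by rewrite ler1n.
  have : (0 : R) <= (j - k)%:R by []. rewrite natrB//; nra.
rewrite (eqP (_ : (j - k)%N == 0%N)) ?subn_eq0// add0n.
apply: le_trans (@decayX (k - j) (1 - sigma) _); last by rewrite ge_min lexx orbT.
by apply: eq_ler; congr (2 `^ _); rewrite natrB//; ring.
Qed.

Variables (N : nat) (J : seq nat) (keep : nat -> nat -> bool).
Hypothesis uJ : uniq J.
Hypothesis hkeep : forall l m, keep l m ->
  \sum_(l' <- J | (l' < l)%N) \sum_(m' < 2 ^ l' | keep l' m') dist N l' m' (pt l m : R) ^- 2 <= 4.

Definition bump_layer (l : nat) (x : R) : R := \sum_(m < 2 ^ l | keep l m) bump (l + N) (pt l m) x.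
Definition bump_test (x : R) : R := \sum_(l <- J) 2 `^ ((l + N)%:R * sigma) * bump_layer l x.
Definition wave_test (x : R) : R := \sum_(j <- J) 2 `^ (- (j%:R * sigma)) * wave j x.

Lemma nice_bump_layer l : nice (bump_layer l).
Proof. by apply: nice_sum => m; exact: nice_bump. Qed.

Lemma nice_bump_test : nice bump_test.
Proof. by apply: nice_sum => l; apply: niceZ; exact: nice_bump_layer. Qed.

Lemma nice_wave_test : nice wave_test.
Proof. by apply: nice_sum => j; apply: niceZ; exact: nice_wave. Qed.

Variables (a b : R -> R[i]) (C : R).
Hypotheses (ka : ckernel C a) (kb : ckernel C b).
Let C0 : 0 <= C := ckernel_ge0 ka.

Lemma pt_jap l (m : 'I_(2 ^ l)) (x : R) : jap (x - pt l m) ^- 2 <= 4 * jap x ^- 2.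
Proof.
have h : jap x <= 2 * jap (x - pt l m).
  apply: le_trans (japB x (pt l m)) _; rewrite ler_wpM2r ?jap_ge0//.
  have m0 : 0 <= pt l m :> R by rewrite mulr_ge0 ?ipow2_ge0// addr_ge0.
  rewrite /jap ger0_norm// -[leRHS]/(1 + 1) lerD2l /pt mulrC ler_pdivrMr ?pow2_gt0// mul1r.
  apply: (@le_trans _ _ (m.+1%:R)); first by rewrite -[X in _ <= X]natr1 lerD2l; lra.
  by rewrite -natrX ler_nat ltn_ord.
rewrite ler_pdivlMr ?exprn_gt0 ?jap_gt0// mulrC ler_pdivrMr ?exprn_gt0 ?jap_gt0//.
apply: le_trans (_ : (2 * jap (x - pt l m)) ^+ 2 <= _).
  by rewrite lerXn2r ?nnegrE ?mulr_ge0 ?jap_ge0.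
by rewrite exprMn; apply: eq_ler; congr (_ * _); ring.
Qed.

Lemma cconv_bump_layer_le k l x : cmod (cconv (TL_kernel a b k) (bump_layer l) x) <=
  8 * Kbump * C * jap x ^- 2 * (2 ^- (l + N - k) * \sum_(m < 2 ^ l | keep l m) dist N l m x ^- 3).
Proof.
have Kb := @Kbump_gt0 R.
rewrite /bump_layer; under [X in cconv _ X]eq_fun do rewrite -big_filter.
rewrite (cconv_sum _ _ _ ka kb); last by move=> m; exact: nice_bump.
apply: le_trans (cmod_sum _ _ _) _; rewrite big_filter !mulr_sumr; apply: ler_sum => m _.
apply: le_trans (cconv_bump_le k (l + N) (pt l m) x ka kb) _.
apply: (@le_trans _ _ (2 * Kbump * C * 2 ^- (l + N - k) * (dist N l m x ^- 3 * (4 * jap x ^- 2)))).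
  rewrite ler_wpM2l ?mulr_ge0 ?ipow2_ge0 ?(ltW Kb)//.
  by rewrite ler_wpM2l ?japX_ge0// pt_jap.
by apply: eq_ler; ring.
Qed.

Lemma bump_test_bound (Q : R) : 1 <= Q -> forall K x,
  \sum_(k < K) (2 `^ (- (k%:R * sigma)) * cmod (cconv (TL_kernel a b k) bump_test x)) `^ Q <=
  (8 * Kbump * C * Kdecay * Koverlap * jap x ^- 2) `^ Q.
Proof.
move=> Q1 K x; have Kb := ltW (@Kbump_gt0 R); have Kd := Kdecay_ge0; have Ko := @Koverlap_ge0 R.
pose w l : R := \sum_(m < 2 ^ l | keep l m) dist N l m x ^- 3.
have w0 l : 0 <= w l by apply: sumr_ge0 => m _; exact: japX_ge0.
pose M0 := 8 * Kbump * C * jap x ^- 2.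
have M00 : 0 <= M0 by rewrite !mulr_ge0 ?japX_ge0.
pose A k := M0 * \sum_(l <- J) decay ^+ ((l + N - k) + (k - (l + N))) * w l.
have A0 k : 0 <= A k.
  by rewrite mulr_ge0//; apply: sumr_ge0 => l _; rewrite mulr_ge0// exprn_ge0 ?decay_ge0.
have tA k : 2 `^ (- (k%:R * sigma)) * cmod (cconv (TL_kernel a b k) bump_test x) <= A k.
  rewrite /bump_test (cconv_sum _ _ _ ka kb); last by move=> l; apply: niceZ; exact: nice_bump_layer.
  apply: le_trans (ler_wpM2l (powR_ge0 _ _) (cmod_sum _ _ _)) _.
  rewrite /A !mulr_sumr; apply: ler_sum => l _.
  rewrite (cconvZ _ _ _ ka kb); last exact: nice_bump_layer.
  rewrite cmodM cmodR ger0_norm ?powR_ge0// [leLHS]mulrA.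
  apply: le_trans (ler_wpM2l _ (cconv_bump_layer_le k l x)) _; first by rewrite mulr_ge0 ?powR_ge0.
  rewrite -/(w l) -/M0 mulrCA ler_wpM2l// mulrA ler_wpM2r//.
  exact: bump_weight.
apply: (@le_trans _ _ (\sum_(k < K) A k `^ Q)).
  apply: ler_sum => k _; apply: ler_powRl => //; first by lra.
  by rewrite mulr_ge0 ?powR_ge0 ?cmod_ge0.
have S0 : 0 <= 8 * Kbump * C * Kdecay * Koverlap * jap x ^- 2.
  by apply: mulr_ge0; [do 4!apply: mulr_ge0 => //|exact: japX_ge0].
apply: sum_powR_le1 => //.
rewrite /A -mulr_sumr.
have -> : 8 * Kbump * C * Kdecay * Koverlap * jap x ^- 2 = M0 * (Kdecay * Koverlap) by rewrite /M0; ring.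
rewrite ler_wpM2l// exchange_big/=.
apply: (@le_trans _ _ (\sum_(l <- J) Kdecay * w l)).
  apply: ler_sum => l _; rewrite -mulr_suml ler_wpM2r//.
  by apply: two_sided_geo; [exact: decay_ge0|exact: decay_lt1].
by rewrite -mulr_sumr ler_wpM2l//; exact: overlap_le.
Qed.

Lemma wave_test_bound (Q : R) : 1 <= Q -> cintegral b = 0 -> forall K x,
  \sum_(k < K) (2 `^ (k%:R * sigma) * cmod (cconv (TL_kernel a b k) wave_test x)) `^ Q <=
  (2 * Kwave * C * Kdecay * (size J)%:R `^ Q^-1 * jap x ^- 2) `^ Q.
Proof.
move=> Q1 b0 K x; have Kw := ltW (@Kwave_gt0 R); have Kd := Kdecay_ge0.
pose M0 := 2 * Kwave * C * jap x ^- 2.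
have M00 : 0 <= M0 by rewrite !mulr_ge0 ?japX_ge0.
pose A k := M0 * \sum_(j <- J) decay ^+ ((j - k) + (k - j)).
have A0 k : 0 <= A k.
  by rewrite mulr_ge0//; apply: sumr_ge0 => l _; rewrite exprn_ge0 ?decay_ge0.
have tA k : 2 `^ (k%:R * sigma) * cmod (cconv (TL_kernel a b k) wave_test x) <= A k.
  rewrite /wave_test (cconv_sum _ _ _ ka kb); last by move=> l; apply: niceZ; exact: nice_wave.
  apply: le_trans (ler_wpM2l (powR_ge0 _ _) (cmod_sum _ _ _)) _.
  rewrite /A !mulr_sumr; apply: ler_sum => j _.
  rewrite (cconvZ _ _ _ ka kb); last exact: nice_wave.
  rewrite cmodM cmodR ger0_norm ?powR_ge0// mulrA.
  apply: le_trans (ler_wpM2l _ (cconv_wave_le x ka kb (or_intror b0))) _; first by rewrite mulr_ge0 ?powR_ge0.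
  have -> : 2 `^ (k%:R * sigma) * 2 `^ (- (j%:R * sigma)) *
    (2 * Kwave * C / 2 ^+ (j - k + (k - j)) / jap x ^+ 2) = M0 *
    (2 `^ (k%:R * sigma) * 2 `^ (- (j%:R * sigma)) * 2 ^- (j - k + (k - j))) by rewrite /M0; ring.
  by rewrite ler_wpM2l// wave_weight.
apply: (@le_trans _ _ (\sum_(k < K) A k `^ Q)).
  apply: ler_sum => k _; apply: ler_powRl => //; first by lra.
  by rewrite mulr_ge0 ?powR_ge0 ?cmod_ge0.
apply: le_trans (sum_powR_le (B := M0 * Kdecay) (S := M0 * Kdecay * (size J)%:R) Q1 A0 _ _) _.
- move=> k; rewrite /A ler_wpM2l//.
  pose Mx := (\max_(j <- J) j).+1.
  have JM j : j \in J -> (j < Mx)%N.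
    by move=> jJ; rewrite /Mx ltnS -(big_map id xpredT id) map_id (big_rem j)//= leq_maxl.
  apply: le_trans (uniq_sum_le (F := fun j => decay ^+ ((j - k) + (k - j))) uJ JM _) _.
    by move=> j; rewrite exprn_ge0 ?decay_ge0.
  under eq_bigr do rewrite addnC.
  by apply: two_sided_geo; [exact: decay_ge0|exact: decay_lt1].
- rewrite /A -mulr_sumr -mulrA ler_wpM2l// exchange_big/=.
  apply: (@le_trans _ _ (\sum_(j <- J) Kdecay)).
    by apply: ler_sum => j _; apply: two_sided_geo; [exact: decay_ge0|exact: decay_lt1].
  by rewrite big_const_seq iter_addr addr0 count_predT mulr_natr.
have B0 : 0 <= M0 * Kdecay by rewrite mulr_ge0.
have Q0 : Q != 0 by rewrite gt_eqF//; lra.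
have -> : 2 * Kwave * C * Kdecay * (size J)%:R `^ Q^-1 * jap x ^- 2 =
   (M0 * Kdecay) * (size J)%:R `^ Q^-1 by rewrite /M0; ring.
rewrite [leRHS]powRM ?powR_ge0// (powRKV Q0)// mulrA ler_wpM2r//.
rewrite -{2}(powRr1 B0) -powRD ?subrK//; apply/implyP; rewrite gt_eqF//; lra.
Qed.

End test_function_norms.

Section haar_pairings.
Context {R : realType}.
Local Notation mu := (@lebesgue_measure R).
Implicit Types (x : R) (i j l m n N : nat).

Lemma haarE i n x : haar i n x =
  ind (2 ^- i * n%:R) (pt i n) x - ind (pt i n) (2 ^- i * (n%:R + 1)) x.
Proof. by []. Qed.

Lemma indD (a b c x : R) : a <= b -> b <= c -> ind a b x + ind b c x = ind a c x.
Proof.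
move=> ab bc; rewrite !indE.
case: (leP b x) => bx; rewrite ?andbF ?addr0.
  by rewrite (le_trans ab bx)/= add0r.
by rewrite (lt_le_trans bx bc) !andbT.
Qed.

Lemma ind_mul_sub (a b a' b' x : R) : a <= a' -> b' <= b -> ind a' b' x * ind a b x = ind a' b' x.
Proof.
move=> aa bb; rewrite !indE; case: (boolP (a' <= x < b')) => [/andP[h1 h2]|_]; last by rewrite mul0r.
by rewrite (le_trans aa h1) (lt_le_trans h2 bb) mul1r.
Qed.

Lemma ind_mul_disj (a b a' b' x : R) : b <= a' -> ind a b x * ind a' b' x = 0.
Proof.
move=> ba; rewrite !indE; case: (boolP (a <= x < b)) => [/andP[h1 h2]|_]; last by rewrite mul0r.
by rewrite leNgt (lt_le_trans h2 ba)/= mulr0.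
Qed.

Lemma pt_mem i n : (2 ^- i * n%:R <= pt i n :> R) /\ (pt i n <= 2 ^- i * (n%:R + 1) :> R).
Proof. by split; rewrite ler_wpM2l ?ipow2_ge0// ?lerDl// lerD2l; lra. Qed.

Lemma haar_abs i n x : `|haar i n x| <= ind (2 ^- i * n%:R) (2 ^- i * (n%:R + 1)) x.
Proof.
have [h1 h2] := pt_mem i n.
rewrite haarE -(indD x h1 h2); apply: le_trans (ler_normB _ _) _.
by rewrite !ger0_norm ?ind_ge0.
Qed.

Lemma dyadic_ind l m (A B : nat) x : 2 ^- l * m%:R <= x -> x < 2 ^- l * (m%:R + 1) ->
  ind (2 ^- l * A%:R) (2 ^- l * B%:R) x = ((A <= m < B)%N : nat)%:R.
Proof.
move=> xl xr; rewrite indE; congr (_%:R); congr (nat_of_bool (_ && _)).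
  apply/idP/idP => [h|Am]; last by apply: le_trans xl; rewrite ler_wpM2l ?ipow2_ge0// ler_nat.
  have := le_lt_trans h xr; rewrite ltr_pM2l ?ipow2_gt0// natr1 ltr_nat ltnS //.
apply/idP/idP => [h|mB]; last first.
  by apply: lt_le_trans xr _; rewrite ler_wpM2l ?ipow2_ge0// natr1 ler_nat.
by have := le_lt_trans xl h; rewrite ltr_pM2l ?ipow2_gt0// ltr_nat.
Qed.

Lemma bump_supp l m N x : bump (l + N) (pt l m) x != 0 ->
  2 ^- l * m%:R <= x /\ x < 2 ^- l * (m%:R + 1).
Proof.
move=> b0; have := bump_abs (l + N) (pt l m) x.
rewrite indE; case: (boolP (_ <= x < _)) => [/andP[h1 h2] _|_].
  have d : 2 ^- (l + N).+1 <= 2 ^- l * 2^-1 :> R.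
    rewrite exprS exprD !invfM mulrC ler_wpM2r ?invr_ge0// ler_piMr ?ipow2_ge0 ?ipow2_le1//.
  move: h1 h2; rewrite /pt !mulrDr mulr1; lra.
by rewrite mulr0 normr_le0 (negbTE b0).
Qed.

Lemma Int_bump m (c : R) : \int[mu]_x bump m c x = 0.
Proof.
have t0 : 0 <= 2 ^- m.+2 :> R by exact: ipow2_ge0.
have li := @Lint_ind R.
rewrite /bump IntD; [|apply: LintB; [apply: LintD; [exact: LintN|exact: LintZ]|exact: LintZ]|] => //.
rewrite IntB; [|apply: LintD; [exact: LintN|exact: LintZ]|exact: LintZ].
rewrite IntD; [|exact: LintN|exact: LintZ].
rewrite IntN// !IntZ// !Int_ind ?lerD2l ?lerN2 ?lerDl ?lerBlDr ?lerDl//; first (by ring);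
  by rewrite mulr2n ?lerDl// ?lerDr.
Qed.

Lemma Int_bump_haar_gt i l n m N : (i < l)%N ->
  \int[mu]_x (bump (l + N) (pt l m) x * haar i n x) = 0.
Proof.
move=> il.
pose c : R := ((2 ^ (l - i) * n <= m < 2 ^ (l - i) * n + 2 ^ (l - i).-1)%N : nat)%:R -
  ((2 ^ (l - i) * n + 2 ^ (l - i).-1 <= m < 2 ^ (l - i) * n + 2 ^ (l - i))%N : nat)%:R.
transitivity (\int[mu]_x (c * bump (l + N) (pt l m) x)); last by rewrite IntZ ?Int_bump ?mulr0//; exact: Lint_bump.
apply: eq_Rintegral => x _; have [->|/bump_supp[xl xr]] := eqVneq (bump (l + N) (pt l m) x) 0.
  by rewrite mul0r mulr0.
rewrite mulrC; congr (_ * _); rewrite haarE /c -!(dyadic_ind _ _ xl xr).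
have d0 : (0 < l - i)%N by rewrite subn_gt0.
have e : (2 ^+ l : R) = 2 * 2 ^+ (l - i).-1 * 2 ^+ i by rewrite -exprS prednK// -exprD subnK// ltnW.
have e2 : (2 ^+ (l - i) : R) = 2 * 2 ^+ (l - i).-1 by rewrite -exprS prednK.
by congr (ind _ _ x - ind _ _ x); rewrite /pt ?natrD ?natrM ?natrX e e2; field; rewrite !pow2_neq0.
Qed.

Lemma Int_bump_haar_eq l n m N :
  \int[mu]_x (bump (l + N) (pt l m) x * haar l n x) = if n == m then 2 ^- (l + N) else 0.
Proof.
case: eqP => [->|/eqP nm]; last first.
  rewrite -[RHS]Int0; apply: eq_Rintegral => x _.
  have [->|/bump_supp[xl xr]] := eqVneq (bump (l + N) (pt l m) x) 0; first by rewrite mul0r.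
  suff -> : haar l n x = 0 by rewrite mulr0.
  apply/eqP; rewrite -normr_le0; apply: le_trans (haar_abs l n x) _.
  rewrite natr1 (dyadic_ind _ _ xl xr) ltnS -eqn_leq (negbTE nm)//.
set c := pt l m; set t : R := 2 ^- (l + N).+2.
have t0 : 0 <= t by exact: ipow2_ge0.
have dt : t *+ 2 <= 2 ^- l * 2^-1.
  have -> : t *+ 2 = 2 ^- (l + N).+1 by rewrite /t mulr2n exprS; field; rewrite pow2_neq0.
  by rewrite exprS exprD !invfM mulrC ler_wpM2r ?invr_ge0// ler_piMr ?ipow2_ge0 ?ipow2_le1.
have e x : bump (l + N) c x * haar l m x =
    - ind (c - t *+ 2) (c - t) x + 3 * ind (c - t) c x +
    3 * ind c (c + t) x + (-1) * ind (c + t) (c + t *+ 2) x.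
  rewrite haarE /bump -/t -/c.
  have -> : 2 ^- l * m%:R = c - 2 ^- l * 2^-1 by rewrite /c /pt mulrDr addrK.
  have -> : 2 ^- l * (m%:R + 1) = c + 2 ^- l * 2^-1 by rewrite /c /pt -mulrDr; congr (_ * _); lra.
  set d := 2 ^- l * 2^-1; rewrite -/d in dt.
  have t2 : t <= t *+ 2 by rewrite mulr2n lerDl.
  have f1 := @ind_mul_sub (c - d) c (c - t *+ 2) (c - t) x.
  have f2 := @ind_mul_sub (c - d) c (c - t) c x.
  have f3 := @ind_mul_sub c (c + d) c (c + t) x.
  have f4 := @ind_mul_sub c (c + d) (c + t) (c + t *+ 2) x.
  have g1 := @ind_mul_disj (c - t *+ 2) (c - t) c (c + d) x.
  have g2 := @ind_mul_disj (c - t) c c (c + d) x.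
  have g3 := @ind_mul_disj (c - d) c c (c + t) x.
  have g4 := @ind_mul_disj (c - d) c (c + t) (c + t *+ 2) x.
  move: f1 f2 f3 f4 g1 g2 g3 g4.
  move: (ind (c - t *+ 2) (c - t) x) (ind (c - t) c x) (ind c (c + t) x)
    (ind (c + t) (c + t *+ 2) x) (ind (c - d) c x) (ind c (c + d) x) => I1 I2 I3 I4 H1 H2 f1 f2 f3 f4 g1 g2 g3 g4.
  transitivity (- (I1 * H1) + 3 * (I2 * H1) + 3 * (I3 * H2) - I4 * H2 +
    (I1 * H2 - 3 * (I2 * H2) - 3 * (H1 * I3) + H1 * I4)); first by ring.
  have [h1 h2 h3 h4] : [/\ c - d <= c - t *+ 2, c - t <= c, c - d <= c - t & c <= c] by split; lra.
  have [h5 h6 h7 h8] : [/\ c + t <= c + d, c <= c + t, c + t *+ 2 <= c + d & c - t <= c + t] by split; lra.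
  by rewrite f1// f2// f3// f4// g1// g2// g3// g4// !mulr0 !subr0 !addr0 mulN1r.
have li := @Lint_ind R.
under eq_Rintegral do rewrite e.
rewrite IntD; [|apply: LintD; [apply: LintD; [exact: LintN|exact: LintZ]|exact: LintZ]|exact: LintZ].
rewrite IntD; [|apply: LintD; [exact: LintN|exact: LintZ]|exact: LintZ].
rewrite IntD; [|exact: LintN|exact: LintZ].
have t2 : t <= t *+ 2 by rewrite mulr2n lerDl.
rewrite IntN// !IntZ// !Int_ind; [|lra|lra|lra|lra].
have -> : 2 ^- (l + N) = 4 * t by rewrite /t !exprS; field; rewrite pow2_neq0.
by ring.
Qed.

Lemma haar_sum_abs i (M : nat) x : \sum_(n < M) `|haar i n x| <= 1.
Proof.
apply: le_trans (_ : ind (2 ^- i * 0) (2 ^- i * M%:R) x <= _); last exact: ind_le1.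
elim: M => [|M IH]; first by rewrite big_ord0 ind_ge0.
rewrite big_ord_recr/=.
have h1 : 2 ^- i * 0 <= 2 ^- i * M%:R :> R by rewrite ler_wpM2l ?ipow2_ge0.
have h2 : 2 ^- i * M%:R <= 2 ^- i * (M%:R + 1) :> R by rewrite ler_wpM2l ?ipow2_ge0// lerDl.
have -> : M.+1%:R = M%:R + 1 :> R by rewrite -[LHS]natr1.
by rewrite -(indD x h1 h2) lerD// haar_abs.
Qed.

Lemma sum_Int_haar_le i (M : nat) (f : R -> R) : nice f ->
  \sum_(n < M) `|\int[mu]_x (f x * haar i n x)| <= \int[mu]_x `|f x|.
Proof.
move=> nf; have lf := nice_Lint0 nf.
have ln n : Lint (fun x => `|f x * haar i n x|).
  by apply: Lint_norm; apply: nice_Lint0; apply: niceM => //; exact: nice_haar.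
apply: (@le_trans _ _ (\sum_(n < M) \int[mu]_x `|f x * haar i n x|)).
  apply: ler_sum => n _; apply: Int_norm_le => //.
  by apply: nice_meas; apply: niceM => //; exact: nice_haar.
rewrite -Int_sum; last by move=> n _; exact: ln.
apply: Int_le; [apply: Lint_sum => n _; exact: ln|exact: Lint_norm|] => x.
under eq_bigr do rewrite normrM.
by rewrite -mulr_sumr ler_piMr// haar_sum_abs.
Qed.

Lemma pi_le4 : pi <= 4 :> R.
Proof. by have [/andP[_]] := pihalf_02_cos_pihalf R; lra. Qed.

Lemma wprim_dyadic j n : wprim j (2 ^- j * n%:R) = 0 :> R.
Proof.
rewrite /wprim (_ : freq j * _ = 2 * pi * n%:R); first by rewrite cos_int subrr mul0r.
by rewrite /freq; field; rewrite pow2_neq0.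
Qed.

Lemma Int_haar_wave i j n : (n < 2 ^ i)%N -> \int[mu]_x (haar i n x * wave j x) =
  2 * wprim j (pt i n) - wprim j (2 ^- i * n%:R) - wprim j (2 ^- i * (n%:R + 1)).
Proof.
move=> ni; have [h1 h2] := pt_mem i n.
have a0 : 0 <= 2 ^- i * n%:R :> R by rewrite mulr_ge0 ?ipow2_ge0.
have b1 : 2 ^- i * (n%:R + 1) <= 1 :> R.
  by rewrite mulrC ler_pdivrMr ?pow2_gt0// mul1r natr1 -natrX ler_nat.
have cs := @continuous_sin_scale R (freq j).
have ls a b : Lint (fun x => sin (freq j * x) * ind a b x) by exact: Lint_mul_ind.
transitivity (\int[mu]_x (sin (freq j * x) * ind (2 ^- i * n%:R) (pt i n) x -
    sin (freq j * x) * ind (pt i n) (2 ^- i * (n%:R + 1)) x)).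
  apply: eq_Rintegral => x _; rewrite /wave haarE mulrBl !(mulrCA _ (sin _)).
  rewrite ind_mul_sub//; last exact: le_trans h2 b1.
  by rewrite ind_mul_sub//; exact: le_trans a0 h1.
rewrite IntB// (Int_FTC h1 (wprim_is_derive j) cs) (Int_FTC h2 (wprim_is_derive j) cs).
by ring.
Qed.

Lemma Int_haar_wave_gt i j n : (n < 2 ^ i)%N -> (i < j)%N -> \int[mu]_x (haar i n x * wave j x) = 0.
Proof.
move=> ni ij; rewrite Int_haar_wave//.
have d0 : (0 < j - i)%N by rewrite subn_gt0.
have e : (2 ^+ j : R) = 2 * 2 ^+ (j - i).-1 * 2 ^+ i by rewrite -exprS prednK// -exprD subnK// ltnW.
have e2 : (2 ^+ (j - i) : R) = 2 * 2 ^+ (j - i).-1 by rewrite -exprS prednK.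
have -> : pt i n = 2 ^- j * (2 ^ (j - i) * n + 2 ^ (j - i).-1)%N%:R :> R.
  by rewrite /pt natrD natrM !natrX e e2; field; rewrite !pow2_neq0.
have -> : 2 ^- i * n%:R = 2 ^- j * (2 ^ (j - i) * n)%N%:R :> R.
  by rewrite natrM !natrX e e2; field; rewrite !pow2_neq0.
have -> : 2 ^- i * (n%:R + 1) = 2 ^- j * (2 ^ (j - i) * n.+1)%N%:R :> R.
  by rewrite natrM -[n.+1%:R]natr1 !natrX e e2; field; rewrite !pow2_neq0.
by rewrite !wprim_dyadic mulr0 !subr0.
Qed.

Lemma Int_haar_wave_eq i n : (n < 2 ^ i)%N -> \int[mu]_x (haar i n x * wave i x) = 2 / pi * 2 ^- i.
Proof.
move=> ni; rewrite Int_haar_wave// natr1 !wprim_dyadic !subr0 /wprim.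
have -> : freq i * pt i n = 2 * pi * n%:R + pi :> R.
  by rewrite /freq /pt; field; rewrite pow2_neq0.
have p0 : pi != 0 :> R by rewrite gt_eqF ?pi_gt0.
rewrite cosDpi cos_int opprK /freq; move: (pi : R) p0 => P p0.
by field; rewrite pow2_neq0.
Qed.

Lemma Int_haar_wave_le i j n : (n < 2 ^ i)%N -> (j <= i)%N ->
  `|\int[mu]_x (haar i n x * wave j x)| <= 2 * 2 ^+ j * 2 ^- i * 2 ^- i.
Proof.
move=> ni _; rewrite Int_haar_wave//.
set d : R := 2 ^- i * 2^-1.
have d0 : 0 <= d by rewrite mulr_ge0 ?ipow2_ge0.
set a : R := 2 ^- i * n%:R.
have -> : pt i n = a + d by rewrite /pt mulrDr.
have -> : 2 ^- i * (n%:R + 1) = a + d + d by rewrite /a /d; field; rewrite pow2_neq0.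
pose H (y : R) := wprim j (y + d) - wprim j y.
have dH (y : R) : is_derive y 1 H (sin (freq j * (y + d)) - sin (freq j * y)).
  apply: is_deriveB; last exact: wprim_is_derive.
  have h : is_derive y 1 (fun y : R => y + d) (1 : R) by rewrite -[X in is_derive _ _ _ X]addr0; exact: is_deriveD.
  by have := @is_derive1_comp _ (wprim j) (fun y => y + d) y _ _ (wprim_is_derive j _) h; rewrite mulr1.
have f0 := @freq_gt0 R j.
have bH (y : R) : `|sin (freq j * (y + d)) - sin (freq j * y)| <= freq j * d.
  apply: le_trans (MVT_dist (c := freq j) _ _ (@is_derive_sin_scale R (freq j)) _) _.
    by move=> z; rewrite normrM (gtr0_norm f0) ler_piMr ?(ltW f0)// norm_cos_le1.
  by rewrite addrAC subrr add0r ger0_norm.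
have := MVT_dist a (a + d) dH bH.
have -> : a - (a + d) = - d by ring.
rewrite /H normrN (ger0_norm d0).
have -> : wprim j (a + d) - wprim j a - (wprim j (a + d + d) - wprim j (a + d)) =
  2 * wprim j (a + d) - wprim j a - wprim j (a + d + d) by ring.
move=> h; apply: le_trans h _; rewrite /freq /d.
move: (pi : R) pi_le4 => P p4.
have -> : 2 * P * 2 ^+ j * (2 ^- i * 2^-1) * (2 ^- i * 2^-1) =
  (P / 2) * (2 ^+ j * 2 ^- i * 2 ^- i) by field; rewrite pow2_neq0.
have -> : 2 * 2 ^+ j / 2 ^+ i / 2 ^+ i = 2 * (2 ^+ j / 2 ^+ i / 2 ^+ i) :> R by rewrite !mulrA.
by rewrite ler_wpM2r ?mulr_ge0 ?pow2_ge0 ?ipow2_ge0//; lra.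
Qed.

End haar_pairings.

Section haar_lower_bound.
Context {R : realType}.
Local Notation mu := (@lebesgue_measure R).

Lemma tail_sum (J : seq nat) (al : R) (i r : nat) : uniq J -> 0 <= al -> al < 1 ->
  (forall l, l \in J -> (l < i)%N -> (l + r <= i)%N) ->
  \sum_(l <- J | l != i) (if (l <= i)%N then al ^+ (i - l) else 0) <= al ^+ r / (1 - al).
Proof.
move=> uJ a0 a1 sep.
have d0 : 0 < 1 - al by rewrite subr_gt0.
pose J' := [seq l <- J | (l + r <= i)%N].
apply: (@le_trans _ _ (\sum_(l <- J') al ^+ (i - l))).
  rewrite big_filter [leLHS]big_seq_cond [leLHS]big_mkcond [leRHS]big_seq_cond [leRHS]big_mkcond.
  apply: ler_sum => l _; case lJ : (l \in J) => //=.
  case: eqP => [->|/eqP li] /=; first by case: ifP => // _; exact: exprn_ge0.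
  case: ifP => [le_li|_]; last by case: ifP => // _; exact: exprn_ge0.
  by rewrite sep// ltn_neqAle li.
have [ir|ri] := ltnP i r.
  rewrite big_seq big1 ?divr_ge0 ?exprn_ge0 ?(ltW d0)// => l; rewrite mem_filter => /andP[h _].
  by move: (leq_ltn_trans h ir); rewrite ltnNge leq_addl.
apply: le_trans (uniq_sum_le (M := (i - r).+1) (F := fun l => al ^+ (i - l)) _ _ _) _.
- exact: filter_uniq.
- by move=> l; rewrite mem_filter => /andP[h _]; rewrite ltnS leq_subRL// addnC.
- by move=> l; exact: exprn_ge0.
rewrite (reindex_inj rev_ord_inj)/=.
apply: (@le_trans _ _ (\sum_(k < (i - r).+1) al ^+ r * al ^+ k)); last first.
  by rewrite -mulr_sumr ler_wpM2l ?exprn_ge0// geo_sum_le.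
apply: ler_sum => k _; rewrite subSS -exprD; apply: eq_ler; congr (_ ^+ _).
have kr : (k <= i - r)%N by rewrite -ltnS.
by lia.
Qed.

Variables (sigma : R) (N r : nat) (J : seq nat) (keep : nat -> nat -> bool).
Hypothesis sig : 0 < sigma < 1.
Hypothesis uJ : uniq J.
Hypothesis sepJ : forall i l, i \in J -> l \in J -> (l < i)%N -> (l + r <= i)%N.
Hypothesis half_kept : forall l, 2 ^+ l / 2 <= \sum_(m < 2 ^ l | keep l m) (1 : R).

Definition Fb (i l n : nat) : R := \int[mu]_x (bump_layer N keep l x * haar i n x).
Definition Gb (i j n : nat) : R := \int[mu]_x (haar i n x * wave j x).

Lemma Lint_bump_haar i l m (n : nat) : Lint (fun x : R => bump (l + N) (pt l m) x * haar i n x).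
Proof. by apply/nice_Lint0/niceM; [exact: nice_bump|exact: nice_haar]. Qed.

Lemma FbE i l n : Fb i l n = \sum_(m < 2 ^ l | keep l m) \int[mu]_x (bump (l + N) (pt l m) x * haar i n x).
Proof.
rewrite /Fb /bump_layer; under eq_Rintegral do rewrite mulr_suml.
by apply: Int_sum => m _; exact: Lint_bump_haar.
Qed.

Lemma Fb_gt i l n : (i < l)%N -> Fb i l n = 0.
Proof. by move=> il; rewrite FbE; apply: big1 => m _; exact: Int_bump_haar_gt. Qed.

Lemma Fb_eq i (n : 'I_(2 ^ i)) : Fb i i n = if keep i n then 2 ^- (i + N) else 0.
Proof.
rewrite FbE (eq_bigr (fun m : 'I_(2 ^ i) => if (n : nat) == m then 2 ^- (i + N) else 0)); last first.
  by move=> m _; exact: Int_bump_haar_eq.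
rewrite -big_mkcondr/=; case: ifP => kn.
  rewrite (big_pred1 n)// => m /=; rewrite -[m == n]val_eqE/= [RHS]eq_sym.
  by case: eqP => [<-|_]; rewrite ?andbF// kn.
rewrite big_pred0// => m; case: eqP => [e|]; last by rewrite andbF.
by rewrite andbT -e kn.
Qed.

Lemma Fb_sum_le i l : \sum_(n < 2 ^ i) `|Fb i l n| <= 3 * 2 ^- N.
Proof.
have nl := @nice_bump_layer R N keep l.
apply: le_trans (sum_Int_haar_le i (2 ^ i) nl) _.
pose g x := \sum_(m < 2 ^ l) 3 * ind (pt l m - 2 ^- (l + N).+1) (pt l m + 2 ^- (l + N).+1 : R) x.
have lg (m : 'I_(2 ^ l)) : Lint (fun x => 3 * ind (pt l m - 2 ^- (l + N).+1) (pt l m + 2 ^- (l + N).+1 : R) x).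
  by apply: LintZ; exact: Lint_ind.
apply: (@le_trans _ _ (\int[mu]_x g x)).
  apply: Int_le; first exact/Lint_norm/nice_Lint0.
    by apply: Lint_sum => m _; exact: lg.
  move=> x; apply: le_trans (ler_norm_sum _ _ _) _; rewrite big_mkcond/=.
  apply: ler_sum => m _; case: ifP => _; first exact: bump_abs.
  by rewrite mulr_ge0 ?ind_ge0.
rewrite /g Int_sum; last by move=> m _; exact: lg.
have i0 : 0 <= 2 ^- (l + N).+1 :> R by exact: ipow2_ge0.
rewrite (eq_bigr (fun=> 3 * (2 * 2 ^- (l + N).+1))); last first.
  move=> m _; rewrite IntZ; last exact: Lint_ind.
  by rewrite Int_ind; [congr (_ * _); ring|lra].
rewrite sumr_const card_ord -[_ *+ (2 ^ l)]mulr_natr natrX exprS exprD; apply: eq_ler.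
by field; rewrite !pow2_neq0.
Qed.

Definition Xb i l j : R := 2 ^+ i * (2 `^ ((l + N)%:R * sigma) * 2 `^ (- (j%:R * sigma))) *
  \sum_(n < 2 ^ i) Fb i l n * Gb i j n.
Definition Lambda : R := 2 `^ (N%:R * sigma) * 2 ^- N.
Let al : R := 2 `^ (- sigma).
Let be : R := 2 `^ (- (1 - sigma)).

Lemma Lambda_gt0 : 0 < Lambda. Proof. by rewrite mulr_gt0 ?powR_gt0 ?ipow2_gt0. Qed.

Lemma Xb0 i l j : (i < l)%N \/ (i < j)%N -> Xb i l j = 0.
Proof.
move=> h; rewrite /Xb big1 ?mulr0// => n _; case: h => h; first by rewrite Fb_gt ?mul0r.
by rewrite /Gb Int_haar_wave_gt ?mulr0.
Qed.

Lemma Xb_le i l j : (l <= i)%N -> (j <= i)%N ->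
  `|Xb i l j| <= 6 * Lambda * al ^+ (i - l) * be ^+ (i - j).
Proof.
move=> li ji; rewrite /Xb normrM (@ger0_norm _ (2 ^+ i * _)) ?mulr_ge0 ?pow2_ge0 ?powR_ge0//.
apply: (@le_trans _ _ (2 ^+ i * (2 `^ ((l + N)%:R * sigma) * 2 `^ (- (j%:R * sigma))) *
    (3 * 2 ^- N * (2 * 2 ^+ j * 2 ^- i * 2 ^- i)))).
  rewrite ler_wpM2l ?mulr_ge0 ?pow2_ge0 ?powR_ge0//.
  apply: le_trans (ler_norm_sum _ _ _) _.
  apply: le_trans (_ : (\sum_(n < 2 ^ i) `|Fb i l n|) * (2 * 2 ^+ j * 2 ^- i * 2 ^- i) <= _).
    rewrite mulr_suml; apply: ler_sum => n _; rewrite normrM ler_wpM2l//.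
    exact: Int_haar_wave_le.
  by rewrite ler_wpM2r ?Fb_sum_le// !mulr_ge0 ?pow2_ge0 ?ipow2_ge0.
apply: eq_ler.
have e1 : al ^+ (i - l) * be ^+ (i - j) =
    2 `^ (l%:R * sigma) * 2 `^ (- (j%:R * sigma)) * 2 ^+ j * 2 ^- i :> R.
  rewrite -!powR_mulrn ?powR_ge0// /al /be -!powRrM -!powRN -!powRD ?pnatr_eq0 ?implybT//.
  by congr (2 `^ _); rewrite !natrB//; ring.
rewrite -[RHS]mulrA e1 /Lambda natrD mulrDl powRD ?pnatr_eq0 ?implybT//.
move: (2 `^ (l%:R * sigma)) (2 `^ (N%:R * sigma)) (2 `^ (- (j%:R * sigma))) => u v w.
by field; rewrite !pow2_neq0.
Qed.

Lemma Xb_diag i : Lambda / 4 <= Xb i i i.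
Proof.
rewrite /Xb.
have -> : \sum_(n < 2 ^ i) Fb i i n * Gb i i n =
    2 ^- (i + N) * (2 / pi * 2 ^- i) * \sum_(n < 2 ^ i | keep i n) 1.
  rewrite mulr_sumr [RHS]big_mkcond/=; apply: eq_bigr => n _.
  rewrite Fb_eq /Gb Int_haar_wave_eq//; case: ifP => _; first by rewrite mulr1.
  by rewrite mul0r.
have g : 2^-1 * 2 ^- i <= 2 / pi * 2 ^- i :> R.
  rewrite ler_wpM2r ?ipow2_ge0// ler_pdivlMr ?pi_gt0//.
  by move: (pi : R) (@pi_le4 R) => P; lra.
apply: (@le_trans _ _ (2 ^+ i * (2 `^ ((i + N)%:R * sigma) * 2 `^ (- (i%:R * sigma))) *
   (2 ^- (i + N) * (2^-1 * 2 ^- i) * (2 ^+ i / 2)))).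
  rewrite -powRD ?pnatr_eq0 ?implybT//.
  have -> : (i + N)%:R * sigma + - (i%:R * sigma) = N%:R * sigma by rewrite natrD; ring.
  rewrite /Lambda exprD; move: (2 `^ (N%:R * sigma)) => v.
  by apply: eq_ler; field; rewrite !pow2_neq0.
rewrite ler_wpM2l ?mulr_ge0 ?pow2_ge0 ?powR_ge0//.
apply: ler_pM; rewrite ?half_kept ?mulr_ge0 ?ipow2_ge0 ?pow2_ge0//.
by rewrite ler_wpM2l ?ipow2_ge0.
Qed.

Lemma haar_block_sum i :
  \sum_(n < 2 ^ i) haar_coef (bump_test sigma N J keep) i n * (\int[mu]_x (haar i n x * wave_test sigma J x))
  = \sum_(l <- J) \sum_(j <- J) Xb i l j.
Proof.
have F (n : nat) : \int[mu]_x (bump_test sigma N J keep x * haar i n x) =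
    \sum_(l <- J) 2 `^ ((l + N)%:R * sigma) * Fb i l n.
  rewrite /bump_test; under eq_Rintegral do rewrite mulr_suml.
  rewrite Int_sum; last first.
    by move=> l _; apply/nice_Lint0/niceM; [apply: niceZ; exact: nice_bump_layer|exact: nice_haar].
  apply: eq_bigr => l _; rewrite /Fb -IntZ; first by apply: eq_Rintegral => x _; rewrite mulrA.
  by apply/nice_Lint0/niceM; [exact: nice_bump_layer|exact: nice_haar].
have G (n : nat) : \int[mu]_x (haar i n x * wave_test sigma J x) =
    \sum_(j <- J) 2 `^ (- (j%:R * sigma)) * Gb i j n.
  rewrite /wave_test; under eq_Rintegral do rewrite mulr_sumr.
  rewrite Int_sum; last first.
    by move=> j _; apply/nice_Lint0/niceM; [exact: nice_haar|apply: niceZ; exact: nice_wave].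
  apply: eq_bigr => j _; rewrite /Gb -IntZ; first by apply: eq_Rintegral => x _; rewrite mulrCA.
  by apply/nice_Lint0/niceM; [exact: nice_haar|exact: nice_wave].
transitivity (\sum_(n < 2 ^ i) \sum_(l <- J) \sum_(j <- J)
    2 ^+ i * (2 `^ ((l + N)%:R * sigma) * 2 `^ (- (j%:R * sigma))) * (Fb i l n * Gb i j n)).
  apply: eq_bigr => n _; rewrite /haar_coef F G -mulrA big_distrlr/= mulr_sumr.
  apply: eq_bigr => l _; rewrite mulr_sumr; apply: eq_bigr => j _; ring.
rewrite exchange_big/=; apply: eq_bigr => l _; rewrite exchange_big/=; apply: eq_bigr => j _.
by rewrite -mulr_sumr.
Qed.

Hypothesis al_small : al ^+ r / (1 - al) <= 200^-1.
Hypothesis be_small : be ^+ r / (1 - be) <= 200^-1.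

(* The separation of [J] makes the off-diagonal terms small compared with [Xb i i i]. *)
Lemma haar_block_ge i : i \in J -> Lambda / 8 <= \sum_(l <- J) \sum_(j <- J) Xb i l j.
Proof.
move=> iJ; have L0 := Lambda_gt0; have /andP[s0 s1] := sig.
have lt1 (t : R) : 0 < t -> 2 `^ (- t) < 1 by move=> t0; rewrite powRN invf_lt1 ?powR_gt0// two_powR_gt1.
have a1 : al < 1 by exact: lt1.
have b1 : be < 1 by apply: lt1; rewrite subr_gt0.
have a0 : 0 <= al by exact: powR_ge0.
have b0 : 0 <= be by exact: powR_ge0.
pose phi l := if (l <= i)%N then al ^+ (i - l) else 0.
pose psi j := if (j <= i)%N then be ^+ (i - j) else 0.
have ph0 l : 0 <= phi l by rewrite /phi; case: ifP => // _; exact: exprn_ge0.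
have ps0 l : 0 <= psi l by rewrite /psi; case: ifP => // _; exact: exprn_ge0.
have X l j : `|Xb i l j| <= 6 * Lambda * (phi l * psi j).
  rewrite /phi /psi; case: leqP => li; last by rewrite Xb0 ?normr0 ?mul0r ?mulr0//; left.
  case: leqP => ji; last by rewrite Xb0 ?normr0 ?mulr0//; right.
  by rewrite mulrA; exact: Xb_le.
have ea : \sum_(l <- J | l != i) phi l <= 200^-1.
  by apply: le_trans al_small; apply: tail_sum => // l lJ; exact: sepJ.
have eb : \sum_(l <- J | l != i) psi l <= 200^-1.
  by apply: le_trans be_small; apply: tail_sum => // l lJ; exact: sepJ.
have eb2 : \sum_(l <- J) psi l <= 1 + 200^-1.
  by rewrite (bigD1_seq i)//= lerD// /psi leqnn subnn expr0.
rewrite (bigD1_seq i)//= (bigD1_seq i (F := fun j => Xb i i j))//=.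
have h1 : `|\sum_(j <- J | j != i) Xb i i j| <= 6 * Lambda * 200^-1.
  apply: le_trans (ler_norm_sum _ _ _) _.
  apply: le_trans (ler_sum _ (fun j _ => X i j)) _.
  rewrite -mulr_sumr ler_wpM2l ?mulr_ge0 ?(ltW L0)//.
  rewrite -mulr_sumr {1}/phi leqnn subnn expr0 mul1r//.
have h2 : `|\sum_(l <- J | l != i) \sum_(j <- J) Xb i l j| <= 6 * Lambda * (200^-1 * (1 + 200^-1)).
  apply: le_trans (ler_norm_sum _ _ _) _.
  apply: (@le_trans _ _ (\sum_(l <- J | l != i) 6 * Lambda * (phi l * \sum_(j <- J) psi j))).
    apply: ler_sum => l _; apply: le_trans (ler_norm_sum _ _ _) _.
    rewrite !mulr_sumr; apply: ler_sum => j _; exact: X.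
  rewrite -mulr_sumr ler_wpM2l ?mulr_ge0 ?(ltW L0)// -mulr_suml.
  by apply: ler_pM => //; apply: sumr_ge0.
have := Xb_diag i; move: h1 h2; rewrite !ler_norml => /andP[h1 _] /andP[h2 _] h3.
move: h1 h2 h3; set a := \sum_(j <- J | j != i) _; set b := \sum_(l <- J | l != i) _.
move: (Xb i i i) a b => X0 a b.
have c1 : (200^-1 : R) <= 100^-1 by rewrite lef_pV2 ?posrE// ler_nat.
lra.
Qed.

Lemma haar_form_ge : (size J)%:R * (Lambda / 8) <= \sum_(i <- J) \sum_(n < 2 ^ i)
  haar_coef (bump_test sigma N J keep) i n * (\int[mu]_x (haar i n x * wave_test sigma J x)).
Proof.
under eq_bigr do rewrite haar_block_sum.
apply: (@le_trans _ _ (\sum_(i <- J) Lambda / 8)).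
  by rewrite big_const_seq iter_addr addr0 count_predT mulr_natl.
by rewrite [leLHS]big_seq [leRHS]big_seq; apply: ler_sum => i; exact: haar_block_ge.
Qed.

End haar_lower_bound.

(** * Lower bounds for the operator norm *)

Section norm_lower_bound.
Context {R : realType}.
Local Notation mu := (@lebesgue_measure R).
Local Notation reg u := (regular_distribution (fun x => (u x)%:C)).

Lemma haar_coefZ (c : R) u j n : nice u -> haar_coef (fun x => c * u x) j n = c * haar_coef u j n.
Proof.
move=> nu; rewrite /haar_coef mulrCA; congr (_ * _).
rewrite -IntZ; first by apply: eq_Rintegral => x _; rewrite mulrA.
by apply/nice_Lint0/niceM => //; exact: nice_haar.
Qed.

Lemma haar_formZ (A : {fset nat}) (c : R) u g : nice u ->
  haar_form A (fun x => c * u x) g = c * haar_form A u g.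
Proof.
move=> nu; rewrite /haar_form mulr_sumr; apply: eq_bigr => a _ /=.
by rewrite mulr_sumr; apply: eq_bigr => n _; rewrite haar_coefZ// mulrA.
Qed.

Lemma haar_formC (A : {fset nat}) (u g : R -> R) : haar_form A u g = haar_form A g u.
Proof.
apply: eq_bigr => a _ /=; apply: eq_bigr => n _; rewrite /haar_coef -!mulrA; congr (_ * _).
by rewrite mulrC; congr (_ * _); apply: eq_Rintegral => x _; rewrite mulrC.
Qed.

Lemma haar_opnorm_lower (p q s q' : R) (psi0 psi kap0 kap : R -> R[i]) (C Cd Du Dg B D : R) u g
    (A : {fset nat}) : 1 < p -> 1 < q -> schwartz psi0 -> schwartz psi ->
  ckernel C psi0 -> ckernel C psi ->
  (forall h E, nice h -> 0 <= E -> dual_bound s kap0 kap q' h E ->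
     exists L, duality_pairing_with p q s psi0 psi (fun x => (h x)%:C) L /\
       forall T, TL_space p q s psi0 psi T ->
         ((cmod (L T))%:E <= (Cd * E)%:E * TL_norm p q s psi0 psi T)%E) ->
  (forall a b, a <= b -> exists L, duality_pairing_with p q s psi0 psi (fun x => (ind a b x)%:C) L) ->
  nice u -> nice g -> 0 <= Du -> 0 <= Dg ->
  (forall K x, \sum_(k < K) (2 `^ (k%:R * s) * cmod (cconv (TL_kernel psi0 psi k) u x)) `^ q
     <= (Du * jap x ^- 2) `^ q) ->
  dual_bound s kap0 kap q' g Dg ->
  0 < B -> 0 < D -> Du * @japI R `^ p^-1 <= B -> Cd * Dg <= D ->
  ((haar_form A u g / (B * D))%:E <= TL_opnorm p q s psi0 psi (haar_projection p q s psi0 psi A))%E.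
Proof.
move=> p1 q1 sp0 sp k0 k1 pair ip nu ng Du0 Dg0 hu hg B0 D0 hB hD.
have [L [pL bL]] := pair g Dg ng Dg0 hg.
have nv := niceZ B^-1 nu.
have -> : haar_form A u g / (B * D) = haar_form A (fun x => B^-1 * u x) g / D.
  by rewrite haar_formZ// invfM mulrA [in RHS](mulrC B^-1).
apply: (opnorm_ge k0 k1 ip A nv ng _ pL _ D0).
  have Bi : 0 <= B^-1 by rewrite invr_ge0 ltW.
  apply: le_trans (TL_norm_le (D := B^-1 * Du) p1 q1 sp0 sp (nice_tempered nv) _ _) _.
  - by rewrite mulr_ge0.
  - move=> K x; rewrite (eq_bigr (fun k : 'I_K => B^-1 `^ q *
        (2 `^ (k%:R * s) * cmod (cconv (TL_kernel psi0 psi k) u x)) `^ q)).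
      rewrite -mulr_sumr -mulrA powRM ?mulr_ge0 ?japX_ge0//.
      by rewrite ler_wpM2l ?powR_ge0 ?hu.
    move=> k _; rewrite convolution_regular (cconvZ _ _ _ k0 k1)// cmodM cmodR ger0_norm//.
    by rewrite powRrM !powRM ?mulr_ge0 ?powR_ge0 ?cmod_ge0//; ring.
  by rewrite lee_fin -mulrA mulrC ler_pdivrMr// mul1r.
move=> T TT; apply: le_trans (bL T TT) _; apply: lee_wpmul2r; first exact: Lnorm_ge0.
by rewrite lee_fin.
Qed.

Lemma power_small (al : R) : 0 <= al -> al < 1 ->
  exists r0 : nat, forall r, (r0 <= r)%N -> al ^+ r / (1 - al) <= 200^-1.
Proof.
move=> a0 a1; have d0 : 0 < 1 - al by rewrite subr_gt0.
have e0 : 0 < 200^-1 * (1 - al) by rewrite mulr_gt0// invr_gt0 ltr0n.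
have /cvgrPdist_le/(_ _ e0)[r0 _ h] : al ^+ n @[n --> \oo] --> (0 : R).
  by apply: cvg_expr; rewrite ger0_norm.
exists r0 => r rr; rewrite ler_pdivrMr//; apply: le_trans (h r rr).
by rewrite sub0r normrN ler_norm.
Qed.

Lemma test_pair (sigma : R) : 0 < sigma < 1 -> exists r : nat, (1 < r)%N /\
  forall (N : nat) (J : seq nat), uniq J -> (size J <= 2 ^ N)%N ->
  (forall i l, i \in J -> l \in J -> (l < i)%N -> (l + r <= i)%N) ->
  exists keep : nat -> nat -> bool,
    (forall l m, keep l m ->
       \sum_(l' <- J | (l' < l)%N) \sum_(m' < 2 ^ l' | keep l' m') dist N l' m' (pt l m : R) ^- 2 <= 4) /\
    (size J)%:R * (Lambda sigma N / 8) <= \sum_(i <- J) \sum_(n < 2 ^ i)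
      haar_coef (bump_test sigma N J keep) i n * (\int[mu]_x (haar i n x * wave_test sigma J x)).
Proof.
move=> sig; have /andP[s0 s1] := sig.
have lt1 (t : R) : 0 < t -> 2 `^ (- t) < 1 by move=> t0; rewrite powRN invf_lt1 ?powR_gt0// two_powR_gt1.
have [r1 h1] := power_small (powR_ge0 2 (- sigma)) (lt1 _ s0).
have [r2 h2] : exists r0 : nat, forall r, (r0 <= r)%N ->
    (2 `^ (- (1 - sigma))) ^+ r / (1 - 2 `^ (- (1 - sigma))) <= 200^-1 :> R.
  by apply: power_small; [exact: powR_ge0|apply: lt1; rewrite subr_gt0].
exists (r1 + r2 + 2)%N; split; first by rewrite addn2.
move=> N J uJ sJ sepJ; have [keep [half hk]] := @pruning R N J sJ.
exists keep; split => //.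
apply: (haar_form_ge N sig uJ sepJ half).
  by apply: h1; rewrite -addnA leq_addr.
by apply: h2; rewrite addnAC leq_addl.
Qed.

End norm_lower_bound.

Lemma power_count (R : realType) (n N r : nat) (t t' Lam K : R) :
  0 <= t -> t + t' = 1 -> (0 < N)%N -> (0 < r)%N -> 2 ^+ (N - 1) / r%:R <= n%:R :> R ->
  0 < K -> 0 <= Lam ->
  (2 * r%:R) `^ (- t) / (8 * K) * (2 `^ (N%:R * t) * Lam) <= n%:R * (Lam / 8) / (K * n%:R `^ t').
Proof.
move=> t0 tt N0 r0 hn K0 L0.
have rp : 0 < r%:R :> R by rewrite ltr0n.
have np : 0 < n%:R :> R by apply: lt_le_trans hn; rewrite divr_gt0 ?pow2_gt0.
have h : (2 * r%:R) `^ (- t) * 2 `^ (N%:R * t) <= n%:R `^ t.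
  have -> : (2 * r%:R) `^ (- t) * 2 `^ (N%:R * t) = (2 ^+ (N - 1) / r%:R) `^ t.
    have -> : 2 ^+ (N - 1) / r%:R = (2 * r%:R)^-1 * 2 ^+ N :> R.
      by rewrite -[in RHS](subnK N0) exprD expr1; field; rewrite gt_eqF.
    have inv (z : R) : 0 < z -> z^-1 `^ t = z `^ (- t).
      by move=> z0; rewrite -(powR_inv1 (ltW z0)) -powRrM mulN1r.
    rewrite [RHS]powRM ?invr_ge0 ?mulr_ge0 ?pow2_ge0 ?(ltW rp)// (inv _ (mulr_gt0 _ rp))//; congr (_ * _).
    by rewrite powRrM powR_mulrn.
  by apply: ler_powRl => //; rewrite divr_ge0 ?pow2_ge0 ?(ltW rp).
have e : n%:R * (Lam / 8) / (K * n%:R `^ t') = n%:R `^ t * (Lam / (8 * K)).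
  have -> : n%:R = n%:R `^ t * n%:R `^ t' :> R.
    by rewrite -powRD ?tt ?powRr1 ?(ltW np)// gt_eqF ?implybT.
  have : n%:R `^ t' != 0 :> R by rewrite gt_eqF ?powR_gt0.
  have : K != 0 by rewrite gt_eqF.
  rewrite -powRD ?tt ?powRr1 ?(ltW np)//; last by rewrite gt_eqF ?implybT.
  have : n%:R `^ t * n%:R `^ t' = n%:R :> R.
    by rewrite -powRD ?tt ?powRr1 ?(ltW np)// gt_eqF ?implybT.
  move: (n%:R `^ t) (n%:R `^ t') => a b <- k0 b0.
  by field; rewrite k0 b0.
rewrite e; have -> : (2 * r%:R) `^ (- t) / (8 * K) * (2 `^ (N%:R * t) * Lam) =
   (2 * r%:R) `^ (- t) * 2 `^ (N%:R * t) * (Lam / (8 * K)) by ring.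
by rewrite ler_wpM2r// divr_ge0// mulr_ge0// ltW.
Qed.

Lemma exponents (A : {fset nat}) (r : nat) (J := [seq trunc_log 2 a | a <- A]) :
  (forall a : nat, a \in A -> exists2 j : nat, (1 <= j)%N & a = (2 ^ j)%N) ->
  (forall n m : nat, (2 ^ n)%N \in A -> (2 ^ m)%N \in A -> n <> m -> r%:Z <= `|n%:Z - m%:Z|) ->
  [/\ uniq J, size J = #|` A| &
      forall i l, i \in J -> l \in J -> (l < i)%N -> (l + r <= i)%N].
Proof.
move=> hA sep.
have JA i : i \in J -> (2 ^ i)%N \in A.
  by move=> /mapP[a aA ->]; have [j _ ej] := hA a aA; rewrite ej trunc_expnK// -ej.
split; last 2 first.
- by rewrite size_map.
- move=> i l /JA iA /JA lA li; have := sep _ _ iA lA; lia.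
rewrite map_inj_in_uniq ?fset_uniq// => a b aA bA.
by have [j _ ->] := hA a aA; have [k _ ->] := hA b bA; rewrite !trunc_expnK// => ->.
Qed.

Section both_cases.
Context {R : realType}.
Variables (p q s : R) (psi0 psi : R -> R[i]).
Hypothesis adm : TL_admissible s psi0 psi.

Definition opnorm_growth (e : R) : Prop := exists (r N0 : nat) (c : R),
  [/\ (1 < r)%N, (r < N0)%N, 0 < c &
    forall N : nat, (N0 <= N)%N ->
    forall A : {fset nat},
      (forall a : nat, a \in A -> exists2 j : nat, (1 <= j)%N & a = (2 ^ j)%N) ->
      2 ^+ (N - 1) / r%:R <= #|` A|%:R :> R ->
      (#|` A| <= 2 ^ N)%N ->
      (forall n m : nat, (2 ^ n)%N \in A -> (2 ^ m)%N \in A -> n <> m ->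
         r%:Z <= `|n%:Z - m%:Z|) ->
      ((c * 2 `^ (N%:R * e))%:E <=
       TL_opnorm p q s psi0 psi (haar_projection p q s psi0 psi A))%E].

Lemma opnorm_growth_of (sigma t t' K : R) : 0 < sigma < 1 -> 0 <= t -> t + t' = 1 -> 0 < K ->
  (forall (N : nat) (J : seq nat) (keep : nat -> nat -> bool) (A : {fset nat}), uniq J -> J = [seq trunc_log 2 a | a <- A] ->
     (0 : R) < #|` A|%:R ->
     (forall l m, keep l m -> \sum_(l' <- J | (l' < l)%N)
        \sum_(m' < 2 ^ l' | keep l' m') dist N l' m' (pt l m : R) ^- 2 <= 4) ->
     ((haar_form A (bump_test sigma N J keep) (wave_test sigma J) / (K * #|` A|%:R `^ t'))%:E <=
       TL_opnorm p q s psi0 psi (haar_projection p q s psi0 psi A))%E) ->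
  opnorm_growth (sigma - 1 + t).
Proof.
move=> sig t0 tt K0 main; have [r [r1 test]] := test_pair sig.
have r0 : (0 < r)%N by exact: ltn_trans r1.
exists r, r.+1, ((2 * r%:R) `^ (- t) / (8 * K)); split => //.
  by rewrite divr_gt0 ?(mulr_gt0 _ K0)// powR_gt0// mulr_gt0// ltr0n.
move=> N rN A hA nA An sep; have [uJ sJ sepJ] := exponents hA sep.
pose J := [seq trunc_log 2 a | a <- A].
have sJN : (size J <= 2 ^ N)%N by rewrite sJ.
have [keep [hk low]] := test N J uJ sJN sepJ.
have n0 : (0 : R) < #|` A|%:R by apply: lt_le_trans nA; rewrite divr_gt0 ?pow2_gt0// ltr0n.
apply: le_trans (main N J keep A uJ erefl n0 hk); rewrite lee_fin.
have L0 := ltW (@Lambda_gt0 R sigma N).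
have N0 : (0 < N)%N by exact: leq_ltn_trans rN.
have -> : 2 `^ (N%:R * (sigma - 1 + t)) = 2 `^ (N%:R * t) * Lambda sigma N.
  rewrite /Lambda -powR_mulrn// -powRN -!powRD ?pnatr_eq0 ?implybT//.
  by congr (2 `^ _); ring.
apply: le_trans (power_count t0 tt N0 r0 nA K0 L0) _.
rewrite ler_wpM2r ?invr_ge0 ?mulr_ge0 ?powR_ge0 ?(ltW K0)//.
by rewrite -sJ; apply: le_trans low _; rewrite /haar_form big_map.
Qed.

Lemma growth_case_i : 1 < p -> p < q -> q^-1 < s -> s < p^-1 -> opnorm_growth (s - q^-1).
Proof.
move=> p1 pq qs sp'; have [sp0 sp _ [M1 [sM1 mom]]] := adm.
have J0 := @japI_ge0 R.
have Kb := @Kbump_gt0 R; have Kw := @Kwave_gt0 R; have Ko := @Koverlap_ge0 R.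
have q1 : 1 < q by exact: lt_trans pq.
have qp : 0 < q^-1 by rewrite invr_gt0; exact: lt_trans q1.
have pp : p^-1 < 1 by rewrite invf_lt1//; exact: lt_trans p1.
have q1' : q^-1 < 1 by rewrite invf_lt1//; exact: lt_trans q1.
have sig : 0 < s < 1 by apply/andP; split; [exact: lt_trans qs|exact: lt_trans sp' pp].
have ps : -1 + p^-1 < s by case/andP: sig; lra.
have psi_int : cintegral psi = 0.
  have M10 : 0 <= M1.
    by rewrite -ltzD1 -(ltr_int R); apply: lt_trans sM1; case/andP: sig.
  by rewrite -(mom 0%N M10); apply: eq_cintegral => x; rewrite expr0 mulr1.
have [q' [q'1 qq _]] := conjugate_exponent q1.
have [kap0 [kap [C [Cd [[k0 k1 kk0 kk] _ Cd0 pair ip]]]]] := dual_system p1 q1 ps adm q'1 qq.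
have C0 := ckernel_ge0 k0; have Kd := Kdecay_ge0 sig.
have Dw : 0 <= 2 * Kwave * C * Kdecay s by do 3!apply: mulr_ge0 => //; exact: ltW.
have Db : 0 <= 8 * Kbump * C * Kdecay s * Koverlap by do 4!apply: mulr_ge0 => //; exact: ltW.
pose K1 := 2 * Kwave * C * Kdecay s * @japI R `^ p^-1 + 1.
pose K2 := Cd * (8 * Kbump * C * Kdecay s * Koverlap) + 1.
have K10 : 0 < K1 by rewrite ltr_wpDl// mulr_ge0 ?powR_ge0.
have K20 : 0 < K2 by rewrite ltr_wpDl// mulr_ge0 ?(ltW Cd0).
have -> : s - q^-1 = s - 1 + (1 - q^-1) by ring.
apply: (opnorm_growth_of (t' := q^-1) (K := K1 * K2)) => //.
- by rewrite subr_ge0 ltW.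
- by rewrite subrK.
- exact: mulr_gt0.
move=> N J keep A uJ JA n0 hk.
have sJ : size J = #|` A| by rewrite JA size_map.
rewrite haar_formC mulrAC.
apply: (haar_opnorm_lower (Du := 2 * Kwave * C * Kdecay s * (size J)%:R `^ q^-1)
   A p1 q1 sp0 sp k0 k1 pair ip (nice_wave_test _ _) (nice_bump_test _ _ _ _) _ Db).
- by rewrite mulr_ge0 ?powR_ge0.
- exact: (wave_test_bound sig uJ k0 k1 (ltW q1) psi_int).
- exact: (bump_test_bound sig uJ hk kk0 kk (ltW q'1)).
- by rewrite mulr_gt0 ?powR_gt0.
- exact: K20.
- rewrite sJ mulrAC ler_wpM2r ?powR_ge0// /K1 lerDl//.
by rewrite /K2 lerDl.
Qed.

Lemma growth_case_ii : 1 < q -> q < p -> -1 + p^-1 < s -> s < -1 + q^-1 ->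
  opnorm_growth (q^-1 - s - 1).
Proof.
move=> q1 qp ps sq; have [sp0 sp _ _] := adm.
have J0 := @japI_ge0 R.
have Kb := @Kbump_gt0 R; have Kw := @Kwave_gt0 R; have Ko := @Koverlap_ge0 R.
have p1 : 1 < p by exact: lt_trans qp.
have pp : 0 < p^-1 by rewrite invr_gt0; exact: lt_trans p1.
have q0' : 0 < q^-1 by rewrite invr_gt0; exact: lt_trans q1.
have q1' : q^-1 < 1 by rewrite invf_lt1//; exact: lt_trans q1.
have sig : 0 < - s < 1 by apply/andP; split; lra.
have [q' [q'1 qq q'E]] := conjugate_exponent q1.
have [kap0 [kap [C [Cd [[k0 k1 kk0 kk] kap_int Cd0 pair ip]]]]] := dual_system p1 q1 ps adm q'1 qq.
have C0 := ckernel_ge0 k0; have Kd := Kdecay_ge0 sig.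
have Dw : 0 <= 2 * Kwave * C * Kdecay (- s) by do 3!apply: mulr_ge0 => //; exact: ltW.
have Db : 0 <= 8 * Kbump * C * Kdecay (- s) * Koverlap by do 4!apply: mulr_ge0 => //; exact: ltW.
pose K1 := 8 * Kbump * C * Kdecay (- s) * Koverlap * @japI R `^ p^-1 + 1.
pose K2 := Cd * (2 * Kwave * C * Kdecay (- s)) + 1.
have K10 : 0 < K1 by rewrite ltr_wpDl// mulr_ge0 ?powR_ge0.
have K20 : 0 < K2 by rewrite ltr_wpDl// mulr_ge0 ?(ltW Cd0).
have -> : q^-1 - s - 1 = - s - 1 + q^-1 by ring.
apply: (opnorm_growth_of (t' := q'^-1) (K := K1 * K2)) => //.
- exact: ltW.
- exact: mulr_gt0.
move=> N J keep A uJ JA n0 hk.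
have sJ : size J = #|` A| by rewrite JA size_map.
rewrite -(mulrA K1).
apply: (haar_opnorm_lower (Dg := 2 * Kwave * C * Kdecay (- s) * (size J)%:R `^ q'^-1)
   A p1 q1 sp0 sp k0 k1 pair ip (nice_bump_test _ _ _ _) (nice_wave_test _ _) Db).
- by rewrite mulr_ge0 ?powR_ge0.
- move=> K x; apply: le_trans (bump_test_bound sig uJ hk k0 k1 (ltW q1) K x).
  by apply: ler_sum => k _; rewrite mulrN opprK.
- move=> K x; apply: le_trans (wave_test_bound sig uJ kk0 kk (ltW q'1) kap_int K x).
  by apply: ler_sum => k _; rewrite mulrN.
- exact: K10.
- by rewrite mulr_gt0 ?powR_gt0.
- by rewrite /K1 lerDl.
by rewrite sJ mulrA ler_wpM2r ?powR_ge0// /K2 lerDl.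
Qed.

End both_cases.

Theorem theorem1p1 (R : realType) (p q s : R) (psi0 psi : R -> R[i]) :
  TL_admissible s psi0 psi ->
  let case_i := [/\ 1 < p, p < q, q^-1 < s & s < p^-1] in
  let case_ii := [/\ 1 < q, q < p, -1 + p^-1 < s & s < -1 + q^-1] in
  case_i \/ case_ii ->
  exists (r N0 : nat) (c : R),
    [/\ (1 < r)%N, (r < N0)%N, 0 < c &
      forall N : nat, (N0 <= N)%N ->
      forall A : {fset nat},
        (forall a : nat, a \in A -> exists2 j : nat, (1 <= j)%N & a = (2 ^ j)%N) ->
        2 ^+ (N - 1) / r%:R <= #|` A|%:R :> R ->
        (#|` A| <= 2 ^ N)%N ->
        (forall n m : nat, (2 ^ n)%N \in A -> (2 ^ m)%N \in A -> n <> m ->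
           r%:Z <= `|n%:Z - m%:Z|) ->
        let norm_PE := TL_opnorm p q s psi0 psi
                         (haar_projection p q s psi0 psi A) in
        (case_i -> ((c * 2 `^ (N%:R * (s - q^-1)))%:E <= norm_PE)%E) /\
        (case_ii -> ((c * 2 `^ (N%:R * (q^-1 - s - 1)))%:E <= norm_PE)%E)].
Proof.
move=> adm case_i case_ii [ci|cii].
  have [p1 pq qs sp] := ci.
  have [r [N0 [c [r1 rN c0 h]]]] := growth_case_i adm p1 pq qs sp.
  exists r, N0, c; split => // N NN A hA nA An sep /=; split; first by move=> _; exact: h.
  by move=> [_ qp _ _]; move: (lt_trans qp pq); rewrite ltxx.
have [q1 qp ps sq] := cii.
have [r [N0 [c [r1 rN c0 h]]]] := growth_case_ii adm q1 qp ps sq.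
exists r, N0, c; split => // N NN A hA nA An sep /=; split; last by move=> _; exact: h.
by move=> [_ pq _ _]; move: (lt_trans qp pq); rewrite ltxx.
Qed.
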